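(* The following two uniform stability results hold for the HDG bilinear form $A_h$ (defined in the context). 1. Let $0<\rho\le 1$, $k\ge 0$ and $\tau=\rho h_K$ on $\partial K$. Suppose that either $\boldsymbol Q_h=\boldsymbol Q_h^{k+1}$, $V_h=V_h^k$ and $\hat V_h=\hat V_h^r$ with $0\le r\le k+1$, or $\boldsymbol Q_h=\boldsymbol Q_h^{k,RT}$, $V_h=V_h^k$ and $\hat V_h=\hat V_h^r$ with $0\le r\le k$. Then $A_h$ is uniformly stable with respect to the norm $\big(\|\boldsymbol q_h\|_{\mathrm{div},\rho,h}^2+\|\tilde v_h\|_{0,\rho,h}^2\big)^{1/2}$ on $\boldsymbol Q_h\times\tilde V_h$, where $$\|\tilde v_h\|_{0,\rho,h}^2=(v_h,v_h)_{\mathcal T_h}+\rho\sum_{e\in\mathcal E_h^i}h_e\langle\hat v_h,\hat v_h\rangle_e,$$ $$\|\boldsymbol q_h\|_{\mathrm{div},\rho,h}^2=(c\boldsymbol q_h,\boldsymbol q_h)_{\mathcal T_h}+(\mathrm{div}_h\boldsymbol q_h,\mathrm{div}_h\boldsymbol q_h)_{\mathcal T_h}+\rho^{-1}\sum_{e\in\mathcal E_h^i}h_e^{-1}\langle\hat P_e([\boldsymbol q_h]),\hat P_e([\boldsymbol q_h])\rangle_e .$$ 2. Assume that $\nabla_hV_h\subset\boldsymbol Q_h$. Then there exists a constant $\rho_0>0$ such that for any $0<\rho\le\rho_0$ the form $A_h$ with $\tau=\rho^{-1}h_K^{-1}$ on $\partial K$ is uniformly stable with respect to the norm $\big(\|\boldsymbol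 q_h\|^2+\|\tilde v_h\|_{\tilde 1,\rho,h}^2\big)^{1/2}$ on $\boldsymbol Q_h\times\tilde V_h$, where $$\|\boldsymbol q_h\|^2=(c\boldsymbol q_h,\boldsymbol q_h)_{\mathcal T_h},\qquad \|\tilde v_h\|_{\tilde 1,\rho,h}^2=(\nabla_hv_h,\nabla_hv_h)_{\mathcal T_h}+\rho^{-1}\sum_{K\in\mathcal T_h}h_K^{-1}\langle v_h-\hat v_h,v_h-\hat v_h\rangle_{\partial K}.$$
   Context: $\Omega\subset\mathbb R^d$ ($d\ge1$) is a bounded polygonal (polyhedral) domain, $f\in L^2(\Omega)$, and $\alpha$ is a bounded symmetric positive definite $d\times d$ matrix coefficient with bounded inverse $c=\alpha^{-1}$. The model problem is: $c\boldsymbol p+\nabla u=0$, $\mathrm{div}\,\boldsymbol p=f$ in $\Omega$, $u=0$ on $\partial\Omega$. $\{\mathcal T_h\}_h$ is a family of conforming simplicial triangulations of $\overline\Omega$ satisfying the minimal angle condition (shape regular). $h_K=\mathrm{diam}(K)$, $h=\max_Kh_K$, $\mathcal E_h^i$ is the set of interior edges/faces, $\mathcal E_h$ the set of all edges/faces, $\mathcal E_h^\partial=\mathcal E_h\setminus\mathcal E_h^i$, $h_e=\mathrm{diam}(e)$, and $\boldsymbol n_K$ (written $\boldsymbol n$ in integrals over $\partial\mathcal T_h$) is the outward unit normal of $K$. $(\cdot,\cdot)_{\mathcal T_h}=\sum_{K}(\cdot,\cdot)_K$ and $\langle\cdot,\cdot\rangle_{\partial\mathcal T_h}=\sum_K\langle\cdot,\cdot\rangle_{\partial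 K}$ are $L^2$ products; $\nabla_h,\mathrm{div}_h$ are taken elementwise. On an interior face $e=\partial K^+\cap\partial K^-$, $[\boldsymbol q]=\boldsymbol q^+\cdot\boldsymbol n^++\boldsymbol q^-\cdot\boldsymbol n^-$. $\mathcal P_k$ denotes polynomials of degree at most $k$. $V_h\subset L^2(\Omega)$ and $\boldsymbol Q_h\subset L^2(\Omega)^d$ are discontinuous piecewise polynomial spaces on $\mathcal T_h$ (degrees fixed, independent of $h$). $\hat V_h=\{\hat v_h:\hat v_h|_e\in\hat V(e)\ \forall e\in\mathcal E_h^i,\ \hat v_h|_{\mathcal E_h^\partial}=0\}$ for local finite-dimensional spaces $\hat V(e)\subset L^2(e)$; functions in $\hat V_h$ are single-valued on faces. $\tilde V_h=V_h\times\hat V_h$, $\tilde v_h=(v_h,\hat v_h)$. $\hat P_e:L^2(e)\to\hat V(e)$ is the $L^2$ projection. Specific spaces: $V_h^k=\{v_h:v_h|_K\in\mathcal P_k(K)\}$, $\boldsymbol Q_h^k=\{\boldsymbol p_h:\boldsymbol p_h|_K\in\mathcal P_k(K)^d\}$, $\boldsymbol Q_h^{k,RT}=\{\boldsymbol p_h:\boldsymbol p_h|_K\in\mathcal P_k(K)^d+\boldsymbol x\mathcal P_k(K)\}$ (all with no continuity across faces), and $\hat V_h^r$ is $\hat V_h$ with $\hat V(e)=\mathcal P_r(e)$. HDG form: $$A_h((\boldsymbol p_h,\tilde u_h),(\boldsymbol q_h,\tilde v_h))=a_h(\boldsymbol p_h,\boldsymbol q_h)+b_h(\boldsymbol q_h,\tilde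 u_h)+b_h(\boldsymbol p_h,\tilde v_h)+c_h(\tilde u_h,\tilde v_h),$$ where $a_h(\boldsymbol p_h,\boldsymbol q_h)=(c\boldsymbol p_h,\boldsymbol q_h)_{\mathcal T_h}$, $b_h(\boldsymbol q_h,\tilde u_h)=-(u_h,\mathrm{div}_h\boldsymbol q_h)_{\mathcal T_h}+\langle\hat u_h,\boldsymbol q_h\cdot\boldsymbol n\rangle_{\partial\mathcal T_h}$, $c_h(\tilde u_h,\tilde v_h)=-\sum_K\langle\tau(u_h-\hat u_h),v_h-\hat v_h\rangle_{\partial K}$. Uniformly stable with respect to a norm $\|\cdot\|_{U}$ on $U_h=\boldsymbol Q_h\times\tilde V_h$ means all three of the following: (i) consistency: the exact solution $\mathcal U=(\boldsymbol p,(u,u|_{\mathcal E_h}))$ (assumed regular enough for the traces to make sense) satisfies $A_h(\mathcal U,(\boldsymbol q_h,\tilde v_h))=-(f,v_h)_{\mathcal T_h}$ for all $(\boldsymbol q_h,\tilde v_h)\in U_h$; (ii) uniform continuity: $|A_h(X,Y)|\le M_0\|X\|_U\|Y\|_U$ for all $X,Y\in U_h$; (iii) uniform inf-sup: $\inf_{0\ne Y\in U_h}\sup_{0\ne X\in U_h}\frac{A_h(X,Y)}{\|X\|_U\|Y\|_U}\ge\beta_1>0$; with $M_0,\beta_1$ independent of $\rho$ and $h$ (for $\rho$ in the indicated range; $\rho_0$ is also independent of $h$). Constants may depend on $\Omega,d,\alpha$, shape regularity and polynomial degrees.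
   Formalization: For d=1 a face is a single point, so h_e=diam(e)=0 and h_e^{-1} in the norm of part 1 is undefined; there h_e is taken to be the larger of the diameters h_K of the adjacent elements, while h_e=diam(e) is kept for d≥2. *)

(* Defs.v *)
From HB Require Import structures.
From mathcomp Require Import all_boot all_order all_algebra.
(* The notations of multinomials clash with those of mathcomp-analysis. *)
From mathcomp Require Import -(notations) mpoly.
From mathcomp Require Import all_classical all_reals all_analysis.

Set Implicit Arguments.
Unset Strict Implicit.
Unset Printing Implicit Defensive.

Import Order.TTheory GRing.Theory Num.Theory.
Import numFieldNormedType.Exports.

Local Open Scope classical_set_scope.
Local Open Scope ring_scope.

Section LebesgueRn.
Context {R : realType}.
Local Notation T := (measurableTypeR R).

Definition tcons n (z : T * n.-tuple T) : n.+1.-tuple T :=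
  [the n.+1.-tuple T of z.1 :: z.2].

Definition tsplit n (t : n.+1.-tuple T) : T * n.-tuple T :=
  (thead t, [tuple of behead t]).

Lemma tconsK n : cancel (@tcons n) (@tsplit n).
Proof. by move=> [a t]; congr pair; apply: val_inj. Qed.

Lemma measurable_tcons n : measurable_fun setT (@tcons n).
Proof. exact: measurable_cons. Qed.

Lemma measurable_tsplit n : measurable_fun setT (@tsplit n).
Proof.
apply: measurable_fun_pair; last exact: measurable_behead.
exact: (measurable_tnth ord0).
Qed.

Section step.
Variables (n : nat) (m : {sigma_finite_measure set (n.-tuple T) -> \bar R}).

Let lprod : {measure set (T * n.-tuple T)%type -> \bar R} :=
  [the {measure set (T * n.-tuple T)%type -> \bar R}
   of product_measure1 (@lebesgue_measure R) m].

Definition leb_step : set (n.+1.-tuple T) -> \bar R :=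
  pushforward lprod (@tcons n).

Let leb_step0 : leb_step set0 = 0%E.
Proof. by rewrite /leb_step /pushforward preimage_set0 measure0. Qed.

Let leb_step_ge0 A : (0 <= leb_step A)%E.
Proof. exact: (measure_ge0 lprod). Qed.

Let leb_step_sigma_additive : semi_sigma_additive leb_step.
Proof.
move=> F mF tF mUF; rewrite /leb_step /pushforward preimage_bigcup.
apply: (@measure_semi_sigma_additive _ _ _ lprod).
- by move=> k; rewrite -[X in measurable X]setTI; exact: measurable_tcons.
- apply/trivIsetP => /= i j _ _ ij; rewrite -preimage_setI.
  by move/trivIsetP : tF => /(_ _ _ _ _ ij) ->//; rewrite preimage_set0.
- rewrite -preimage_bigcup -[X in measurable X]setTI.
  exact: measurable_tcons.
Qed.

HB.instance Definition _ := isMeasure.Build _ _ _ leb_step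
  leb_step0 leb_step_ge0 leb_step_sigma_additive.

Let leb_step_sigma_finite : sigma_finite setT leb_step.
Proof.
have /sigma_finiteP[F [FT ndF Foo]] := sigma_finiteT (@lebesgue_measure R).
have /sigma_finiteP[G [GT ndG Goo]] := sigma_finiteT m.
have mFG k : measurable (F k `*` G k).
  by apply: measurableX; [have [] := Foo k|have [] := Goo k].
exists (fun k => @tsplit n @^-1` (F k `*` G k)).
  apply/seteqP; split=> // t _.
  have [i _ Fi] : (\bigcup_i F i) (tsplit t).1 by rewrite -FT.
  have [j _ Gj] : (\bigcup_i G i) (tsplit t).2 by rewrite -GT.
  exists (maxn i j) => //; split.
  - by move: Fi; exact/subsetPset/ndF/leq_maxl.
  - by move: Gj; exact/subsetPset/ndG/leq_maxr.
move=> k; split.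
  by rewrite -[X in measurable X]setTI; apply: measurable_tsplit.
rewrite /leb_step /pushforward -comp_preimage.
rewrite (_ : _ @^-1` _ = F k `*` G k); last first.
  by rewrite (_ : _ \o _ = id)//; apply/funext; exact: tconsK.
have [mF Fk] := Foo k; have [mG Gk] := Goo k.
by rewrite /lprod /= product_measure1E// lte_mul_pinfty// ge0_fin_numE.
Qed.

HB.instance Definition _ :=
  Measure_isSigmaFinite.Build _ _ _ leb_step leb_step_sigma_finite.

End step.

(* Lebesgue measure on R^n, the n-fold product of lebesgue_measure. *)
Fixpoint lebn n : {sigma_finite_measure set (n.-tuple T) -> \bar R} :=
  match n with
  | 0 => dirac ([tuple] : 0.-tuple T)
  | n'.+1 => leb_step (lebn n')
  end.

Definition rowt n (t : n.-tuple T) : 'rV[R]_n := \row_i tnth t i.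
End LebesgueRn.

Section Integrals.
Context {R : realType}.
Implicit Types n : nat.

Definition vint n (A : set 'rV[R]_n) (f : 'rV[R]_n -> R) : R :=
  \int[lebn n]_(t in @rowt R n @^-1` A) f (rowt t).

Definition L2 n (A : set 'rV[R]_n) (f : 'rV[R]_n -> R) : Prop :=
  measurable_fun (@rowt R n @^-1` A) (f \o @rowt R n) /\
  (lebn n).-integrable (@rowt R n @^-1` A) (fun t => (f (rowt t) ^+ 2)%:E).

Definition ae_in n (A : set 'rV[R]_n) (P : 'rV[R]_n -> Prop) : Prop :=
  {ae lebn n, forall t : n.-tuple (measurableTypeR R),
    A (rowt t) -> P (rowt t)}.

Definition dot n (u v : 'rV[R]_n) : R := \sum_i u 0 i * v 0 i.

(* The library norm on 'rV[R]_n is the sup norm. *)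
Definition enorm n (u : 'rV[R]_n) : R := Num.sqrt (dot u u).

Definition mulmv n (A : 'M[R]_n) (v : 'rV[R]_n) : 'rV[R]_n := (A *m v^T)^T.

Definition diam n (A : set 'rV[R]_n) : R :=
  sup [set r | exists y z, [/\ A y, A z & r = enorm (y - z)]].

(* Supremum of the diameters of the closed balls contained in A. *)
Definition inball_diam n (A : set 'rV[R]_n) : R :=
  sup [set r | 0 <= r /\
    exists y, forall z, enorm (z - y) <= r / 2 -> A z].

End Integrals.

Section Sobolev.
Context {R : realType} {d : nat}.
Local Notation pt := 'rV[R]_d.

Definition partial (i : 'I_d) (f : pt -> R) (x : pt) : R :=
  'D_(delta_mx 0 i : pt) f x.

Definition grad (f : pt -> R) (x : pt) : pt := \row_i partial i f x.

Definition C1 (f : pt -> R) : Prop :=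
  continuous f /\
  forall i : 'I_d, (forall x, derivable f x (delta_mx 0 i)) /\
                   continuous (partial i f).

Definition C1c (Omega : set pt) (f : pt -> R) : Prop :=
  C1 f /\ exists A, [/\ compact A, A `<=` Omega &
                     forall x, ~ A x -> f x = 0].

Definition L2v (A : set pt) (p : pt -> pt) : Prop :=
  forall i, L2 A (fun x => p x 0 i).

(* (w_n, grad w_n) --> (u, g) in L^2(A) *)
Definition H1_cvg (A : set pt) (w : nat -> pt -> R) (u : pt -> R)
    (g : pt -> pt) : Prop :=
  (fun n => vint A (fun x => (w n x - u x) ^+ 2)) @ \oo --> (0 : R) /\
  (fun n => vint A (fun x => dot (grad (w n) x - g x) (grad (w n) x - g x)))
    @ \oo --> (0 : R).

(* u belongs to H^1_0(Omega), the H^1-closure of C^1_c(Omega), and its weak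
   gradient is g. *)
Definition H10 (Omega : set pt) (u : pt -> R) (g : pt -> pt) : Prop :=
  [/\ L2 Omega u, L2v Omega g &
      exists w, (forall n, C1c Omega (w n)) /\ H1_cvg Omega w u g].

Definition weak_div (Omega : set pt) (p : pt -> pt) (f : pt -> R) : Prop :=
  forall phi, C1c Omega phi ->
    vint Omega (fun x => dot (p x) (grad phi x)) =
    - vint Omega (fun x => f x * phi x).

End Sobolev.

(* Cells are the vertex sets of the simplices. *)
Record mesh (R : realType) (d : nat) := Mesh {
  nvert : nat;
  vert : 'I_nvert -> 'rV[R]_d;
  cells : {set {set 'I_nvert}}
}.

Section Mesh.
Context {R : realType} {d : nat}.
Local Notation pt := 'rV[R]_d.

Definition hull n (x : 'I_n -> pt) (S : {set 'I_n}) : set pt :=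
  [set y | exists l : 'I_n -> R,
    [/\ forall i, 0 <= l i, forall i, i \notin S -> l i = 0,
        \sum_i l i = 1 & y = \sum_i l i *: x i]].

Definition aff_indep n (x : 'I_n -> pt) (S : {set 'I_n}) : Prop :=
  forall l : 'I_n -> R, (forall i, i \notin S -> l i = 0) ->
    \sum_i l i = 0 -> \sum_i l i *: x i = 0 -> forall i, l i = 0.

(* The interior of a finite union of convex polytopes, nonempty and connected;
   boundedness and openness follow.  Taking the interior excludes slits. *)
Definition polyhedral_domain (Omega : set pt) : Prop :=
  [/\ Omega !=set0, connected Omega &
      exists n (x : 'I_n -> pt) (C : {set {set 'I_n}}),
        Omega = interior (\bigcup_(S in [set S | S \in C]) hull x S)].

Variable M : mesh R d.
Local Notation V := 'I_(nvert M).
Implicit Types K F : {set V}.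

Definition simplex K : set pt := hull (@vert _ _ M) K.

Definition triangulation (Omega : set pt) : Prop :=
  [/\ forall K, K \in cells M -> #|K| = d.+1 /\ aff_indep (@vert _ _ M) K,
      closure Omega = \bigcup_(K in [set K | K \in cells M]) simplex K &
      forall K K', K \in cells M -> K' \in cells M ->
        simplex K `&` simplex K' = simplex (K :&: K')].

Definition hK K : R := diam (simplex K).

Definition shape_regular (sigma : R) : Prop :=
  forall K, K \in cells M -> hK K <= sigma * inball_diam (simplex K).

Definition facets K : {set {set V}} := [set K :\ v | v in K].

Definition faces : {set {set V}} :=
  [set F | [exists K in cells M, F \in facets K]].

Definition cells_of F : {set {set V}} := [set K in cells M | F \in facets K].

Definition ifaces : {set {set V}} := [set F in faces | (1 < #|cells_of F|)%N].

(* diam(e) vanishes when d = 1: a vertex then gets the largest of the lengths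
   of the adjacent intervals. *)
Definition hF F : R :=
  if d == 1%N then \big[Num.max/0]_(K in cells_of F) hK K
  else diam (simplex F).

(* Affine parametrization of a face by the reference simplex of R^(d-1). *)
Definition fpt F (j : nat) : pt := nth 0 [seq vert v | v <- enum F] j.

Definition fedge F (j : 'I_d.-1) : pt := fpt F j.+1 - fpt F 0.

Definition face_map F (y : 'rV[R]_d.-1) : pt :=
  fpt F 0 + \sum_j y 0 j *: fedge F j.

Definition refsimplex n : set 'rV[R]_n :=
  [set y | (forall j, 0 <= y 0 j) /\ \sum_j y 0 j <= 1].

(* Surface integral, with the Gram determinant as area element; for d = 1 it is
   evaluation at the vertex. *)
Definition sint F (g : pt -> R) : R :=
  Num.sqrt (\det (\matrix_(i, j) dot (fedge F i) (fedge F j))) *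
  vint (@refsimplex d.-1) (g \o face_map F).

Definition L2F F (g : pt -> R) : Prop := L2 (@refsimplex d.-1) (g \o face_map F).

Definition ae_face F (P : pt -> Prop) : Prop :=
  ae_in (@refsimplex d.-1) (P \o face_map F).

Definition is_normal K F (nu : pt) : Prop :=
  [/\ enorm nu = 1,
      forall a b, a \in F -> b \in F -> dot nu (vert a - vert b) = 0 &
      forall a v, a \in F -> v \in K :\: F -> dot nu (vert v - vert a) < 0].

Definition outnormal K F : pt := xget 0 [set nu | is_normal K F nu].

(* The cell boundary is null, so integrals over K are taken over its interior,
   which lies in Omega. *)
Definition kint K (f : pt -> R) : R := vint (interior (simplex K)) f.

Definition bint K (g : {set V} -> pt -> R) : R :=
  \sum_(F in facets K) sint F (g F).

End Mesh.

Section Spaces.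
Context {R : realType} {d : nat}.
Local Notation pt := 'rV[R]_d.
Local Notation poly := (mpoly d R).

Definition peval (p : poly) (x : pt) : R := meval (fun i => x 0 i) p.

(* msize is the total degree plus one, and 0 for the zero polynomial. *)
Definition deg_le (k : nat) (p : poly) : Prop := (msize p <= k.+1)%N.

Definition pgrad (p : poly) : {ffun 'I_d -> poly} := [ffun i => mderiv i p].
Definition pdiv (q : {ffun 'I_d -> poly}) : poly := \sum_i mderiv i (q i).
Definition pevalv (q : {ffun 'I_d -> poly}) (x : pt) : pt :=
  \row_i peval (q i) x.

Definition lin_subspace (E : lmodType R) (S : set E) : Prop :=
  S 0 /\ forall a u v, S u -> S v -> S (a *: u + v).

(* Local spaces V(K), Q(K) and hat V(e). *)
Record spaces (M : mesh R d) := Spaces {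
  Vloc : {set 'I_(nvert M)} -> set poly;
  Qloc : {set 'I_(nvert M)} -> set {ffun 'I_d -> poly};
  Hloc : {set 'I_(nvert M)} -> set (pt -> R)
}.

Definition Pk (k : nat) : set poly := [set p | deg_le k p].

Definition Pkd (k : nat) : set {ffun 'I_d -> poly} :=
  [set q | forall i, deg_le k (q i)].

Definition RTk (k : nat) : set {ffun 'I_d -> poly} :=
  [set q | exists a b, [/\ Pkd k a, Pk k b &
    forall i, q i = a i + mpolyX R (mnm1 i) * b]].

Definition Pk_face (r : nat) : set (pt -> R) :=
  [set g | exists2 p, deg_le r p & g = peval p].

Definition spaces_P (k r : nat) (M : mesh R d) : spaces M :=
  Spaces (fun=> Pk k) (fun=> Pkd k.+1) (fun=> Pk_face r).

Definition spaces_RT (k r : nat) (M : mesh R d) : spaces M :=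
  Spaces (fun=> Pk k) (fun=> RTk k) (fun=> Pk_face r).

Variables (M : mesh R d).
Local Notation V := 'I_(nvert M).

(* Discontinuous piecewise polynomial spaces of degree at most m, and arbitrary
   finite-dimensional trace spaces in L^2(e). *)
Definition admissible (m : nat) (S : spaces M) : Prop :=
  [/\ forall K, K \in cells M -> lin_subspace (Vloc S K) /\ Vloc S K `<=` Pk m,
      forall K, K \in cells M -> lin_subspace (Qloc S K) /\ Qloc S K `<=` Pkd m &
      forall F, F \in ifaces M -> exists n (phi : 'I_n -> pt -> R),
        (forall j, L2F F (phi j)) /\
        Hloc S F = [set g | exists a : 'I_n -> R,
                            g = fun x => \sum_j a j * phi j x]].

(* (q, (v, hat v)); values outside the cells and faces of M are irrelevant. *)
Record dfun := DFun {
  dq : {set V} -> {ffun 'I_d -> poly};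
  dv : {set V} -> poly;
  dh : {set V} -> pt -> R
}.

Definition in_Vh (S : spaces M) (v : {set V} -> poly) : Prop :=
  forall K, K \in cells M -> Vloc S K (v K).

Definition in_Qh (S : spaces M) (q : {set V} -> {ffun 'I_d -> poly}) : Prop :=
  forall K, K \in cells M -> Qloc S K (q K).

Definition in_Hh (S : spaces M) (h : {set V} -> pt -> R) : Prop :=
  (forall F, F \in ifaces M -> Hloc S F (h F)) /\
  (forall F, F \in faces M :\: ifaces M -> h F = fun=> 0).

Definition in_Uh (S : spaces M) (X : dfun) : Prop :=
  [/\ in_Qh S (dq X), in_Vh S (dv X) & in_Hh S (dh X)].

(* Zero in L^2: hat v is only determined almost everywhere. *)
Definition is_zero (X : dfun) : Prop :=
  (forall K, K \in cells M -> dq X K = 0 /\ dv X K = 0) /\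
  (forall F, F \in faces M -> ae_face F (fun x => dh X F x = 0)).

Definition grad_incl (S : spaces M) : Prop :=
  forall v, in_Vh S v -> in_Qh S (fun K => pgrad (v K)).

End Spaces.

Section HDG.
Context {R : realType} {d : nat}.
Local Notation pt := 'rV[R]_d.

Definition coefficient (Omega : set pt) (alpha : pt -> 'M[R]_d) : Prop :=
  [/\ forall i j, measurable_fun (@rowt R d @^-1` Omega)
                    (fun t => alpha (rowt t) i j),
      exists B, forall x, Omega x -> forall i j,
        `|alpha x i j| <= B /\ `|invmx (alpha x) i j| <= B,
      forall x, Omega x -> (alpha x)^T = alpha x &
      forall x, Omega x -> forall xi, xi != 0 ->
        0 < dot (mulmv (alpha x) xi) xi].

Variable M : mesh R d.
Local Notation V := 'I_(nvert M).
Implicit Types K F : {set V}.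

(* What A_h sees of a triple (p, (u, hat u)): elementwise values, elementwise
   divergence of p, and traces p.n_K and u|_K on the faces F of K. *)
Record broken := Broken {
  bp : {set V} -> pt -> pt;
  bdiv : {set V} -> pt -> R;
  bpn : {set V} -> {set V} -> pt -> R;
  bu : {set V} -> pt -> R;
  btr : {set V} -> {set V} -> pt -> R;
  bhat : {set V} -> pt -> R
}.

Definition embed (X : dfun M) : broken := {|
  bp := fun K => pevalv (dq X K);
  bdiv := fun K => peval (pdiv (dq X K));
  bpn := fun K F x => dot (pevalv (dq X K) x) (outnormal K F);
  bu := fun K => peval (dv X K);
  btr := fun K _ => peval (dv X K);
  bhat := dh X
|}.

Variable c : pt -> 'M[R]_d.

Definition ah (X Y : broken) : R :=
  \sum_(K in cells M)
    kint K (fun x => dot (mulmv (c x) (bp X K x)) (bp Y K x)).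

(* bh q u uses the flux components of q and the scalar components of u. *)
Definition bh (q u : broken) : R :=
  - \sum_(K in cells M) kint K (fun x => bu u K x * bdiv q K x) +
  \sum_(K in cells M) bint K (fun F x => bhat u F x * bpn q K F x).

Definition ch (tau : {set V} -> R) (X Y : broken) : R :=
  - \sum_(K in cells M) bint K (fun F x =>
      tau K * (btr X K F x - bhat X F x) * (btr Y K F x - bhat Y F x)).

Definition Ah (tau : {set V} -> R) (X Y : broken) : R :=
  ah X Y + bh Y X + bh X Y + ch tau X Y.

Definition jump (X : broken) F (x : pt) : R :=
  \sum_(K in cells_of F) bpn X K F x.

Definition l2proj (S : spaces M) F (g : pt -> R) : pt -> R :=
  xget (fun=> 0) [set w | Hloc S F w /\
    forall z, Hloc S F z -> sint F (fun x => (w x - g x) * z x) = 0].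

Definition norm_q2 (X : dfun M) : R := ah (embed X) (embed X).

Definition norm_div2 (S : spaces M) (rho : R) (X : dfun M) : R :=
  norm_q2 X +
  \sum_(K in cells M) kint K (fun x => bdiv (embed X) K x ^+ 2) +
  rho^-1 * \sum_(F in ifaces M) (hF F)^-1 *
    sint F (fun x => l2proj S F (jump (embed X) F) x ^+ 2).

Definition norm_02 (rho : R) (X : dfun M) : R :=
  \sum_(K in cells M) kint K (fun x => peval (dv X K) x ^+ 2) +
  rho * \sum_(F in ifaces M) hF F * sint F (fun x => dh X F x ^+ 2).

Definition norm_12 (rho : R) (X : dfun M) : R :=
  \sum_(K in cells M) kint K (fun x =>
    dot (pevalv (pgrad (dv X K)) x) (pevalv (pgrad (dv X K)) x)) +
  rho^-1 * \sum_(K in cells M) (hK K)^-1 *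
    bint K (fun F x => (peval (dv X K) x - dh X F x) ^+ 2).

Definition normU1 (S : spaces M) (rho : R) (X : dfun M) : R :=
  Num.sqrt (norm_div2 S rho X + norm_02 rho X).

Definition normU2 (rho : R) (X : dfun M) : R :=
  Num.sqrt (norm_q2 X + norm_12 rho X).

Variable Omega : set pt.

(* c p + grad u = 0 and div p = f in Omega, u = 0 on the boundary of Omega;
   g stands for grad u. *)
Definition exact_solution (f : pt -> R) (p : pt -> pt) (u : pt -> R)
    (g : pt -> pt) : Prop :=
  [/\ H10 Omega u g, L2v Omega p,
      ae_in Omega (fun x => mulmv (c x) (p x) + g x = 0) &
      weak_div Omega p f].

(* The trace operator H^1(K) -> L^2(F) is the continuous extension of the
   restriction operator. *)
Definition is_trace K F (u : pt -> R) (g : pt -> pt) (uF : pt -> R) : Prop :=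
  L2F F uF /\ exists w, [/\ forall n, C1 (w n),
    H1_cvg (interior (simplex K)) w u g &
    (fun n => sint F (fun x => (w n x - uF x) ^+ 2)) @ \oo --> (0 : R)].

(* The normal trace on the boundary of K of p in H(div, K), with div p = f, is
   defined by Green's formula. *)
Definition is_normal_trace K (p : pt -> pt) (f : pt -> R)
    (pn : {set V} -> pt -> R) : Prop :=
  (forall F, F \in facets K -> L2F F (pn F)) /\
  forall w, C1 w ->
    kint K (fun x => dot (p x) (grad w x) + f x * w x) =
    bint K (fun F x => pn F x * w x).

(* (p, (u, u|_Eh)) seen by A_h; uh is single-valued on faces. *)
Definition exact_broken (f : pt -> R) (p : pt -> pt) (u : pt -> R)
    (pn : {set V} -> {set V} -> pt -> R) (uh : {set V} -> pt -> R) : broken :=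
  {| bp := fun=> p; bdiv := fun=> f; bpn := pn;
     bu := fun=> u; btr := fun=> uh; bhat := uh |}.

Definition consistent (S : spaces M) (tau : {set V} -> R) : Prop :=
  forall f p u g pn uh, L2 Omega f -> exact_solution f p u g ->
    (forall K F, K \in cells M -> F \in facets K -> is_trace K F u g (uh F)) ->
    (forall K, K \in cells M -> is_normal_trace K p f (pn K)) ->
    forall Y, in_Uh S Y ->
      Ah tau (exact_broken f p u pn uh) (embed Y) =
      - \sum_(K in cells M) kint K (fun x => f x * peval (dv Y K) x).

Definition continuous_form (S : spaces M) (tau : {set V} -> R)
    (N : dfun M -> R) (M0 : R) : Prop :=
  forall X Y, in_Uh S X -> in_Uh S Y ->
    `|Ah tau (embed X) (embed Y)| <= M0 * N X * N Y.

Definition inf_sup (S : spaces M) (tau : {set V} -> R) (N : dfun M -> R)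
    (beta1 : R) : Prop :=
  let U := [set X | in_Uh S X /\ ~ is_zero X] in
  (beta1%:E <=
   ereal_inf [set ereal_sup
     [set (Ah tau (embed X) (embed Y) / (N X * N Y))%:E | X in U] | Y in U])%E.

Definition uniformly_stable (S : spaces M) (tau : {set V} -> R)
    (N : dfun M -> R) (M0 beta1 : R) : Prop :=
  [/\ consistent S tau, continuous_form S tau N M0 & inf_sup S tau N beta1].

End HDG.

(* Main.v *)
(* Test A_h(., Y), Y = (q, v, v^), with (q, -v, -v^) plus a small multiple of a
   second triple Z.  The first triple yields (c q, q) and the tau-norm of v - v^.

   When tau = 1/(rho h), Z = (grad_h v, 0, 0): after elementwise integration by
   parts it yields |grad_h v|^2 up to a jump term, absorbed by a discrete trace
   inequality.

   When tau = rho h, Z = (p, - div_h q, (rho h_e)^-1 P_e[q]) yields the terms in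
   div_h q and P_e[q], while v^ is controlled by v and v - v^.  The field p has
   single-valued normal traces, is bounded by v together with its divergence,
   and satisfies |v|^2 <= - C (v, div_h p).  It is the sum of two Raviart-Thomas
   fields.  One is a tangential bubble, with vanishing normal traces, which
   controls v up to its mean on each cell.  The other is of lowest order, with
   divergence minus the mean of v: its fluxes (w_K - w_F) / h_K come from the
   lowest order hybrid discretization of the Poisson problem, solvable by the
   broken Poincare inequality, itself obtained by integrating div (w^2 x).

   Consistency reduces, by elementwise Green formulas, to the normal traces of
   the exact flux having no jump across an interior face: test the weak
   divergence with C^1 bumps near that face, vanishing on all other faces, whose
   restrictions to the face tend to the indicator function of a box. *)

Require Import Defs.
From mathcomp Require Import all_boot all_order all_algebra.
From mathcomp Require Import -(notations) mpoly.
From mathcomp Require Import all_classical all_reals all_analysis.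
From mathcomp Require Import measurable_realfun.
From mathcomp Require Import ring lra perm.
Import Order.TTheory GRing.Theory Num.Theory.
Import numFieldNormedType.Exports.
Local Open Scope classical_set_scope.
Local Open Scope ring_scope.
Set Implicit Arguments.
Unset Strict Implicit.
Unset Printing Implicit Defensive.

(** * Lebesgue measure and integrals on R^n *)

Section Measure.
Context {R : realType}.
Local Notation T := (measurableTypeR R).
Local Notation mu := (@lebesgue_measure R).

(** Uniformity in the mesh is the difficulty: every constant must come from [Omega], [alpha],
    [sigma] and the degrees. Inequalities between polynomials are therefore proved once on the
    reference simplex, where compactness of a sphere of coefficients yields a constant, and are
    transported affinely; shape regularity enters only as the bound [sigma] on [hK K] times the
    gradients of the barycentric coordinates. Inequalities across cells cannot be localized, and a
    nonconvex domain offers no full elliptic regularity, so they rest on the divergence theorem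
    alone. A flux [p] without normal jumps lets one proof serve every [r]: it is invisible to all
    single-valued traces, and it lies in the Raviart-Thomas space of order [k], which both choices
    of the flux space contain. Uniformity in [rho] comes from weights: each Cauchy-Schwarz
    inequality puts a power of [rho] on one factor and its inverse on the other, as the norms do,
    and [rho <= 1] absorbs what is left; hence also [rho0 = 1] in the second part. *)

Definition unrow n (v : 'rV[R]_n) : n.-tuple T := [tuple v 0 i | i < n].

Lemma unrowK n : cancel (@unrow n) (@rowt R n).
Proof. by move=> v; apply/rowP => i; rewrite mxE tnth_mktuple. Qed.

Lemma rowtK n : cancel (@rowt R n) (@unrow n).
Proof. by move=> t; apply: eq_from_tnth => i; rewrite tnth_mktuple mxE. Qed.

Lemma measurable_box n (B : 'I_n -> set T) : (forall i, measurable (B i)) ->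
  measurable [set t : n.-tuple T | forall i, B i (tnth t i)].
Proof.
move=> mB.
rewrite (_ : [set t | _] =
    ~` \bigcup_i ((@tnth n T)^~ i @^-1` (~` B i))); last first.
  apply/seteqP; split => [t Bt [i _ /=]|t /= nB i]; first exact.
  by apply: contrapT => Bi; apply: nB; exists i.
apply: measurableC; apply: countable_bigcupT_measurable => // i.
by rewrite -[X in measurable X]setTI; apply: measurable_tnth => //; exact: measurableC.
Qed.

(** The topology is that of the sup norm while measurability refers to the product sigma-algebra. An
    open set is the union of the cubes inside it with rational centre and radius of the form
    1/(k+1), and these are countably many. *)
Lemma open_measurable_rowt n (A : set 'rV[R]_n) : open A ->
  measurable (@rowt R n @^-1` A).
Proof.
move=> oA.
pose q (p : n.-tuple rat * nat) i : R := ratr (tnth p.1 i).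
pose F (p : n.-tuple rat * nat) : set (n.-tuple T) :=
  if `[<forall y : 'rV[R]_n, (forall i, `|q p i - y 0 i| < p.2.+1%:R^-1) -> A y>]
  then [set t : n.-tuple T | forall i, ball (q p i) p.2.+1%:R^-1 (tnth t i)]
  else set0.
rewrite (_ : _ @^-1` _ = \bigcup_p F p).
  apply: countable_bigcupT_measurable => // p; rewrite /F; case: ifP => _ //.
  by apply: (@measurable_box n (fun i => ball (q p i) p.2.+1%:R^-1)) => i; exact: measurable_ball.
apply/seteqP; split => [t /= At|t [p _]]; last first.
  rewrite /F; case: asboolP => // H /= Ht; apply: H => i.
  by rewrite mxE; exact: Ht.
have [e /= e0 He] : exists2 e : R, 0 < e & ball (rowt t) e `<=` A.
  by have /nbhs_ballP[e e0 H] := open_nbhs_nbhs (conj oA At); exists e.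
(* With radius below [e / 2], a cube that contains the point lies in the ball of radius [e] around
   it. *)
pose k := Num.truncn (2 / e).
have k0 : 0 < k.+1%:R^-1 :> R by rewrite invr_gt0.
have ke : k.+1%:R^-1 < e / 2.
  by rewrite -[e / 2]invrK ltf_pV2 ?posrE ?invr_gt0 ?divr_gt0// invf_div truncnS_gt.
have /choice[f Hf] : forall i : 'I_n, exists r : rat, `|ratr r - tnth t i : R| < k.+1%:R^-1.
  move=> i; have [|r] := @rat_in_itvoo R (tnth t i - k.+1%:R^-1) (tnth t i + k.+1%:R^-1).
    by rewrite ltrBlDr -addrA ltrDl addr_gt0.
  rewrite in_itv/= => /andP[h1 h2]; exists r.
  have aux (x y z : R) : x - z < y -> y < x + z -> `|y - x| < z.
    by move=> ? ?; rewrite ltr_norml; apply/andP; split; lra.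
  exact: aux h1 h2.
exists ([tuple f i | i < n], k) => //; rewrite /F; case: asboolP => [_ i|nH].
  by rewrite /q /= /ball/= tnth_mktuple; exact: Hf.
exfalso; apply: nH => y Hy; apply: He; split => // i0 i.
rewrite (ord1 i0) /ball/= mxE.
have := Hy i; rewrite /q /= tnth_mktuple => Hy'.
rewrite (_ : tnth t i - y 0 i = - (ratr (f i) - tnth t i) + (ratr (f i) - y 0 i)); last by ring.
rewrite (le_lt_trans (ler_normD _ _))// normrN.
by rewrite [ltRHS](_ : _ = e/2 + e/2) ?ltrD ?(lt_trans _ ke)//; field.
Qed.

Lemma continuous_measurable_rowt n (f : 'rV[R]_n -> R) : continuous f ->
  measurable_fun setT (f \o @rowt R n : n.-tuple T -> T).
Proof.
move=> cf; apply: (measurability _ (RGenOpens.measurableE R)).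
move=> _ [_ [a [b ->] <-]]; rewrite setTI comp_preimage.
apply: open_measurable_rowt; apply: open_comp => // x _; exact: cf.
Qed.

Lemma measurable_unrow d (S : measurableType d) n (g : S -> 'rV[R]_n) :
  (forall i, measurable_fun setT (fun x => g x 0 i : T)) ->
  measurable_fun setT (fun x => unrow (g x)).
Proof.
move=> mg; apply/measurable_fun_tnthP => i.
by rewrite (_ : _ \o _ = fun x => g x 0 i)//; apply/funext => x /=; rewrite tnth_mktuple.
Qed.

Definition aff m n (A : 'M[R]_(m, n)) (b : 'rV[R]_n) (t : m.-tuple T) : n.-tuple T :=
  unrow (rowt t *m A + b).

Lemma measurable_aff m n (A : 'M[R]_(m, n)) b : measurable_fun setT (aff A b).
Proof.
apply: measurable_unrow => i.
rewrite (_ : (fun x => _) = fun t : m.-tuple T => \sum_j tnth t j * A j i + b 0 i); last first.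
  by apply/funext => t; rewrite !mxE; congr (_ + _); apply: eq_bigr => j _; rewrite mxE.
apply: measurable_funD => //; apply: measurable_sum => j.
by apply: measurable_funM => //; exact: measurable_tnth.
Qed.

Lemma tonelli_cons n (f : n.+1.-tuple T -> \bar R) :
  measurable_fun setT f -> (forall t, 0 <= f t)%E ->
  (\int[lebn n.+1]_t f t = \int[mu]_a \int[lebn n]_t f (tcons (a, t)))%E.
Proof.
move=> mf f0.
pose lprod : {measure set (T * n.-tuple T)%type -> \bar R} :=
  [the {measure set (T * n.-tuple T)%type -> \bar R}
   of product_measure1 mu (lebn n)].
pose nu := measure_function_pushforward__canonical__measure_function_Measure
  lprod (@measurable_tcons R n).
transitivity (\int[nu]_t f t)%E; first exact: eq_measure_integral.
rewrite (ge0_integral_pushforward (@measurable_tcons R n))//.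
rewrite preimage_setT fubini_tonelli1 //; last by move=> x; exact: f0.
exact: (measurableT_comp mf (@measurable_tcons R n)).
Qed.

Lemma tonelli_cons_swap n (f : n.+1.-tuple T -> \bar R) :
  measurable_fun setT f -> (forall t, 0 <= f t)%E ->
  (\int[lebn n.+1]_t f t = \int[lebn n]_t \int[mu]_a f (tcons (a, t)))%E.
Proof.
move=> mf f0; rewrite tonelli_cons//.
apply: (@fubini_tonelli _ _ _ _ _ mu (lebn n) (f \o @tcons R n)) => //.
  exact: (measurableT_comp mf (@measurable_tcons R n)).
by move=> x; exact: f0.
Qed.

Lemma measurable_tonelli_cons n (f : n.+1.-tuple T -> \bar R) :
  measurable_fun setT f -> (forall t, 0 <= f t)%E ->
  measurable_fun setT (fun a => \int[lebn n]_t f (tcons (a, t)))%E.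
Proof.
move=> mf f0.
apply: (@measurable_fun_fubini_tonelli_F _ _ _ _ _ (lebn n) (f \o @tcons R n)).
  exact: (measurableT_comp mf (@measurable_tcons R n)).
by move=> x; exact: f0.
Qed.

(** The pushforward of Lebesgue measure, scaled by [|a|], agrees with Lebesgue measure on half-open
    intervals, hence everywhere by uniqueness. A negative [a] exchanges the open and the closed end,
    which has no effect on the length. *)
Lemma integral_affine1 (a b : R) (f : R -> \bar R) : a != 0 ->
  measurable_fun setT f -> (forall x, 0 <= f x)%E ->
  (\int[mu]_x f (a * x + b)%R = (`|a|^-1)%:E * \int[mu]_x f x)%E.
Proof.
move=> a0 mf f0.
have mphi : measurable_fun setT (fun x : T => a * x + b : T).
  by apply: measurable_funD => //; exact: measurable_funM.
have a_gt0 : 0 < `|a| by rewrite normr_gt0.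
pose k : {nonneg R} := NngNum (normr_ge0 a).
pose nu := measure_function_pushforward__canonical__measure_function_Measure mu mphi.
have H A : measurable A -> mu A = mscale k nu A.
  apply: (@lebesgue_measure_unique R [the measure _ _ of mscale k nu]).
  move=> X [[l u] _ <-] /=; rewrite /mscale /nu /= /pushforward.
  rewrite lebesgue_measure_itv/= lte_fin.
  have [agt|alt|] := ltrgt0P a; last by move/eqP; rewrite (negbTE a0).
    rewrite (_ : _ @^-1` _ = `](l - b) / a, (u - b) / a]%classic); last first.
      apply/seteqP; split => x; rewrite /= !in_itv/= ltr_pdivrMr// ler_pdivlMr// ltrBlDr lerBrDr (mulrC x);
      by [].
    rewrite lebesgue_measure_itv/= lte_fin ltr_pM2r ?invr_gt0// ltrD2r.
    case: ifP => _; last by rewrite mule0.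
    by rewrite -!EFinB -EFinM; congr EFin; field.
  rewrite (_ : _ @^-1` _ = `[(u - b) / a, (l - b) / a[%classic); last first.
    apply/seteqP; split => x; rewrite /= !in_itv/= ltr_ndivlMr// ler_ndivrMr// ltrBlDr lerBrDr (mulrC x) andbC;
      by [].
  rewrite lebesgue_measure_itv/= lte_fin ltr_nM2r ?invr_lt0// ltrD2r.
  case: ifP => _; last by rewrite mule0.
  by rewrite -!EFinB -EFinM; congr EFin; field.
rewrite [in RHS](@eq_measure_integral _ _ _ _ [the measure _ _ of mscale k nu]); last first.
  by move=> A mA _; exact: H.
rewrite ge0_integral_mscale// muleA -EFinM mulVf ?gt_eqF// mul1e.
by rewrite (ge0_integral_pushforward mphi).
Qed.

Lemma aff_cons n (a : T) (t : n.-tuple T) : rowt (tcons (a, t)) = row_mx a%:M (rowt t) :> 'rV_(1 + n).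
Proof.
apply/rowP => i; rewrite mxE; case: (split_ordP i) => j ->.
  rewrite row_mxEl mxE (ord1 j) eqxx mulr1n.
  by rewrite (_ : lshift n ord0 = ord0) ?tnth0//; exact: val_inj.
rewrite row_mxEr mxE -[RHS](@tnthS _ _ a); congr (tnth _ _); exact: val_inj.
Qed.

Lemma unrow_cons n (a : 'M[R]_1) (v : 'rV[R]_n) :
  unrow (row_mx a v : 'rV[R]_(1 + n)) = tcons (a 0 0 : T, unrow v).
Proof.
apply: (can_inj (@rowtK n.+1)); rewrite unrowK aff_cons unrowK.
by rewrite -mx11_scalar.
Qed.

(** The change of variables formula, required for all translations [b] at once: a block of a
    triangular matrix is applied with a translation that depends on the remaining variable. *)
Definition cov n (A : 'M[R]_n) := forall b (f : n.-tuple T -> \bar R),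
  measurable_fun setT f -> (forall t, 0 <= f t)%E ->
  (\int[lebn n]_t f (aff A b t) = (`|\det A|^-1)%:E * \int[lebn n]_t f t)%E.

Lemma measurable_comp_aff m n (A : 'M[R]_(m, n)) b (f : n.-tuple T -> \bar R) :
  measurable_fun setT f -> measurable_fun setT (fun t => f (aff A b t)).
Proof. by move=> mf; exact: (measurableT_comp mf (measurable_aff A b)). Qed.

Lemma cov_mul n (A B : 'M[R]_n) : cov A -> cov B -> cov (A *m B).
Proof.
move=> cA cB b f mf f0.
rewrite (_ : (fun t => f _) = fun t => f (aff B b (aff A 0 t))); last first.
  by apply/funext => t; rewrite /aff unrowK addr0 mulmxA.
rewrite (cA 0 (fun t => f (aff B b t)))//; last exact: measurable_comp_aff.
by rewrite cB// muleA -EFinM det_mulmx normrM invfM.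
Qed.

(** Vectors are rows, so [(x, t)] is sent to [(a x, x r + t S)]. For fixed [x] the inner integral is
    an instance of [cov S] with translation [x r + b1]; the outer one is one-dimensional. *)
Lemma cov_utri n (a : R) (r : 'rV[R]_n) (S : 'M[R]_n) : a != 0 -> cov S ->
  @cov n.+1 (block_mx a%:M r 0 S : 'M[R]_(1 + n)).
Proof.
move=> a0 cS b f mf f0.
pose b0 : 'M[R]_1 := lsubmx (b : 'rV[R]_(1 + n)); pose b1 := rsubmx (b : 'rV[R]_(1 + n)).
rewrite tonelli_cons//; last exact: measurable_comp_aff.
transitivity (\int[mu]_x \int[lebn n]_t
   f (tcons ((a * x + b0 0 0)%R, aff S (x *: r + b1)%R t) : n.+1.-tuple T))%E.
  apply: eq_integral => x _; apply: eq_integral => t _; congr f.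
  rewrite /aff aff_cons (@mul_row_block R 1 1 n 1 n) mulmx0 addr0 -scalar_mxM mul_scalar_mx.
  rewrite -[b](@hsubmxK _ 1 1 n) (@add_row_mx _ 1 1 n) unrow_cons; congr (tcons (_, unrow _)).
    by rewrite !mxE eqxx mulr1n mulrC; congr (_ + b _ _); exact: val_inj.
  by rewrite -addrA addrCA.
have mfx x : measurable_fun setT (fun t : n.-tuple T => f (tcons (x, t))).
  apply: (measurableT_comp mf); exact: (measurableT_comp (@measurable_tcons R n) (pair1_measurable x)).
transitivity (\int[mu]_x ((`|\det S|^-1)%:E *
    \int[lebn n]_t f (tcons ((a * x + b0 0 0)%R, t) : n.+1.-tuple T)))%E.
  by apply: eq_integral => x _; rewrite (cS _ (fun t => f (tcons (_, t)))).
rewrite ge0_integralZl_EFin//; first last.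
- apply: (measurableT_comp (measurable_tonelli_cons mf f0)).
  by apply: measurable_funD => //; exact: measurable_funM.
- by move=> x _; apply: integral_ge0.
rewrite (@integral_affine1 a (b0 0 0)
   (fun x => \int[lebn n]_t f (tcons (x, t) : n.+1.-tuple T))%E)//; first last.
- by move=> x; apply: integral_ge0.
- exact: measurable_tonelli_cons.
rewrite muleA -EFinM -tonelli_cons//; congr (_%:E * _)%E.
by rewrite (@det_ublock R 1 n) det_scalar expr1 normrM invfM mulrC.
Qed.

Lemma cov1 n : cov (1%:M : 'M[R]_n).
Proof.
elim: n => [|n IH]; last first.
  have := @cov_utri n 1 0 1%:M (oner_neq0 _) IH.
  by rewrite -scalar_mx_block.
move=> b f mf f0; rewrite det1 normr1 invr1 mul1e; apply: eq_integral => t _.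
by congr f; apply: eq_from_tnth => -[].
Qed.

(** Here [(x, t)] is sent to [(x + t c, t)]. Integrating in [x] first turns the shear into a
    translation of the line. *)
Lemma cov_ltri n (c : 'cV[R]_n) : @cov n.+1 (block_mx 1 0 c 1%:M : 'M[R]_(1 + n)).
Proof.
move=> b f mf f0.
pose g t := f (aff 1%:M b t).
have mg : measurable_fun setT g by exact: measurable_comp_aff.
rewrite (_ : (fun t => _) = fun t => g (aff (block_mx 1 0 c 1%:M : 'M[R]_(1 + n)) 0 t)); last first.
  by apply/funext => t; rewrite /g /aff unrowK addr0 mulmx1.
have g0 t : (0 <= g t)%E by exact: f0.
rewrite [LHS]tonelli_cons_swap; [|
  exact: (@measurable_comp_aff n.+1 n.+1 (block_mx 1 0 c 1%:M : 'M[R]_(1 + n)) 0 g mg)|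
  by move=> t; exact: g0].
transitivity (\int[lebn n]_t \int[mu]_x
    g (tcons ((1 * x + (rowt t *m c) 0 0)%R, t) : n.+1.-tuple T))%E.
  apply: eq_integral => t _; apply: eq_integral => x _; congr g.
  rewrite /aff aff_cons addr0 (@mul_row_block R 1 1 n 1 n) mulmx0 mulmx1 add0r mulmx1.
  rewrite unrow_cons rowtK; congr (tcons (_, _)).
  by rewrite mxE [in LHS]mxE eqxx mulr1n mul1r.
transitivity (\int[lebn n]_t \int[mu]_x g (tcons (x, t) : n.+1.-tuple T))%E.
  apply: eq_integral => t _.
  rewrite (@integral_affine1 1 ((rowt t *m c) 0 0) (fun x => g (tcons (x, t) : n.+1.-tuple T)))//.
  - by rewrite normr1 invr1 mul1e.
  - apply: (measurableT_comp mg); exact: (measurableT_comp (@measurable_tcons R n) (pair2_measurable t)).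
rewrite -tonelli_cons_swap// (@cov1 n.+1 b f)//.
by rewrite (@det_lblock R 1 n) !det1 mulr1.
Qed.

(** One step of Gaussian elimination: a nonzero pivot factors [A] into a shear and a block
    triangular matrix whose corner is the Schur complement. *)
Lemma cov_pivot n (A : 'M[R]_(1 + n)) : ulsubmx A 0 0 != 0 ->
  (forall S : 'M[R]_n, S \in unitmx -> cov S) -> A \in unitmx -> @cov n.+1 A.
Proof.
move=> a0 IH uA.
set a := ulsubmx A 0 0 in a0.
set r := ursubmx A; set c := dlsubmx A; set S := drsubmx A.
have EA : A = block_mx 1 0 (a^-1 *: c) 1%:M *m block_mx a%:M r 0 (S - a^-1 *: (c *m r)).
  rewrite mulmx_block !mul1mx !mul0mx !addr0 -!scalemxAl.
  rewrite mul_mx_scalar scalerA mulVf// scale1r addrC subrK.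
  by rewrite -[LHS]submxK -mx11_scalar.
rewrite EA; apply: cov_mul; first exact: cov_ltri.
apply: cov_utri => //; apply: IH.
move: uA; rewrite !unitmxE EA det_mulmx det_lblock det_ublock !det1 !mul1r.
by rewrite det_scalar expr1 unitrM => /andP[].
Qed.

Theorem cov_unit n (A : 'M[R]_n) : A \in unitmx -> cov A.
Proof.
elim: n A => [|n IH] A uA.
  move=> b f mf f0; rewrite det_mx00 normr1 invr1 mul1e; apply: eq_integral => t _.
  by congr f; apply: eq_from_tnth => -[].
have [a0|a0] := eqVneq (ulsubmx (A : 'M[R]_(1 + n)) 0 0) 0; last exact: cov_pivot.
have [i ci] : exists i, dlsubmx (A : 'M[R]_(1 + n)) i 0 != 0.
  apply: contrapT => nc.
  have c0 : dlsubmx (A : 'M[R]_(1 + n)) = 0.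
    apply/colP => i; rewrite [RHS]mxE; apply/eqP; apply: contrapT => /negP ci.
    by apply: nc; exists i.
  move: uA; rewrite unitmxE -(@submxK _ 1 n 1 n A) c0 (mx11_scalar (ulsubmx _)) a0.
  by rewrite (@det_ublock R 1 n) det_scalar expr1 mul0r unitr0.
(* Left multiplication by [E 1] adds row [i] of the lower part to the first row, which makes the
   pivot nonzero; [E (-1)] undoes it. *)
pose E s : 'M[R]_(1 + n) := block_mx 1 (s *: delta_mx 0 i) 0 1%:M.
have EK : E (-1) *m E 1 = 1%:M.
  rewrite mulmx_block !mul1mx !mul0mx !mulmx0 !addr0 !mulmx1 add0r scale1r scaleN1r subrr.
  by rewrite -scalar_mx_block.
rewrite -[A](@mul1mx _ n.+1 n.+1) -EK -mulmxA; apply: (@cov_mul n.+1).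
  by have := @cov_utri n 1 (-1 *: delta_mx 0 i) 1%:M (oner_neq0 _) (@cov1 n).
apply: cov_pivot => //.
  rewrite -[A](@submxK _ 1 n 1 n) (@mulmx_block R 1 n 1 n 1 n) block_mxKul (mx11_scalar (ulsubmx _)) a0.
  by rewrite scale1r mul1mx raddf0 add0r -rowE mxE.
rewrite unitmx_mul uA andbT unitmxE det_ublock !det1 mulr1; exact: unitr1.
Qed.

End Measure.

(** * Null sets, integrals over subsets of R^n, square-integrable functions *)

Section Vint.
Context {R : realType}.
Local Notation T := (measurableTypeR R).
Local Notation mu := (@lebesgue_measure R).

Definition lform n (a : 'I_n -> R) (t : n.-tuple T) : T := \sum_i a i * tnth t i.

Lemma measurable_lform n (a : 'I_n -> R) : measurable_fun setT (lform a).
Proof.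
apply: measurable_sum => j.
by apply: measurable_funM => //; exact: measurable_tnth.
Qed.

(** Induction by slicing. If a coefficient other than the first is nonzero, the slices at fixed
    first coordinate are hyperplanes of lower dimension; otherwise the slices in the first
    coordinate are single points. *)
Lemma lebn_hyperplane n (a : 'I_n -> R) b : (exists i, a i != 0) ->
  lebn n [set t : n.-tuple T | lform a t = b] = 0%E.
Proof.
elim: n a b => [|n IH] a b [i ai]; first by case: i ai.
have mN m (c : 'I_m -> R) d : measurable [set t : m.-tuple T | lform c t = d].
  rewrite -[X in measurable X]setTI.
  exact: (@measurable_lform m c measurableT [set d] (measurable_set1 d)).
have mI : measurable_fun setT (fun t => (\1_[set t : n.+1.-tuple T | lform a t = b] t)%:E : \bar R).
  by apply/measurable_EFinP; apply: measurable_indic; exact: mN.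
have II m (A : set (m.-tuple T)) : measurable A ->
    lebn m A = (\int[lebn m]_t (\1_A t)%:E)%E.
  by move=> mA; rewrite integral_indic// setIT.
rewrite II//.
have E x (t : n.-tuple T) : lform a (tcons (x, t)) = a ord0 * x + lform (fun j => a (lift ord0 j)) t.
  rewrite /lform big_ord_recl/= tnth0; congr (_ + _).
  by apply: eq_bigr => j _; rewrite tnthS.
have [/existsP[j aj]|] := boolP [exists j : 'I_n, a (lift ord0 j) != 0].
  rewrite tonelli_cons// integral0_eq// => x _.
  rewrite -(IH (fun j => a (lift ord0 j)) (b - a ord0 * x)); last by exists j.
  rewrite II//; apply: eq_integral => t _.
  rewrite !indicE; congr (_%:E); congr (_%:R); congr nat_of_bool.
  apply/idP/idP; rewrite !inE/= E => H; first by rewrite -H addrC addKr.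
  by rewrite H addrC subrK.
rewrite negb_exists => /forallP H.
have a0 : a ord0 != 0.
  by case: (unliftP ord0 i) ai => [j|] -> //; move: (H j); rewrite negbK => /eqP ->; rewrite eqxx.
rewrite tonelli_cons_swap// integral0_eq// => t _.
rewrite -(lebesgue_measure_set1 (b / a ord0)) -[X in mu X]setIT -integral_indic//.
apply: eq_integral => x _; rewrite !indicE; congr (_%:E); congr (_%:R); congr nat_of_bool.
have E0 : lform (fun j => a (lift ord0 j)) t = 0.
  by apply: big1 => j _; move: (H j); rewrite negbK => /eqP ->; rewrite mul0r.
apply/idP/idP; rewrite !inE/= E E0 addr0 => K; first by rewrite -K mulrC mulKf.
by rewrite K mulrC divfK.
Qed.

Lemma lebn_box n (B : 'I_n -> set T) : (forall i, measurable (B i)) ->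
  ((forall i, 0 < mu (B i)) -> 0 < lebn n [set t : n.-tuple T | forall i, B i (tnth t i)])%E /\
  ((forall i, mu (B i) < +oo) -> lebn n [set t : n.-tuple T | forall i, B i (tnth t i)] < +oo)%E.
Proof.
elim: n B => [|n IH] B mB.
  have -> : [set t : 0.-tuple T | forall i, B i (tnth t i)] = setT by apply/seteqP; split => // t _ [].
  by rewrite /= diracT; split => // _; rewrite ltry.
have [IH1 IH2] := IH (fun i => B (lift ord0 i)) (fun i => mB _).
set Bn := [set t : n.-tuple T | _] in IH1 IH2.
have mBn : measurable Bn by apply: (@measurable_box R n (fun i => B (lift ord0 i))).
have -> : lebn n.+1 [set t : n.+1.-tuple T | forall i, B i (tnth t i)] = (mu (B ord0) * lebn n Bn)%E.
  rewrite -product_measure1E//; congr ((mu \x lebn n)%E _).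
  apply/seteqP; split => -[x t] /=.
    move=> H; split; first by have := H ord0; rewrite tnth0.
    by move=> i; have := H (lift ord0 i); rewrite tnthS.
  move=> [H0 H] i; case: (unliftP ord0 i) => [j|] ->; last by rewrite tnth0.
  by rewrite tnthS; exact: H.
split => H; first by apply: mule_gt0 => //; exact: IH1.
by apply: lte_mul_pinfty => //; [rewrite ge0_fin_numE|exact: IH2].
Qed.

Lemma open_lebn_gt0 n (A : set 'rV[R]_n) x : open A -> A x ->
  (0 < lebn n (@rowt R n @^-1` A))%E.
Proof.
move=> oA Ax.
have /nbhs_ballP[e /= e0 He] := open_nbhs_nbhs (conj oA Ax).
have mB i : measurable (ball (x 0 i) e : set T) by exact: measurable_ball.
have [H _] := lebn_box mB.
apply: (lt_le_trans (H _)).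
  by move=> i; rewrite lebesgue_measure_ball ?lte_fin ?ltW// mulrn_wgt0.
apply: le_measure; rewrite ?inE.
- exact: (@measurable_box R n (fun i => ball (x 0 i) e)).
- exact: open_measurable_rowt.
- by move=> t Ht; apply: He; split => // i0 i; rewrite (ord1 i0) mxE; exact: Ht.
Qed.

Definition msr n (A : set 'rV[R]_n) := measurable (@rowt R n @^-1` A).
Definition intg n (A : set 'rV[R]_n) (f : 'rV[R]_n -> R) :=
  (lebn n).-integrable (@rowt R n @^-1` A) (fun t => (f (rowt t))%:E).

Variable n : nat.
Implicit Types (A B : set 'rV[R]_n) (f g : 'rV[R]_n -> R).

Lemma bounded_lebn A (M : R) : msr A -> (forall x, A x -> forall i, `|x 0 i| <= M) ->
  (lebn n (@rowt R n @^-1` A) < +oo)%E.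
Proof.
move=> mA bA.
have mB (i : 'I_n) : measurable (`[- M, M]%classic : set T) by [].
have [_ H] := lebn_box mB.
apply: (le_lt_trans _ (H _)).
  apply: le_measure; rewrite ?inE//; first exact: (@measurable_box R n (fun=> `[- M, M]%classic)).
  by move=> t At i /=; have := bA _ At i; rewrite in_itv/= mxE ler_norml.
by move=> i; rewrite lebesgue_measure_itv/=; case: ifP => _; rewrite ?ltry// -EFinB ltry.
Qed.

Lemma eq_vint A f g : (forall x, A x -> f x = g x) -> vint A f = vint A g.
Proof. by move=> fg; apply: eq_Rintegral => t; rewrite inE => At; exact: fg. Qed.

Lemma vint_ge0 A f : (forall x, A x -> 0 <= f x) -> 0 <= vint A f.
Proof. by move=> f0; apply: Rintegral_ge0 => t At; exact: f0. Qed.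

Lemma vint_eq0 A f : (forall x, A x -> f x = 0) -> vint A f = 0.
Proof.
move=> f0; rewrite (@eq_vint _ _ (fun=> 0))// /vint /Rintegral.
by rewrite integral0.
Qed.

Lemma vintD A f g : msr A -> intg A f -> intg A g ->
  vint A (fun x => f x + g x) = vint A f + vint A g.
Proof. by move=> mA fi gi; rewrite -RintegralD. Qed.

Lemma vintB A f g : msr A -> intg A f -> intg A g ->
  vint A (fun x => f x - g x) = vint A f - vint A g.
Proof. by move=> mA fi gi; rewrite -RintegralB. Qed.

Lemma vintZ A f r : msr A -> intg A f -> vint A (fun x => r * f x) = r * vint A f.
Proof. by move=> mA fi; rewrite -RintegralZl. Qed.

Lemma le_vint A f g : msr A -> intg A f -> intg A g ->
  (forall x, A x -> f x <= g x) -> vint A f <= vint A g.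
Proof. by move=> mA fi gi fg; apply: le_Rintegral => // t At; exact: fg. Qed.

Lemma eq_intg A f g : msr A -> (forall x, A x -> f x = g x) -> intg A f -> intg A g.
Proof.
move=> mA fg; apply: eq_integrable => // t; rewrite inE => At.
by congr EFin; exact: fg.
Qed.

Lemma intgD A f g : msr A -> intg A f -> intg A g -> intg A (fun x => f x + g x).
Proof. by move=> mA fi gi; apply: (integrableD mA fi gi). Qed.

Lemma intgB A f g : msr A -> intg A f -> intg A g -> intg A (fun x => f x - g x).
Proof. by move=> mA fi gi; apply: (integrableB mA fi gi). Qed.

Lemma intgZ A f r : msr A -> intg A f -> intg A (fun x => r * f x).
Proof. by move=> mA fi; apply: (integrableZl mA r fi). Qed.

Lemma intg0 A : msr A -> intg A (fun=> 0).
Proof. by move=> mA; exact: integrable0. Qed.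

Lemma intg_sum A (I : Type) (s : seq I) (P : pred I) (F : I -> 'rV[R]_n -> R) : msr A ->
  (forall i, P i -> intg A (F i)) -> intg A (fun x => \sum_(i <- s | P i) F i x).
Proof.
move=> mA Fi; elim: s => [|i s IH].
  by apply: eq_intg (intg0 mA) => // x _; rewrite big_nil.
have [Pi|nPi] := boolP (P i); last by apply: eq_intg IH => // x _; rewrite big_cons (negbTE nPi).
by apply: eq_intg (intgD mA (Fi i Pi) IH) => // x _; rewrite big_cons Pi.
Qed.

Lemma vint_sum A (I : Type) (s : seq I) (P : pred I) (F : I -> 'rV[R]_n -> R) : msr A ->
  (forall i, P i -> intg A (F i)) ->
  vint A (fun x => \sum_(i <- s | P i) F i x) = \sum_(i <- s | P i) vint A (F i).
Proof.
move=> mA Fi; elim: s => [|i s IH].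
  by rewrite big_nil; apply: vint_eq0 => x _; rewrite big_nil.
rewrite big_cons; case: ifPn => [Pi|nPi]; last first.
  by rewrite -IH; apply: eq_vint => x _; rewrite big_cons (negbTE nPi).
rewrite -IH -vintD//; last 2 first.
- exact: Fi.
- exact: intg_sum.
by apply: eq_vint => x _; rewrite big_cons Pi.
Qed.

Lemma mfun_dom A f g : msr A -> measurable_fun (@rowt R n @^-1` A) (f \o @rowt R n) ->
  intg A g -> (forall x, A x -> `|f x| <= g x) -> intg A f.
Proof.
move=> mA mf gi fg; apply: (le_integrable mA _ _ gi).
  exact/measurable_EFinP.
by move=> t At /=; rewrite lee_fin (le_trans (fg _ At))// ler_norm.
Qed.

Lemma L2_sqr A f : L2 A f -> intg A (fun x => f x ^+ 2).
Proof. by case. Qed.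

Lemma L2_mul A f g : msr A -> L2 A f -> L2 A g -> intg A (fun x => f x * g x).
Proof.
move=> mA [mf fi] [mg gi].
apply: (@mfun_dom _ _ (fun x => f x ^+ 2 + g x ^+ 2)) => //.
- exact: measurable_funM.
- exact: intgD.
move=> x _; rewrite -subr_ge0 normrM -(real_normK (num_real (f x))) -(real_normK (num_real (g x))).
rewrite (_ : _ - _ = ((`|f x| - `|g x|) ^+ 2 + `|f x| ^+ 2 + `|g x| ^+ 2) / 2); last by field.
by rewrite divr_ge0// !addr_ge0// sqr_ge0.
Qed.

Lemma L2D A f g : msr A -> L2 A f -> L2 A g -> L2 A (fun x => f x + g x).
Proof.
move=> mA Lf Lg; split; first exact: (measurable_funD Lf.1 Lg.1).
have H := intgD mA (intgD mA (L2_sqr Lf) (intgZ 2 mA (L2_mul mA Lf Lg))) (L2_sqr Lg).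
by apply: (@eq_intg A _ (fun x => (f x + g x) ^+ 2)) H => // x _; ring.
Qed.

Lemma L2Z A f r : msr A -> L2 A f -> L2 A (fun x => r * f x).
Proof.
move=> mA Lf; split; first by apply: measurable_funM => //; exact: Lf.1.
by apply: (@eq_intg A _ (fun x => (r * f x) ^+ 2)) (intgZ (r ^+ 2) mA (L2_sqr Lf)) => // x _; ring.
Qed.

Lemma L2N A f : msr A -> L2 A f -> L2 A (fun x => - f x).
Proof.
move=> mA Lf; have := L2Z (-1) mA Lf.
by rewrite (_ : (fun x => -1 * f x) = fun x => - f x)//; apply/funext => x; rewrite mulN1r.
Qed.

Lemma L2B A f g : msr A -> L2 A f -> L2 A g -> L2 A (fun x => f x - g x).
Proof. by move=> mA Lf Lg; exact: (L2D mA Lf (L2N mA Lg)). Qed.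

Lemma L2_0 A : msr A -> L2 A (fun=> 0).
Proof.
move=> mA; split; first exact: measurable_cst.
by apply: (@eq_intg A _ (fun=> 0 ^+ 2)) (intg0 mA) => // x _; rewrite expr0n.
Qed.

Lemma L2_sum A (I : Type) (s : seq I) (P : pred I) (F : I -> 'rV[R]_n -> R) : msr A ->
  (forall i, P i -> L2 A (F i)) -> L2 A (fun x => \sum_(i <- s | P i) F i x).
Proof.
move=> mA Fi; elim: s => [|i s IH].
  rewrite (_ : (fun x => _) = fun=> 0); first exact: L2_0.
  by apply/funext => x; rewrite big_nil.
have [Pi|nPi] := boolP (P i); last first.
  by rewrite (_ : (fun x => _) = fun x => \sum_(j <- s | P j) F j x)//; apply/funext => x; rewrite big_cons (negbTE nPi).
rewrite (_ : (fun x => _) = fun x => F i x + \sum_(j <- s | P j) F j x); first exact: L2D (Fi i Pi) IH.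
by apply/funext => x; rewrite big_cons Pi.
Qed.

Lemma intg_cont A f (M : R) : msr A -> (forall x, A x -> forall i, `|x 0 i| <= M) ->
  continuous f -> intg A f.
Proof.
move=> mA bA cf.
have [-> //|A0] := eqVneq A set0.
  have m0 : msr (set0 : set 'rV[R]_n) by rewrite /msr preimage_set0.
  by apply: eq_intg (intg0 _).
have /set0P[x0 Ax0] := A0.
pose B := [set x : 'rV[R]_n | forall i, (`[- M, M]%classic : set R) (x 0 i)].
have cB : compact B by apply: (@rV_compact R n (fun=> `[- M, M]%classic)) => i; exact: segment_compact.
have sAB : A `<=` B by move=> x Ax i /=; rewrite in_itv/= -ler_norml; exact: bA.
have [c cBc Hc] : exists2 c, c \in B & forall t, t \in B -> `|f t| <= `|f c|.
  apply: EVT_max_rV => //; first by exists x0; exact: sAB.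
  apply: continuous_subspaceT => x; exact: (cvg_norm (cf x)).
apply: (@mfun_dom _ _ (fun=> `|f c|)) => //.
- apply: measurable_funTS; exact: continuous_measurable_rowt.
- rewrite /intg; apply/integrableP; split; first exact: measurable_cst.
  rewrite integral_cst//= lte_mul_pinfty//.
  exact: (bounded_lebn mA bA).
- by move=> x Ax; apply: Hc; rewrite inE; exact: sAB.
Qed.

Lemma L2_cont A f (M : R) : msr A -> (forall x, A x -> forall i, `|x 0 i| <= M) ->
  continuous f -> L2 A f.
Proof.
move=> mA bA cf; split.
  by apply: measurable_funTS; exact: continuous_measurable_rowt.
apply: (@intg_cont A (fun x => f x ^+ 2) M mA bA) => x.
exact: (continuousM (cf x) (cf x)).
Qed.

Lemma young A f g t : 0 < t -> msr A -> L2 A f -> L2 A g ->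
  2 * vint A (fun x => f x * g x) <=
  t * vint A (fun x => f x ^+ 2) + t^-1 * vint A (fun x => g x ^+ 2).
Proof.
move=> t0 mA Lf Lg.
have := L2_mul mA Lf Lg; have := L2_sqr Lf; have := L2_sqr Lg => ig i_f ifg.
rewrite -(vintZ 2 mA ifg) -(vintZ t mA i_f) -(vintZ t^-1 mA ig) -vintD; [|by []|exact: intgZ|exact: intgZ].
apply: le_vint => //; [exact: intgZ|by apply: intgD => //; exact: intgZ|].
move=> x _; rewrite -subr_ge0.
rewrite (_ : _ - _ = t^-1 * (t * f x - g x) ^+ 2); last by field; exact: lt0r_neq0.
by apply: mulr_ge0; [rewrite invr_ge0 ltW|exact: sqr_ge0].
Qed.

Lemma L2_sub A B f : msr A -> msr B -> A `<=` B -> L2 B f -> L2 A f.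
Proof.
move=> mA mB AB [mf fi]; split.
  by apply: measurable_funS mf => // t; exact: AB.
by apply: (integrableS _ _ _ fi) => // t; exact: AB.
Qed.

Lemma intg_sub A B f : msr A -> msr B -> A `<=` B -> intg B f -> intg A f.
Proof. by move=> mA mB AB fi; apply: (integrableS _ _ _ fi) => // t; exact: AB. Qed.

Lemma vint_negl A B f : msr A -> msr B -> A `<=` B -> intg B f ->
  lebn n (@rowt R n @^-1` (B `\` A)) = 0%E -> vint A f = vint B f.
Proof.
move=> mA mB AB fi N0; rewrite /vint /Rintegral; congr fine.
have mN : measurable (@rowt R n @^-1` (B `\` A)) by exact: measurableD.
rewrite [RHS](negligible_integral mN mB fi N0); congr integral.
by apply/seteqP; split => t /=; [move=> At; split; [exact: AB|case]|move=> [Bt nN]; apply: contrapT => nA; apply: nN].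
Qed.

Lemma ae_vint A f g : msr A ->
  measurable_fun (@rowt R n @^-1` A) (f \o @rowt R n) ->
  measurable_fun (@rowt R n @^-1` A) (g \o @rowt R n) ->
  ae_in A (fun x => f x = g x) -> vint A f = vint A g.
Proof.
move=> mA mf mg fg; rewrite /vint /Rintegral; congr fine.
apply: ae_eq_integral => //; [exact/measurable_EFinP|exact/measurable_EFinP|].
by move: fg; rewrite /ae_in; apply: filterS => t /= H At; rewrite H.
Qed.

End Vint.

(** * Functions of class C^1 *)

Section Calculus.
Context {R : realType}.

Lemma dotC n (u v : 'rV[R]_n) : dot u v = dot v u.
Proof. by apply: eq_bigr => i _; rewrite mulrC. Qed.

Lemma dotDl n (u v w : 'rV[R]_n) : dot (u + v) w = dot u w + dot v w.
Proof. by rewrite -big_split/=; apply: eq_bigr => i _; rewrite mxE mulrDl. Qed.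

Lemma dotZl n a (u w : 'rV[R]_n) : dot (a *: u) w = a * dot u w.
Proof. by rewrite mulr_sumr; apply: eq_bigr => i _; rewrite mxE mulrA. Qed.

Lemma dotNl n (u w : 'rV[R]_n) : dot (- u) w = - dot u w.
Proof. by rewrite -scaleN1r dotZl mulN1r. Qed.

Lemma dotBl n (u v w : 'rV[R]_n) : dot (u - v) w = dot u w - dot v w.
Proof. by rewrite dotDl dotNl. Qed.

Lemma dot0l n (w : 'rV[R]_n) : dot 0 w = 0.
Proof. by rewrite -(scale0r 0) dotZl mul0r. Qed.

Lemma dotDr n (u v w : 'rV[R]_n) : dot w (u + v) = dot w u + dot w v.
Proof. by rewrite dotC dotDl !(dotC w). Qed.

Lemma dotZr n a (u w : 'rV[R]_n) : dot w (a *: u) = a * dot w u.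
Proof. by rewrite dotC dotZl (dotC w). Qed.

Lemma dotNr n (u w : 'rV[R]_n) : dot w (- u) = - dot w u.
Proof. by rewrite dotC dotNl (dotC w). Qed.

Lemma dotBr n (u v w : 'rV[R]_n) : dot w (u - v) = dot w u - dot w v.
Proof. by rewrite dotDr dotNr. Qed.

Lemma dot0r n (w : 'rV[R]_n) : dot w 0 = 0.
Proof. by rewrite dotC dot0l. Qed.

Lemma dot_suml n (I : Type) (s : seq I) (P : pred I) (F : I -> 'rV[R]_n) w :
  dot (\sum_(i <- s | P i) F i) w = \sum_(i <- s | P i) dot (F i) w.
Proof.
by elim/big_rec2: _ => [|i x y _ IH]; [rewrite dot0l|rewrite dotDl IH].
Qed.

Lemma dot_sumr n (I : Type) (s : seq I) (P : pred I) (F : I -> 'rV[R]_n) w :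
  dot w (\sum_(i <- s | P i) F i) = \sum_(i <- s | P i) dot w (F i).
Proof. by rewrite dotC dot_suml; apply: eq_bigr => i _; rewrite dotC. Qed.

Lemma dot_deltar n (u : 'rV[R]_n) i : dot u (delta_mx 0 i) = u 0 i.
Proof.
rewrite /dot (bigD1 i)//= mxE !eqxx mulr1 big1 ?addr0// => j ji.
by rewrite mxE (negbTE ji) andbF mulr0.
Qed.

Lemma dot_ge0 n (u : 'rV[R]_n) : 0 <= dot u u.
Proof. by apply: sumr_ge0 => i _; rewrite -expr2 sqr_ge0. Qed.

Lemma continuous_sumf (U : topologicalType) (I : Type) (s : seq I) (P : pred I) (F : I -> U -> R) :
  (forall i, P i -> continuous (F i)) -> continuous (fun x => \sum_(i <- s | P i) F i x).
Proof.
move=> cF; elim: s => [|i s IH] x.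
  rewrite (_ : (fun x => _) = cst 0); first exact: cst_continuous.
  by apply/funext => y; rewrite big_nil.
have [Pi|nPi] := boolP (P i); last first.
  rewrite (_ : (fun x => _) = fun x => \sum_(j <- s | P j) F j x); first exact: IH.
  by apply/funext => y; rewrite big_cons (negbTE nPi).
rewrite (_ : (fun x => _) = fun x => F i x + \sum_(j <- s | P j) F j x).
  exact: (continuousD (cF i Pi x) (IH x)).
by apply/funext => y; rewrite big_cons Pi.
Qed.

Lemma continuous_dotl n (w : 'rV[R]_n) : continuous (fun x => dot x w).
Proof.
apply: continuous_sumf => i _ x.
apply: (@continuousM R _ (fun x : 'rV[R]_n => x 0 i) (fun=> w 0 i)); last exact: cst_continuous.
exact: coord_continuous.
Qed.

Lemma continuous_dotr n (w : 'rV[R]_n) : continuous (dot w).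
Proof.
rewrite (_ : dot w = fun x => dot x w); first exact: continuous_dotl.
by apply/funext => x; rewrite dotC.
Qed.

(** The two difference quotients coincide. This gives access to the one-variable theorems on
    lines. *)
Lemma line_is_derive n (f : 'rV[R]_n -> R) z v (s D : R) :
  is_derive (z + s *: v) v f D <-> is_derive s (1 : R) (fun s => f (z + s *: v)) D.
Proof.
have E : (fun h => h^-1 *: (((fun s => f (z + s *: v)) \o shift s) (h *: (1 : R)) - f (z + s *: v))) =
         (fun h : R => h^-1 *: ((f \o shift (z + s *: v)) (h *: v) - f (z + s *: v))).
  apply/funext => h /=; congr (_ *: (f _ - _)).
  by rewrite [h *: 1]mulr1 scalerDl addrCA.
split => -[d1 d2]; split.
- by rewrite /derivable E.
- by rewrite /derive E.
- by rewrite /derivable -E.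
- by rewrite /derive -E.
Qed.

Lemma is_derive_continuous1 (g dg : R -> R) :
  (forall s, is_derive s (1 : R) g (dg s)) -> continuous g.
Proof.
move=> H s; apply: differentiable_continuous; apply/derivable1_diffP.
by case: (H s).
Qed.

Lemma mvt_line n (f df : 'rV[R]_n -> R) v z (b : R) :
  (forall x, is_derive x v f (df x)) ->
  exists2 xi : R, `|xi| <= `|b| & f (z + b *: v) - f z = b * df (z + xi *: v).
Proof.
move=> H.
have dg s : is_derive s (1 : R) (fun s => f (z + s *: v)) (df (z + s *: v)).
  by apply/line_is_derive.
have cg := is_derive_continuous1 dg.
have [b0|b0] := leP 0 b.
  have [|c + E] := @MVT_segment R (fun s => f (z + s *: v)) _ 0 b b0 (fun s _ => dg s).
    exact: continuous_subspaceT.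
  rewrite in_itv/= => /andP[c0 cb]; exists c; first by rewrite !ger0_norm.
  by move: E; rewrite scale0r addr0 subr0 mulrC.
have [|c + E] := @MVT_segment R (fun s => f (z + s *: v)) _ b 0 (ltW b0) (fun s _ => dg s).
  exact: continuous_subspaceT.
rewrite in_itv/= => /andP[bc c0]; exists c; first by rewrite !ler0_norm ?lerN2// ltW.
by move: E; rewrite scale0r addr0 sub0r mulrN => /(congr1 -%R); rewrite opprB opprK mulrC.
Qed.

(** The definition of [C1] knows only partial derivatives. Moving one coordinate at a time and
    applying the mean value theorem to each move, continuity of the partials gives the derivative in
    any direction. *)
Lemma C1_is_derive n (f : 'rV[R]_n -> R) x (v : 'rV[R]_n) : C1 f ->
  is_derive x v f (dot (grad f x) v).
Proof.
move=> [cf Hf].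
have df i y : is_derive y (delta_mx 0 i) f (partial i f y).
  by split => //; exact: (Hf i).1.
pose vk k : 'rV[R]_n := \row_i (if (i < k)%N then v 0 i else 0).
pose N := 1 + \sum_i `|v 0 i|.
have S0 : 0 <= \sum_i `|v 0 i| by apply: sumr_ge0.
have N0 : 0 < N by rewrite ltr_pwDl.
have vN j : `|v 0 j| <= N.
  by rewrite /N (bigD1 j)//= addrCA lerDl addr_ge0// sumr_ge0.
(* First-order expansion along [vk k], that is [v] with only its first [k] entries kept; [k = n]
   gives the claim. Half of the tolerance goes to the previous coordinates, half to the new one,
   whose increment is at most [|h| N]. *)
have key k (e : R) : (k <= n)%N -> 0 < e -> exists2 d : R, 0 < d & forall h : R, `|h| < d ->
    `|f (x + h *: vk k) - f x - h * \sum_(i < n | (i < k)%N) v 0 i * partial i f x| <= e * `|h|.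
  elim: k e => [|k IH] e kn e0.
    exists 1 => // h _; rewrite big_pred0// mulr0 subr0.
    rewrite (_ : vk 0 = 0); last by apply/rowP => i; rewrite !mxE.
    by rewrite scaler0 addr0 subrr normr0 mulr_ge0// ltW.
  pose i0 := Ordinal kn.
  have [d1 d10 H1] := IH (e / 2) (ltnW kn) (divr_gt0 e0 (ltr0Sn _ 1)).
  have e1 : 0 < e / 2 / N by rewrite !divr_gt0.
  have /cvgrPdist_lt /(_ _ e1) /nbhs_ballP[d2 /= d20 H2] := (Hf i0).2 x.
  have d3 : 0 < d2 / N by rewrite divr_gt0.
  exists (Num.min d1 (d2 / N)); first by rewrite lt_min d10.
  move=> h; rewrite lt_min => /andP[hd1 hd2].
  have EV : x + h *: vk k.+1 = (x + h *: vk k) + (h * v 0 i0) *: delta_mx 0 i0.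
    rewrite -addrA; congr (_ + _); apply/rowP => i; rewrite !mxE/= ltnS.
    have [->|ni] := eqVneq i i0; first by rewrite leqnn ltnn mulr0 add0r mulr1.
    by rewrite mulr0 addr0 leq_eqVlt -(inj_eq val_inj)/= in ni *; rewrite (negbTE ni).
  have -> : \sum_(i < n | (i < k.+1)%N) v 0 i * partial i f x =
     \sum_(i < n | (i < k)%N) v 0 i * partial i f x + v 0 i0 * partial i0 f x.
    rewrite (bigD1 i0)//= addrC; congr (_ + _); apply: eq_bigl => i.
    by rewrite ltnS -(inj_eq val_inj)/= andbC ltn_neqAle.
  rewrite EV.
  have [xi xih E] := mvt_line (x + h *: vk k) (h * v 0 i0) (df i0).
  set z := x + h *: vk k in E *.
  have Hd : `|partial i0 f x - partial i0 f (z + xi *: delta_mx 0 i0)| < e / 2 / N.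
    apply: H2; split => // i' j; rewrite (ord1 i') /ball/= !mxE.
    have hN : `|h| * N < d2 by rewrite -ltr_pdivlMr.
    have hv : `|h| * `|v 0 j| < d2.
      by apply: le_lt_trans hN; rewrite ler_wpM2l.
    have [ji|ji] := eqVneq j i0.
      rewrite ji ltnn mulr0 addr0 mulr1 opprD addrA subrr sub0r normrN.
      by rewrite (le_lt_trans xih)// normrM -ji.
    rewrite mulr0 addr0 opprD addrA subrr sub0r normrN normrM.
    by case: ifP => _ //; rewrite normr0 mulr0.
  rewrite (_ : _ - _ = (f z - f x - h * \sum_(i < n | (i < k)%N) v 0 i * partial i f x) +
     (h * v 0 i0) * (partial i0 f (z + xi *: delta_mx 0 i0) - partial i0 f x)); last first.
    have -> : f (z + (h * v 0 i0) *: delta_mx 0 i0) = f z + h * v 0 i0 * partial i0 f (z + xi *: delta_mx 0 i0).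
      by rewrite -E; ring.
    by ring.
  rewrite (le_trans (ler_normD _ _))//.
  rewrite (_ : e * `|h| = e / 2 * `|h| + (`|h| * N) * (e / 2 / N)); last by field; exact: lt0r_neq0.
  rewrite lerD ?H1// normrM; apply: ler_pM => //.
    by rewrite normrM ler_wpM2l.
  by rewrite distrC ltW.
have vkn : vk n = v by apply/rowP => i; rewrite mxE ltn_ord.
have cvgq : h^-1 *: ((f \o shift x) (h *: v) - f x) @[h --> 0^'] --> dot (grad f x) v.
  apply/cvgrPdist_le => e e0.
  have [d d0 Hd] := key n e (leqnn _) e0.
  near=> h.
  have h0 : h != 0 by near: h; exact: nbhs_dnbhs_neq.
  have hd : `|h| < d by near: h; exact: dnbhs0_lt.
  have := Hd h hd; rewrite vkn => Hd'.
  rewrite distrC -(ler_pM2r (x := `|h|)) ?normr_gt0// -normrM.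
  move: Hd'; congr (`|_| <= _).
  rewrite /= mulrBl /GRing.scale/= (mulrC h^-1) mulfVK// [h *: v + x]addrC.
  congr (_ - _); rewrite mulrC; congr (_ * _); rewrite /dot.
  by under eq_bigl do rewrite ltn_ord; apply: eq_bigr => i _; rewrite mxE mulrC.
split; first by apply/cvg_ex; exists (dot (grad f x) v).
exact: cvg_lim.
Unshelve. all: by end_near.
Qed.

(** Carries the partial derivatives as explicit functions, so that sums, products and polynomials
    produce usable formulas and not only differentiability. *)
Definition C1g n (f : 'rV[R]_n -> R) (g : 'I_n -> 'rV[R]_n -> R) :=
  (forall i x, is_derive x (delta_mx 0 i) f (g i x)) /\ continuous f /\ forall i, continuous (g i).

Lemma C1g_C1 n (f : 'rV[R]_n -> R) g : C1g f g -> C1 f.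
Proof.
move=> [df [cf cg]]; split => // i; split; first by move=> x; case: (df i x).
rewrite (_ : partial i f = g i)//; apply/funext => x.
exact: (@derive_val _ _ _ _ _ _ _ (df i x)).
Qed.

Lemma C1g_partial n (f : 'rV[R]_n -> R) g i x : C1g f g -> partial i f x = g i x.
Proof. by move=> [df _]; exact: (@derive_val _ _ _ _ _ _ _ (df i x)). Qed.

Lemma C1_C1g n (f : 'rV[R]_n -> R) : C1 f -> C1g f (fun i => partial i f).
Proof.
move=> [cf Hf]; split; last by split => // i; exact: (Hf i).2.
by move=> i x; split => //; exact: (Hf i).1.
Qed.

Lemma C1g_cst n (a : R) : C1g (fun=> a : R) (fun (i : 'I_n) => fun=> 0).
Proof.
split; first by move=> i x; exact: is_derive_cst.
by split => [|i]; exact: cst_continuous.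
Qed.

Lemma C1gD n (f f' : 'rV[R]_n -> R) g g' : C1g f g -> C1g f' g' ->
  C1g (fun x => f x + f' x) (fun i x => g i x + g' i x).
Proof.
move=> [df [cf cg]] [df' [cf' cg']]; split; first by move=> i x; exact: (is_deriveD (df i x) (df' i x)).
split; first by move=> x; exact: (continuousD (cf x) (cf' x)).
by move=> i x; exact: (continuousD (cg i x) (cg' i x)).
Qed.

Lemma C1gM n (f f' : 'rV[R]_n -> R) g g' : C1g f g -> C1g f' g' ->
  C1g (fun x => f x * f' x) (fun i x => g i x * f' x + f x * g' i x).
Proof.
move=> [df [cf cg]] [df' [cf' cg']]; split.
  move=> i x; apply: (is_derive_eq (is_deriveM (df i x) (df' i x))).
  by rewrite /GRing.scale/= addrC; congr (_ + _); rewrite mulrC.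
split; first by move=> x; exact: (continuousM (cf x) (cf' x)).
move=> i x; apply: (continuousD (f := fun x => g i x * f' x) (g := fun x => f x * g' i x)).
  exact: (continuousM (cg i x) (cf' x)).
exact: (continuousM (cf x) (cg' i x)).
Qed.

Lemma C1g_coord n (j : 'I_n) : C1g (fun x : 'rV[R]_n => x 0 j) (fun i _ => (i == j)%:R).
Proof.
split.
  move=> i x; have -> : x = x + 0 *: delta_mx 0 i by rewrite scale0r addr0.
  apply/line_is_derive.
  rewrite (_ : (fun s : R => _) = (cst (x 0 j) + cst (i == j)%:R * id : R -> R)); last first.
    by apply/funext => s; rewrite !mxE eqxx/= mulrC eq_sym.
  apply: (is_derive_eq (is_deriveD (is_derive_cst _ _ _) (is_deriveM (is_derive_cst _ _ _) (is_derive_id _ _)))).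
  by rewrite /GRing.scale/= mulr0 addr0 add0r mulr1.
by split => [x|i]; [exact: coord_continuous|exact: cst_continuous].
Qed.

Lemma C1g_ext n (f f' : 'rV[R]_n -> R) g g' : C1g f g -> f =1 f' -> (forall i, g i =1 g' i) -> C1g f' g'.
Proof.
move=> H /funext <- gg; suff -> : g' = g by [].
by apply/funext => i; apply/esym/funext; exact: gg.
Qed.

Lemma C1g_peval n (p : mpoly n R) : C1g (peval p) (fun i => peval (mderiv i p)).
Proof.
have HM p1 p2 : C1g (peval p1) (fun i => peval (mderiv i p1)) ->
    C1g (peval p2) (fun i => peval (mderiv i p2)) ->
    C1g (peval (p1 * p2)) (fun i => peval (mderiv i (p1 * p2))).
  move=> h1 h2; apply: (C1g_ext (C1gM h1 h2)) => [x|i x]; rewrite /peval ?mderivM ?mevalD ?mevalM//.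
have HC a : C1g (peval (mpolyC n a)) (fun i => peval (mderiv i (mpolyC n a))).
  by apply: (C1g_ext (C1g_cst n a)) => [x|i x]; rewrite /peval ?mderivC ?mevalC ?meval0.
elim/mpolyind: p => [|c m p _ _ IH].
  by apply: (C1g_ext (C1g_cst n 0)) => [x|i x]; rewrite /peval ?mderiv0 meval0.
have HX : C1g (peval (mpolyX R m)) (fun i => peval (mderiv i (mpolyX R m))).
  rewrite mpolyXE_id.
  elim/big_rec: _ => [|j q _ IHq]; first by rewrite -mpolyC1; exact: HC.
  apply: (HM _ _ _ _ IHq); elim: (m j) => [|k IHk]; first by rewrite expr0 -mpolyC1; exact: HC.
  rewrite exprS; apply: (HM _ _ _ _ IHk).
  apply: (C1g_ext (C1g_coord j)) => [x|i x]; rewrite /peval ?mevalXU// mderivX mevalZ mnm1E eq_sym.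
  case: eqVneq => [->|]; last by rewrite mul0r.
  rewrite (_ : mnm_sub _ _ = mnm0); last by apply/mnmP => l; rewrite mnmBE subnn mnm0E.
  by rewrite mpolyX0 meval1 mulr1.
apply: (C1g_ext (C1gD (HM _ _ _ (HC c) HX) IH)) => [x|i x]; rewrite /peval.
  by rewrite mevalD mevalM mevalC mevalZ.
by rewrite mderivD mderivZ mderivM mderivC mul0r add0r !mevalD mevalM mevalC mevalZ.
Qed.

Lemma continuous_peval n (p : mpoly n R) : continuous (peval p).
Proof. by have [_ []] := C1g_peval p. Qed.

Lemma deg_leP n k (p : mpoly n R) :
  deg_le k p <-> forall m, (k < mdeg m)%N -> mcoeff m p = 0.
Proof.
split => H.
  by move=> m km; apply/eqP; rewrite mcoeff_eq0 msize_mdeg_ge// (leq_trans H).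
rewrite /deg_le msizeE; apply/bigmax_leqP_seq => m mp _; rewrite leqNgt.
by apply/negP => km; move: mp; rewrite mcoeff_msupp H ?eqxx.
Qed.

Lemma deg_le0 n k : deg_le k (0 : mpoly n R).
Proof. by apply/deg_leP => m _; rewrite mcoeff0. Qed.

Lemma deg_leD n k (p q : mpoly n R) : deg_le k p -> deg_le k q -> deg_le k (p + q).
Proof. by move=> /deg_leP hp /deg_leP hq; apply/deg_leP => m km; rewrite mcoeffD hp// hq// addr0. Qed.

Lemma deg_leZ n k a (p : mpoly n R) : deg_le k p -> deg_le k (a *: p).
Proof. by move=> /deg_leP hp; apply/deg_leP => m km; rewrite mcoeffZ hp// mulr0. Qed.

Lemma deg_leN n k (p : mpoly n R) : deg_le k p -> deg_le k (- p).
Proof. by rewrite -scaleN1r; exact: deg_leZ. Qed.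

Lemma deg_le_sum n k (I : Type) (s : seq I) (P : pred I) (F : I -> mpoly n R) :
  (forall i, P i -> deg_le k (F i)) -> deg_le k (\sum_(i <- s | P i) F i).
Proof.
by move=> H; elim/big_ind: _ => //; [exact: deg_le0|move=> x y; exact: deg_leD].
Qed.

Lemma deg_leM n k l (p q : mpoly n R) : deg_le k p -> deg_le l q -> deg_le (k + l) (p * q).
Proof.
rewrite /deg_le => hp hq.
have [->|p0] := eqVneq p 0; first by rewrite mul0r; exact: deg_le0.
have [->|q0] := eqVneq q 0; first by rewrite mulr0; exact: deg_le0.
rewrite msizeM//; have := leq_add hp hq; rewrite addSn addnS.
by case: (_ + _)%N.
Qed.

Lemma deg_leW n k l (p : mpoly n R) : (k <= l)%N -> deg_le k p -> deg_le l p.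
Proof. by rewrite /deg_le => kl kp; rewrite (leq_trans kp). Qed.

Lemma deg_leC n k (a : R) : deg_le k (mpolyC n a).
Proof.
by apply/deg_leP => m km; rewrite mcoeffC; case: eqVneq km => [->|_ _]; rewrite ?mdeg0 ?mulr0.
Qed.

Lemma deg_leX n (i : 'I_n) : deg_le 1 (mpolyX R (mnm1 i)).
Proof. by rewrite /deg_le msizeX mdeg1. Qed.

Lemma deg_le_mderiv n k i (p : mpoly n R) : deg_le k p -> deg_le k.-1 (mderiv i p).
Proof.
move=> /deg_leP hp; apply/deg_leP => m km; rewrite mcoeff_deriv hp ?mul0rn//.
by rewrite mdegD mdeg1 addn1; case: k km {hp} => [|k] //.
Qed.

(** In characteristic zero, the coefficient of a monomial with positive exponent in the variable [i]
    reappears, times that exponent, in the derivative with respect to [i]. *)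
Lemma mderiv_eq0 n (p : mpoly n R) : (forall i, mderiv i p = 0) -> p = mpolyC n (mcoeff mnm0 p).
Proof.
move=> dp.
apply/mpolyP => m; rewrite mcoeffC; have [->|m0] := eqVneq m mnm0; first by rewrite mulr1.
rewrite mulr0; have [i mi] : exists i, m i != 0%N.
  apply: contrapT => H; move/eqP: m0; apply; apply/mnmP => i; rewrite mnm0E.
  by apply/eqP; apply: contrapT => /negP mi; apply: H; exists i.
have -> : m = mnm_add (mnm_sub m (mnm1 i)) (mnm1 i).
  apply/mnmP => j; rewrite mnmDE mnmBE mnm1E; case: eqVneq => [<-|_]; last by rewrite subn0 addn0.
  by rewrite subnK// lt0n.
have := mcoeff_deriv i (mnm_sub m (mnm1 i)) p; rewrite dp mcoeff0 => /esym/eqP.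
by rewrite mulrn_eq0 => /eqP.
Qed.

(** Induction on the degree: the derivatives also vanish on the open set, so they are zero
    polynomials and [p] is a constant. *)
Lemma peval_open_eq0 n (p : mpoly n R) (U : set 'rV[R]_n) x0 : open U -> U x0 ->
  (forall x, U x -> peval p x = 0) -> p = 0.
Proof.
move=> oU Ux0.
have [k hk] : exists k, deg_le k p by exists (mmeasure mdeg p); rewrite /deg_le.
elim: k p hk => [|k IH] p hk pU.
  move: hk => /msize1_polyC; set c := mcoeff _ p => E.
  by move: (pU _ Ux0); rewrite E /peval mevalC => ->; rewrite mpolyC0.
have dp i : mderiv i p = 0.
  apply: (IH _ (deg_le_mderiv i hk)) => x Ux.
  have [H _] := C1g_peval p; rewrite -(@derive_val _ _ _ _ _ _ _ (H i x)).
  rewrite (@near_eq_derive _ _ _ _ (cst 0)); first by rewrite derive_cst.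
  by near=> y; apply: pU; near: y; exact: open_nbhs_nbhs.
have := mderiv_eq0 dp; set c := mcoeff _ p => E.
by move: (pU _ Ux0); rewrite E /peval mevalC => ->; rewrite mpolyC0.
Unshelve. all: by end_near.
Qed.

Lemma continuous_rV (U : topologicalType) n (f : U -> 'rV[R]_n) :
  (forall i, continuous (fun x => f x 0 i)) -> continuous f.
Proof.
move=> cf x; apply/cvg_ballP => e e0.
suff H : \forall y \near x, forall i, ball (f x 0 i) e (f y 0 i).
  by apply: filterS H => y Hy; split => // i' i; rewrite (ord1 i').
apply: filter_forall => i.
have /cvg_ballP/(_ e e0) := cf i x.
exact.
Qed.

Lemma continuous_affmx m n (A : 'M[R]_(m, n)) b : continuous (fun y : 'rV[R]_m => y *m A + b).
Proof.
apply: continuous_rV => i.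
rewrite (_ : (fun x => _) = fun x : 'rV[R]_m => dot x (\row_j A j i) + b 0 i); last first.
  by apply/funext => x; rewrite !mxE; congr (_ + _); apply: eq_bigr => j _; rewrite mxE.
move=> x; apply: (@continuousD R R^o _ (fun x : 'rV[R]_m => dot x (\row_j A j i)) (fun=> b 0 i)).
  exact: continuous_dotl.
exact: cst_continuous.
Qed.

Lemma C1_aff m n (A : 'M[R]_(m, n)) b (f : 'rV[R]_n -> R) : C1 f ->
  C1g (fun y => f (y *m A + b)) (fun i y => dot (grad f (y *m A + b)) (row i A)).
Proof.
move=> Cf; have [cf Hf] := Cf.
have ca := @continuous_affmx m n A b.
split.
  move=> i y; have -> : y = y + 0 *: delta_mx 0 i by rewrite scale0r addr0.
  apply/line_is_derive.
  rewrite (_ : (fun s : R => _) = fun s : R => f ((y *m A + b) + s *: row i A)); last first.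
    by apply/funext => s; rewrite mulmxDl -scalemxAl -rowE addrAC.
  rewrite scale0r addr0; apply/line_is_derive; rewrite scale0r addr0.
  exact: C1_is_derive.
split; first by move=> y; apply: (continuous_comp (ca y)); exact: cf.
move=> i; apply: continuous_sumf => j _ y.
apply: (@continuousM R _ (fun y : 'rV[R]_m => grad f (y *m A + b) 0 j) (fun=> row i A 0 j)); last exact: cst_continuous.
rewrite (_ : (fun y => _) = (partial j f) \o (fun y : 'rV[R]_m => y *m A + b)); last first.
  by apply/funext => z /=; rewrite mxE.
apply: (continuous_comp (ca y)); exact: (Hf j).2.
Qed.
End Calculus.

(** * The reference simplex *)

Section Ref.
Context {R : realType}.
Local Notation T := (measurableTypeR R).
Local Notation mu := (@lebesgue_measure R).

(** Barycentric coordinates of the reference simplex. Its vertex [ord0] is the origin and its vertex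
    [lift ord0 j] is the [j]-th unit vector. *)
Definition bary n (y : 'rV[R]_n) (i : 'I_n.+1) : R :=
  oapp (fun j => y 0 j) (1 - \sum_j y 0 j) (unlift ord0 i).

Lemma bary0 n (y : 'rV[R]_n) : bary y ord0 = 1 - \sum_j y 0 j.
Proof. by rewrite /bary unlift_none. Qed.

Lemma baryS n (y : 'rV[R]_n) (j : 'I_n) : bary y (lift ord0 j) = y 0 j.
Proof. by rewrite /bary liftK. Qed.

Lemma sum_bary n (y : 'rV[R]_n) : \sum_i bary y i = 1.
Proof.
by rewrite big_ord_recl bary0; under [X in _ + X]eq_bigr => j _ do rewrite baryS; rewrite subrK.
Qed.

Lemma refsimplexE n (y : 'rV[R]_n) : refsimplex y <-> forall i, 0 <= bary y i.
Proof.
split => [[y0 y1] i|H].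
  by case: (unliftP ord0 i) => [j|] ->; rewrite ?baryS// bary0 subr_ge0.
split => [j|]; first by rewrite -baryS.
by rewrite -subr_ge0 -bary0.
Qed.

Lemma continuous_bary n (i : 'I_n.+1) : continuous (fun y : 'rV[R]_n => bary y i).
Proof.
case: (unliftP ord0 i) => [j|] ->.
  rewrite (_ : (fun y => _) = fun y : 'rV[R]_n => y 0 j); first exact: coord_continuous.
  by apply/funext => y; rewrite baryS.
rewrite (_ : (fun y => _) = fun y : 'rV[R]_n => 1 - \sum_j y 0 j); last first.
  by apply/funext => y; rewrite bary0.
move=> y; apply: (@continuousB R R^o _ (fun=> 1) (fun y : 'rV[R]_n => \sum_j y 0 j)).
  exact: cst_continuous.
by apply: continuous_sumf => j _; exact: coord_continuous.
Qed.

Definition refint n : set 'rV[R]_n := [set y | forall i, 0 < bary y i].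

Lemma open_pos_forall (U : topologicalType) (I : finType) (F : I -> U -> R) :
  (forall i, continuous (F i)) -> open [set x | forall i, 0 < F i x].
Proof.
move=> cF; rewrite openE => x Fx; apply: filter_forall => i.
have : \forall y \near F i x, 0 < y by exact: lt_nbhsr.
by move/(cF i x).
Qed.

Lemma open_refint n : open (@refint n).
Proof. by apply: open_pos_forall => i; exact: continuous_bary. Qed.

Lemma refint_sub n : @refint n `<=` @refsimplex R n.
Proof. by move=> y Hy; apply/refsimplexE => i; exact: ltW. Qed.

Lemma refint_neq0 n : exists y, @refint n y.
Proof.
exists (\row_j n.+1%:R^-1) => i.
case: (unliftP ord0 i) => [j|] ->; first by rewrite baryS mxE invr_gt0.
rewrite bary0 subr_gt0; under eq_bigr do rewrite mxE.
by rewrite sumr_const card_ord -(mulr_natr n.+1%:R^-1) mulrC ltr_pdivrMr// mul1r ltr_nat.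
Qed.

Lemma msr_forall n (I : finType) (P : I -> set 'rV[R]_n) : (forall i, msr (P i)) ->
  msr [set y | forall i, P i y].
Proof.
move=> mP; rewrite /msr (_ : _ @^-1` _ =
    ~` \bigcup_i (@rowt R n @^-1` (~` P i))); last first.
  apply/seteqP; split => [t Pt [i _ /=]|t /= nP i]; first exact.
  by apply: contrapT => Pi; apply: nP; exists i.
apply: measurableC; apply: countable_bigcupT_measurable => // i.
by rewrite preimage_setC; apply: measurableC; exact: mP.
Qed.

Lemma msr_preimage n (f : 'rV[R]_n -> R) (A : set R) : continuous f ->
  measurable (A : set T) -> msr (f @^-1` A).
Proof.
move=> /continuous_measurable_rowt mf mA.
by have := mf measurableT _ mA; rewrite setTI.
Qed.

Lemma msr_refsimplex n : msr (@refsimplex R n).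
Proof.
rewrite (_ : @refsimplex R n = [set y | forall i, ((fun y : 'rV[R]_n => bary y i) @^-1` `[0, +oo[) y]).
  by apply: msr_forall => i; apply: msr_preimage => //; exact: continuous_bary.
apply/seteqP; split => y; first by move/refsimplexE => H i /=; rewrite in_itv/= andbT.
by move=> H; apply/refsimplexE => i; have := H i; rewrite /= in_itv/= andbT.
Qed.

Lemma msr_open n (A : set 'rV[R]_n) : open A -> msr A.
Proof. exact: open_measurable_rowt. Qed.

Lemma bounded_refsimplex n (x : 'rV[R]_n) : refsimplex x -> forall i, `|x 0 i| <= 1.
Proof.
move=> [x0 x1] i; rewrite ger0_norm//; apply: le_trans x1.
by rewrite (bigD1 i)//= lerDl sumr_ge0.
Qed.

Lemma null_finset n (I : finType) (P : I -> set 'rV[R]_n) (A : set 'rV[R]_n) : msr A ->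
  (forall i, msr (P i) /\ lebn n (@rowt R n @^-1` (P i)) = 0%E) ->
  A `<=` [set x | exists i, P i x] -> lebn n (@rowt R n @^-1` A) = 0%E.
Proof.
move=> mA HP AP; apply: measure_negligible => //.
pose N k := if [pick i | enum_rank i == k :> nat] is Some i then @rowt R n @^-1` P i else set0.
apply: (@negligibleS _ _ _ _ (\bigcup_k N k)).
  move=> t /AP[i Pi]; exists (enum_rank i) => //; rewrite /N.
  case: pickP => [j /eqP/val_inj/enum_rank_inj -> //|/(_ i)]; by rewrite eqxx.
apply: negligible_bigcup => k; rewrite /N; case: pickP => [i _|_]; last exact: negligible_set0.
by apply/negligibleP; [exact: (HP i).1|exact: (HP i).2].
Qed.

Lemma null_refsimplex n : lebn n (@rowt R n @^-1` (@refsimplex R n `\` @refint n)) = 0%E.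
Proof.
apply: (@null_finset n _ (fun i : 'I_n.+1 => (fun y => bary y i) @^-1` [set 0] `&` @refsimplex R n)).
- by apply: measurableD; [exact: msr_refsimplex|apply: msr_open; exact: open_refint].
- move=> i; have mi : msr ((fun y : 'rV[R]_n => bary y i) @^-1` [set 0] `&` @refsimplex R n).
    apply: measurableI; last exact: msr_refsimplex.
    by apply: msr_preimage => //; exact: continuous_bary.
  split => //; apply/eqP; rewrite eq_le measure_ge0 andbT.
  case: (unliftP ord0 i) => [j|] Ei.
    rewrite -(@lebn_hyperplane _ n (fun l => (l == j)%:R) 0); last by exists j; rewrite eqxx oner_neq0.
    apply: le_measure; rewrite ?inE//.
      rewrite -[X in measurable X]setTI; exact: (@measurable_lform _ n _ measurableT [set 0] (measurable_set1 0)).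
    move=> t [] /=; rewrite Ei baryS mxE => Et _.
    by rewrite /lform (bigD1 j)//= eqxx mul1r Et big1 ?addr0// => l /negbTE ->; rewrite mul0r.
  (* In dimension zero the only barycentric coordinate is 1, so the set is empty; there is no
     hyperplane to invoke. *)
  case: n i mi Ei => [|n] i mi Ei.
    rewrite (_ : _ `&` _ = set0) ?preimage_set0 ?measure0//.
    apply/seteqP; split => // y [] /=; rewrite Ei bary0 big_ord0 subr0 => /eqP.
    by rewrite oner_eq0.
  rewrite -(@lebn_hyperplane _ n.+1 (fun l => 1) 1); last by exists ord0; rewrite oner_neq0.
  apply: le_measure; rewrite ?inE//.
    rewrite -[X in measurable X]setTI; exact: (@measurable_lform _ n.+1 _ measurableT [set 1] (measurable_set1 1)).
  move=> t [] /=; rewrite Ei bary0 => /eqP; rewrite subr_eq0 => /eqP E _.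
  by rewrite /lform [RHS]E; apply: eq_bigr => l _; rewrite mul1r mxE.
- move=> y [/refsimplexE Hy /existsNP[i /negP]]; rewrite -leNgt => yi.
  exists i; split; last exact/refsimplexE.
  by apply/eqP; rewrite eq_le yi Hy.
Qed.

(** At a point of [U] with [f x > 0], the function exceeds [f x / 2] on an open set, which has
    positive measure. *)
Lemma vint_pos_eq0 n (A U : set 'rV[R]_n) (f : 'rV[R]_n -> R) (M : R) : msr A ->
  (forall x, A x -> forall i, `|x 0 i| <= M) -> continuous f ->
  (forall x, A x -> 0 <= f x) -> open U -> U `<=` A -> vint A f = 0 ->
  forall x, U x -> f x = 0.
Proof.
move=> mA bA cf f0 oU UA If x Ux; apply/eqP; apply: contrapT => /negP fx.
have fx0 : 0 < f x by rewrite lt_neqAle eq_sym fx f0//; exact: UA.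
pose V := U `&` f @^-1` `]f x / 2, +oo[.
have oV : open V by apply: openI => //; apply: open_comp => // y _; exact: cf.
have Vx : V x by split => //=; rewrite in_itv/= andbT ltr_pdivrMr// mulr_natr mulr2n ltrDl.
have mV := msr_open oV.
have VA : V `<=` A by move=> y [/UA].
have bV y : V y -> forall i, `|y 0 i| <= M by move=> /VA/bA.
have : vint V (fun=> f x / 2) <= vint V f.
  apply: le_vint => //; [by apply: (intg_cont mV bV); exact: cst_continuous|exact: (intg_cont mV bV)|].
  by move=> y [_] /=; rewrite in_itv/= andbT => /ltW.
have : vint V f <= vint A f.
  rewrite /vint; rewrite -lee_fin !fineK; last 2 first.
  - by apply: integrable_fin_num => //; exact: (intg_cont mA bA cf).
  - by apply: integrable_fin_num => //; exact: (intg_cont mV bV cf).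
  apply: ge0_subset_integral => //.
  - by apply/measurable_EFinP/measurable_funTS; exact: continuous_measurable_rowt.
  - by move=> t At; rewrite lee_fin; exact: f0.
  - by move=> t; exact: VA.
rewrite If => h1 h2; have := le_trans h2 h1.
rewrite /vint Rintegral_cst// leNgt mulr_gt0 ?divr_gt0//.
rewrite fine_gt0// (open_lebn_gt0 oV Vx) (bounded_lebn mV bV)//.
Qed.

Definition rvol n := vint (@refsimplex R n) (fun=> 1).

Lemma rvol_gt0 n : 0 < rvol n.
Proof.
have h0 : 0 <= rvol n by apply: vint_ge0 => x _; exact: ler01.
rewrite lt_neqAle h0 andbT eq_sym; apply/eqP => H.
have [y Hy] := refint_neq0 n.
have := @vint_pos_eq0 n _ _ (fun=> 1) 1 (@msr_refsimplex n) (@bounded_refsimplex n)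
  (@cst_continuous _ _ _) (fun _ _ => ler01) (@open_refint n) (@refint_sub n) H y Hy.
by move/eqP; rewrite oner_eq0.
Qed.

(** Extension by zero outside [A], then the formula for nonnegative functions applied to the
    positive and the negative parts, which are finite by integrability. *)
Lemma vint_cov n (B : 'M[R]_n) b (A : set 'rV[R]_n) f : B \in unitmx -> msr A -> intg A f ->
  vint A f = `|\det B| * vint [set y | A (y *m B + b)] (fun y => f (y *m B + b)).
Proof.
move=> uB mA fA.
pose F := (fun t => (f (rowt t))%:E) \_ (@rowt R n @^-1` A).
have iF : (lebn n).-integrable setT F by exact: (proj1 (integrable_mkcond _ mA) fA).
rewrite /vint /Rintegral !(integral_mkcond (_ @^-1` _)).
rewrite (_ : (fun t => (f (rowt t *m B + b))%:E) \_ _ = fun t => F (aff B b t)); last first.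
  apply/funext => t; rewrite /F /patch; rewrite [in RHS]/aff unrowK.
  by congr (if _ then _ else _); apply/idP/idP; rewrite !inE /= unrowK.
rewrite -/F integralE [in RHS]integralE.
have mF : measurable_fun setT F by have /integrableP[] := iF.
have cp := @cov_unit R n B uB b (F^\+)%E (measurable_funepos mF) (fun t => funepos_ge0 F t).
have cn := @cov_unit R n B uB b (F^\-)%E (measurable_funeneg mF) (fun t => funeneg_ge0 F t).
have {}cp : (\int[lebn n]_t (fun t => F (aff B b t))^\+ t)%E =
  ((`|\det B|^-1)%:E * \int[lebn n]_t F^\+ t)%E.
  by rewrite -cp; apply: eq_integral => t _; rewrite !funeposE.
have {}cn : (\int[lebn n]_t (fun t => F (aff B b t))^\- t)%E =
  ((`|\det B|^-1)%:E * \int[lebn n]_t F^\- t)%E.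
  by rewrite -cn; apply: eq_integral => t _; rewrite !funenegE.
rewrite cp cn.
have fp : (\int[lebn n]_x F^\+ x)%E \is a fin_num by apply: integrable_pos_fin_num.
have fn : (\int[lebn n]_x F^\- x)%E \is a fin_num by apply: integrable_neg_fin_num.
rewrite -(fineK fp) -(fineK fn) -!EFinM -!EFinB/=.
have d0 : `|\det B| != 0 by rewrite normr_eq0 -unitfE -unitmxE.
by rewrite -mulrBr mulrA divff// mul1r.
Qed.

Definition consv n (a : R) (y : 'rV[R]_n) : 'rV[R]_n.+1 := row_mx (a%:M : 'M[R]_1) y.

Lemma consv0 n a (y : 'rV[R]_n) : consv a y 0 ord0 = a.
Proof.
rewrite /consv (_ : ord0 = lshift n (ord0 : 'I_1)); last exact: val_inj.
by rewrite (@row_mxEl _ 1 1 n) mxE eqxx mulr1n.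
Qed.

Lemma consvS n a (y : 'rV[R]_n) (j : 'I_n) : consv a y 0 (lift ord0 j) = y 0 j.
Proof.
rewrite /consv (_ : lift ord0 j = rshift 1 j); last exact: val_inj.
by rewrite (@row_mxEr _ 1 1 n).
Qed.

Lemma consvE n a (y : 'rV[R]_n) : consv a y = consv 0 y + a *: delta_mx 0 ord0.
Proof.
apply/rowP => i; rewrite [RHS]mxE [X in _ = _ + X]mxE [X in _ = _ + _ * X]mxE eqxx/=.
case: (unliftP ord0 i) => [j|] ->; first by rewrite mulr0 addr0 !consvS.
by rewrite !consv0 add0r mulr1.
Qed.

Lemma ref_consv n a (y : 'rV[R]_n) : refsimplex (consv a y) <->
  0 <= a <= 1 - \sum_j y 0 j /\ forall j, 0 <= y 0 j.
Proof.
have E : \sum_j consv a y 0 j = a + \sum_j y 0 j.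
  by rewrite big_ord_recl consv0; congr (_ + _); apply: eq_bigr => j _; rewrite consvS.
split => [[H1 H2]|[/andP[a0 a1] y0]].
  split; last by move=> j; rewrite -(consvS a).
  by rewrite -{1}(consv0 a y) H1/= lerBrDr -E.
split; last by rewrite E -lerBrDr.
by move=> j; case: (unliftP ord0 j) => [l|] ->; rewrite ?consv0 ?consvS.
Qed.

Lemma fubini_cons n (f : n.+1.-tuple T -> \bar R) : (lebn n.+1).-integrable setT f ->
  (\int[lebn n.+1]_t f t = \int[lebn n]_t \int[mu]_a f (tcons (a, t)))%E.
Proof.
move=> /integrableP[mf foo].
pose lprod : {measure set (T * n.-tuple T)%type -> \bar R} :=
  [the {measure set (T * n.-tuple T)%type -> \bar R}
   of product_measure1 mu (lebn n)].
pose nu := measure_function_pushforward__canonical__measure_function_Measure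
  lprod (@measurable_tcons R n).
have E g : (\int[lebn n.+1]_t g t = \int[nu]_t g t)%E by exact: eq_measure_integral.
have mf' : measurable_fun setT (f \o @tcons R n).
  exact: (measurableT_comp mf (@measurable_tcons R n)).
have iF : lprod.-integrable setT (f \o @tcons R n).
  apply/integrableP; split => //.
  move: foo; rewrite E (ge0_integral_pushforward (@measurable_tcons R n))//.
  exact: measurableT_comp.
rewrite E (integral_pushforward (@measurable_tcons R n))//.
by rewrite preimage_setT -integral21_prod_meas1.
Qed.

(** Fubini in the first variable: the simplex meets the line above [y] in the segment from 0 to
    [1 - \sum_j y 0 j], on which the fundamental theorem of calculus applies. The two end points run
    over two facets. *)
Lemma ref_ftc n (f : 'rV[R]_n.+1 -> R) : C1 f ->
  vint (@refsimplex R n.+1) (partial ord0 f) =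
  vint (@refsimplex R n) (fun y => f (consv (1 - \sum_j y 0 j) y) - f (consv 0 y)).
Proof.
move=> Cf; have [cf Hf] := Cf.
have ip : intg (@refsimplex R n.+1) (partial ord0 f).
  exact: (intg_cont (@msr_refsimplex _) (@bounded_refsimplex _) (Hf ord0).2).
rewrite /vint /Rintegral; congr fine.
rewrite integral_mkcond fubini_cons; last exact: (proj1 (integrable_mkcond _ (@msr_refsimplex _)) ip).
rewrite [RHS]integral_mkcond; apply: eq_integral => t _.
set y := rowt t.
have Ey a : rowt (tcons (a, t)) = consv a y by rewrite aff_cons.
rewrite [RHS]/patch; case: ifPn => [|ny]; last first.
  rewrite integral0_eq// => a _; rewrite /patch; case: ifPn => //.
  rewrite inE /= Ey => /ref_consv[/andP[a0 a1] y0]; exfalso; move/negP: ny; apply.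
  by rewrite inE; split => //; rewrite -subr_ge0 (le_trans a0).
rewrite inE => -[y0 y1].
set b := 1 - \sum_j y 0 j; have b0 : 0 <= b by rewrite subr_ge0.
rewrite (_ : (fun a => _) = (fun a => (partial ord0 f (consv a y))%:E) \_ `[0, b]); last first.
  apply/funext => a; rewrite /patch Ey; congr (if _ then _ else _).
  apply/idP/idP; rewrite !inE /= Ey in_itv/=; first by move/ref_consv => [].
  by move=> ?; apply/ref_consv.
rewrite -integral_mkcond.
have dF a : is_derive a (1 : R) (fun a => f (consv a y)) (partial ord0 f (consv a y)).
  rewrite (_ : (fun a => _) = fun a : R => f (consv 0 y + a *: delta_mx 0 ord0)); last first.
    by apply/funext => a'; rewrite consvE.
  by apply/line_is_derive; rewrite -consvE; split => //; exact: (Hf ord0).1.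
have cF := is_derive_continuous1 dF.
have cc : continuous (fun a : R => consv a y).
  apply: continuous_rV => i; case: (unliftP ord0 i) => [j|] ->.
    by rewrite (_ : (fun x => _) = cst (y 0 j)); [exact: cst_continuous|apply/funext => x; rewrite consvS].
  by rewrite (_ : (fun x => _) = id); [move=> ?; exact: cvg_id|apply/funext => x; rewrite consv0].
(* The segment may shrink to a point, a case which the fundamental theorem does not cover. *)
move: b0; rewrite le_eqVlt => /predU1P[<-|b0].
  by rewrite set_itv1 integral_set1 subrr.
rewrite (@continuous_FTC2 R _ (fun a => f (consv a y)) 0 b b0) -?EFinB//.
- apply: continuous_subspaceT => a; apply: (continuous_comp (cc a)); exact: (Hf ord0).2.
- split; [by move=> a _; case: (dF a)|apply: cvg_at_right_filter; exact: cF|apply: cvg_at_left_filter; exact: cF].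
- by move=> a _; rewrite derive1E (@derive_val _ _ _ _ _ _ _ (dF a)).
Qed.

Definition spt n d (z : 'I_n.+1 -> 'rV[R]_d) (y : 'rV[R]_n) : 'rV[R]_d := \sum_i bary y i *: z i.
Definition smx n d (z : 'I_n.+1 -> 'rV[R]_d) : 'M[R]_(n, d) :=
  \matrix_(j, k) (z (lift ord0 j) - z ord0) 0 k.

Lemma sptE n d (z : 'I_n.+1 -> 'rV[R]_d) y : spt z y = y *m smx z + z ord0.
Proof.
have -> : y *m smx z = \sum_(j < n) y 0 j *: z (lift ord0 j) - \sum_(j < n) y 0 j *: z ord0.
  rewrite -sumrB; apply/rowP => k; rewrite summxE !mxE; apply: eq_bigr => j _.
  by rewrite !mxE mulrBr.
rewrite /spt big_ord_recl bary0 scalerBl scale1r scaler_suml.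
under [X in _ + X = _]eq_bigr => j _ do rewrite baryS.
by rewrite addrC addrA addrAC.
Qed.

Lemma continuous_spt n d (z : 'I_n.+1 -> 'rV[R]_d) : continuous (spt z).
Proof.
rewrite (_ : spt z = fun y => y *m smx z + z ord0); first exact: continuous_affmx.
by apply/funext => y; rewrite sptE.
Qed.

(** A mean value up to the constant factor [rvol n], the volume of the reference simplex. It depends
    on the vertices only, which is what separates the shape of a simplex from its size. *)
Definition avg n d (z : 'I_n.+1 -> 'rV[R]_d) (f : 'rV[R]_d -> R) := vint (@refsimplex R n) (f \o spt z).

(** Renumbering the vertices is an affine bijection of the reference simplex onto itself. The lemma
    makes face integrals independent of the order in which a cell lists the vertices. *)
Lemma avg_perm n d (z : 'I_n.+1 -> 'rV[R]_d) (s : 'S_n.+1) f : continuous f ->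
  avg (z \o s) f = avg z f.
Proof.
move=> cf.
(* The reference vertices permuted by [s]; the affine map [spt (Z s)] permutes the barycentric
   coordinates. *)
pose Z (s : 'S_n.+1) (i : 'I_n.+1) : 'rV[R]_n := \row_j (lift ord0 j == s i)%:R.
have ZE (s' : 'S_n.+1) y i : bary (spt (Z s') y) i = bary y (perm.perm_inv s' i).
  have ES j : spt (Z s') y 0 j = bary y (perm.perm_inv s' (lift ord0 j)).
    rewrite /spt summxE (bigD1 (perm.perm_inv s' (lift ord0 j)))//= !mxE permKV eqxx mulr1.
    rewrite big1 ?addr0// => l lj; rewrite !mxE.
    case: eqP => [E|_]; last by rewrite mulr0.
    by move: lj; rewrite E permK eqxx.
  have EL (j : 'I_n) : bary (spt (Z s') y) (lift ord0 j) = bary y (perm.perm_inv s' (lift ord0 j)).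
    by rewrite baryS ES.
  case: (unliftP ord0 i) => [j|] -> //.
  have /(congr1 (fun x => x - \sum_j bary (spt (Z s') y) (lift ord0 j))) := sum_bary (spt (Z s') y).
  rewrite big_ord_recl addrK => ->.
  have := sum_bary y; rewrite (reindex_inj (@perm_inj _ (perm.perm_inv s'))) big_ord_recl => <-.
  rewrite /=; under [X in _ - X]eq_bigr => j _ do rewrite EL.
  by rewrite addrK.
have zs y : spt (z \o s) y = spt z (spt (Z s) y).
  rewrite /spt [RHS](reindex_inj (@perm_inj _ s)); apply: eq_bigr => i _.
  by rewrite -/(spt (Z s) y) ZE permK.
have bij s' y : spt (Z (perm.perm_inv s')) (spt (Z s') y) = y.
  apply/rowP => j; rewrite -!baryS !ZE; congr (bary y _).
  by rewrite -[perm.perm_inv (perm.perm_inv s')]/(s'^-1^-1)%g invgK permK.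
have uS : smx (Z s) \in unitmx.
  suff H : smx (Z s) *m smx (Z (perm.perm_inv s)) = 1%:M by case/mulmx1_unit: H.
  have K y : y *m (smx (Z s) *m smx (Z (perm.perm_inv s))) + 
     (Z s ord0 *m smx (Z (perm.perm_inv s)) + Z (perm.perm_inv s) ord0) = y.
    by rewrite mulmxA addrA -mulmxDl -!sptE.
  have K0 := K 0; rewrite mul0mx add0r in K0.
  apply/row_matrixP => i; rewrite !rowE mulmx1.
  by have := K (delta_mx 0 i); rewrite K0 addr0.
have SR : [set y | refsimplex (y *m smx (Z s) + Z s ord0)] = @refsimplex R n.
  apply/seteqP; split => y /=; rewrite -sptE => /refsimplexE H; apply/refsimplexE => i.
    by have := H (s i); rewrite ZE permK.
  by rewrite ZE.
have CV g : continuous g -> vint (@refsimplex R n) g = `|\det (smx (Z s))| * vint (@refsimplex R n) (g \o spt (Z s)).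
  move=> cg; rewrite (vint_cov (Z s ord0) uS (@msr_refsimplex n) (intg_cont (@msr_refsimplex n) (@bounded_refsimplex n) cg)).
  by rewrite SR; congr (_ * _); apply: eq_vint => y _ /=; rewrite sptE.
(* Change of variables for the constant 1 on a set that the map preserves. *)
have d1 : `|\det (smx (Z s))| = 1.
  have := CV (fun=> 1) (@cst_continuous _ _ _).
  rewrite -/(rvol n) => /esym/eqP; rewrite -subr_eq0 -{2}[rvol n]mul1r -mulrBl mulf_eq0.
  by rewrite (gt_eqF (rvol_gt0 n)) orbF subr_eq0 => /eqP.
rewrite /avg (CV (f \o spt z)); last first.
  by move=> y; apply: (continuous_comp (@continuous_spt _ _ z y)); exact: cf.
by rewrite d1 mul1r; apply: eq_vint => y _ /=; rewrite zs.
Qed.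

End Ref.

Section Affine.
Context {R : realType}.

Lemma contM (U : topologicalType) (f g : U -> R) : continuous f -> continuous g ->
  continuous (fun x => f x * g x).
Proof. by move=> cf cg x; exact: (continuousM (cf x) (cg x)). Qed.

Lemma contX2 (U : topologicalType) (f : U -> R) : continuous f -> continuous (fun x => f x ^+ 2).
Proof. by move=> cf; exact: contM. Qed.

Lemma contD (U : topologicalType) (f g : U -> R) : continuous f -> continuous g ->
  continuous (fun x => f x + g x).
Proof. by move=> cf cg x; exact: (@continuousD R R^o _ _ _ _ (cf x) (cg x)). Qed.

Lemma contB (U : topologicalType) (f g : U -> R) : continuous f -> continuous g ->
  continuous (fun x => f x - g x).
Proof. by move=> cf cg x; exact: (@continuousB R R^o _ _ _ _ (cf x) (cg x)). Qed.

Lemma contC (U : topologicalType) (a : R) : continuous (fun _ : U => a).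
Proof. by move=> x; exact: cst_continuous. Qed.

Lemma deg_le_exp n k m (p : mpoly n R) : deg_le k p -> deg_le (k * m) (p ^+ m).
Proof.
move=> kp; elim: m => [|m IH]; first by rewrite expr0 -mpolyC1; exact: deg_leC.
by rewrite exprS mulnS; exact: deg_leM.
Qed.

Lemma deg_le_prod n (I : Type) (s : seq I) (k : I -> nat) (F : I -> mpoly n R) :
  (forall i, deg_le (k i) (F i)) -> deg_le (\sum_(i <- s) k i) (\prod_(i <- s) F i).
Proof.
move=> H; elim/big_rec2: _ => [|i m p _ IH]; first by rewrite -mpolyC1; exact: deg_leC.
exact: deg_leM.
Qed.

Lemma meval_sum n (I : Type) (s : seq I) (P : pred I) (F : I -> mpoly n R) v :
  meval v (\sum_(i <- s | P i) F i) = \sum_(i <- s | P i) meval v (F i).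
Proof. exact: raddf_sum. Qed.

Lemma peval_aff m n k (p : mpoly n R) (A : 'M[R]_(m, n)) (b : 'rV[R]_n) : deg_le k p ->
  exists2 q : mpoly m R, deg_le k q & forall y, peval q y = peval p (y *m A + b).
Proof.
move=> kp.
pose l i : mpoly m R := \sum_j A j i *: mpolyX R (mnm1 j) + mpolyC m (b 0 i).
have dl i : deg_le 1 (l i).
  apply: deg_leD; last exact: deg_leC.
  by apply: deg_le_sum => j _; apply: deg_leZ; exact: deg_leX.
have el i y : peval (l i) y = (y *m A + b) 0 i.
  rewrite /peval mevalD mevalC !mxE meval_sum; congr (_ + _); apply: eq_bigr => j _.
  by rewrite mevalZ mevalXU mulrC.
exists (\sum_(u <- msupp p) mcoeff u p *: \prod_i l i ^+ u i).
  rewrite big_seq; apply: deg_le_sum => u up; apply: deg_leZ.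
  apply: (@deg_leW _ _ (mdeg u)).
    by rewrite -ltnS; exact: leq_trans (msize_mdeg_lt up) kp.
  by rewrite mdegE; apply: deg_le_prod => i; have := deg_le_exp (u i) (dl i); rewrite mul1n.
move=> y; rewrite /peval [RHS]mevalE meval_sum; apply: eq_bigr => u _.
rewrite mevalZ; congr (_ * _); rewrite rmorph_prod/=; apply: eq_bigr => i _.
by rewrite rmorphXn/= -el.
Qed.

End Affine.

(** * Domination between quadratic forms in finite dimension *)

Section Quad.
Context {R : realType}.
Variable N : nat.
Implicit Types Q : 'rV[R]_N -> R.

Definition quad Q := exists G : 'I_N -> 'I_N -> R, forall x, Q x = \sum_i \sum_j x 0 i * x 0 j * G i j.

Lemma quadD Q1 Q2 : quad Q1 -> quad Q2 -> quad (fun x => Q1 x + Q2 x).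
Proof.
move=> [G1 H1] [G2 H2]; exists (fun i j => G1 i j + G2 i j) => x.
rewrite H1 H2 -big_split; apply: eq_bigr => i _; rewrite -big_split; apply: eq_bigr => j _.
by rewrite mulrDr.
Qed.

Lemma quadN Q : quad Q -> quad (fun x => - Q x).
Proof.
move=> [G H]; exists (fun i j => - G i j) => x; rewrite H -sumrN; apply: eq_bigr => i _.
by rewrite -sumrN; apply: eq_bigr => j _; rewrite mulrN.
Qed.

Lemma quad0 : quad (fun=> 0).
Proof. by exists (fun _ _ => 0) => x; rewrite big1// => i _; rewrite big1// => j _; rewrite mulr0. Qed.

Lemma quad_sum (I : Type) (s : seq I) (F : I -> 'rV[R]_N -> R) : (forall i, quad (F i)) ->
  quad (fun x => \sum_(i <- s) F i x).
Proof.
move=> H; elim: s => [|i s IH].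
  by rewrite (_ : (fun x => _) = fun=> 0); [exact: quad0|apply/funext => x; rewrite big_nil].
rewrite (_ : (fun x => _) = fun x => F i x + \sum_(j <- s) F j x); first exact: quadD.
by apply/funext => x; rewrite big_cons.
Qed.

Lemma quad_sqr (a : 'I_N -> R) : quad (fun x => (\sum_i x 0 i * a i) ^+ 2).
Proof.
exists (fun i j => a i * a j) => x; rewrite expr2 mulr_suml; apply: eq_bigr => i _.
by rewrite mulr_sumr; apply: eq_bigr => j _; ring.
Qed.

Lemma quad_vint n (A : set 'rV[R]_n) (M : R) (w : 'rV[R]_n -> R) (phi : 'I_N -> 'rV[R]_n -> R) :
  msr A -> (forall x, A x -> forall i, `|x 0 i| <= M) -> continuous w ->
  (forall i, continuous (phi i)) ->
  quad (fun x => vint A (fun y => w y * (\sum_i x 0 i * phi i y) ^+ 2)).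
Proof.
move=> mA bA cw cphi.
have c2 i j : continuous (fun y => w y * (phi i y * phi j y)).
  by move=> y; exact: (continuousM (cw y) (continuousM (cphi i y) (cphi j y))).
exists (fun i j => vint A (fun y => w y * (phi i y * phi j y))) => x.
have ii i j : intg A (fun y => x 0 i * x 0 j * (w y * (phi i y * phi j y))).
  by apply: intgZ => //; exact: (intg_cont mA bA).
transitivity (vint A (fun y => \sum_i \sum_j x 0 i * x 0 j * (w y * (phi i y * phi j y)))).
  apply: eq_vint => y _; rewrite expr2 mulr_suml mulr_sumr; apply: eq_bigr => i _.
  by rewrite !mulr_sumr; apply: eq_bigr => j _; ring.
rewrite vint_sum//; last by move=> i _; apply: intg_sum.
apply: eq_bigr => i _; rewrite vint_sum//; apply: eq_bigr => j _.
by rewrite vintZ//; exact: (intg_cont mA bA).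
Qed.

Lemma quad_continuous Q : quad Q -> continuous Q.
Proof.
move=> [G H]; rewrite (_ : Q = fun x => \sum_i \sum_j x 0 i * x 0 j * G i j); last exact/funext.
apply: continuous_sumf => i _; apply: continuous_sumf => j _ x.
apply: (@continuousM R _ (fun x : 'rV[R]_N => x 0 i * x 0 j) (fun=> G i j)); last exact: cst_continuous.
apply: (@continuousM R _ (fun x : 'rV[R]_N => x 0 i) (fun x : 'rV[R]_N => x 0 j)); exact: coord_continuous.
Qed.

Lemma quadZ Q a x : quad Q -> Q (a *: x) = a ^+ 2 * Q x.
Proof.
move=> [G H]; rewrite !H mulr_sumr; apply: eq_bigr => i _; rewrite mulr_sumr; apply: eq_bigr => j _.
by rewrite !mxE; ring.
Qed.

Let sph := [set x : 'rV[R]_N | dot x x = 1].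

Lemma compact_sphere : compact sph.
Proof.
have cd : continuous (fun x : 'rV[R]_N => dot x x).
  apply: continuous_sumf => i _ x.
  apply: (@continuousM R _ (fun x : 'rV[R]_N => x 0 i) (fun x : 'rV[R]_N => x 0 i)); exact: coord_continuous.
apply: (@subclosed_compact _ _ [set x : 'rV[R]_N | forall i, (`[-1, 1]%classic : set R) (x 0 i)]).
- rewrite (_ : sph = (fun x => dot x x) @^-1` [set 1]); last by [].
  by apply: preimage_closed => //; exact: closed_eq || exact: closed1.
- by apply: (@rV_compact R N (fun=> `[-1, 1]%classic)) => i; exact: segment_compact.
- move=> x /= Hx i; rewrite in_itv/= -ler_norml -(@ler_pXn2r _ 2)// ?nnegrE// expr1n -Hx.
  rewrite real_normK ?num_real// /dot (bigD1 i)//= -expr2 lerDl.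
  by apply: sumr_ge0 => j _; rewrite -expr2 sqr_ge0.
Qed.

Lemma dot_gt0 n (x : 'rV[R]_n) : x != 0 -> 0 < dot x x.
Proof.
move=> x0; rewrite lt_neqAle dot_ge0 andbT eq_sym; apply: contra x0 => /eqP H.
apply/eqP/rowP => i; rewrite mxE; apply/eqP; rewrite -sqrf_eq0.
have := H; rewrite /dot => /eqP; rewrite psumr_eq0; last by move=> j _; rewrite -expr2 sqr_ge0.
by move/allP => /(_ i (mem_index_enum _)); rewrite -expr2.
Qed.

(** On the compact unit sphere [Q1] has a maximum and [Q2] a positive minimum; both forms are
    homogeneous of degree two. Every inverse or Poincare constant for polynomials originates
    here. *)
Lemma quad_dom Q1 Q2 : quad Q1 -> quad Q2 -> (forall x, x != 0 -> 0 < Q2 x) ->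
  exists2 C, 0 < C & forall x, Q1 x <= C * Q2 x.
Proof.
move=> q1 q2 pos.
have sc Q x : quad Q -> x != 0 -> Q x = dot x x * Q ((Num.sqrt (dot x x))^-1 *: x).
  move=> q x0; rewrite quadZ// exprVn sqr_sqrtr ?dot_ge0// mulrA mulfV ?mul1r//.
  by rewrite gt_eqF// dot_gt0.
have ns (x : 'rV[R]_N) : x != 0 -> sph ((Num.sqrt (dot x x))^-1 *: x).
  move=> x0; rewrite /sph/= dotZl dotZr mulrA -expr2 exprVn sqr_sqrtr ?dot_ge0//.
  by rewrite mulVf// gt_eqF// dot_gt0.
have [[x0 nx0]|all0] := pselect (exists x : 'rV[R]_N, x != 0); last first.
  exists 1 => // x; have -> : x = 0.
    by apply/eqP; apply: contrapT => /negP H; apply: all0; exists x.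
  by rewrite -(scale0r 0) !quadZ// expr0n !mul0r mulr0.
have s0 : sph !=set0 by exists ((Num.sqrt (dot x0 x0))^-1 *: x0); exact: ns.
have cQ Q : quad Q -> {within sph, continuous Q}.
  by move=> q; apply: continuous_subspaceT; exact: quad_continuous.
have [u us Hu] := EVT_max_rV s0 compact_sphere (cQ _ q1).
have [v vs Hv] := EVT_min_rV s0 compact_sphere (cQ _ q2).
have v0 : 0 < Q2 v.
  apply: pos; apply: contraTneq vs => ->; rewrite notin_setE /sph/= dot0l.
  by move/eqP; rewrite eq_sym oner_eq0.
(* The added 1 keeps the constant positive even if [Q1] vanishes at its maximum point. *)
exists ((`|Q1 u| + 1) / Q2 v); first by rewrite divr_gt0// ltr_wpDl.
move=> x; have [->|nx] := eqVneq x 0; first by rewrite -(scale0r 0) !quadZ// expr0n !mul0r mulr0.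
rewrite (sc _ x q1)// (sc _ x q2)// mulrCA ler_wpM2l ?dot_ge0//.
set y := _ *: x; have ys : y \in sph by rewrite inE; exact: ns.
rewrite (le_trans (Hu y ys))// (le_trans (ler_norm _))//.
rewrite (le_trans (y := (`|Q1 u| + 1) / Q2 v * Q2 v))//.
  by rewrite divfK ?gt_eqF// lerDl.
by rewrite ler_wpM2l ?Hv// divr_ge0// ?addr_ge0// ltW.
Qed.

End Quad.

Section PolyDom.
Context {R : realType}.
Variables (n k : nat).
Local Notation N := #|{: bmultinom n k.+1}|.

(** [bmultinom n k.+1] bounds the degree strictly, so these are the monomials of degree at most
    [k]. *)
Definition mon (i : 'I_N) : mpoly n R := mpolyX R (bmnm (enum_val i)).
Definition pcomb (x : 'rV[R]_N) : mpoly n R := \sum_i x 0 i *: mon i.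

Lemma deg_le_pcomb x : deg_le k (pcomb x).
Proof.
apply: deg_le_sum => i _; apply: deg_leZ; rewrite /deg_le msizeX.
exact: bmdeg.
Qed.

Lemma pcomb_surj p : deg_le k p -> exists x, p = pcomb x.
Proof.
move=> kp; exists (\row_i mcoeff (bmnm (enum_val i)) p).
rewrite {1}(mpolywE kp) /pcomb (reindex_onto (@enum_val _ {: bmultinom n k.+1}) enum_rank)/=; last first.
  by move=> i _; rewrite enum_rankK.
by apply: eq_big => [i|i _]; rewrite ?enum_valK ?eqxx// mxE.
Qed.

Lemma pcomb_eq0 x : pcomb x = 0 -> x = 0.
Proof.
move=> H; apply/rowP => i; rewrite mxE.
have : mcoeff (bmnm (enum_val i)) (pcomb x) = 0 by rewrite H mcoeff0.
rewrite /pcomb raddf_sum/= (bigD1 i)//= mcoeffZ mcoeffX eqxx mulr1 big1 ?addr0// => j ji.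
rewrite mcoeffZ mcoeffX (_ : (_ == _) = false) ?mulr0//.
by apply: contraNF ji => /eqP/val_inj/enum_val_inj ->.
Qed.

Definition pquad (Q : mpoly n R -> R) := quad (fun x => Q (pcomb x)).

Lemma poly_dom Q1 Q2 : pquad Q1 -> pquad Q2 ->
  (forall p, deg_le k p -> p != 0 -> 0 < Q2 p) ->
  exists2 C, 0 < C & forall p, deg_le k p -> Q1 p <= C * Q2 p.
Proof.
move=> q1 q2 pos; have [|C C0 H] := quad_dom q1 q2.
  move=> x x0; apply: pos; first exact: deg_le_pcomb.
  by apply: contra x0 => /eqP/pcomb_eq0 ->.
by exists C => // p /pcomb_surj[x ->]; exact: H.
Qed.

Lemma peval_pcomb x y : peval (pcomb x) y = \sum_i x 0 i * peval (mon i) y.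
Proof. by rewrite /peval meval_sum; apply: eq_bigr => i _; rewrite mevalZ. Qed.

Lemma peval_mderiv_pcomb j x y : peval (mderiv j (pcomb x)) y = \sum_i x 0 i * peval (mderiv j (mon i)) y.
Proof.
rewrite /pcomb raddf_sum/= /peval meval_sum; apply: eq_bigr => i _.
by rewrite mderivZ mevalZ.
Qed.

End PolyDom.

(** * Inverse and Poincare inequalities for polynomials on the reference simplex *)

Section RefIneq.
Context {R : realType}.
Variable (n : nat).
Local Notation ref := (@refsimplex R n).
Let mref := @msr_refsimplex R n.
Let bref := @bounded_refsimplex R n.

(** A variance: the weights are the barycentric coordinates of [y], the values are the derivatives
    of [p] along the edges from vertex 0, with value 0 at vertex 0 itself. It is the pullback of
    [grad p . bubble]. *)
Definition rvar (p : mpoly n R) (y : 'rV[R]_n) : R :=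
  \sum_j y 0 j * peval (mderiv j p) y ^+ 2 - (\sum_j y 0 j * peval (mderiv j p) y) ^+ 2.

Lemma rvarE (p : mpoly n R) (y : 'rV[R]_n) : let m := \sum_j y 0 j * peval (mderiv j p) y in
  rvar p y = \sum_j y 0 j * (peval (mderiv j p) y - m) ^+ 2 + (1 - \sum_j y 0 j) * m ^+ 2.
Proof.
move=> m; rewrite /rvar -/m.
have -> : \sum_j y 0 j * (peval (mderiv j p) y - m) ^+ 2 =
    \sum_j y 0 j * peval (mderiv j p) y ^+ 2 - 2 * m * m + (\sum_j y 0 j) * m ^+ 2.
  rewrite {3}/m mulr_sumr mulr_suml -sumrB -big_split/=; apply: eq_bigr => j _; ring.
by ring.
Qed.

Lemma rvar_ge0 p y : ref y -> 0 <= rvar p y.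
Proof.
move=> [y0 y1]; rewrite rvarE addr_ge0//.
  by apply: sumr_ge0 => j _; rewrite mulr_ge0// sqr_ge0.
by rewrite mulr_ge0 ?sqr_ge0// subr_ge0.
Qed.

(** All weights are positive in the interior, so a zero variance makes all values equal to the one
    at vertex 0, which is 0. *)
Lemma rvar_int_eq0 p y : refint y -> rvar p y = 0 -> forall j, peval (mderiv j p) y = 0.
Proof.
move=> Hy; have [y0 y1] := refint_sub Hy; rewrite rvarE.
set m := \sum_j y 0 j * peval (mderiv j p) y => /eqP.
have h1 : 0 <= \sum_j y 0 j * (peval (mderiv j p) y - m) ^+ 2.
  by apply: sumr_ge0 => j _; rewrite mulr_ge0// sqr_ge0.
have b0 : 0 < 1 - \sum_j y 0 j by rewrite -bary0.
rewrite paddr_eq0//; last by rewrite mulr_ge0 ?sqr_ge0// ltW.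
rewrite mulf_eq0 (gt_eqF b0)/= sqrf_eq0 => /andP[h /eqP m0] j.
move: h; rewrite psumr_eq0; last by move=> i _; rewrite mulr_ge0// sqr_ge0.
move/allP => /(_ j (mem_index_enum _)); rewrite m0 subr0 mulf_eq0 sqrf_eq0.
by rewrite gt_eqF/= => [/eqP//|]; rewrite -baryS.
Qed.

Let cx (j : 'I_n) : continuous (fun y : 'rV[R]_n => y 0 j).
Proof. exact: coord_continuous. Qed.

Lemma continuous_rvar p : continuous (rvar p).
Proof.
have cp j := @continuous_peval R n (mderiv j p).
rewrite /rvar => y.
apply: (@continuousB R R^o _ (fun y : 'rV[R]_n => \sum_j y 0 j * peval (mderiv j p) y ^+ 2)
  (fun y : 'rV[R]_n => (\sum_j y 0 j * peval (mderiv j p) y) ^+ 2)).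
  by apply: continuous_sumf => j _; apply: contM => //; exact: contX2.
by apply: contX2; apply: continuous_sumf => j _; exact: contM.
Qed.

Lemma ref_vint_sqr_gt0 (p : mpoly n R) : p != 0 -> 0 < vint ref (fun y => peval p y ^+ 2).
Proof.
move=> p0; rewrite lt_neqAle vint_ge0 ?andbT; last by move=> y _; exact: sqr_ge0.
apply: contra p0 => /eqP /esym H; apply/eqP.
have cp := @continuous_peval R n p.
have [y0 Hy0] := @refint_neq0 R n.
apply: (peval_open_eq0 (@open_refint R n) Hy0) => y Hy; apply/eqP; rewrite -sqrf_eq0; apply/eqP.
apply: (@vint_pos_eq0 R n ref (@refint R n) (fun y => peval p y ^+ 2) 1) => //.
- exact: contX2.
- by move=> z _; exact: sqr_ge0.
- exact: open_refint.
- exact: refint_sub.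
Qed.

Lemma ref_inverse k : exists2 C, 0 < C & forall p : mpoly n R, deg_le k p ->
  \sum_j vint ref (fun y => peval (mderiv j p) y ^+ 2) <= C * vint ref (fun y => peval p y ^+ 2).
Proof.
apply: (@poly_dom R n k (fun p => \sum_j vint ref (fun y => peval (mderiv j p) y ^+ 2))
   (fun p => vint ref (fun y => peval p y ^+ 2))).
- apply: quad_sum => j.
  have := @quad_vint R _ n ref 1 (fun=> 1) (fun i => peval (mderiv j (@mon R n k i))) mref bref
    (@cst_continuous _ _ _) (fun i => @continuous_peval R n _).
  congr quad; apply/funext => x; apply: eq_vint => y _.
  by rewrite mul1r peval_mderiv_pcomb.
- have := @quad_vint R _ n ref 1 (fun=> 1) (fun i => peval (@mon R n k i)) mref bref
    (@cst_continuous _ _ _) (fun i => @continuous_peval R n _).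
  congr quad; apply/funext => x; apply: eq_vint => y _.
  by rewrite mul1r peval_pcomb.
- by move=> p _; exact: ref_vint_sqr_gt0.
Qed.

(** The right-hand side is a quadratic form in the coefficients, positive off zero: a vanishing
    integral of [rvar p] makes [p] constant, and a vanishing mean then makes it zero. *)
Lemma ref_poincare k : exists2 C, 0 < C & forall p : mpoly n R, deg_le k p ->
  vint ref (fun y => peval p y ^+ 2) <= C * (vint ref (rvar p) + vint ref (peval p) ^+ 2).
Proof.
apply: (@poly_dom R n k (fun p => vint ref (fun y => peval p y ^+ 2))
   (fun p => vint ref (rvar p) + vint ref (peval p) ^+ 2)).
- have := @quad_vint R _ n ref 1 (fun=> 1) (fun i => peval (@mon R n k i)) mref bref
    (@cst_continuous _ _ _) (fun i => @continuous_peval R n _).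
  congr quad; apply/funext => x; apply: eq_vint => y _.
  by rewrite mul1r peval_pcomb.
- apply: quadD; last first.
    have := @quad_sqr R _ (fun i => vint ref (peval (@mon R n k i))).
    congr quad; apply/funext => x; congr (_ ^+ 2).
    rewrite (_ : peval (pcomb x) = fun y => \sum_i x 0 i * peval (mon i) y); last first.
      by apply/funext => y; rewrite peval_pcomb.
    rewrite vint_sum//; last first.
      by move=> i _; apply: intgZ => //; apply: (intg_cont mref bref); exact: continuous_peval.
    apply: eq_bigr => i _; rewrite vintZ//.
    by apply: (intg_cont mref bref); exact: continuous_peval.
  have c1 i : continuous (fun y : 'rV[R]_n => \sum_j y 0 j * peval (mderiv j (@mon R n k i)) y).
    by apply: continuous_sumf => j _; apply: contM => //; exact: continuous_peval.
  have H1 := quad_sum (index_enum 'I_n) (fun j => @quad_vint R _ n ref 1 (fun y : 'rV[R]_n => y 0 j)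
    (fun i => peval (mderiv j (@mon R n k i))) mref bref (@cx j) (fun i => @continuous_peval R n _)).
  have H2 := @quad_vint R _ n ref 1 (fun=> 1) _ mref bref (@cst_continuous _ _ _) c1.
  have := quadD H1 (quadN H2).
  congr quad; apply/funext => x /=.
  have cs j : continuous (fun y : 'rV[R]_n => y 0 j * (\sum_i x 0 i * peval (mderiv j (@mon R n k i)) y) ^+ 2).
    apply: contM => //; apply: contX2; apply: continuous_sumf => i _.
    by apply: contM; [move=> y; exact: cst_continuous|exact: continuous_peval].
  rewrite -vint_sum//; last by move=> j _; exact: (intg_cont mref bref).
  rewrite -vintB//; last 2 first.
  - apply: (intg_cont mref bref); apply: continuous_sumf => j _; exact: cs.
  - apply: (intg_cont mref bref); apply: contM; first by move=> y; exact: cst_continuous.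
    apply: contX2; apply: continuous_sumf => i _; apply: contM; last exact: c1.
    by move=> y; exact: cst_continuous.
  apply: eq_vint => y _; rewrite /rvar mul1r; congr (_ - _ ^+ 2).
    by apply: eq_bigr => j _; rewrite peval_mderiv_pcomb.
  under [in RHS]eq_bigr do rewrite peval_mderiv_pcomb mulr_sumr.
  rewrite exchange_big/=; apply: eq_bigr => i _; rewrite mulr_sumr; apply: eq_bigr => j _; ring.
- move=> p _ p0.
  have v0 : 0 <= vint ref (rvar p) by apply: vint_ge0 => y; exact: rvar_ge0.
  rewrite lt_neqAle addr_ge0 ?sqr_ge0// andbT; apply: contra p0.
  rewrite eq_sym paddr_eq0 ?sqr_ge0// => /andP[/eqP h1]; rewrite sqrf_eq0 => /eqP h2.
  have [y0 Hy0] := @refint_neq0 R n.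
  have Ep : p = mpolyC n (mcoeff mnm0 p).
    apply: mderiv_eq0 => j; apply: (peval_open_eq0 (@open_refint R n) Hy0) => y Hy.
    apply: rvar_int_eq0 => //.
    apply: (@vint_pos_eq0 R n ref (@refint R n) (rvar p) 1) => //.
    - exact: continuous_rvar.
    - by move=> z; exact: rvar_ge0.
    - exact: open_refint.
    - exact: refint_sub.
  move: h2; rewrite Ep; set c := mcoeff _ p.
  rewrite (@eq_vint _ _ _ _ (fun y => c * 1)); last by move=> y _; rewrite /peval mevalC mulr1.
  rewrite vintZ//; last by apply: (intg_cont mref bref); exact: cst_continuous.
  move/eqP; rewrite -/(rvol n) mulf_eq0 (gt_eqF (rvol_gt0 n)) orbF => /eqP ->.
  by rewrite mpolyC0.
Qed.

End RefIneq.

(** * Simplices, barycentric coordinates, normals *)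

Section Enum.
Context {R : realType} (V : finType).

Definition isenum m (s : 'I_m.+1 -> V) (S : {set V}) := injective s /\ S = [set s i | i : 'I_m.+1].

Lemma isenum_card m (s : 'I_m.+1 -> V) S : isenum s S -> #|S| = m.+1.
Proof. by move=> [si ->]; rewrite card_imset// card_ord. Qed.

Lemma isenum_mem m (s : 'I_m.+1 -> V) S i : isenum s S -> s i \in S.
Proof. by move=> [_ ->]; exact: imset_f. Qed.

Lemma isenum_seq m (t : seq V) (v0 : V) (S : {set V}) : uniq t -> size t = m.+1 -> S =i t ->
  isenum (fun i : 'I_m.+1 => nth v0 t i) S.
Proof.
move=> ut st St; split.
  move=> i j /eqP; rewrite nth_uniq ?st ?ltn_ord// => /eqP; exact: val_inj.
apply/setP => v; rewrite St; apply/idP/imsetP => [vt|[i _ ->]]; last by rewrite mem_nth ?st.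
have vi : (index v t < m.+1)%N by rewrite -st index_mem.
by exists (Ordinal vi) => //=; rewrite nth_index.
Qed.

Lemma isenum_perm m (s s' : 'I_m.+1 -> V) S : isenum s S -> isenum s' S ->
  exists p : {perm 'I_m.+1}, s' = s \o p.
Proof.
move=> [si Es] [si' Es'].
have H i : exists k, s k = s' i.
  have : s' i \in S by rewrite Es' imset_f.
  by rewrite Es => /imsetP[k _ ->]; exists k.
have [p Hp] := choice H.
have pi : injective p by move=> i j pij; apply: si'; rewrite -!Hp pij.
by exists (perm pi); apply/funext => i /=; rewrite permE Hp.
Qed.

Lemma isenum_sum m (s : 'I_m.+1 -> V) S (W : nmodType) (F : V -> W) : isenum s S ->
  \sum_(v in S) F v = \sum_i F (s i).
Proof. by move=> [si ->]; rewrite big_imset//= => i j _ _; exact: si. Qed.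

(** Makes a given edge the first coordinate axis of the reference simplex. *)
Lemma isenum2 m (S : {set V}) i j : #|S| = m.+2 -> i \in S -> j \in S -> i != j ->
  exists s : 'I_m.+2 -> V, [/\ isenum s S, s ord0 = i & s (lift ord0 ord0) = j].
Proof.
move=> cS iS jS ij.
pose t := i :: j :: enum (S :\ i :\ j).
exists (fun k : 'I_m.+2 => nth i t k); split => //.
apply: isenum_seq.
- by rewrite /= enum_uniq inE (negbTE ij) !mem_enum !inE !eqxx/= andbF.
- have jSi : j \in S :\ i by rewrite !inE eq_sym ij jS.
  by rewrite /= -cardE; move: cS; rewrite (cardsD1 i) iS (cardsD1 j) jSi !add1n => -[->].
- move=> v; rewrite !inE mem_enum !inE.
  by have [->|vi] := eqVneq v i; [rewrite iS|have [->|vj] := eqVneq v j; [rewrite jS|]].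
Qed.

Lemma isenum_exists m (S : {set V}) : #|S| = m.+1 -> exists s : 'I_m.+1 -> V, isenum s S.
Proof.
move=> cS; exists (fun i => enum_val (cast_ord (esym cS) i)); split.
  by move=> i j /enum_val_inj/cast_ord_inj.
apply/setP => v; apply/idP/imsetP => [vS|[i _ ->]]; last exact: enum_valP.
exists (cast_ord cS (enum_rank_in vS v)) => //.
by rewrite cast_ordK enum_rankK_in.
Qed.

Lemma isenumD1 m (s : 'I_m.+2 -> V) S (i : 'I_m.+2) : isenum s S ->
  isenum (fun k : 'I_m.+1 => s (lift i k)) (S :\ s i).
Proof.
move=> [si ->]; split; first by move=> k l /si/lift_inj.
apply/setP => v; rewrite !inE; apply/andP/imsetP => [[vi /imsetP[k _ E]]|[k _ ->]].
  case: (unliftP i k) => [l kl|ki]; first by exists l => //; rewrite E kl.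
  by move: vi; rewrite E ki eqxx.
by split; [apply/eqP => /si/eqP; rewrite eq_sym (negbTE (neq_lift _ _))|exact: imset_f].
Qed.

End Enum.

Section Bary.
Context {R : realType} {n : nat} (M : mesh R n.+1).
Local Notation V := 'I_(nvert M).
Local Notation pt := 'rV[R]_n.+1.
Local Notation vx := (@vert R n.+1 M).
Implicit Types (K S F : {set V}) (x y : pt).

Definition nondeg K := #|K| = n.+2 /\ aff_indep vx K.

Definition bcspec K x : set (V -> R) := [set l | [/\ forall v, v \notin K -> l v = 0,
  \sum_v l v = 1 & \sum_v l v *: vx v = x]].
(** Barycentric coordinates with respect to a cell, as a function on all mesh vertices that is zero
    off [K]. They are affine on the whole space, negative values included, so points outside the
    cell can be located as well. *)
Definition bc K x : V -> R := xget (fun=> 0) (bcspec K x).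

Lemma sum_enum K (s : 'I_n.+2 -> V) (w : 'I_n.+2 -> R) (W : lmodType R) (g : V -> W) : isenum s K ->
  \sum_v (\sum_(i | s i == v) w i) *: g v = \sum_i w i *: g (s i).
Proof.
move=> [si _]; rewrite (eq_bigr (fun v => \sum_(i | s i == v) w i *: g (s i))); last first.
  by move=> v _; rewrite scaler_suml; apply: eq_bigr => i /eqP ->.
by rewrite (exchange_big_dep predT)//=; apply: eq_bigr => i _; rewrite (big_pred1 (s i))// => v; rewrite eq_sym.
Qed.

(** A row vector killed by the edge matrix becomes, with minus its sum placed at vertex 0, an affine
    dependence of the vertices. *)
Lemma smx_unit K (s : 'I_n.+2 -> V) : nondeg K -> isenum s K -> smx (vx \o s) \in unitmx.
Proof.
move=> [cK aK] es; rewrite -row_free_unit -kermx_eq0; apply/eqP/row_matrixP => i.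
rewrite row0; set u := row i _.
have uZ : u *m smx (vx \o s) = 0 by apply/sub_kermxP; exact: row_sub.
pose w k := oapp (fun j => u 0 j) (- \sum_j u 0 j) (unlift ord0 k).
have wS (j : 'I_n.+1) : w (lift ord0 j) = u 0 j by rewrite /w liftK.
have w0 : w ord0 = - \sum_j u 0 j by rewrite /w unlift_none.
have sw : \sum_k w k = 0.
  by rewrite big_ord_recl w0; under [X in _ + X]eq_bigr => j _ do rewrite wS; rewrite addNr.
have wz : \sum_k w k *: vx (s k) = 0.
  rewrite big_ord_recl w0; under [X in _ + X]eq_bigr => j _ do rewrite wS.
  rewrite scaleNr scaler_suml addrC -sumrB -[RHS]uZ; apply/rowP => k.
  by rewrite summxE !mxE; apply: eq_bigr => j _; rewrite !mxE mulrBr.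
have H := aK (fun v => \sum_(k | s k == v) w k).
have {}H v : \sum_(k | s k == v) w k = 0.
  apply: H => [u' uK||].
  - by rewrite big_pred0// => k; apply: contraNF uK => /eqP <-; exact: isenum_mem es.
  - have := sum_enum w (fun=> 1 : R^o) es; rewrite /GRing.scale/=.
    by under eq_bigr do rewrite mulr1; under [RHS]eq_bigr do rewrite mulr1; move=> ->.
  - by rewrite (sum_enum _ _ es).
apply/rowP => j; rewrite [RHS]mxE -wS -[RHS](H (s (lift ord0 j))) (big_pred1 (lift ord0 j))//.
by move=> k; rewrite /= (inj_eq es.1).
Qed.

Lemma bc_exists K x : nondeg K -> exists l, bcspec K x l.
Proof.
move=> ndK; have [cK aK] := ndK; have [s es] := isenum_exists cK.
have uZ := smx_unit ndK es.
pose y := (x - vx (s ord0)) *m invmx (smx (vx \o s)).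
exists (fun v => \sum_(k | s k == v) bary y k); split.
- by move=> v vK; rewrite big_pred0// => k; apply: contraNF vK => /eqP <-; exact: isenum_mem es.
- have := sum_enum (bary y) (fun=> 1 : R^o) es; rewrite /GRing.scale/=.
  under eq_bigr do rewrite mulr1; under [RHS]eq_bigr do rewrite mulr1.
  by rewrite sum_bary.
- rewrite (sum_enum _ _ es) -/(spt (vx \o s) y) sptE /y mulmxKV//.
  by rewrite subrK.
Qed.

Section Cell.
Variables (K : {set V}) (ndK : nondeg K).

Lemma bcP x : bcspec K x (bc K x).
Proof. exact: (xgetPex _ (bc_exists x ndK)). Qed.

Lemma bc_notin x v : v \notin K -> bc K x v = 0.
Proof. by have [+ _ _] := bcP x; exact. Qed.

Lemma bc_sum x : \sum_v bc K x v = 1.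
Proof. by have [] := bcP x. Qed.

Lemma bc_comb x : \sum_v bc K x v *: vx v = x.
Proof. by have [] := bcP x. Qed.

Lemma bc_uniq x l : bcspec K x l -> bc K x = l.
Proof.
move=> [l1 l2 l3]; apply/funext => v; apply/eqP; rewrite -subr_eq0; apply/eqP.
have [_ aK] := ndK; apply: (aK (fun v => bc K x v - l v)) => [u uK||].
- by rewrite bc_notin// l1// subrr.
- by rewrite sumrB bc_sum l2 subrr.
- by under eq_bigr do rewrite scalerBl; rewrite sumrB bc_comb l3 subrr.
Qed.

(** The gradient of the barycentric coordinate of [v]: for an affine function, difference quotients
    with step one are exact. Its norm is the inverse of the height of [K] above the facet opposite
    to [v]. *)
Definition gbc v : pt := \row_k (bc K (delta_mx 0 k) v - bc K 0 v).

Lemma bcE x v : bc K x v = bc K 0 v + dot (gbc v) x.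
Proof.
rewrite (bc_uniq (l := fun v => bc K 0 v + dot (gbc v) x))//; split.
- by move=> u uK; rewrite bc_notin// add0r /dot big1// => k _; rewrite mxE !bc_notin// subrr mul0r.
- rewrite big_split/= bc_sum -dot_suml (_ : \sum_u gbc u = 0) ?dot0l ?addr0//.
  apply/rowP => k; rewrite summxE mxE; under eq_bigr do rewrite mxE.
  by rewrite sumrB !bc_sum subrr.
- under eq_bigr do rewrite scalerDl; rewrite big_split/= bc_comb add0r.
  under eq_bigr do rewrite /dot scaler_suml; rewrite exchange_big/=.
  rewrite [RHS]row_sum_delta; apply: eq_bigr => k _.
  under eq_bigr do rewrite mxE mulrC -scalerA scalerBl.
  by rewrite -scaler_sumr sumrB !bc_comb subr0.
Qed.

Lemma bcB x y v : bc K x v - bc K y v = dot (gbc v) (x - y).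
Proof. by rewrite bcE (bcE y) dotBr; ring. Qed.

Lemma gbc_notin v : v \notin K -> gbc v = 0.
Proof. by move=> vK; apply/rowP => k; rewrite !mxE !bc_notin// subrr. Qed.

Lemma gbc_sum : \sum_v gbc v = 0.
Proof.
apply/rowP => k; rewrite summxE mxE; under eq_bigr do rewrite mxE.
by rewrite sumrB !bc_sum subrr.
Qed.

Lemma gbc_comb a : \sum_v dot (gbc v) a *: vx v = a.
Proof.
have := bc_comb a; under eq_bigr do rewrite bcE scalerDl.
by rewrite big_split/= bc_comb add0r.
Qed.

Lemma bc_vert u v : u \in K -> bc K (vx u) v = (u == v)%:R.
Proof.
move=> uK; rewrite (bc_uniq (l := fun v => (u == v)%:R))//; split.
- by move=> w wK; case: eqVneq => // uw; move: wK; rewrite -uw uK.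
- by rewrite (bigD1 u)//= eqxx big1 ?addr0// => w /negbTE; rewrite eq_sym => ->.
- by rewrite (bigD1 u)//= eqxx scale1r big1 ?addr0// => w /negbTE; rewrite eq_sym => ->; rewrite scale0r.
Qed.

Lemma gbc_edge u w v : u \in K -> w \in K -> dot (gbc v) (vx u - vx w) = (u == v)%:R - (w == v)%:R.
Proof. by move=> uK wK; rewrite -bcB !bc_vert. Qed.

Lemma simplexE S x : S \subset K -> simplex S x <-> (forall v, 0 <= bc K x v) /\ forall v, v \notin S -> bc K x v = 0.
Proof.
move=> SK; split => [[l [l0 lS l1 lx]]|[H1 H2]].
  rewrite (bc_uniq (l := l)) ?lx//; split => // v vK; apply: lS.
  by apply: contraNN vK => vS; exact: (fintype.subsetP SK _ vS).
by exists (bc K x); split => //; [exact: bc_sum|rewrite bc_comb].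
Qed.

Lemma simplexKE x : simplex K x <-> forall v, 0 <= bc K x v.
Proof.
rewrite simplexE//; split => [[]//|H]; split => // v; exact: bc_notin.
Qed.

Lemma continuous_bc v : continuous (fun x => bc K x v).
Proof.
rewrite (_ : (fun x => _) = fun x => bc K 0 v + dot (gbc v) x); last by apply/funext => x; exact: bcE.
by apply: contD; [exact: contC|exact: continuous_dotr].
Qed.

Definition ocell := [set x | forall v, v \in K -> 0 < bc K x v].

Lemma open_ocell : open ocell.
Proof.
rewrite (_ : ocell = [set x | forall v, 0 < (if v \in K then bc K x v else 1)]).
  apply: open_pos_forall => v; case: (v \in K); [exact: continuous_bc|exact: contC].
apply/seteqP; split => x H v; first by case: ifPn => // vK; exact: H.
by move=> vK; have := H v; rewrite vK.
Qed.

Lemma ocell_sub : ocell `<=` simplex K.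
Proof.
move=> x H; apply/simplexKE => v; have [vK|vK] := boolP (v \in K); first exact/ltW/H.
by rewrite bc_notin.
Qed.

(** A point of the simplex whose coordinate at [v] vanishes leaves the simplex as soon as it is
    moved away from [v]: that coordinate becomes negative. *)
Lemma interior_simplex : interior (simplex K) = ocell.
Proof.
apply/seteqP; split => [x Kx v vK|x Hx]; last first.
  by apply: (filterS ocell_sub); exact: (open_nbhs_nbhs (conj open_ocell Hx)).
have Sx : simplex K x by exact: interior_subset.
rewrite lt_neqAle ((simplexKE x).1 Sx) andbT eq_sym; apply/eqP => bx0.
have /nbhs_ballP[e /= e0 He] := Kx.
pose N := `|x - vx v| + 1.
have N0 : 0 < N by rewrite ltr_wpDl.
pose z := x + (e / (2 * N)) *: (x - vx v).
have : ball x e z.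
  rewrite mx_norm_ball /ball_/= /z opprD addrA subrr sub0r normrN normrZ.
  rewrite gtr0_norm ?divr_gt0 ?mulr_gt0//.
  rewrite mulrAC ltr_pdivrMr ?mulr_gt0// ltr_pM2l//.
  by rewrite /N mulrDr mulr1 (mulr_natl _ 2) mulr2n -addrA ltrDl ltr_wpDl.
move=> /He/simplexKE/(_ v).
have -> : bc K z v = bc K x v + (bc K z v - bc K x v) by rewrite addrC subrK.
rewrite bcB /z addrAC subrr add0r dotZr -bcB bx0 bc_vert// eqxx sub0r mulrN1 add0r.
by rewrite leNgt oppr_lt0 divr_gt0 ?mulr_gt0.
Qed.

Lemma bc_spt (s : 'I_n.+2 -> V) y i : isenum s K -> bc K (spt (vx \o s) y) (s i) = bary y i.
Proof.
move=> es; rewrite (bc_uniq (l := fun v => \sum_(k | s k == v) bary y k)).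
  by rewrite (big_pred1 i)// => k; rewrite /= (inj_eq es.1).
split.
- by move=> v vK; rewrite big_pred0// => k; apply: contraNF vK => /eqP <-; exact: isenum_mem es.
- have := sum_enum (bary y) (fun=> 1 : R^o) es; rewrite /GRing.scale/=.
  under eq_bigr do rewrite mulr1; under [RHS]eq_bigr do rewrite mulr1.
  by rewrite sum_bary.
- by rewrite (sum_enum _ _ es).
Qed.

End Cell.
End Bary.

Section Geometry.
Context {R : realType} {n : nat} (M : mesh R n.+1).
Local Notation V := 'I_(nvert M).
Local Notation pt := 'rV[R]_n.+1.
Local Notation vx := (@vert R n.+1 M).
Implicit Types (K S F : {set V}) (x y : pt).

Definition vbnd : R := \sum_(v : V) \sum_k `|vx v 0 k|.

Lemma bounded_simplex S x : simplex S x -> forall k, `|x 0 k| <= vbnd.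
Proof.
move=> [l [l0 _ l1 ->]] k; rewrite summxE (le_trans (ler_norm_sum _ _ _))//.
apply: ler_sum => v _; rewrite mxE normrM ger0_norm//.
have lv : l v <= 1 by rewrite -l1 (bigD1 v)//= lerDl sumr_ge0.
apply: (le_trans (ler_piMl (normr_ge0 _) lv)).
by rewrite (bigD1 k)//= lerDl sumr_ge0.
Qed.

Definition favg F (f : pt -> R) : R := vint (@refsimplex R n) (f \o face_map F : 'rV[R]_n -> R).

Lemma face_map_spt F (s0 : V) : s0 \in F -> #|F| = n.+1 ->
  face_map F = spt (vx \o (fun i : 'I_n.+1 => nth s0 (enum F) i)).
Proof.
move=> sF cF; apply/funext => y; rewrite sptE /face_map addrC.
have E (i : nat) : (i < n.+1)%N -> fpt F i = vx (nth s0 (enum F) i).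
  by move=> iF; rewrite /fpt (nth_map s0)// -cardE cF.
rewrite E//; congr (_ + _); apply/rowP => k; rewrite summxE !mxE.
apply: eq_bigr => j _; rewrite !mxE /fedge E//; last by rewrite ltnS.
by rewrite E// !mxE /= !add1n; congr (_ * (_ - vx (nth _ _ _) _ _)).
Qed.

Lemma isenum_enum F (s0 : V) : s0 \in F -> #|F| = n.+1 ->
  isenum (fun i : 'I_n.+1 => nth s0 (enum F) i) F.
Proof.
move=> sF cF; apply: isenum_seq; [exact: enum_uniq|by rewrite -cardE|].
by move=> v; rewrite mem_enum.
Qed.

(** [face_map] follows the order of [enum F], whereas a cell numbers its facets by deleting a
    vertex; [avg_perm] reconciles the two. *)
Lemma favg_enum F (s : 'I_n.+1 -> V) f : isenum s F -> continuous f ->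
  favg F f = avg (vx \o s) f.
Proof.
move=> es cf; have cF := isenum_card es; have sF := isenum_mem ord0 es.
rewrite /favg (face_map_spt sF cF) -/(avg _ f).
have [p ->] := isenum_perm es (isenum_enum sF cF).
exact: (avg_perm (vx \o s)).
Qed.

Lemma bintE K g : bint K g = \sum_(v in K) sint (K :\ v) (g (K :\ v)).
Proof.
rewrite /bint /facets big_imset//= => u v uK vK E.
apply/eqP/negPn/negP => uv; have : u \in K :\ v by rewrite !inE uv uK.
by rewrite -E !inE eqxx.
Qed.

Section Cell.
Variables (K : {set V}) (ndK : nondeg K).

Let oK : open (ocell K). Proof. exact: open_ocell. Qed.

Lemma bounded_ocell x : ocell K x -> forall k, `|x 0 k| <= vbnd.
Proof. by move/(ocell_sub ndK)/bounded_simplex. Qed.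

Lemma intg_ocell f : continuous f -> intg (ocell K) f.
Proof. exact: (intg_cont (msr_open oK) bounded_ocell). Qed.

Lemma kint_cov s f : isenum s K -> continuous f ->
  kint K f = `|\det (smx (vx \o s))| * avg (vx \o s) f.
Proof.
move=> es cf; rewrite /kint interior_simplex//.
rewrite (vint_cov (vx (s ord0)) (smx_unit ndK es) (msr_open oK) (intg_ocell cf)); congr (_ * _).
have -> : [set y | ocell K (y *m smx (vx \o s) + vx (s ord0))] = @refint R n.+1.
  apply/seteqP; split => y /=; rewrite -[_ + _](sptE (vx \o s)) => H.
    by move=> i; rewrite -(bc_spt ndK y i es); apply: H; exact: isenum_mem es.
  move=> v vK; move: (vK); rewrite {1}es.2 => /imsetP[i _ ->].
  rewrite (bc_spt ndK _ _ es); exact: H.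
have cfs : continuous (f \o spt (vx \o s)).
  by move=> y; apply: (continuous_comp (@continuous_spt _ _ _ _ y)); exact: cf.
have EQ : (fun y => f (y *m smx (vx \o s) + vx (s ord0))) = f \o spt (vx \o s).
  by apply/funext => y /=; rewrite sptE.
rewrite EQ; apply: (vint_negl (msr_open (@open_refint R n.+1)) (@msr_refsimplex R n.+1)).
- exact: refint_sub.
- exact: (intg_cont (@msr_refsimplex R _) (@bounded_refsimplex R _)).
- exact: null_refsimplex.
Qed.

(** The absolute Jacobian of any affine parametrization of [K] ([det_jac]), defined through the
    volume so as not to depend on a numbering. *)
Definition jac : R := kint K (fun=> 1) / rvol n.+1.

Lemma det_jac s : isenum s K -> `|\det (smx (vx \o s))| = jac.
Proof.
move=> es; rewrite /jac (kint_cov es (@contC _ _ _)).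
by rewrite -[avg _ _]/(rvol n.+1) mulfK// gt_eqF// rvol_gt0.
Qed.

Lemma jac_gt0 : 0 < jac.
Proof.
have [s es] := isenum_exists ndK.1.
by rewrite -(det_jac es) normr_gt0 -unitfE -unitmxE (smx_unit ndK es).
Qed.

Lemma kint_avg (s : 'I_n.+2 -> V) f : isenum s K -> continuous f -> kint K f = jac * avg (vx \o s) f.
Proof. by move=> es cf; rewrite (kint_cov es cf) (det_jac es). Qed.

Lemma smx_row0 (z : 'I_n.+2 -> pt) : row ord0 (smx z) = z (lift ord0 ord0) - z ord0.
Proof. by apply/rowP => k; rewrite !mxE. Qed.

Lemma sum_consv m a (y : 'rV[R]_m) : \sum_j consv a y 0 j = a + \sum_j y 0 j.
Proof.
by rewrite big_ord_recl consv0; congr (_ + _); apply: eq_bigr => j _; rewrite consvS.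
Qed.

Lemma spt_consv_top (z : 'I_n.+2 -> pt) (y : 'rV[R]_n) :
  spt z (consv (1 - \sum_j y 0 j) y) = spt (fun i : 'I_n.+1 => z (lift ord0 i)) y.
Proof.
rewrite /spt big_ord_recl bary0 sum_consv subrK subrr scale0r add0r; apply: eq_bigr => i _; rewrite baryS.
by case: (unliftP ord0 i) => [j|] ->; rewrite ?consv0 ?consvS ?bary0 ?baryS.
Qed.

Lemma spt_consv_bot (z : 'I_n.+2 -> pt) (y : 'rV[R]_n) :
  spt z (consv 0 y) = spt (fun i : 'I_n.+1 => z (lift (lift ord0 ord0) i)) y.
Proof.
rewrite /spt big_ord_recl bary0 sum_consv add0r big_ord_recl baryS consv0 scale0r add0r.
rewrite [RHS]big_ord_recl bary0; congr (_ *: z _ + _).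
- exact: val_inj.
- apply: eq_bigr => j _; rewrite !baryS consvS; congr (_ *: z _); exact: val_inj.
Qed.

(** With [i] and [j] as vertices 0 and 1, the derivative along the edge is the first partial
    derivative on the reference simplex, and the two boundary terms of [ref_ftc] live on the facets
    opposite to [i] and [j]. *)
Lemma cell_green_edge f i j : C1 f -> i \in K -> j \in K -> i != j ->
  kint K (fun x => dot (grad f x) (vx j - vx i)) = jac * (favg (K :\ i) f - favg (K :\ j) f).
Proof.
move=> Cf iK jK ij; have [cf Hf] := Cf.
have [s [es s0 s1]] := isenum2 ndK.1 iK jK ij.
have cg : continuous (fun x => dot (grad f x) (vx j - vx i)).
  apply: continuous_sumf => k _; apply: contM; last exact: contC.
  rewrite (_ : (fun x => _) = partial k f); first exact: (Hf k).2.
  by apply/funext => x; rewrite mxE.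
rewrite (kint_avg es cg); congr (_ * _).
set z := vx \o s.
have Ca := C1_aff (smx z) (z ord0) Cf.
have E1 : avg z (fun x => dot (grad f x) (vx j - vx i)) =
   vint (@refsimplex R n.+1) (partial ord0 (fun y => f (y *m smx z + z ord0))).
  apply: eq_vint => y _ /=; rewrite (C1g_partial ord0 y Ca) smx_row0 sptE /z /=.
  by rewrite s0 s1.
have cfs m (z' : 'I_m.+1 -> pt) : continuous (f \o spt z').
  by move=> y; apply: (continuous_comp (@continuous_spt _ _ _ z' y)); exact: cf.
rewrite E1 (ref_ftc (C1g_C1 Ca)).
rewrite (@eq_vint _ n _ _ (fun y : 'rV[R]_n => (f \o spt (fun i : 'I_n.+1 => z (lift ord0 i))) y -
   (f \o spt (fun i : 'I_n.+1 => z (lift (lift ord0 ord0) i))) y)); last first.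
  by move=> y _; rewrite -!sptE spt_consv_top spt_consv_bot.
rewrite vintB; [|exact: msr_refsimplex| |]; last 2 first.
- exact: (intg_cont (@msr_refsimplex R _) (@bounded_refsimplex R _)).
- exact: (intg_cont (@msr_refsimplex R _) (@bounded_refsimplex R _)).
by rewrite -s0 -s1 (favg_enum (isenumD1 ord0 es) cf) (favg_enum (isenumD1 (lift ord0 ord0) es) cf).
Qed.

Lemma sum_compensate (p q : V -> R) (c j : R) : \sum_(v in K) p v = 0 ->
  \sum_(v in K) (p v * (j * c) - j * (p v * q v)) = - j * \sum_(v in K) p v * q v.
Proof. by move=> p0; rewrite sumrB -mulr_suml p0 mul0r sub0r -mulr_sumr mulNr. Qed.

(** Since the [gbc K v] sum to zero, [a] is the combination of the edges from one vertex [i] with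
    coefficients [dot (gbc K v) a]. For the same reason the contributions of the facet opposite to
    [i] add up correctly. *)
Lemma cell_green f a : C1 f ->
  kint K (fun x => dot (grad f x) a) = - jac * \sum_(v in K) dot (gbc K v) a * favg (K :\ v) f.
Proof.
move=> Cf; have [cf Hf] := Cf.
have [s es] := isenum_exists ndK.1.
set i := s ord0; have iK : i \in K by exact: isenum_mem es.
have cg w : continuous (fun x => dot (grad f x) w).
  apply: continuous_sumf => k _; apply: contM; last exact: contC.
  rewrite (_ : (fun x => _) = partial k f); first exact: (Hf k).2.
  by apply/funext => x; rewrite mxE.
have sG : \sum_v dot (gbc K v) a = 0 by rewrite -dot_suml gbc_sum// dot0l.
have EK (W : nmodType) (F : V -> W) : (forall v, v \notin K -> F v = 0) -> \sum_v F v = \sum_(v in K) F v.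
  by move=> F0; rewrite [LHS](bigID (mem K))/= [X in _ + X]big1 ?addr0.
have Ea : a = \sum_(v in K) dot (gbc K v) a *: (vx v - vx i).
  rewrite -EK; last by move=> v vK; rewrite gbc_notin// dot0l scale0r.
  under eq_bigr do rewrite scalerBr.
  by rewrite sumrB gbc_comb// -scaler_suml sG scale0r subr0.
transitivity (\sum_(v in K) kint K (fun x => dot (gbc K v) a * dot (grad f x) (vx v - vx i))).
  rewrite /kint interior_simplex// -vint_sum; last 2 first.
  - exact: msr_open.
  - by move=> v _; apply: intg_ocell; apply: contM; [exact: contC|exact: cg].
  apply: eq_vint => x _; rewrite {1}Ea dot_sumr; apply: eq_bigr => v _.
  by rewrite dotZr.
have sG' : \sum_(v in K) dot (gbc K v) a = 0.
  by rewrite -EK// => v vK; rewrite gbc_notin// dot0l.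
transitivity (\sum_(v in K) (dot (gbc K v) a * (jac * favg (K :\ i) f) - jac * (dot (gbc K v) a * favg (K :\ v) f))).
  apply: eq_bigr => v vK.
  rewrite /kint interior_simplex// vintZ; [|exact: msr_open|exact: intg_ocell].
  have [->|iv] := eqVneq i v.
    rewrite subrr vint_eq0; last by move=> x _; rewrite dot0r.
    by rewrite mulr0 mulrCA subrr.
  have := cell_green_edge Cf iK vK iv; rewrite /kint interior_simplex// => ->.
  move: (dot _ _) jac (favg _ _) (favg _ _) => p q r t.
  by rewrite !mulrBr (mulrCA q).
exact: sum_compensate.
Qed.

End Cell.

End Geometry.

Section Enorm.
Context {R : realType} {d : nat}.
Implicit Types u v : 'rV[R]_d.

Lemma enorm_ge0 u : 0 <= enorm u.
Proof. exact: sqrtr_ge0. Qed.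

Lemma enorm_sqr u : enorm u ^+ 2 = dot u u.
Proof. by rewrite sqr_sqrtr// dot_ge0. Qed.

Lemma enorm_gt0 u : u != 0 -> 0 < enorm u.
Proof. by move=> u0; rewrite sqrtr_gt0 dot_gt0. Qed.

Lemma enormZ a u : enorm (a *: u) = `|a| * enorm u.
Proof. by rewrite /enorm dotZl dotZr mulrA -expr2 sqrtrM ?sqr_ge0// sqrtr_sqr. Qed.

Lemma enormN u : enorm (- u) = enorm u.
Proof. by rewrite -scaleN1r enormZ normrN normr1 mul1r. Qed.

Lemma dot_sqr_le u v : dot u v ^+ 2 <= dot u u * dot v v.
Proof.
have [->|v0] := eqVneq v 0; first by rewrite !dot0r expr0n mulr0.
have vv := dot_gt0 v0.
have := dot_ge0 (dot v v *: u - dot u v *: v).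
rewrite !dotBl !dotBr !dotZl !dotZr (dotC v u).
rewrite (_ : _ - _ = dot v v * (dot u u * dot v v - dot u v ^+ 2)); last by ring.
by rewrite pmulr_rge0// subr_ge0.
Qed.

Lemma dot_le u v : dot u v <= enorm u * enorm v.
Proof.
rewrite (le_trans (ler_norm _))// -(@ler_pXn2r _ 2)// ?nnegrE ?mulr_ge0 ?enorm_ge0//.
by rewrite real_normK ?num_real// exprMn !enorm_sqr dot_sqr_le.
Qed.

End Enorm.

(** * Normals, areas, the divergence theorem and shape regularity on one cell *)

Section Normals.
Context {R : realType} {n : nat} (M : mesh R n.+1).
Local Notation V := 'I_(nvert M).
Local Notation pt := 'rV[R]_n.+1.
Local Notation vx := (@vert R n.+1 M).
Implicit Types (S F : {set V}) (x y : pt).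
Variables (K : {set V}) (ndK : nondeg K).

Lemma other_vertex v : v \in K -> exists2 u, u \in K & u != v.
Proof.
move=> vK; have : (0 < #|K :\ v|)%N.
  by have := ndK.1; rewrite (cardsD1 v) vK add1n => -[->].
by move/card_gt0P => [u]; rewrite !inE => /andP[uv uK]; exists u.
Qed.

Lemma gbc_neq0 v : v \in K -> gbc K v != 0.
Proof.
move=> vK; have [u uK uv] := other_vertex vK.
have := gbc_edge ndK v vK uK; rewrite eqxx (negbTE uv) subr0 => H.
by apply/eqP => G0; move: H; rewrite G0 dot0l => /eqP; rewrite eq_sym oner_eq0.
Qed.

Lemma facetE v F : v \in K -> F = K :\ v -> F \in facets K.
Proof. by move=> vK ->; exact: imset_f. Qed.

Lemma card_facet v : v \in K -> #|K :\ v| = n.+1.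
Proof. by move=> vK; have := ndK.1; rewrite (cardsD1 v) vK add1n => -[]. Qed.

Definition nrm v : pt := - ((enorm (gbc K v))^-1 *: gbc K v).

Lemma nrm_is_normal v : v \in K -> is_normal K (K :\ v) (nrm v).
Proof.
move=> vK; have G0 := enorm_gt0 (gbc_neq0 vK); split.
- by rewrite enormN enormZ ger0_norm ?invr_ge0 ?enorm_ge0// mulVf ?gt_eqF.
- move=> a b; rewrite !inE => /andP[av aK] /andP[bv bK].
  by rewrite dotNl dotZl (gbc_edge ndK)// (negbTE av) (negbTE bv) subrr mulr0 oppr0.
- move=> a u; rewrite !inE => /andP[av aK] /andP[+ uK].
  rewrite uK andbT negbK => /eqP ->.
  by rewrite dotNl dotZl (gbc_edge ndK)// (negbTE av) eqxx subr0 mulr1 oppr_lt0 invr_gt0.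
Qed.

(** The edges from [a] span the space and [nu] sees only the one towards [v], exactly as [gbc K v]
    does. *)
Lemma perp_gbc v a nu : v \in K -> a \in K :\ v ->
  (forall a b, a \in K :\ v -> b \in K :\ v -> dot nu (vx a - vx b) = 0) ->
  nu = dot nu (vx v - vx a) *: gbc K v.
Proof.
move=> vK aF nu2; set t := dot nu (vx v - vx a).
have E y : dot nu y = t * dot (gbc K v) y.
  rewrite -{1}(gbc_comb ndK y) dot_sumr.
  transitivity (\sum_u dot (gbc K u) y * dot nu (vx u - vx a)).
    under [RHS]eq_bigr do rewrite dotBr mulrBr.
    rewrite sumrB -mulr_suml -dot_suml (gbc_sum ndK) dot0l mul0r subr0.
    by apply: eq_bigr => u _; rewrite dotZr.
  rewrite (bigD1 v)//= mulrC big1 ?addr0// => u uv.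
  have [uK|uK] := boolP (u \in K); last by rewrite (gbc_notin ndK)// dot0l mul0r.
  by rewrite nu2 ?mulr0// !inE uv.
by apply/rowP => k; rewrite mxE -!dot_deltar E.
Qed.

Lemma normal_uniq v nu : v \in K -> is_normal K (K :\ v) nu -> nu = nrm v.
Proof.
move=> vK [nu1 nu2 nu3]; have G0 := enorm_gt0 (gbc_neq0 vK).
have [a aK av] := other_vertex vK.
have aF : a \in K :\ v by rewrite !inE av.
have := perp_gbc vK aF nu2; set t := dot nu (vx v - vx a) => nuE.
have t0 : t < 0 by apply: nu3 => //; rewrite !inE eqxx.
move: nu1; rewrite nuE enormZ ltr0_norm// => H.
rewrite /nrm -scaleNr; congr (_ *: _).
by rewrite -[t]opprK; congr (- _); rewrite -[LHS](mulfK (lt0r_neq0 G0)) H mul1r.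
Qed.

Lemma outnormalE v : v \in K -> outnormal K (K :\ v) = nrm v.
Proof.
move=> vK; apply: normal_uniq => //.
by apply: (xgetPex 0); exists (nrm v); exact: nrm_is_normal.
Qed.

Lemma mulmx_tr_dot (u w : pt) : \sum_k u 0 k * w^T k 0 = dot u w.
Proof. by apply: eq_bigr => k _; rewrite mxE. Qed.

(** Base times height equals volume. Replacing the edge towards [v] by the unit normal turns the
    Gram determinant into the square of a full determinant, and changes the determinant of the edge
    matrix by the inverse height. *)
Lemma sqrt_gram v : v \in K ->
  Num.sqrt (\det (\matrix_(i, j) dot (fedge (K :\ v) i) (fedge (K :\ v) j))) = jac K * enorm (gbc K v).
Proof.
move=> vK; set F := K :\ v; have cF : #|F| = n.+1 by exact: card_facet.
have G0 := enorm_gt0 (gbc_neq0 vK).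
have [f0 f0F] : exists f0, f0 \in F by apply/card_gt0P; rewrite cF.
case eF : (enum F) => [|f1 r]; first by move: cF; rewrite cardE eF.
have f1F : f1 \in F by rewrite -mem_enum eF inE eqxx.
have sr : size r = n by have := cF; rewrite cardE eF => -[].
have vF : v \notin F by rewrite !inE eqxx.
(* With this order the edge matrix has the edge from [f1] to [v] as first row, followed by the edges
   that parametrize the face. *)
pose t := [:: f1, v & r].
have et : isenum (fun i : 'I_n.+2 => nth f1 t i) K.
  apply: isenum_seq.
  - have := enum_uniq F; rewrite eF /= inE => /andP[f1r ->]; rewrite negb_or f1r !andbT.
    have : v \notin enum F by rewrite mem_enum.
    by rewrite eF inE negb_or eq_sym => /andP[-> ->].
  - by rewrite /= sr.
  - move=> u; rewrite !inE; have : (u \in F) = (u \in f1 :: r) by rewrite -eF mem_enum.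
    rewrite !inE; have [->|uv] := eqVneq u v; first by rewrite vK orbT.
    by move=> /= ->.
set s := (fun i : 'I_n.+2 => nth f1 t i) in et.
pose Z : 'M[R]_(1 + n) := smx (vx \o s).
pose E : 'M[R]_(n, 1 + n) := \matrix_j fedge F j.
pose w : 'rV[R]_(1 + n) := vx v - vx f1.
have ZE : Z = col_mx w E.
  apply/row_matrixP => i; case: (split_ordP i) => j ->.
    rewrite rowKu; apply/rowP => k; rewrite !mxE (ord1 j).
    by rewrite (_ : lshift n ord0 = ord0) //=; exact: val_inj.
  rewrite rowKd; apply/rowP => k; rewrite !mxE /=.
  by rewrite /fedge /fpt eF /= (nth_map f1) ?sr// !mxE.
pose nu : 'rV[R]_(1 + n) := nrm v.
have [nu1 nu2 _] := nrm_is_normal vK.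
have nunu : nu *m nu^T = 1%:M.
  apply/matrixP => i j; rewrite !ord1 !mxE eqxx.
  transitivity (dot (nrm v) (nrm v)); first exact: (mulmx_tr_dot nu nu).
  by rewrite -enorm_sqr nu1 expr1n.
have nuE : nu *m E^T = 0.
  apply/matrixP => i j; rewrite !ord1 [LHS]mxE [RHS]mxE.
  transitivity (dot (nrm v) (fedge F j)); first by apply: eq_bigr => k _; rewrite [E^T _ _]mxE [E _ _]mxE.
  rewrite /fedge /fpt eF /= (nth_map f1) ?sr//; apply: nu2 => //.
  by rewrite -mem_enum eF inE mem_nth ?orbT ?sr.
have wnu : (w *m nu^T) 0 0 = - (enorm (gbc K v))^-1.
  rewrite mxE; transitivity (dot w (nrm v)); first exact: (mulmx_tr_dot w nu).
  rewrite dotC.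
  rewrite /nrm dotNl dotZl (gbc_edge ndK)//; last by move: f1F; rewrite !inE => /andP[].
  rewrite eqxx; have /negbTE -> : f1 != v by apply: contraNneq vF => <-.
  by rewrite subr0 mulr1.
have uZ : Z \in unitmx by exact: (smx_unit ndK et).
pose X : 'M[R]_(1 + n) := col_mx nu E.
(* The normal expressed in the edges; only its first entry matters for the determinant, and pairing
   with the normal shows it to be [- enorm (gbc K v)]. *)
pose q : 'rV[R]_(1 + n) := nu *m invmx Z.
have XE : X = block_mx (lsubmx q) (rsubmx q) 0 1%:M *m Z.
  rewrite {1}ZE mul_block_col mul0mx mul1mx add0r; congr col_mx.
  by rewrite -mul_row_col hsubmxK -ZE /q mulmxKV.
have q0 : q 0 0 * (w *m nu^T) 0 0 = 1.
  have : nu *m nu^T = lsubmx q *m (w *m nu^T) + rsubmx q *m (E *m nu^T).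
    by rewrite !mulmxA -mulmxDl -mul_row_col hsubmxK -ZE /q mulmxKV.
  have -> : E *m nu^T = 0 by rewrite -[E]trmxK -trmx_mul nuE trmx0.
  rewrite mulmx0 addr0 nunu => /matrixP/(_ 0 0); rewrite [LHS]mxE eqxx [RHS]mxE big_ord1 => H.
  by move: H; rewrite mxE (_ : lshift n ord0 = 0)//; exact: val_inj.
have dX : \det X = q 0 0 * \det Z.
  rewrite XE det_mulmx det_ublock det1 mulr1; congr (_ * _).
  by rewrite (mx11_scalar (lsubmx q)) det_scalar expr1 mxE; congr (q 0 _); exact: val_inj.
have gX : \det (\matrix_(i, j) dot (fedge F i) (fedge F j)) = \det X ^+ 2.
  rewrite expr2 -{2}(det_tr X) -det_mulmx tr_col_mx mul_col_row nunu nuE.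
  have -> : E *m nu^T = 0 by rewrite -[E]trmxK -trmx_mul nuE trmx0.
  rewrite det_ublock det1 mul1r; congr (\det _); apply/matrixP => i j.
  by rewrite !mxE; apply: eq_bigr => k _; rewrite !mxE.
rewrite gX sqrtr_sqr dX normrM -(det_jac ndK et) mulrC; congr (_ * _).
have -> : q 0 0 = - enorm (gbc K v).
  by move: q0; rewrite wnu; move: (q 0 0) (enorm _) (lt0r_neq0 G0) => a b b0 H; rewrite -[RHS]mul1r -H; field.
by rewrite normrN ger0_norm// ltW.
Qed.

Lemma sintE v g : v \in K -> sint (K :\ v) g = jac K * enorm (gbc K v) * favg (K :\ v) g.
Proof. by move=> vK; rewrite -sqrt_gram. Qed.

Lemma continuous_face_map F : continuous (face_map F : 'rV[R]_n -> pt).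
Proof.
apply: continuous_rV => i.
rewrite (_ : (fun z : 'rV[R]_n => _) = fun z : 'rV[R]_n => fpt F 0 0 i + \sum_j z 0 j * fedge F j 0 i).
  apply: contD; first exact: contC.
  apply: continuous_sumf => j _; apply: contM; last exact: contC.
  exact: coord_continuous.
by apply/funext => y; rewrite mxE summxE; congr (_ + _); apply: eq_bigr => j _; rewrite mxE.
Qed.

Lemma intg_face F f : continuous f -> intg (@refsimplex R n) (f \o face_map F : 'rV[R]_n -> R).
Proof.
move=> cf; apply: (intg_cont (@msr_refsimplex R n) (@bounded_refsimplex R n)) => y.
apply: (continuous_comp (@continuous_face_map F y)); exact: cf.
Qed.

Lemma favgZ F (a : R) (f : pt -> R) : continuous f -> favg F (fun x => a * f x) = a * favg F f.
Proof. by move=> cf; exact: (vintZ a (@msr_refsimplex R n) (intg_face F cf)). Qed.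

Lemma favg_sum F (I : Type) (s : seq I) (f : I -> pt -> R) : (forall i, continuous (f i)) ->
  favg F (fun x => \sum_(i <- s) f i x) = \sum_(i <- s) favg F (f i).
Proof.
by move=> cf; rewrite /favg -vint_sum//; [exact: msr_refsimplex|move=> i _; exact: intg_face].
Qed.

(** The facet opposite to [v] has area factor [jac K * enorm (gbc K v)] and outward normal minus the
    normalized [gbc K v]. The norms cancel and [cell_green] for each component remains. *)
Lemma cell_div (f : 'I_n.+1 -> pt -> R) : (forall k, C1 (f k)) ->
  kint K (fun x => \sum_k partial k (f k) x) =
  bint K (fun F x => dot (\row_k f k x) (outnormal K F)).
Proof.
move=> Cf; have cf k : continuous (f k) by case: (Cf k).
have oK := open_ocell ndK.
have cp k : continuous (partial k (f k)) by exact: ((Cf k).2 k).2.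
have E1 : kint K (fun x => \sum_k partial k (f k) x) =
    \sum_k kint K (fun x => dot (grad (f k) x) (delta_mx 0 k)).
  rewrite /kint interior_simplex// vint_sum; last 2 first.
  - exact: msr_open.
  - by move=> k _; apply: intg_ocell.
  by apply: eq_bigr => k _; apply: eq_vint => x _; rewrite dot_deltar mxE.
rewrite E1 bintE.
transitivity (\sum_k \sum_(v in K) (- jac K * (gbc K v 0 k * favg (K :\ v) (f k)))).
  apply: eq_bigr => k _; rewrite (cell_green ndK _ (Cf k)) mulr_sumr.
  by apply: eq_bigr => v vK; rewrite dot_deltar.
rewrite exchange_big/=; apply: eq_bigr => v vK.
rewrite sintE// outnormalE//.
have -> : favg (K :\ v) (fun x => dot (\row_k f k x) (nrm v)) =
    - (enorm (gbc K v))^-1 * \sum_k gbc K v 0 k * favg (K :\ v) (f k).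
  rewrite mulr_sumr (_ : (fun x => _) = fun x => \sum_k (- (enorm (gbc K v))^-1 * gbc K v 0 k) * f k x).
    rewrite favg_sum; last by move=> k; apply: contM; [exact: contC|].
    by apply: eq_bigr => k _; rewrite favgZ// mulrA.
  by apply/funext => x; apply: eq_bigr => k _; rewrite !mxE; ring.
have G0 := lt0r_neq0 (enorm_gt0 (gbc_neq0 vK)).
rewrite -mulr_sumr; move: (jac K) (\sum_k _) => a b.
by rewrite mulrA -(mulrA a) mulrN mulfV// mulrN1.
Qed.

Lemma has_sup_dist S x y : simplex S x -> simplex S y ->
  enorm (x - y) <= diam (simplex S).
Proof.
move=> Sx Sy; apply: ub_le_sup; last by exists x, y.
exists (Num.sqrt (\sum_(k < n.+1) (vbnd M + vbnd M) ^+ 2)) => r [x' [y' [Sx' Sy' ->]]].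
apply: ler_wsqrtr; apply: ler_sum => k _; rewrite -expr2 -real_normK ?num_real//.
rewrite lerXn2r ?nnegrE ?addr_ge0 ?sumr_ge0//.
- by move=> *; exact: sumr_ge0.
- by move=> *; exact: sumr_ge0.
rewrite !mxE (le_trans (ler_normB _ _))// lerD//; [exact: bounded_simplex Sx' _|exact: bounded_simplex Sy' _].
Qed.

Lemma simplex_vert S v : v \in S -> simplex S (vx v).
Proof.
move=> vS; exists (fun u => (u == v)%:R); split.
- by move=> u; exact: ler0n.
- by move=> u uS; case: eqVneq => // uv; move: uS; rewrite uv vS.
- by rewrite (bigD1 v)//= eqxx big1 ?addr0// => u /negbTE ->.
- by rewrite (bigD1 v)//= eqxx scale1r big1 ?addr0// => u /negbTE ->; rewrite scale0r.
Qed.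

Lemma vert_inj u v : u \in K -> v \in K -> u != v -> 0 < enorm (vx u - vx v).
Proof.
move=> uK vK uv; apply: enorm_gt0; apply: contraNneq uv => /eqP; rewrite subr_eq0 => /eqP E.
have := bc_vert ndK v uK; rewrite E (bc_vert ndK)// eqxx.
by case: eqVneq => // _ /eqP; rewrite oner_eq0.
Qed.

Lemma hK_gt0 : 0 < hK K.
Proof.
have [v vK] : exists v, v \in K by apply/card_gt0P; rewrite ndK.1.
have [u uK uv] := other_vertex vK.
apply: (lt_le_trans (vert_inj uK vK uv)).
by apply: has_sup_dist; exact: simplex_vert.
Qed.

Lemma bc_le1 x v : simplex K x -> bc K x v <= 1.
Proof.
move=> /(simplexKE ndK) H; rewrite -(bc_sum ndK x) (bigD1 v)//= lerDl.
by apply: sumr_ge0.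
Qed.

(** Along a diameter parallel to [gbc K v], of length [r], the coordinate of [v] grows by
    [r * enorm (gbc K v)], yet it stays between 0 and 1 in the simplex. *)
Lemma inball_le v : v \in K -> inball_diam (simplex K) <= (enorm (gbc K v))^-1.
Proof.
move=> vK; have G0 := enorm_gt0 (gbc_neq0 vK).
apply: ge_sup.
  exists 0; split => //; exists (vx v) => z; rewrite mul0r => H.
  have -> : z = vx v; last exact: simplex_vert.
  apply/eqP; rewrite -subr_eq0; apply: contraLR H => /enorm_gt0; by rewrite ltNge.
move=> r [r0 [y Hy]]; rewrite -div1r ler_pdivlMr//.
pose z (e : R) := y + (e * (r / 2) / enorm (gbc K v)) *: gbc K v.
have zK (e : R) : `|e| = 1 -> simplex K (z e).
  move=> e1; apply: Hy; rewrite /z addrAC subrr add0r enormZ !normrM e1 mul1r.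
  rewrite (ger0_norm (_ : 0 <= r))// !ger0_norm ?invr_ge0 ?(ltW G0)//.
  by rewrite divfK ?lexx// lt0r_neq0.
have h1 := bc_le1 v (zK 1 (normr1 _)).
have h2 : 0 <= bc K (z (-1)) v by apply: ((simplexKE ndK _).1 (zK (-1) _)); rewrite normrN normr1.
have : bc K (z 1) v - bc K (z (-1)) v <= 1 by rewrite lerBlDr (le_trans h1)// lerDl.
rewrite (bcB ndK) /z opprD addrACA subrr add0r -scaleNr -scalerDl dotZr -enorm_sqr.
congr (_ <= _); field; exact: lt0r_neq0.
Qed.

(** The form in which shape regularity is used from here on: diameter over height is at most
    [sigma]. *)
Lemma hK_gbc_le sigma v : 0 < sigma -> hK K <= sigma * inball_diam (simplex K) -> v \in K ->
  hK K * enorm (gbc K v) <= sigma.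
Proof.
move=> s0 H vK; have G0 := enorm_gt0 (gbc_neq0 vK).
rewrite -ler_pdivlMr// (le_trans H)// ler_wpM2l ?inball_le//; exact: ltW.
Qed.

End Normals.

(** * Meshes *)

Section MeshFaces.
Context {R : realType} {n : nat} (M : mesh R n.+1) (Omega : set 'rV[R]_n.+1).
Local Notation V := 'I_(nvert M).
Local Notation pt := 'rV[R]_n.+1.
Local Notation vx := (@vert R n.+1 M).
Implicit Types (S F K L J : {set V}) (x y : pt).
Hypothesis tri : triangulation M Omega.

Lemma cell_nondeg K : K \in cells M -> nondeg K.
Proof. by case: tri => H _ _; exact: H. Qed.

Lemma cells_ofP F K : reflect (exists v, [/\ K \in cells M, v \in K & F = K :\ v]) (K \in cells_of F).
Proof.
apply: (iffP idP) => [|[v [KM vK ->]]]; last by rewrite inE KM; exact: facetE vK _.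
by rewrite inE => /andP[KM /imsetP[v vK ->]]; exists v.
Qed.

Lemma shared_facet K L v w : K \in cells M -> L \in cells M -> K != L -> v \in K -> w \in L ->
  K :\ v = L :\ w -> v \notin L.
Proof.
move=> KM LM KL vK wL E; apply: contraNN KL => vL.
rewrite eqEcard (cell_nondeg KM).1 (cell_nondeg LM).1 leqnn andbT.
rewrite -(finset.setD1K vK) finset.subUset finset.sub1set vL E; exact: finset.subsetDl.
Qed.

(* If both cells were on the same side of [F], the barycenter of [F] moved
   slightly inwards would lie in both, hence in [F]. *)
Lemma outnormal_opp F K L : K \in cells_of F -> L \in cells_of F -> K != L ->
  outnormal L F = - outnormal K F.
Proof.
move=> /cells_ofP[v [KM vK FK]] /cells_ofP[w [LM wL FL]] KL.
have ndK := cell_nondeg KM; have ndL := cell_nondeg LM.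
have vL : v \notin L by apply: (shared_facet KM LM KL vK wL); rewrite -FK.
have GK := enorm_gt0 (gbc_neq0 ndK vK); have GL := enorm_gt0 (gbc_neq0 ndL wL).
rewrite {2}FK FL (outnormalE ndK)// (outnormalE ndL)//.
have cF : #|F| = n.+1 by rewrite FK card_facet.
have [a aF] : exists a, a \in F by apply/card_gt0P; rewrite cF.
have FinK u : u \in F -> u \in K by rewrite FK inE => /andP[].
have FinL u : u \in F -> u \in L by rewrite FL inE => /andP[].
have vF : v \notin F by rewrite FK !inE eqxx.
have wF : w \notin F by rewrite FL !inE eqxx.
have [t tE] : exists t, gbc L w = t *: gbc K v.
  eexists; apply: (perp_gbc ndK (a := a) vK); first by rewrite -FK.
  move=> b c; rewrite -FK => bF cF'; rewrite (gbc_edge ndL) ?FinL//.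
  by move: wF; case: eqVneq => [<-|_]; [rewrite bF|case: eqVneq => [<-|_]; [rewrite cF'|rewrite subrr]].
have t0 : t != 0 by apply: contraTneq GL => t0; rewrite tE t0 scale0r /enorm dot0l sqrtr0 ltxx.
have tneg : t < 0.
  rewrite ltNge le_eqVlt eq_sym (negbTE t0)/=; apply/negP => tpos.
  pose N : R := n.+1%:R; have N0 : 0 < N by rewrite ltr0n.
  pose b := N^-1 *: \sum_(u in F) vx u.
  pose l (u : V) := (u \in F)%:R / N.
  have bl J : F \subset J -> bcspec J b l.
    move=> FJ; split.
    - by move=> u uJ; rewrite /l (negbTE (contraNN (fintype.subsetP FJ u) uJ)) mul0r.
    - rewrite /l -mulr_suml (_ : \sum_u _ = N) ?mulfV ?gt_eqF//.
      transitivity (\sum_(u in F) (1 : R)); last by rewrite sumr_const cF.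
      by rewrite [RHS]big_mkcond/=; apply: eq_bigr => u _; case: (u \in F).
    - rewrite /b scaler_sumr [RHS]big_mkcond/=; apply: eq_bigr => u _.
      by rewrite /l; case: (u \in F); rewrite ?mul1r// mul0r scale0r.
  have bK : bc K b = l by apply: (bc_uniq ndK); apply: bl; apply/fintype.subsetP.
  have bL : bc L b = l by apply: (bc_uniq ndL); apply: bl; apply/fintype.subsetP.
  pose D := 1 + \sum_u (`|dot (gbc K u) (gbc K v)| + `|dot (gbc L u) (gbc K v)|).
  have D0 : 0 < D by rewrite ltr_pwDl// sumr_ge0// => u _; rewrite addr_ge0.
  have Du u : `|dot (gbc K u) (gbc K v)| <= D /\ `|dot (gbc L u) (gbc K v)| <= D.
    suff H : `|dot (gbc K u) (gbc K v)| + `|dot (gbc L u) (gbc K v)| <= D.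
      by split; apply: le_trans H; rewrite ?lerDl ?lerDr.
    by rewrite /D (bigD1 u)//= addrCA lerDl addr_ge0// sumr_ge0// => *; rewrite addr_ge0.
  (* The coordinates of the barycenter at the vertices of [F] are [N^-1], and [D] bounds their rates
     of change in both cells, so a displacement by [e] keeps them nonnegative. *)
  pose e := (N * D)^-1; have e0 : 0 < e by rewrite invr_gt0 mulr_gt0.
  pose x := b + e *: gbc K v.
  have key J u : bc J b = l -> bc J x u - bc J b u = e * dot (gbc J u) (gbc K v) -> u \in F ->
      `|dot (gbc J u) (gbc K v)| <= D -> 0 <= bc J x u.
    move=> bJ E uF H; rewrite -(subrK (bc J b u) (bc J x u)) E bJ /l uF mul1r.
    rewrite -[N^-1]opprK subr_ge0 (_ : N^-1 = e * D); last first.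
      by rewrite /e invfM divfK// gt_eqF.
    by rewrite -mulrN ler_wpM2l ?(ltW e0)//; move: H; rewrite ler_norml => /andP[].
  have xb J u : nondeg J -> bc J x u - bc J b u = e * dot (gbc J u) (gbc K v).
    by move=> ndJ; rewrite (bcB ndJ) /x addrAC subrr add0r dotZr.
  have xv : bc K x v = e * dot (gbc K v) (gbc K v).
    by rewrite -xb// bK /l (negbTE vF) mul0r subr0.
  have xw : bc L x w = e * (t * dot (gbc K v) (gbc K v)).
    by rewrite -dotZl -tE -xb// bL /l (negbTE wF) mul0r subr0.
  have q0 : 0 < dot (gbc K v) (gbc K v) by rewrite -enorm_sqr exprn_gt0.
  have xK : simplex K x.
    apply/(simplexKE ndK) => u; have [uK|uK] := boolP (u \in K); last by rewrite (bc_notin ndK).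
    have [->|uv] := eqVneq u v; first by rewrite xv mulr_ge0// ltW.
    by apply: key => //; [exact: xb|rewrite FK !inE uv|case: (Du u)].
  have xL : simplex L x.
    apply/(simplexKE ndL) => u; have [uL|uL] := boolP (u \in L); last by rewrite (bc_notin ndL).
    have [->|uw] := eqVneq u w; first by rewrite xw !mulr_ge0// ltW.
    by apply: key => //; [exact: xb|rewrite FL !inE uw|case: (Du u)].
  have [_ _ triI] := tri.
  have : simplex (K :&: L) x by rewrite -triI.
  move=> /(simplexE ndK _ (finset.subsetIl _ _))[_ /(_ v)]; rewrite inE (negbTE vL) andbF => /(_ isT).
  by rewrite xv => /eqP; rewrite mulf_eq0 !gt_eqF.
rewrite /nrm tE enormZ ltr0_norm// opprK scalerA -scaleNr; congr (_ *: _).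
by move: (enorm _) (lt0r_neq0 GK) => g g0; field; rewrite t0 g0.
Qed.

(** Among three cells sharing a facet the outward normals would be pairwise opposite, hence zero. *)
Lemma cells_of_pair F K L : K \in cells_of F -> L \in cells_of F -> K != L ->
  cells_of F = [set K; L]%SET.
Proof.
move=> KF LF KL; apply/setP => J; rewrite !inE; apply/idP/orP => [|[/eqP->|/eqP->]]; last 2 first.
- by move: KF; rewrite inE.
- by move: LF; rewrite inE.
rewrite -[_ && _]/(_) => JF0; have JF : J \in cells_of F by rewrite inE.
have [->|JK] := eqVneq J K; first by left.
have [JL|JL] := eqVneq J L; first by right.
have := outnormal_opp KF JF; rewrite eq_sym JK => /(_ isT) h1.
have := outnormal_opp LF JF; rewrite eq_sym JL => /(_ isT) h2.
have h3 := outnormal_opp KF LF KL.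
move: h1; rewrite h2 h3 opprK => /eqP; rewrite -subr_eq0 opprK -mulr2n -scaler_nat scaler_eq0 pnatr_eq0/=.
move: KF => /cells_ofP[v [KM vK ->]]; rewrite (outnormalE (cell_nondeg KM))// => /eqP N0.
by have [] := nrm_is_normal (cell_nondeg KM) vK; rewrite N0 /enorm dot0l sqrtr0 => /eqP; rewrite eq_sym oner_eq0.
Qed.

Lemma iface_cells F : F \in ifaces M -> exists K L, [/\ K \in cells_of F, L \in cells_of F, K != L &
  cells_of F = [set K; L]%SET].
Proof.
rewrite inE => /andP[_ /card_gt1P[K [L [KF LF KL]]]]; exists K, L; split => //.
exact: cells_of_pair.
Qed.

Lemma face_sum (g : {set V} -> {set V} -> R) :
  \sum_(K in cells M) \sum_(F in facets K) g K F = \sum_(F in faces M) \sum_(K in cells_of F) g K F.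
Proof.
rewrite (exchange_big_dep (fun F => F \in faces M))/=.
  by apply: eq_bigr => F _; apply: eq_bigl => K; rewrite inE.
by move=> K F KM FK; rewrite inE; apply/exists_inP; exists K.
Qed.

Lemma face_sum_single (s : {set V} -> {set V} -> R) :
  (forall F K L, F \in ifaces M -> K \in cells_of F -> L \in cells_of F -> K != L -> s L F = - s K F) ->
  (forall F K, F \in faces M :\: ifaces M -> K \in cells_of F -> s K F = 0) ->
  \sum_(K in cells M) \sum_(F in facets K) s K F = 0.
Proof.
move=> H1 H2; rewrite face_sum big1// => F Ff; have [Fi|Fi] := boolP (F \in ifaces M); last first.
  by rewrite big1// => K KF; apply: H2 => //; rewrite !inE; move: Fi Ff; rewrite !inE => /negbTE -> ->.
have [K [L [KF LF KL ->]]] := iface_cells Fi.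
by rewrite big_setU1 ?inE//= big_set1 (H1 _ _ _ Fi KF LF KL) subrr.
Qed.

Lemma face_cell F : F \in faces M -> exists K, K \in cells_of F.
Proof. by rewrite inE => /exists_inP[K KM FK]; exists K; rewrite inE KM. Qed.

Lemma diam_sub S F : F \subset S -> F != finset.set0 -> diam (simplex F) <= diam (simplex S).
Proof.
move=> FS /set0Pn[v vF]; apply: ge_sup.
  by exists (enorm (vx v - vx v)), (vx v), (vx v); split => //; exact: simplex_vert.
move=> r [y [z [Fy Fz ->]]]; apply: has_sup_dist.
  by case: Fy => l [l0 lF l1 ->]; exists l; split => // u uS; apply/lF/(contraNN _ uS)/(fintype.subsetP FS).
by case: Fz => l [l0 lF l1 ->]; exists l; split => // u uS; apply/lF/(contraNN _ uS)/(fintype.subsetP FS).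
Qed.

Lemma hF_le_cell F : F \in faces M -> exists2 K, K \in cells_of F & hF F <= hK K.
Proof.
move=> /face_cell[K0 KF0]; rewrite /hF; case: eqP => [_|_]; last first.
  exists K0 => //; move: KF0 => /cells_ofP[v [KM vK ->]]; apply: diam_sub; first exact: finset.subsetDl.
  by rewrite -card_gt0 (card_facet (cell_nondeg KM)).
have [/eqP H|[K KF H]] : \big[Num.max/0]_(K in cells_of F) hK K == 0 \/
    exists2 K, K \in cells_of F & \big[Num.max/0]_(K in cells_of F) hK K <= hK K.
  elim/big_ind: _ => [|a b [/eqP->|[K KF Ha]] [/eqP->|[L LF Hb]]|K KF].
  - by left.
  - by left; rewrite maxxx.
  - by right; exists L => //; rewrite ge_max Hb andbT; move: LF => /cells_ofP[v [LM _ _]]; rewrite ltW// hK_gt0//; exact: cell_nondeg.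
  - by right; exists K => //; rewrite ge_max Ha /=; move: KF => /cells_ofP[v [LM _ _]]; rewrite ltW// hK_gt0//; exact: cell_nondeg.
  - by right; have [h|h] := leP a b; [exists L|exists K].
  - by right; exists K.
- by exists K0 => //; rewrite H; move: KF0 => /cells_ofP[v [KM _ _]]; rewrite ltW// hK_gt0//; exact: cell_nondeg.
- by exists K.
Qed.

(** A face of positive dimension has an edge from [b] to [a], along which the coordinate of [a]
    grows by 1; so [1 <= enorm (gbc K a) * diam (simplex F)], and [hK_gbc_le] concludes. When
    [d = 1], [hF] is a maximum of cell diameters; the summand 1 in [1 + sigma] covers that case. *)
Lemma hK_le_hF sigma F K : 0 < sigma -> shape_regular M sigma -> K \in cells_of F ->
  hK K <= (1 + sigma) * hF F.
Proof.
move=> s0 sr KF; have := KF => /cells_ofP[v [KM vK FK]]; have ndK := cell_nondeg KM.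
have h0 := hK_gt0 ndK.
rewrite /hF; case: eqP => [_|/eqP n0].
  have H : hK K <= \big[Num.max/0]_(J in cells_of F) hK J.
    by rewrite (bigD1 K)//= le_max lexx.
  by rewrite (le_trans H)// mulrDl mul1r lerDl mulr_ge0 ?(ltW s0)// (le_trans _ H)// ltW.
have : (1 < #|F|)%N by rewrite FK (card_facet ndK)// ltnS lt0n; apply: contraNneq n0 => ->.
move=> /card_gt1P[a [b [aF bF ab]]].
have FinK u : u \in F -> u \in K by rewrite FK inE => /andP[].
have := dot_le (gbc K a) (vx a - vx b).
rewrite (gbc_edge ndK) ?FinK// eqxx eq_sym (negbTE ab) subr0 => H.
have Hd : enorm (vx a - vx b) <= diam (simplex F) by apply: has_sup_dist; exact: simplex_vert.
have d0 : 0 <= diam (simplex F) := le_trans (enorm_ge0 _) Hd.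
have H2 := hK_gbc_le ndK s0 (sr _ KM) (FinK _ aF).
rewrite (@le_trans _ _ (hK K * (enorm (gbc K a) * enorm (vx a - vx b))))//.
  by rewrite ler_peMr// ltW.
rewrite mulrA mulrDl mul1r (@le_trans _ _ (sigma * diam (simplex F)))//; last by rewrite lerDr.
by apply: ler_pM => //; rewrite ?mulr_ge0 ?enorm_ge0// ltW.
Qed.

Lemma hF_gt0 sigma F : 0 < sigma -> shape_regular M sigma -> F \in faces M -> 0 < hF F.
Proof.
move=> s0 sr /face_cell[K KF]; have := hK_le_hF s0 sr KF.
move: KF => /cells_ofP[v [KM _ _]]; have := hK_gt0 (cell_nondeg KM).
move=> h1 h2; have := lt_le_trans h1 h2; rewrite pmulr_rgt0// addr_gt0//.
Qed.

End MeshFaces.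

Section Restr.
Context {R : realType} {n : nat}.
Implicit Types (A B : set 'rV[R]_n) (f : 'rV[R]_n -> R).

Definition restr A f : 'rV[R]_n -> R := fun x => if x \in A then f x else 0.

Lemma restr_patch A f :
  (fun t => (restr A f (@rowt R n t))%:E) = (fun t => (f (rowt t))%:E) \_ (@rowt R n @^-1` A).
Proof.
apply/funext => t; rewrite /restr /patch.
have -> : (t \in @rowt R n @^-1` A) = (rowt t \in A) by apply/idP/idP; rewrite !inE.
by case: ifP.
Qed.

Lemma intg_restr A B f : msr A -> msr B -> intg A f -> intg B (restr A f).
Proof.
move=> mA mB fA; have H := proj1 (integrable_mkcond _ mA) fA.
rewrite /intg restr_patch; apply: (integrableS _ _ _ H) => //; exact: measurableT.
Qed.

Lemma vint_restr A B f : msr A -> msr B -> A `<=` B -> vint B (restr A f) = vint A f.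
Proof.
move=> mA mB AB; rewrite /vint /Rintegral; congr (fine _).
rewrite restr_patch [RHS]integral_mkcond [LHS]integral_mkcond; apply: eq_integral => t _.
rewrite /patch; case: ifP => // tB; case: ifP => // tA.
by move: tA; rewrite inE => /AB H; move: tB; rewrite mem_set.
Qed.

End Restr.

(** * Polyhedral domains and the partition of the domain into open cells *)

Section Domain.
Context {R : realType} {n : nat}.
Local Notation pt := 'rV[R]_n.

Lemma closed_hull m (x : 'I_m -> pt) (S : {set 'I_m}) : closed (hull x S).
Proof.
apply: compact_closed; first exact: norm_hausdorff.
pose A := [set l : 'rV[R]_m | (forall i, 0 <= l 0 i) /\ (forall i, i \notin S -> l 0 i = 0) /\ \sum_i l 0 i = 1].
rewrite (_ : hull x S = [set \sum_i l 0 i *: x i | l in A]); last first.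
  apply/seteqP; split => [y [l [l0 lS l1 ->]]|y [l [l0 [lS l1]] <-]].
    exists (\row_i l i); last by apply: eq_bigr => i _; rewrite mxE.
    by split => [i|]; [rewrite mxE|split => [i iS|]; [rewrite mxE lS|under eq_bigr do rewrite mxE]].
  by exists (fun i => l 0 i).
apply: continuous_compact.
  apply: continuous_subspaceT; apply: continuous_rV => k.
  rewrite (_ : (fun l : 'rV[R]_m => _) = fun l : 'rV[R]_m => \sum_i l 0 i * x i 0 k); last first.
    by apply/funext => l; rewrite summxE; apply: eq_bigr => i _; rewrite mxE.
  by apply: continuous_sumf => i _; apply: contM; [exact: coord_continuous|exact: contC].
apply: (@subclosed_compact _ _ [set l : 'rV[R]_m | forall i, (`[0, 1]%classic : set R) (l 0 i)]).
- have cl (f : 'rV[R]_m -> R) (B : set R) : continuous f -> closed B -> closed (f @^-1` B).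
    by move=> cf cB; apply: preimage_closed.
  rewrite (_ : A = (\bigcap_(i in setT) [set l : 'rV[R]_m | 0 <= l 0 i]) `&`
    ((\bigcap_(i in [set i | i \notin S]) [set l : 'rV[R]_m | l 0 i = 0]) `&` [set l : 'rV[R]_m | \sum_i l 0 i = 1])); last first.
    apply/seteqP; split => [l [h1 [h2 h3]]|l [h1 [h2 h3]]]; first by split; [move=> i _; exact: h1|split].
    by split; [move=> i; exact: h1|split].
  apply: closedI; last apply: closedI.
  + by apply: closed_bigI => i _; apply: (cl (fun l : 'rV[R]_m => l 0 i) [set r | 0 <= r]); [exact: coord_continuous|exact: closed_ge].
  + by apply: closed_bigI => i _; apply: (cl (fun l : 'rV[R]_m => l 0 i) [set 0]); [exact: coord_continuous|exact: closed_eq].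
  + apply: (cl (fun l : 'rV[R]_m => \sum_i l 0 i) [set 1]); last exact: closed_eq.
    by apply: continuous_sumf => i _; exact: coord_continuous.
- by apply: (@rV_compact R m (fun=> `[0, 1]%classic)) => i; exact: segment_compact.
- move=> l [l0 [lS l1]] i /=; rewrite in_itv/= l0 -l1 (bigD1 i)//= lerDl sumr_ge0//.
Qed.

Lemma bounded_hull m (x : 'I_m -> pt) (S : {set 'I_m}) y : hull x S y ->
  forall k, `|y 0 k| <= \sum_i `|x i 0 k|.
Proof.
move=> [l [l0 _ l1 ->]] k; rewrite summxE (le_trans (ler_norm_sum _ _ _))//.
apply: ler_sum => i _; rewrite mxE normrM ler_piMl//.
by rewrite ger0_norm// -l1 (bigD1 i)//= lerDl sumr_ge0.
Qed.

Lemma domain_bounded (Omega : set pt) : polyhedral_domain Omega ->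
  exists2 D, 0 < D & forall x, closure Omega x -> forall k, `|x 0 k| <= D.
Proof.
move=> [_ _ [m [x [C ->]]]].
exists (1 + \sum_k \sum_i `|x i 0 k|).
  by rewrite ltr_pwDl// sumr_ge0// => k _; apply: sumr_ge0.
move=> y H k; have : (\bigcup_(S in [set S | S \in C]) hull x S) y.
  have cl : closed (\bigcup_(S in [set S | S \in C]) hull x S).
    by apply: closed_bigcup => // S _; exact: closed_hull.
  by apply: cl; apply: closureS H; exact: interior_subset.
move=> [S _ /bounded_hull/(_ k) h]; rewrite (le_trans h)// (bigD1 k)//= addrCA lerDl.
by rewrite addr_ge0// sumr_ge0// => j _; apply: sumr_ge0.
Qed.

(** The domain is the interior of a closed set, so it has no slits. This is what places open cells,
    and neighborhoods of interior faces, inside [Omega]. *)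
Lemma domain_regular (Omega : set pt) : polyhedral_domain Omega -> interior (closure Omega) `<=` Omega.
Proof.
move=> [_ _ [m [x [C ->]]]].
set P := \bigcup_(S in _) _; have cl : closed P.
  by apply: closed_bigcup => // S _; exact: closed_hull.
by apply: interiorS; move=> y H; apply: cl; apply: closureS H; exact: interior_subset.
Qed.

Lemma domain_open (Omega : set pt) : polyhedral_domain Omega -> open Omega.
Proof. by move=> [_ _ [m [x [C ->]]]]; exact: open_interior. Qed.

Lemma enorm_le_bound (x : pt) (B : R) : 0 <= B -> (forall k, `|x 0 k| <= B) -> enorm x <= n%:R * B.
Proof.
move=> B0 H; rewrite -(@ler_pXn2r _ 2)// ?nnegrE ?enorm_ge0 ?mulr_ge0 ?ler0n// enorm_sqr.
apply: (@le_trans _ _ (\sum_(k < n) B ^+ 2)).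
  apply: ler_sum => k _; rewrite -expr2 -real_normK ?num_real// lerXn2r ?nnegrE//.
rewrite sumr_const card_ord exprMn -[leLHS]mulr_natl ler_wpM2r ?sqr_ge0// expr2.
by case: (n) => [|m]; rewrite ?mul0r// ler_peMr ?ler1n.
Qed.

End Domain.

Section MeshDomain.
Context {R : realType} {n : nat} (M : mesh R n.+1) (Omega : set 'rV[R]_n.+1).
Local Notation V := 'I_(nvert M).
Local Notation pt := 'rV[R]_n.+1.
Local Notation vx := (@vert R n.+1 M).
Implicit Types (S F K L : {set V}) (x y : pt).
Hypotheses (polyO : polyhedral_domain Omega) (tri : triangulation M Omega).

Lemma simplex_closure K : K \in cells M -> simplex K `<=` closure Omega.
Proof. by case: tri => _ -> _ KM x Kx; exists K. Qed.

Lemma ocell_domain K : K \in cells M -> ocell K `<=` Omega.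
Proof.
move=> KM; have ndK := cell_nondeg tri KM.
rewrite -(interior_simplex ndK); apply: subset_trans (domain_regular polyO).
apply: interiorS; exact: simplex_closure.
Qed.

Lemma ocell_disjoint K L x : K \in cells M -> L \in cells M -> ocell K x -> ocell L x -> K = L.
Proof.
move=> KM LM Kx Lx; have ndK := cell_nondeg tri KM; have ndL := cell_nondeg tri LM.
apply/eqP; rewrite eqEcard ndK.1 ndL.1 leqnn andbT; apply/fintype.subsetP => v vK.
apply: contraT => vL; have [_ _ triI] := tri.
have : simplex (K :&: L) x.
  by rewrite -triI//; split; exact: ocell_sub.
move=> /(simplexE ndK _ (finset.subsetIl _ _))[_ /(_ v)]; rewrite inE (negbTE vL) andbF => /(_ isT) H.
by have := Kx v vK; rewrite H ltxx.
Qed.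

Lemma null_bc0 K v : nondeg K -> v \in K ->
  msr [set x | bc K x v = 0] /\ lebn n.+1 (@rowt R n.+1 @^-1` [set x | bc K x v = 0]) = 0%E.
Proof.
move=> ndK vK; split.
  apply: (msr_preimage (f := fun x => bc K x v) (A := [set 0])); last exact: measurable_set1.
  exact: continuous_bc.
rewrite -(lebn_hyperplane (a := fun i => gbc K v 0 i) (- bc K 0 v)); last first.
  have /rV0Pn[i Hi] := gbc_neq0 ndK vK; by exists i.
congr (lebn _ _); apply/seteqP; split => t /=; rewrite (bcE ndK (rowt t)).
all: have -> : dot (gbc K v) (rowt t) = lform (fun i => gbc K v 0 i) t by apply: eq_bigr => i _; rewrite [rowt t 0 i]mxE.
  by move=> /eqP; rewrite addrC addr_eq0 => /eqP.
by move=> ->; rewrite addrN.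
Qed.

Definition ocells := [set x | exists2 K, K \in cells M & ocell K x].

Lemma open_ocells : open ocells.
Proof.
rewrite (_ : ocells = \bigcup_(K in [set K | K \in cells M]) ocell K); last first.
  by apply/seteqP; split => x [K KM Kx]; exists K.
by apply: bigcup_open => K KM; exact: open_ocell (cell_nondeg tri KM).
Qed.

Lemma ocells_domain : ocells `<=` Omega.
Proof. by move=> x [K KM]; exact: ocell_domain. Qed.

(** A point of a cell outside its interior annihilates some barycentric coordinate, so the
    difference lies in finitely many hyperplanes. *)
Lemma null_ocells : lebn n.+1 (@rowt R n.+1 @^-1` (Omega `\` ocells)) = 0%E.
Proof.
pose P (i : {set V} * V) := if (i.1 \in cells M) && (i.2 \in i.1) then [set x : pt | bc i.1 x i.2 = 0] else set0.
apply: (null_finset (P := P)).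
- apply: measurableD; apply: msr_open; [exact: domain_open|exact: open_ocells].
- move=> [K v]; rewrite /P/=; case: ifP => [/andP[KM vK]|_].
    by apply: null_bc0 => //; exact: cell_nondeg tri _ KM.
  by split; rewrite /msr preimage_set0//; exact: measure0.
move=> x [Ox nU]; have [_ cO _] := tri.
have : closure Omega x by exact: subset_closure.
rewrite cO => -[K KM Kx]; have ndK := cell_nondeg tri KM.
have [v vK bv] : exists2 v, v \in K & bc K x v = 0.
  apply: contrapT => H; apply: nU; exists K => // v vK; rewrite lt_neqAle ((simplexKE ndK x).1 Kx v) andbT eq_sym.
  by apply/eqP => bv; apply: H; exists v.
by exists (K, v); rewrite /P/= KM vK.
Qed.

Lemma vint_mesh f : intg Omega f -> vint Omega f = \sum_(K in cells M) kint K f.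
Proof.
move=> If; have mO : msr Omega by apply: msr_open; exact: domain_open.
have mU : msr ocells by apply: msr_open; exact: open_ocells.
rewrite -(vint_negl mU mO ocells_domain If null_ocells).
have mK K : K \in cells M -> msr (ocell K) by move=> KM; apply: msr_open; exact: open_ocell (cell_nondeg tri KM).
transitivity (vint ocells (fun x => \sum_(K in cells M) restr (ocell K) f x)).
  apply: eq_vint => x [K KM Kx]; rewrite (bigD1 K)//= {1}/restr mem_set// big1 ?addr0//.
  move=> L /andP[LM LK]; rewrite /restr memNset// => Lx; move: LK.
  by rewrite (ocell_disjoint LM KM Lx Kx) eqxx.
rewrite vint_sum//; last first.
  move=> K KM; apply: intg_restr => //; [exact: mK|].
  by apply: intg_sub If => //; [exact: mK|exact: ocell_domain].
apply: eq_bigr => K KM; rewrite vint_restr//; last 2 first.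
- exact: mK.
- by move=> x Kx; exists K.
by rewrite /kint interior_simplex//; exact: cell_nondeg tri _ KM.
Qed.

End MeshDomain.

(** * Cauchy-Schwarz inequalities *)

Section CauchySchwarz.
Context {R : realType}.
Implicit Types (a x y k t : R).

(* For [x, y >= 0] this says [a ^+ 2 <= x * y]; unlike the latter, it is
   visibly preserved by sums. *)
Definition cs a x y := forall t, 0 < t -> 2 * `|a| <= t * x + t^-1 * y.

Lemma cs0 : cs 0 0 0.
Proof. by move=> t t0; rewrite normr0 !mulr0 addr0. Qed.

Lemma csD a b x y z w : cs a x y -> cs b z w -> cs (a + b) (x + z) (y + w).
Proof.
move=> H1 H2 t t0; have := lerD (H1 t t0) (H2 t t0).
rewrite -mulrDr addrACA -!mulrDr; apply: le_trans.
by rewrite ler_pM2l// ler_normD.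
Qed.

Lemma cs_sum (I : Type) (s : seq I) (P : pred I) (a x y : I -> R) :
  (forall i, P i -> cs (a i) (x i) (y i)) ->
  cs (\sum_(i <- s | P i) a i) (\sum_(i <- s | P i) x i) (\sum_(i <- s | P i) y i).
Proof.
move=> H; elim/big_rec3 : _ => [|i z b c Pi]; first exact: cs0.
by apply: csD; exact: H.
Qed.

Lemma cs_le a x y z w : cs a x y -> x <= z -> y <= w -> cs a z w.
Proof.
move=> H xz yw t t0; apply: (le_trans (H t t0)).
by apply: lerD; rewrite ler_wpM2l// ?invr_ge0 ltW.
Qed.

Lemma csN a x y : cs a x y -> cs (- a) x y.
Proof. by move=> H t t0; rewrite normrN; exact: H. Qed.

Lemma csC a x y : cs a x y -> cs a y x.
Proof. by move=> H t t0; have := H t^-1; rewrite invr_gt0 invrK addrC; exact. Qed.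

(** Shifts a power of [hK] or of [rho] from one factor to the other, to match the weights of the
    norms. *)
Lemma cs_weight k a x y : 0 < k -> cs a x y -> cs a (k * x) (k^-1 * y).
Proof.
move=> k0 H t t0; have := H (t * k) (mulr_gt0 t0 k0).
by rewrite invfM !mulrA [_^-1 * k^-1]mulrC.
Qed.

Lemma csZ k a x y : 0 <= k -> cs a x y -> cs (k * a) (k * x) (k * y).
Proof.
move=> k0 H t t0; rewrite normrM (ger0_norm k0) mulrCA !(mulrCA _ k) -mulrDr.
by rewrite ler_wpM2l// H.
Qed.

Lemma cs_norm a x y : 0 <= x -> 0 <= y -> cs a x y -> `|a| <= Num.sqrt x * Num.sqrt y.
Proof.
move=> x0 y0 H; apply/ler_addgt0Pr => e e0.
set s := Num.sqrt x; set r := Num.sqrt y.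
have s0 : 0 <= s by exact: sqrtr_ge0.
have r0 : 0 <= r by exact: sqrtr_ge0.
have xs : x = s * s by rewrite -expr2 sqr_sqrtr.
have yr : y = r * r by rewrite -expr2 sqr_sqrtr.
(* The optimal parameter would be [r / s], but either root may vanish; adding [f] to both costs at
   most [e]. *)
pose f := e / (s + r + 1).
have f0 : 0 < f by rewrite divr_gt0// ltr_wpDl// addr_ge0.
have sf : 0 < s + f by rewrite ltr_wpDl.
have rf : 0 < r + f by rewrite ltr_wpDl.
have := H ((r + f) / (s + f)) (divr_gt0 rf sf).
have h1 : (r + f) / (s + f) * x <= (r + f) * s.
  by rewrite -mulrA ler_wpM2l ?(ltW rf)// mulrC ler_pdivrMr// xs ler_wpM2l// lerDl ltW.
have h2 : ((r + f) / (s + f))^-1 * y <= (s + f) * r.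
  by rewrite invf_div -mulrA ler_wpM2l ?(ltW sf)// mulrC ler_pdivrMr// yr ler_wpM2l// lerDl ltW.
move=> /le_trans/(_ (lerD h1 h2)) h3.
have h4 : f * (s + r) <= e.
  rewrite /f mulrAC -mulrA ger_pMr// ler_pdivrMr ?mul1r ?lerDl// ltr_wpDl// addr_ge0//.
rewrite -(@ler_pM2l _ 2)//; apply: (le_trans h3).
rewrite (_ : _ + _ = 2 * (s * r) + f * (s + r)); last by ring.
by move: h4 e0; move: (f * (s + r)) => w; lra.
Qed.

Lemma cs_sqr a x y : 0 <= x -> 0 <= y -> cs a x y -> a ^+ 2 <= x * y.
Proof.
move=> x0 y0 H; rewrite -real_normK ?num_real//.
rewrite (le_trans (lerXn2r 2 _ _ (cs_norm x0 y0 H))) ?nnegrE ?mulr_ge0 ?sqrtr_ge0//.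
by rewrite exprMn !sqr_sqrtr.
Qed.

Lemma vint_cs n (A : set 'rV[R]_n) (f g : 'rV[R]_n -> R) : msr A -> L2 A f -> L2 A g ->
  cs (vint A (fun z => f z * g z)) (vint A (fun z => f z ^+ 2)) (vint A (fun z => g z ^+ 2)).
Proof.
move=> mA Lf Lg t t0; have H1 := young t0 mA Lf Lg.
have H2 := young t0 mA Lf (L2N mA Lg).
have E : vint A (fun z => f z * - g z) = - vint A (fun z => f z * g z).
  rewrite -mulN1r -vintZ//; last exact: L2_mul.
  by apply: eq_vint => x _; rewrite mulN1r mulrN.
rewrite E in H2; have E2 : vint A (fun z => (- g z) ^+ 2) = vint A (fun z => g z ^+ 2).
  by apply: eq_vint => x _; rewrite sqrrN.
rewrite E2 in H2; by case: ler0P => _.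
Qed.

End CauchySchwarz.

Section FaceIntegrals.
Context {R : realType} {n : nat} (M : mesh R n.+1).
Local Notation V := 'I_(nvert M).
Local Notation pt := 'rV[R]_n.+1.
Implicit Types (F : {set V}) (f g : pt -> R).
Local Notation ref := (@refsimplex R n).

Lemma msr_ref : @msr R n ref. Proof. exact: msr_refsimplex. Qed.

Lemma eq_sint F f g : (forall y, ref y -> f (face_map F y) = g (face_map F y)) -> sint F f = sint F g.
Proof. by move=> H; congr (_ * _); apply: eq_vint. Qed.

Lemma sint_ge0 F f : (forall x, 0 <= f x) -> 0 <= sint F f.
Proof. by move=> H; apply: mulr_ge0; [exact: sqrtr_ge0|apply: vint_ge0 => y _; exact: H]. Qed.

Definition intgF F f := intg ref (f \o face_map F : 'rV[R]_n -> R).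

Lemma intgFD F f g : intgF F f -> intgF F g -> intgF F (fun x => f x + g x).
Proof. exact: (intgD msr_ref). Qed.

Lemma intgFB F f g : intgF F f -> intgF F g -> intgF F (fun x => f x - g x).
Proof. exact: (intgB msr_ref). Qed.

Lemma intgFZ F f a : intgF F f -> intgF F (fun x => a * f x).
Proof. exact: (intgZ a msr_ref). Qed.

Lemma sintD F f g : intgF F f -> intgF F g -> sint F (fun x => f x + g x) = sint F f + sint F g.
Proof. by move=> If Ig; rewrite /sint -mulrDr -(vintD msr_ref If Ig). Qed.

Lemma sintB F f g : intgF F f -> intgF F g -> sint F (fun x => f x - g x) = sint F f - sint F g.
Proof. by move=> If Ig; rewrite /sint -mulrBr -(vintB msr_ref If Ig). Qed.

Lemma sintZ F f a : intgF F f -> sint F (fun x => a * f x) = a * sint F f.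
Proof. by move=> If; rewrite /sint mulrCA -(vintZ a msr_ref If). Qed.

Lemma sint0 F : sint F (fun=> 0) = 0.
Proof. by rewrite /sint vint_eq0 ?mulr0. Qed.

Lemma sint_sum F (I : Type) (s : seq I) (P : pred I) (f : I -> pt -> R) :
  (forall i, P i -> intgF F (f i)) ->
  sint F (fun x => \sum_(i <- s | P i) f i x) = \sum_(i <- s | P i) sint F (f i).
Proof. by move=> If; rewrite /sint -mulr_sumr -(vint_sum _ msr_ref If). Qed.

Lemma le_sint F f g : intgF F f -> intgF F g -> (forall y, ref y -> f (face_map F y) <= g (face_map F y)) ->
  sint F f <= sint F g.
Proof. by move=> If Ig H; rewrite ler_wpM2l ?sqrtr_ge0//; exact: (le_vint msr_ref If Ig H). Qed.

Lemma L2F_mul F f g : L2F F f -> L2F F g -> intgF F (fun x => f x * g x).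
Proof. exact: L2_mul msr_ref. Qed.

Lemma L2F_sqr F f : L2F F f -> intgF F (fun x => f x ^+ 2).
Proof. exact: L2_sqr. Qed.

Lemma L2FD F f g : L2F F f -> L2F F g -> L2F F (fun x => f x + g x).
Proof. exact: (L2D msr_ref). Qed.

Lemma L2FB F f g : L2F F f -> L2F F g -> L2F F (fun x => f x - g x).
Proof. exact: (L2B msr_ref). Qed.

Lemma L2FZ F a f : L2F F f -> L2F F (fun x => a * f x).
Proof. exact: (L2Z a msr_ref). Qed.

Lemma L2F0 F : L2F F (fun=> 0).
Proof. exact: (L2_0 msr_ref). Qed.

Lemma L2F_sum F (I : Type) (s : seq I) (P : pred I) (f : I -> pt -> R) :
  (forall i, P i -> L2F F (f i)) -> L2F F (fun x => \sum_(i <- s | P i) f i x).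
Proof. exact: (L2_sum _ msr_ref). Qed.

Lemma L2F_cont F f : continuous f -> L2F F f.
Proof.
move=> cf; apply: (L2_cont msr_ref (@bounded_refsimplex R n)) => y.
apply: (continuous_comp (@continuous_face_map R n M F y)); exact: cf.
Qed.

Lemma sint_cs F f g : L2F F f -> L2F F g ->
  cs (sint F (fun x => f x * g x)) (sint F (fun x => f x ^+ 2)) (sint F (fun x => g x ^+ 2)).
Proof. by move=> Lf Lg; apply: csZ; [exact: sqrtr_ge0|exact: (vint_cs msr_ref Lf Lg)]. Qed.

End FaceIntegrals.

(** * The coefficient and its inverse: ellipticity, measurability, Cauchy-Schwarz *)

Section Coefficient.
Context {R : realType} {d : nat}.
Local Notation pt := 'rV[R]_d.
Implicit Types (A : 'M[R]_d) (u v : pt).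

Lemma mulmvE A v i : mulmv A v 0 i = \sum_j A i j * v 0 j.
Proof. by rewrite /mulmv !mxE; apply: eq_bigr => j _; rewrite mxE. Qed.

Lemma mulmvD A u v : mulmv A (u + v) = mulmv A u + mulmv A v.
Proof. by rewrite /mulmv linearD/= mulmxDr linearD. Qed.

Lemma mulmvZ A a v : mulmv A (a *: v) = a *: mulmv A v.
Proof. by rewrite /mulmv linearZ/= -scalemxAr linearZ. Qed.

Lemma mulmvN A v : mulmv A (- v) = - mulmv A v.
Proof. by rewrite -scaleN1r mulmvZ scaleN1r. Qed.

Lemma mulmv_sym A u v : A^T = A -> dot (mulmv A u) v = dot (mulmv A v) u.
Proof.
move=> As; have E (w z : pt) : dot (mulmv A w) z = \sum_i \sum_j A i j * w 0 j * z 0 i.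
  by apply: eq_bigr => i _; rewrite mulmvE mulr_suml.
rewrite !E exchange_big/=; apply: eq_bigr => i _; apply: eq_bigr => j _.
by rewrite -{1}As mxE; ring.
Qed.

Lemma mulmv_le A B u : 0 <= B -> (forall i j, `|A i j| <= B) -> dot (mulmv A u) u <= d%:R * B * dot u u.
Proof.
move=> B0 H; rewrite -(@ler_pM2l _ 2)//.
apply: (@le_trans _ _ (\sum_i \sum_j B * (u 0 i ^+ 2 + u 0 j ^+ 2))).
  rewrite /dot mulr_sumr; apply: ler_sum => i _; rewrite mulmvE mulr_suml mulr_sumr.
  apply: ler_sum => j _; rewrite -mulrA (mulrCA 2) (le_trans (ler_norm _))// normrM.
  apply: ler_pM => //; rewrite normrM ger0_norm// normrM.
  rewrite -(real_normK (num_real (u 0 i))) -(real_normK (num_real (u 0 j))).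
  by move: (`|u 0 i|) (`|u 0 j|) => a b; rewrite -subr_ge0 (_ : _ - _ = (a - b) ^+ 2) ?sqr_ge0//; ring.
rewrite le_eqVlt; apply/orP; left; apply/eqP.
under eq_bigr do rewrite -mulr_sumr big_split/= sumr_const card_ord.
rewrite -mulr_sumr big_split/= sumr_const card_ord.
have -> : dot u u = \sum_i u 0 i ^+ 2 by apply: eq_bigr => i _; rewrite expr2.
rewrite -sumrMnl; under eq_bigr do rewrite -mulr_natl.
by rewrite -mulr_sumr -mulr_natl; move: (\sum_i _) => s; ring.
Qed.

Variables (Omega : set pt) (alpha : pt -> 'M[R]_d).
Hypothesis ca : coefficient Omega alpha.
Local Notation c := (fun x => invmx (alpha x)).

Lemma coef_unit x : Omega x -> alpha x \in unitmx.
Proof.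
move=> Ox; have [_ _ sym pos] := ca.
rewrite unitmxE unitfE; apply/det0P => -[v v0 Hv].
have := pos x Ox v v0.
by rewrite /mulmv trmx_mul trmxK sym// Hv dot0l ltxx.
Qed.

Lemma coef_sym x : Omega x -> (c x)^T = c x.
Proof. by move=> Ox; have [_ _ sym _] := ca; rewrite trmx_inv sym. Qed.

Lemma coefK x v : Omega x -> mulmv (alpha x) (mulmv (c x) v) = v.
Proof. by move=> Ox; rewrite /mulmv trmxK mulKVmx ?trmxK// coef_unit. Qed.

Lemma coef_dotC x u v : Omega x -> dot (mulmv (c x) u) v = dot (mulmv (c x) v) u.
Proof. by move=> Ox; apply: mulmv_sym; exact: coef_sym. Qed.

Lemma coef_ge0 x v : Omega x -> 0 <= dot (mulmv (c x) v) v.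
Proof.
move=> Ox; have [_ _ _ pos] := ca; set e := mulmv _ _.
rewrite -(coefK v Ox) -/e dotC; have [->|e0] := eqVneq e 0; first by rewrite dot0r.
exact/ltW/pos.
Qed.

(** The upper bounds come from the entries. The lower bound for [c] needs no eigenvalues: with
    [e = c v], expand [0 <= alpha (B2 e - v) . (B2 e - v)] using [alpha e = v] and
    [alpha v . v <= B2 |v|^2], which leaves [B2 |v|^2 <= B2^2 (c v . v)]. *)
Lemma coef_bounds : exists2 B, 0 < B & forall x, Omega x ->
  (forall i j, `|c x i j| <= B) /\
  (forall v, dot v v <= B * dot (mulmv (c x) v) v) /\
  (forall v, dot (mulmv (c x) v) v <= B * dot v v).
Proof.
have [_ [B HB] sym pos] := ca.
pose B1 := `|B| + 1; have B10 : 0 < B1 by rewrite ltr_wpDl.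
have BB1 : B <= B1 by rewrite (le_trans (ler_norm _))// lerDl.
pose B2 := d.+1%:R * B1; have B20 : 0 < B2 by rewrite mulr_gt0// ltr0n.
have dB : d%:R * B1 <= B2 by rewrite ler_wpM2r ?ler_nat// ltW.
exists B2 => // x Ox; split; [|split].
- move=> i j; have [_ h] := HB x Ox i j; rewrite (le_trans h)// (le_trans BB1)//.
  by rewrite ler_peMl ?ler1n// ltW.
- move=> v; set e := mulmv (c x) v.
  have ev : mulmv (alpha x) e = v by exact: coefK.
  have h : 0 <= dot (mulmv (alpha x) (B2 *: e - v)) (B2 *: e - v).
    have [->|z0] := eqVneq (B2 *: e - v) 0; first by rewrite dot0r.
    exact/ltW/pos.
  have hv : dot (mulmv (alpha x) v) v <= B2 * dot v v.
    apply: le_trans (ler_wpM2r (dot_ge0 v) dB); apply: mulmv_le; first exact: ltW.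
    by move=> i j; have [h1 _] := HB x Ox i j; rewrite (le_trans h1).
  rewrite mulmvD mulmvZ mulmvN ev dotBl !dotBr !dotZl !dotZr in h.
  rewrite (mulmv_sym _ _ (sym x Ox)) ev (dotC v e) in h.
  rewrite -(ler_pM2l B20); move: (dot _ _) (dot v v) (dot e v) h hv => a1 a2 a3 h hv.
  lra.
- move=> v; apply: le_trans (ler_wpM2r (dot_ge0 v) dB); apply: mulmv_le; first exact: ltW.
  by move=> i j; have [_ h1] := HB x Ox i j; rewrite (le_trans h1).
Qed.

Lemma measurable_inv_neq0 : measurable_fun [set x : R | x != 0] (@GRing.inv R : R -> R).
Proof.
apply: open_continuous_measurable_fun; first exact: open_neq.
by move=> x; rewrite inE /= => x0; exact: inv_continuous.
Qed.

Lemma measurable_det D m (A : d.-tuple (measurableTypeR R) -> 'M[R]_m) :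
  (forall i j, measurable_fun D (fun t => A t i j)) -> measurable_fun D (fun t => \det (A t)).
Proof.
move=> H; apply: measurable_sum => s; apply: measurable_funM; first exact: measurable_cst.
by apply: measurable_prod => i _; exact: H.
Qed.

(** Cramer's formula writes an entry of the inverse as a cofactor over a determinant, and the
    determinant does not vanish on [Omega]. *)
Lemma measurable_coef i j : msr Omega -> measurable_fun (@rowt R d @^-1` Omega) (fun t => c (rowt t) i j).
Proof.
move=> mO; have [mA _ _ _] := ca.
apply: (eq_measurable_fun (fun t => (\det (alpha (rowt t)))^-1 * cofactor (alpha (rowt t)) j i)).
  by move=> t; rewrite inE => Ot; rewrite /invmx coef_unit// !mxE.
apply: measurable_funM.
  apply: (measurable_comp (F := [set x : R | x != 0]) (g := fun t => \det (alpha (rowt t)))).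
  - by apply: open_measurable; exact: open_neq.
  - by move=> _ [t Ot <-] /=; have := coef_unit Ot; rewrite unitmxE unitfE.
  - exact: measurable_inv_neq0.
  - by apply: measurable_det.
apply: measurable_funM; first exact: measurable_cst.
apply: measurable_det => a b.
by rewrite (_ : (fun t => _) = fun t => alpha (rowt t) (lift j a) (lift i b))//; apply/funext => t; rewrite !mxE.
Qed.

Lemma L2_bmul (D : set pt) (a f : pt -> R) B : msr D ->
  measurable_fun (@rowt R d @^-1` D) (a \o @rowt R d) -> (forall x, D x -> `|a x| <= B) ->
  L2 D f -> L2 D (fun x => a x * f x).
Proof.
move=> mD ma aB Lf; have mf := Lf.1; split; first exact: measurable_funM.
apply: (mfun_dom (f := fun x => (a x * f x) ^+ 2) (g := fun x => B ^+ 2 * f x ^+ 2) mD).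
- by apply: measurable_funX; apply: measurable_funM.
- by apply: intgZ => //; exact: L2_sqr.
move=> x Dx; rewrite ger0_norm ?sqr_ge0// exprMn ler_wpM2r ?sqr_ge0//.
by rewrite -real_normK ?num_real// lerXn2r ?nnegrE ?(le_trans _ (aB x Dx))// aB.
Qed.

Lemma L2_coef (D : set pt) p i : msr D -> msr Omega -> D `<=` Omega -> L2v D p ->
  L2 D (fun x => mulmv (c x) (p x) 0 i).
Proof.
move=> mD mO DO Lp; have [B B0 HB] := coef_bounds.
rewrite (_ : (fun x => _) = fun x => \sum_j c x i j * p x 0 j); last first.
  by apply/funext => x; rewrite mulmvE.
apply: L2_sum => // j _; apply: (L2_bmul (B := B)) => //.
- by apply: measurable_funS (measurable_coef _ _ mO) => // t; exact: DO.
- by move=> x Dx; have [h _] := HB x (DO x Dx).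
Qed.

Lemma intg_dot (D : set pt) p q : msr D -> L2v D p -> L2v D q -> intg D (fun x => dot (p x) (q x)).
Proof. by move=> mD Lp Lq; apply: intg_sum => // i _; apply: L2_mul. Qed.

Lemma intg_coef (D : set pt) p q : msr D -> msr Omega -> D `<=` Omega -> L2v D p -> L2v D q ->
  intg D (fun x => dot (mulmv (c x) (p x)) (q x)).
Proof.
move=> mD mO DO Lp Lq; apply: (intg_dot (p := fun x => mulmv (c x) (p x))) => //.
by move=> i; exact: L2_coef.
Qed.

Lemma coef_cs (D : set pt) p q : msr D -> msr Omega -> D `<=` Omega -> L2v D p -> L2v D q ->
  cs (vint D (fun x => dot (mulmv (c x) (p x)) (q x)))
     (vint D (fun x => dot (mulmv (c x) (p x)) (p x)))
     (vint D (fun x => dot (mulmv (c x) (q x)) (q x))).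
Proof.
move=> mD mO DO Lp Lq t t0; have ti := invr_gt0 t.
have I1 := intg_coef mD mO DO Lp Lp; have I2 := intg_coef mD mO DO Lq Lq.
have I3 := intg_coef mD mO DO Lp Lq.
have pos x (s : R) : D x -> s ^+ 2 = 1 ->
    s * 2 * dot (mulmv (c x) (p x)) (q x) <=
    t * dot (mulmv (c x) (p x)) (p x) + t^-1 * dot (mulmv (c x) (q x)) (q x).
  move=> Dx s1; have Ox := DO x Dx; have := coef_ge0 (t *: p x - s *: q x) Ox.
  rewrite mulmvD mulmvN !mulmvZ dotBl !dotBr !dotZl !dotZr (coef_dotC (q x) (p x) Ox).
  move: (dot _ _) (dot _ (q x)) (dot (mulmv _ (q x)) _) => a b e h.
  rewrite -(ler_pM2l t0) -subr_ge0.
  rewrite (_ : _ - _ = t * (t * a) - t * (s * b) - (s * (t * b) - s ^+ 2 * e)); last first.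
    by rewrite s1; field; rewrite gt_eqF.
  by rewrite (_ : s ^+ 2 * e = s * (s * e)) // expr2 mulrA.
have E s : s ^+ 2 = 1 -> s * (2 * vint D (fun x => dot (mulmv (c x) (p x)) (q x))) <=
    t * vint D (fun x => dot (mulmv (c x) (p x)) (p x)) + t^-1 * vint D (fun x => dot (mulmv (c x) (q x)) (q x)).
  move=> s1; rewrite mulrA -!vintZ// -vintD//; [|exact: intgZ..].
  apply: le_vint => //; [exact: intgZ|apply: intgD => //; exact: intgZ|].
  by move=> x Dx; exact: pos.
have := E 1 (expr1n _ _); have := E (-1) (etrans (sqrrN 1) (expr1n _ _)).
by rewrite mul1r mulN1r; case: ler0P; rewrite ?mulrN.
Qed.

End Coefficient.

(** * Local inequalities and bubbles *)

Section DotSum.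
Context {R : realType} {d : nat}.
Implicit Types (u v : 'rV[R]_d).

Lemma dot_young u v : 2 * dot u v <= dot u u + dot v v.
Proof.
have := dot_ge0 (u - v); rewrite dotBl !dotBr (dotC v u).
by move: (dot u u) (dot u v) (dot v v) => a b e; lra.
Qed.

Lemma dot_sum_le (I : finType) (P : pred I) (u : I -> 'rV[R]_d) :
  dot (\sum_(i | P i) u i) (\sum_(i | P i) u i) <= #|P|%:R * \sum_(i | P i) dot (u i) (u i).
Proof.
rewrite -(@ler_pM2l _ 2)//.
apply: (@le_trans _ _ (\sum_(i | P i) \sum_(j | P j) (dot (u i) (u i) + dot (u j) (u j)))).
  rewrite dot_suml mulr_sumr; apply: ler_sum => i _; rewrite dot_sumr mulr_sumr.
  by apply: ler_sum => j _; exact: dot_young.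
rewrite le_eqVlt; apply/orP; left; apply/eqP.
under eq_bigr do rewrite big_split/= sumr_const.
rewrite big_split/= sumr_const -sumrMnl -mulr_natl -mulr_natl.
under eq_bigr do rewrite -mulr_natl.
by rewrite -mulr_sumr; ring.
Qed.

Lemma grad_peval (p : mpoly d R) x : grad (peval p) x = pevalv (pgrad p) x.
Proof. by apply/rowP => i; rewrite !mxE ffunE (C1g_partial _ _ (C1g_peval p)). Qed.

Lemma grad_C1g (f : 'rV[R]_d -> R) g x : C1g f g -> grad f x = \row_k g k x.
Proof. by move=> H; apply/rowP => k; rewrite !mxE (C1g_partial _ _ H). Qed.

Lemma continuous_pevalv (q : {ffun 'I_d -> mpoly d R}) i : continuous (fun x => pevalv q x 0 i).
Proof.
rewrite (_ : (fun x => _) = peval (q i)); first exact: continuous_peval.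
by apply/funext => x; rewrite mxE.
Qed.

Lemma continuous_dot (U : topologicalType) (f g : U -> 'rV[R]_d) :
  (forall i, continuous (fun x => f x 0 i)) -> (forall i, continuous (fun x => g x 0 i)) ->
  continuous (fun x => dot (f x) (g x)).
Proof. by move=> cf cg; apply: continuous_sumf => i _; apply: contM. Qed.

Lemma continuous_grad (w : 'rV[R]_d -> R) i : C1 w -> continuous (fun x => grad w x 0 i).
Proof.
move=> Cw; rewrite (_ : (fun x => _) = partial i w); first by have [_ /(_ i)[]] := Cw.
by apply/funext => x; rewrite mxE.
Qed.

Lemma pevalD (p q : mpoly d R) x : peval (p + q) x = peval p x + peval q x.
Proof. exact: mevalD. Qed.

Lemma pevalN (p : mpoly d R) x : peval (- p) x = - peval p x.
Proof. exact: mevalN. Qed.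

Lemma pevalM (p q : mpoly d R) x : peval (p * q) x = peval p x * peval q x.
Proof. exact: mevalM. Qed.

Lemma pevalZ a (p : mpoly d R) x : peval (a *: p) x = a * peval p x.
Proof. exact: mevalZ. Qed.

Lemma peval0 x : peval (0 : mpoly d R) x = 0.
Proof. exact: meval0. Qed.

Lemma pevalC (a : R) x : peval (mpolyC d a) x = a.
Proof. exact: mevalC. Qed.

Lemma pevalX (i : 'I_d) (x : 'rV[R]_d) : peval (mpolyX R (mnm1 i)) x = x 0 i.
Proof. exact: mevalXU. Qed.

Lemma peval_sum (I : Type) (s : seq I) (P : pred I) (F : I -> mpoly d R) x :
  peval (\sum_(i <- s | P i) F i) x = \sum_(i <- s | P i) peval (F i) x.
Proof. exact: meval_sum. Qed.

End DotSum.

Section CellIneq.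
Context {R : realType} {n : nat}.
Local Notation pt := 'rV[R]_n.+1.
Local Notation poly := (mpoly n.+1 R).

Definition shape (M : mesh R n.+1) (sigma : R) (K : {set 'I_(nvert M)}) :=
  nondeg K /\ forall v, v \in K -> hK K * enorm (gbc K v) <= sigma.

Section OneCell.
Variables (M : mesh R n.+1) (K : {set 'I_(nvert M)}).
Local Notation V := 'I_(nvert M).
Local Notation vx := (@vert R n.+1 M).
Hypothesis ndK : nondeg K.

Lemma intgK f : continuous f -> intg (interior (simplex K)) f.
Proof. by rewrite (interior_simplex ndK); exact: intg_ocell. Qed.

Lemma msrK : msr (interior (simplex K)).
Proof. by apply: msr_open; exact: open_interior. Qed.

Lemma kint_le f g : continuous f -> continuous g -> (forall x, simplex K x -> f x <= g x) ->
  kint K f <= kint K g.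
Proof.
move=> cf cg H; apply: le_vint; [exact: msrK|exact: intgK|exact: intgK|].
by move=> x /interior_subset; exact: H.
Qed.

Lemma kintD f g : continuous f -> continuous g -> kint K (fun x => f x + g x) = kint K f + kint K g.
Proof. by move=> cf cg; rewrite /kint vintD//; [exact: msrK|exact: intgK|exact: intgK]. Qed.

Lemma kintZ (a : R) (f : pt -> R) : continuous f -> kint K (fun x => a * f x) = a * kint K f.
Proof. by move=> cf; rewrite /kint vintZ//; [exact: msrK|exact: intgK]. Qed.

Lemma kint_sum (I : Type) (s : seq I) (P : pred I) (f : I -> pt -> R) : (forall i, continuous (f i)) ->
  kint K (fun x => \sum_(i <- s | P i) f i x) = \sum_(i <- s | P i) kint K (f i).
Proof. by move=> cf; rewrite /kint vint_sum//; [exact: msrK|move=> i _; exact: intgK]. Qed.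

Lemma kint_ge0 f : (forall x, simplex K x -> 0 <= f x) -> 0 <= kint K f.
Proof. by move=> H; apply: vint_ge0 => x /interior_subset; exact: H. Qed.

Lemma kint_cs (f g : pt -> R) : continuous f -> continuous g ->
  cs (kint K (fun x => f x * g x)) (kint K (fun x => f x ^+ 2)) (kint K (fun x => g x ^+ 2)).
Proof.
move=> cf cg; apply: vint_cs; first exact: msrK.
all: apply: (L2_cont (M := vbnd M)) => //; first exact: msrK.
all: by move=> x /interior_subset; exact: bounded_simplex.
Qed.

Lemma L2K f : continuous f -> L2 (interior (simplex K)) f.
Proof.
move=> cf; apply: (L2_cont (M := vbnd M)) => //; first exact: msrK.
by move=> x /interior_subset; exact: bounded_simplex.
Qed.

Lemma face_map_simplex v y : v \in K -> @refsimplex R n y -> simplex (K :\ v) (face_map (K :\ v) y).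
Proof.
move=> vK ry; have cF := card_facet ndK vK.
have [a aF] : exists a, a \in K :\ v by apply/card_gt0P; rewrite cF.
rewrite (face_map_spt aF cF); have es := isenum_enum aF cF.
set s := (fun i : 'I_n.+1 => _) in es *.
exists (fun u => \sum_(i | s i == u) bary y i); split.
- by move=> u; apply: sumr_ge0 => i _; exact: (refsimplexE y).1.
- move=> u uF; apply: big1 => i /eqP iu; move: uF; rewrite -iu.
  by rewrite (isenum_mem i es).
- rewrite -(sum_bary y) (exchange_big_dep xpredT)//=; apply: eq_bigr => i _.
  by rewrite (big_pred1 (s i))// => u; rewrite eq_sym.
- rewrite /spt (partition_big s xpredT)//=; apply: eq_bigr => u _.
  by rewrite scaler_suml; apply: eq_bigr => i /eqP <-.
Qed.

Lemma face_bc0 v y : v \in K -> @refsimplex R n y -> bc K (face_map (K :\ v) y) v = 0.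
Proof.
move=> vK ry; have := face_map_simplex vK ry.
by move=> /(simplexE ndK _ (finset.subsetDl _ _))[_]; apply; rewrite !inE eqxx.
Qed.

(** The field [x - vx v] is tangential to every facet through [v] and has constant normal component,
    the height of [K], on the opposite one. The trace identity, the bubble and the lowest-order
    Raviart-Thomas fields all rest on this. *)
Lemma face_dot_nrm u v y : u \in K -> v \in K -> @refsimplex R n y ->
  dot (face_map (K :\ u) y - vx v) (nrm K u) = (v == u)%:R / enorm (gbc K u).
Proof.
move=> uK vK ry; rewrite /nrm dotNr dotZr dotC -(bcB ndK) face_bc0// (bc_vert ndK)//.
by rewrite sub0r mulrN opprK mulrC.
Qed.

Lemma cell_green_field w (q : {ffun 'I_n.+1 -> poly}) : C1 w ->
  kint K (fun x => w x * peval (Defs.pdiv q) x) + kint K (fun x => dot (grad w x) (pevalv q x)) =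
  bint K (fun F x => w x * dot (pevalv q x) (outnormal K F)).
Proof.
move=> Cw; have Cf k := C1gM (C1_C1g Cw) (C1g_peval (q k)).
have cw : continuous w by case: Cw.
have -> : bint K (fun F x => w x * dot (pevalv q x) (outnormal K F)) =
    bint K (fun F x => dot (\row_k (w x * peval (q k) x)) (outnormal K F)).
  apply: eq_bigr => F _; congr (sint F _); apply/funext => x.
  by rewrite /dot mulr_sumr; apply: eq_bigr => k _; rewrite !mxE mulrA.
rewrite -(cell_div ndK (f := fun k x => w x * peval (q k) x)); last by move=> k; exact: C1g_C1 (Cf k).
rewrite -kintD; last 2 first.
- by apply: contM => //; exact: continuous_peval.
- by apply: continuous_dot => i; [exact: continuous_grad|exact: continuous_pevalv].
congr (kint K _); apply/funext => x; rewrite /Defs.pdiv peval_sum mulr_sumr /dot -big_split/=.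
by apply: eq_bigr => k _; rewrite (C1g_partial _ _ (Cf k)) !mxE addrC.
Qed.

Lemma grad_dual (g : pt) v0 : v0 \in K -> g = \sum_(v in K) dot g (vx v - vx v0) *: gbc K v.
Proof.
move=> v0K; apply/rowP => k; rewrite -!dot_deltar; set a := delta_mx 0 k.
rewrite dot_suml -{1}(gbc_comb ndK a) dot_sumr.
transitivity (\sum_v dot (dot g (vx v - vx v0) *: gbc K v) a).
  under [RHS]eq_bigr do rewrite dotZl dotBr mulrBl mulrC.
  rewrite sumrB -mulr_sumr -dot_suml (gbc_sum ndK) dot0l mulr0 subr0.
  by apply: eq_bigr => v _; rewrite dotZr.
rewrite [RHS]big_mkcond/=; apply: eq_bigr => v _; case: ifPn => // vK.
by rewrite (gbc_notin ndK)// scaler0 dot0l.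
Qed.

Lemma edge_le_hK v x : v \in K -> simplex K x -> dot (x - vx v) (x - vx v) <= hK K ^+ 2.
Proof.
move=> vK Kx; rewrite -enorm_sqr lerXn2r ?nnegrE ?enorm_ge0 ?(ltW (hK_gt0 ndK))//.
by apply: has_sup_dist => //; exact: simplex_vert.
Qed.

(** Divergence theorem for [w^2 (x - vx v)]: only the facet opposite to [v] carries a flux. *)
Lemma cell_trace_id w v : C1 w -> v \in K ->
  (enorm (gbc K v))^-1 * sint (K :\ v) (fun x => w x ^+ 2) =
  n.+1%:R * kint K (fun x => w x ^+ 2) + 2 * kint K (fun x => w x * dot (grad w x) (x - vx v)).
Proof.
move=> Cw vK; have cw : continuous w by case: Cw.
have Cf k := C1gM (C1gM (C1_C1g Cw) (C1_C1g Cw)) (C1gD (C1g_coord k) (@C1g_cst R n.+1 (- vx v 0 k))).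
have := cell_div ndK (fun k => C1g_C1 (Cf k)); rewrite bintE.
have -> : \sum_(u in K) sint (K :\ u) (fun x => dot (\row_k (w x * w x * (x 0 k + - vx v 0 k))) (outnormal K (K :\ u))) =
    (enorm (gbc K v))^-1 * sint (K :\ v) (fun x => w x ^+ 2).
  have E u : u \in K -> sint (K :\ u) (fun x => dot (\row_k (w x * w x * (x 0 k + - vx v 0 k))) (outnormal K (K :\ u))) =
      (v == u)%:R / enorm (gbc K u) * sint (K :\ u) (fun x => w x ^+ 2).
    move=> uK; rewrite -sintZ; last by apply: L2F_sqr; exact: L2F_cont.
    apply: eq_sint => y ry; rewrite (outnormalE ndK)// -(face_dot_nrm uK vK ry) mulrC.
    by rewrite /dot mulr_suml; apply: eq_bigr => k _; rewrite !mxE; ring.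
  rewrite (bigD1 v)//= E// eqxx mul1r big1 ?addr0// => u /andP[uK uv].
  by rewrite E// eq_sym (negbTE uv) !mul0r.
move=> <-; rewrite -!kintZ; last 2 first.
- apply: contM => //; apply: continuous_dot => i; first exact: continuous_grad.
  rewrite (_ : (fun x => _) = fun x : pt => x 0 i - vx v 0 i); first by apply: contB; [exact: coord_continuous|exact: contC].
  by apply/funext => x; rewrite !mxE.
- exact: contX2.
rewrite -kintD; last 2 first.
- by apply: contM; [exact: contC|exact: contX2].
- apply: contM; first exact: contC.
  apply: contM => //; apply: continuous_dot => i; first exact: continuous_grad.
  rewrite (_ : (fun x => _) = fun x : pt => x 0 i - vx v 0 i); first by apply: contB; [exact: coord_continuous|exact: contC].
  by apply/funext => x; rewrite !mxE.
congr (kint K _); apply/funext => x.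
under eq_bigr => k _ do rewrite (C1g_partial _ _ (Cf k)) eqxx addr0 mulr1.
rewrite big_split/= sumr_const card_ord -[w x * w x *+ _]mulr_natl -expr2 addrC; congr (_ + _).
by rewrite /dot !mulr_sumr; apply: eq_bigr => k _; rewrite !mxE; ring.
Qed.

(** From [cell_trace_id], with [|x - vx v| <= hK K] and [2 a b <= a^2 + b^2]; the square of [w]
    raises the factor from [n.+1] to [n.+2]. It holds for all [C1] functions, which the H^1 traces
    of the consistency proof require. *)
Lemma cell_trace_C1 sigma w v : 0 < sigma -> hK K * enorm (gbc K v) <= sigma -> C1 w -> v \in K ->
  hK K * sint (K :\ v) (fun x => w x ^+ 2) <=
  sigma * (n.+2%:R * kint K (fun x => w x ^+ 2) + hK K ^+ 2 * kint K (fun x => dot (grad w x) (grad w x))).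
Proof.
move=> s0 sr Cw vK; have cw : continuous w by case: Cw.
have G0 := enorm_gt0 (gbc_neq0 ndK vK).
have cg : continuous (fun x => dot (grad w x) (grad w x)).
  by apply: continuous_dot => i; exact: continuous_grad.
have c2 : continuous (fun x => w x ^+ 2) by exact: contX2.
have cd : continuous (fun x => dot (grad w x) (x - vx v)).
  apply: continuous_dot => i; first exact: continuous_grad.
  rewrite (_ : (fun x => _) = fun x : pt => x 0 i - vx v 0 i); first by apply: contB; [exact: coord_continuous|exact: contC].
  by apply/funext => x; rewrite !mxE.
apply: (@le_trans _ _ (sigma * ((enorm (gbc K v))^-1 * sint (K :\ v) (fun x => w x ^+ 2)))).
  rewrite [leRHS]mulrA; apply: ler_wpM2r; last by rewrite ler_pdivlMr.
  by apply: sint_ge0 => x; exact: sqr_ge0.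
apply: ler_wpM2l; first exact: ltW.
have -> : forall a b : R, n.+2%:R * a + b = n.+1%:R * a + (a + b) by move=> a b; rewrite -(nat1r n.+1); ring.
rewrite cell_trace_id// lerD2l.
rewrite -!kintZ//; last exact: contM.
rewrite -kintD//; last by apply: contM => //; exact: contC.
apply: kint_le; first by apply: contM; [exact: contC|exact: contM].
  by apply: contD => //; apply: contM => //; exact: contC.
move=> x Kx; have h := edge_le_hK vK Kx.
have := dot_sqr_le (grad w x) (x - vx v) => h2.
have h3 := le_trans h2 (ler_wpM2l (dot_ge0 (grad w x)) h).
move: h3; rewrite [X in _ <= X]mulrC; move: (dot _ (x - _)) (hK K ^+ 2 * _) (w x) => a b e h3.
have := sqr_ge0 (e - a); rewrite sqrrB -mulr_natl.
by move: h3; move: (a ^+ 2) (e ^+ 2) => a2 e2; lra.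
Qed.

End OneCell.

End CellIneq.

Section PolyIneq.
Context {R : realType} {n : nat}.
Local Notation pt := 'rV[R]_n.+1.
Local Notation poly := (mpoly n.+1 R).
Local Notation ref := (@refsimplex R n.+1).
Local Notation sq u := (dot u u).

Lemma continuous_pgrad_sq (p : poly) : continuous (fun x => sq (pevalv (pgrad p) x)).
Proof. by apply: continuous_dot => i; exact: continuous_pevalv. Qed.

Section Pull.
Variables (M : mesh R n.+1) (K : {set 'I_(nvert M)}).
Local Notation V := 'I_(nvert M).
Local Notation vx := (@vert R n.+1 M).
Hypothesis ndK : nondeg K.

Lemma ref_pull (s : 'I_n.+2 -> V) k (p : poly) : deg_le k p ->
  exists q : poly, [/\ deg_le k q, forall y, peval q y = peval p (spt (vx \o s) y) &
    forall j y, peval (mderiv j q) y =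
      dot (pevalv (pgrad p) (spt (vx \o s) y)) (vx (s (lift ord0 j)) - vx (s ord0))].
Proof.
move=> dp; have [q dq Eq] := peval_aff (smx (vx \o s)) (vx (s ord0)) dp.
have E y : peval q y = peval p (spt (vx \o s) y) by rewrite Eq sptE.
exists q; split => // j y.
rewrite -(C1g_partial _ _ (C1g_peval q)) sptE -grad_peval.
have H := C1_aff (smx (vx \o s)) (vx (s ord0)) (C1g_C1 (C1g_peval p)).
have -> : peval q = (fun y => peval p (y *m smx (vx \o s) + vx (s ord0))).
  by apply/funext => z; rewrite Eq.
rewrite (C1g_partial _ _ H); congr dot.
by apply/rowP => i; rewrite !mxE.
Qed.

Lemma dot_grad_dual (g : pt) v0 : v0 \in K ->
  sq g <= n.+2%:R * \sum_(v in K) dot g (vx v - vx v0) ^+ 2 * sq (gbc K v).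
Proof.
move=> v0K; rewrite {1 2}(grad_dual ndK g v0K); apply: le_trans (dot_sum_le _ _) _.
rewrite ndK.1 ler_wpM2l// le_eqVlt; apply/orP; left; apply/eqP.
by apply: eq_bigr => v _; rewrite dotZl dotZr mulrA expr2.
Qed.

End Pull.

(** Reference derivatives are derivatives along the edges from one vertex; the gradient is recovered
    from them through the dual basis [gbc K v], at the cost of [sigma / hK K] for each. *)
Lemma cell_inverse (k : nat) (sigma : R) : 0 < sigma -> exists2 C, 0 < C &
  forall (M : mesh R n.+1) (K : {set 'I_(nvert M)}) (p : poly), shape sigma K -> deg_le k p ->
  hK K ^+ 2 * kint K (fun x => sq (pevalv (pgrad p) x)) <= C * kint K (fun x => peval p x ^+ 2).
Proof.
move=> s0; have [C C0 HC] := @ref_inverse R n.+1 k.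
exists (n.+2%:R * sigma ^+ 2 * C); first by rewrite !mulr_gt0// exprn_gt0.
move=> M K p [ndK sh] dp; have [s es] := isenum_exists ndK.1.
have [q [dq Eq Edq]] := ref_pull s dp.
have cp2 : continuous (fun x => peval p x ^+ 2) by apply: contX2; exact: continuous_peval.
have cg := @continuous_pgrad_sq p.
rewrite (kint_avg ndK es cp2) (kint_avg ndK es cg) mulrCA [leRHS]mulrCA.
apply: ler_wpM2l; first exact: ltW (jac_gt0 ndK).
have -> : avg (@vert _ _ M \o s) (fun x => peval p x ^+ 2) = vint ref (fun y => peval q y ^+ 2).
  by apply: eq_vint => y _; rewrite Eq.
rewrite -[leRHS]mulrA; apply: le_trans (ler_wpM2l _ (HC q dq)); last by rewrite mulr_ge0// sqr_ge0.
have cs_ := @continuous_spt R n.+1 n.+1 (@vert _ _ M \o s).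
have cgs : continuous (fun y => sq (pevalv (pgrad p) (spt (@vert _ _ M \o s) y))).
  by move=> y; exact: (continuous_comp (cs_ y) (cg _)).
have mr := @msr_refsimplex R n.+1; have br := @bounded_refsimplex R n.+1.
have Iq j : intg ref (fun y => peval (mderiv j q) y ^+ 2).
  by apply: intg_cont br _ => //; apply: contX2; exact: continuous_peval.
rewrite -vint_sum// /avg -vintZ//; last exact: intg_cont br _.
rewrite -vintZ//; last exact: intg_sum.
apply: le_vint => //.
- by apply: intgZ => //; exact: intg_cont br _.
- by apply: intgZ => //; exact: intg_sum.
move=> y _ /=; set g := pevalv _ _.
have s0K := isenum_mem ord0 es.
apply: le_trans (ler_wpM2l (sqr_ge0 _) (dot_grad_dual ndK g s0K)) _.
rewrite mulrCA -mulrA; apply: ler_wpM2l => //; rewrite !mulr_sumr.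
rewrite (isenum_sum (fun v => _) es) big_ord_recl subrr dot0r expr0n mul0r mulr0 add0r.
apply: ler_sum => j _; rewrite Edq -/g mulrCA mulrC ler_wpM2r ?sqr_ge0//.
rewrite -enorm_sqr -exprMn lerXn2r ?nnegrE ?mulr_ge0 ?enorm_ge0 ?(ltW s0) ?(ltW (hK_gt0 ndK))//.
by apply: sh; exact: isenum_mem es.
Qed.

Lemma cell_trace (k : nat) (sigma : R) : 0 < sigma -> exists2 C, 0 < C &
  forall (M : mesh R n.+1) (K : {set 'I_(nvert M)}) (p : poly) v, shape sigma K -> deg_le k p -> v \in K ->
  hK K * sint (K :\ v) (fun x => peval p x ^+ 2) <= C * kint K (fun x => peval p x ^+ 2).
Proof.
move=> s0; have [C C0 HC] := cell_inverse k s0.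
exists (sigma * (n.+2%:R + C)); first by rewrite mulr_gt0// addr_gt0.
move=> M K p v [ndK sh] dp vK.
apply: le_trans (cell_trace_C1 ndK s0 (sh v vK) (C1g_C1 (C1g_peval p)) vK) _.
rewrite -[leRHS]mulrA; apply: ler_wpM2l; first exact: ltW.
rewrite [leRHS]mulrDl lerD2l; apply: le_trans _ (HC M K p _ dp) => //.
by under [X in _ * kint _ X <= _]funext do rewrite grad_peval.
Qed.

Section Bubble.
Variables (M : mesh R n.+1) (K : {set 'I_(nvert M)}).
Local Notation V := 'I_(nvert M).
Local Notation vx := (@vert R n.+1 M).
Hypothesis ndK : nondeg K.

Definition bcp v : poly := mpolyC n.+1 (bc K 0 v) + \sum_j gbc K v 0 j *: mpolyX R (mnm1 j).

Lemma peval_bcp v x : peval (bcp v) x = bc K x v.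
Proof.
rewrite /bcp pevalD pevalC peval_sum (bcE ndK x); congr (_ + _).
by apply: eq_bigr => j _; rewrite pevalZ pevalX.
Qed.

Lemma deg_le_bcp v : deg_le 1 (bcp v).
Proof.
apply: deg_leD; first exact: deg_leC.
by apply: deg_le_sum => j _; apply: deg_leZ; exact: deg_leX.
Qed.

Variables (v0 : V) (p : poly).

Definition edgep v : poly := \sum_j (vx v - vx v0) 0 j *: mderiv j p.

Lemma peval_edgep v x : peval (edgep v) x = dot (pevalv (pgrad p) x) (vx v - vx v0).
Proof.
rewrite /edgep peval_sum; apply: eq_bigr => j _; rewrite pevalZ mulrC; congr (_ * _).
by rewrite [RHS]mxE ffunE.
Qed.

Lemma deg_le_mul_edgep k v l : deg_le 1 l -> deg_le k p -> deg_le k (l * edgep v).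
Proof.
move=> dl dp; rewrite /edgep mulr_sumr; apply: deg_le_sum => j _.
(* For [k = 0] the bound [k.-1] on a derivative is 0 rather than -1, so the product would be allowed
   degree 1; but then the derivative is zero. *)
rewrite -scalerAr; apply: deg_leZ; case: k dp => [|k] dp.
  have -> : mderiv j p = 0; last by rewrite mulr0; exact: deg_le0.
  by move: dp; rewrite /deg_le => /msize1_polyC ->; rewrite mderivC.
by have := deg_leM dl (deg_le_mderiv j dp).
Qed.

(* The tangential bubble: its normal trace vanishes and [grad p . bubble] is the
   variance of the edge derivatives of [p], see [ref_poincare]. *)
Definition bubble : {ffun 'I_n.+1 -> poly} :=
  [ffun k => - \sum_(v in K) bcp v * edgep v * (mpolyX R (mnm1 k) - mpolyC n.+1 (vx v 0 k))].

Lemma pevalv_bubble x :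
  pevalv bubble x = - \sum_(v in K) (bc K x v * dot (pevalv (pgrad p) x) (vx v - vx v0)) *: (x - vx v).
Proof.
apply/rowP => k; rewrite mxE ffunE pevalN peval_sum [RHS]mxE summxE; congr (- _).
by apply: eq_bigr => v _; rewrite !pevalM pevalD pevalN pevalX pevalC peval_bcp peval_edgep !mxE.
Qed.

Lemma bubble_RT k : deg_le k p -> RTk k bubble.
Proof.
move=> dp.
exists [ffun k => \sum_(v in K) vx v 0 k *: (bcp v * edgep v)], (- \sum_(v in K) bcp v * edgep v); split.
- move=> i; rewrite ffunE; apply: deg_le_sum => v _; apply: deg_leZ.
  exact: deg_le_mul_edgep (deg_le_bcp v) dp.
- by apply/deg_leN/deg_le_sum => v _; exact: deg_le_mul_edgep (deg_le_bcp v) dp.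
- move=> i; rewrite !ffunE mulrN mulr_sumr -sumrB -sumrN.
  by apply: eq_bigr => v _; rewrite -mul_mpolyC; ring.
Qed.

(** Split [x - vx v] through [vx v0]: the derivative of [p] along [x - vx v0] is the mean of the
    edge derivatives with weights [bc K x v], so the product is mean square minus square of the
    mean, up to the order. *)
Lemma dot_grad_bubble x : v0 \in K ->
  let g v := dot (pevalv (pgrad p) x) (vx v - vx v0) in
  dot (pevalv (pgrad p) x) (pevalv bubble x) =
  \sum_(v in K) bc K x v * g v ^+ 2 - (\sum_(v in K) bc K x v * g v) ^+ 2.
Proof.
move=> v0K g; set G := pevalv (pgrad p) x.
have sumK (f : V -> R) : (forall v, v \notin K -> f v = 0) -> \sum_(v in K) f v = \sum_v f v.
  by move=> H; rewrite [LHS]big_mkcond/=; apply: eq_bigr => v _; case: ifPn => // /H.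
have m0 : dot G (x - vx v0) = \sum_(v in K) bc K x v * g v.
  rewrite sumK; last by move=> v vK; rewrite (bc_notin ndK)// mul0r.
  rewrite -{1}(bc_comb ndK x) -{1}[vx v0]scale1r -(bc_sum ndK x) scaler_suml -sumrB dot_sumr.
  by apply: eq_bigr => v _; rewrite -scalerBr dotZr.
rewrite pevalv_bubble dotNr dot_sumr expr2 -{1}m0 mulr_sumr -sumrN -sumrB.
apply: eq_bigr => v _; rewrite dotZr.
have -> : x - vx v = (x - vx v0) - (vx v - vx v0) by rewrite opprB addrA subrK.
by rewrite (dotBr (x - vx v0)) -/G -/(g v); ring.
Qed.

(** On the facet opposite to [u] all fields [x - vx v] with [v] other than [u] are tangential, and
    the remaining one has the vanishing weight [bc K x u]. *)
Lemma bubble_normal u y : u \in K -> @refsimplex R n y ->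
  dot (pevalv bubble (face_map (K :\ u) y)) (nrm K u) = 0.
Proof.
move=> uK ry; rewrite pevalv_bubble dotNl dot_suml big1 ?oppr0// => v vK.
rewrite dotZl (face_dot_nrm ndK uK vK ry); case: eqVneq => [->|_]; last by rewrite mul0r mulr0.
by rewrite (face_bc0 ndK)// !mul0r.
Qed.

Lemma bubble_bound x : v0 \in K -> simplex K x ->
  sq (pevalv bubble x) <= n.+2%:R ^+ 2 * (hK K ^+ 2) ^+ 2 * sq (pevalv (pgrad p) x).
Proof.
move=> v0K Kx; set G := pevalv (pgrad p) x.
rewrite pevalv_bubble dotNl dotNr opprK; apply: le_trans (dot_sum_le _ _) _.
rewrite ndK.1 expr2 -!mulrA; apply: ler_wpM2l => //.
rewrite mulr_natl -[X in _ *+ X]ndK.1 -sumr_const; apply: ler_sum => v vK.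
rewrite dotZl dotZr -/G.
rewrite (_ : _ * (_ * _) = sq (x - vx v) * (bc K x v ^+ 2 * dot G (vx v - vx v0) ^+ 2)); last first.
  by move: (bc K x v) (dot _ _) (dot _ _) => a b c; ring.
rewrite (_ : hK K * _ = hK K ^+ 2 * (hK K ^+ 2 * sq G)); last by rewrite !expr2 !mulrA.
apply: ler_pM.
- exact: dot_ge0.
- by apply: mulr_ge0; exact: sqr_ge0.
- exact: edge_le_hK.
have b0 := (simplexKE ndK x).1 Kx v; have b1 := bc_le1 ndK v Kx.
apply: (@le_trans _ _ (dot G (vx v - vx v0) ^+ 2)).
  by rewrite ler_piMl ?sqr_ge0// expr_le1.
apply: le_trans (dot_sqr_le _ _) _; rewrite mulrC ler_wpM2r ?dot_ge0//.
apply: edge_le_hK => //; exact: simplex_vert.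
Qed.

End Bubble.

(** Pointwise the bubble is at most a multiple of [hK^2 |grad p|], and one inverse inequality
    removes a factor [hK]. Its components have degree at most [k.+1], so a second inverse inequality
    bounds the divergence and removes the other. *)
Lemma cell_bubble (k : nat) (sigma : R) : 0 < sigma -> exists2 C, 0 < C &
  forall (M : mesh R n.+1) (K : {set 'I_(nvert M)}) (p : poly) v0, shape sigma K -> deg_le k p -> v0 \in K ->
  kint K (fun x => sq (pevalv (bubble K v0 p) x)) <= C * hK K ^+ 2 * kint K (fun x => peval p x ^+ 2) /\
  kint K (fun x => peval (Defs.pdiv (bubble K v0 p)) x ^+ 2) <= C * kint K (fun x => peval p x ^+ 2).
Proof.
move=> s0; have [C1 C10 H1] := cell_inverse k s0; have [C2 C20 H2] := cell_inverse k.+1 s0.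
pose N : R := n.+2%:R; have N0 : 0 < N by rewrite ltr0n.
exists (N ^+ 2 * C1 * (1 + N * C2)); first by rewrite !mulr_gt0 ?exprn_gt0// addr_gt0// mulr_gt0.
move=> M K p v0 shK dp v0K; have [ndK _] := shK; have h0 := hK_gt0 ndK.
set q := bubble K v0 p; set I := kint K (fun x => peval p x ^+ 2).
have I0 : 0 <= I by apply: kint_ge0 => x _; exact: sqr_ge0.
have cq i : continuous (fun x => pevalv q x 0 i) by exact: continuous_pevalv.
have cqq : continuous (fun x => sq (pevalv q x)) by exact: continuous_dot.
have cgg := @continuous_pgrad_sq p.
have A1 : kint K (fun x => sq (pevalv q x)) <= N ^+ 2 * C1 * hK K ^+ 2 * I.
  apply: (@le_trans _ _ (kint K (fun x => N ^+ 2 * (hK K ^+ 2) ^+ 2 * sq (pevalv (pgrad p) x)))).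
    apply: kint_le => //; first by apply: contM => //; exact: contC.
    by move=> x Kx; exact: bubble_bound.
  rewrite (kintZ ndK)//.
  have := ler_wpM2l (_ : 0 <= N ^+ 2 * hK K ^+ 2) (H1 M K p shK dp).
  rewrite mulr_ge0 ?sqr_ge0// => /(_ isT); rewrite -/I.
  by move: (kint _ _) (N ^+ 2) (hK K ^+ 2) => a b c; rewrite (_ : b * C1 * c * I = b * c * (C1 * I)); [rewrite (_ : b * c ^+ 2 * a = b * c * (c * a)); last by ring|ring].
have CN : 1 <= 1 + N * C2 by rewrite lerDl mulr_ge0// ltW.
split.
  apply: (le_trans A1); rewrite -!mulrA !ler_wpM2l ?sqr_ge0 ?(ltW C10)//.
  by rewrite ler_peMl// !mulr_ge0// ltW.
have dq i : deg_le k.+1 (q i).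
  have [a [b [da db E]]] := bubble_RT K v0 dp; rewrite E.
  apply: deg_leD; first by apply: deg_leW (da i); rewrite leqnSn.
  by have := deg_leM (deg_leX i) db.
have A2 : hK K ^+ 2 * kint K (fun x => peval (Defs.pdiv q) x ^+ 2) <= N * C2 * kint K (fun x => sq (pevalv q x)).
  have cgi i : continuous (fun x => sq (pevalv (pgrad (q i)) x)) by exact: continuous_pgrad_sq.
  have E1 : kint K (fun x => peval (Defs.pdiv q) x ^+ 2) <= N * \sum_i kint K (fun x => sq (pevalv (pgrad (q i)) x)).
    rewrite -(kint_sum ndK)// -(kintZ ndK); last by apply: continuous_sumf.
    apply: (kint_le ndK).
    - by apply: contX2; exact: continuous_peval.
    - by apply: contM; [exact: contC|apply: continuous_sumf].
    move=> x Kx; rewrite /Defs.pdiv peval_sum.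
    (* The vector inequality in dimension one serves as the scalar inequality for the square of a
       sum. *)
    have := dot_sum_le (d := 1) xpredT (fun i => const_mx (peval (mderiv i (q i)) x)).
    rewrite /dot !big_ord1 summxE -expr2 cardT size_enum_ord.
    under eq_bigr do rewrite mxE.
    move=> /le_trans; apply; apply: ler_pM => //.
    - by apply: sumr_ge0 => i _; rewrite big_ord1 -expr2 sqr_ge0.
    - by rewrite ler_nat.
    apply: ler_sum => i _; rewrite big_ord1 mxE [leRHS](bigD1 i)//=.
    have -> : pevalv (pgrad (q i)) x 0 i = peval (mderiv i (q i)) x by rewrite mxE ffunE.
    rewrite lerDl.
    by apply: sumr_ge0 => j _; rewrite -expr2 sqr_ge0.
  apply: le_trans (ler_wpM2l (sqr_ge0 _) E1) _.
  rewrite mulrCA -mulrA; apply: ler_wpM2l => //.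
  rewrite mulr_sumr (_ : (fun x => sq (pevalv q x)) = (fun x => \sum_i peval (q i) x ^+ 2)); last first.
    by apply/funext => x; apply: eq_bigr => i _; rewrite !mxE expr2.
  rewrite (kint_sum ndK); last by move=> i; apply: contX2; exact: continuous_peval.
  rewrite mulr_sumr; apply: ler_sum => i _; exact: H2.
rewrite -(ler_pM2l (exprn_gt0 2 h0)); apply: (le_trans A2).
apply: le_trans (ler_wpM2l _ A1) _; first by rewrite mulr_ge0// ltW.
rewrite -subr_ge0; move: (hK K) => h.
rewrite (_ : _ - _ = N ^+ 2 * C1 * h ^+ 2 * I); last by ring.
apply: mulr_ge0 => //; apply: mulr_ge0; last exact: sqr_ge0.
by apply: mulr_ge0; [exact: sqr_ge0|exact: ltW].
Qed.

(** [ref_poincare] pulled back. No shape regularity enters: the bubble is built from edges and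
    barycentric coordinates, hence affinely invariant, and division by [jac K] gives the squared
    mean the scaling of an integral. *)
Lemma cell_poincare (k : nat) : exists2 C, 0 < C &
  forall (M : mesh R n.+1) (K : {set 'I_(nvert M)}) (p : poly) v0, nondeg K -> deg_le k p -> v0 \in K ->
  kint K (fun x => peval p x ^+ 2) <=
  C * (kint K (fun x => dot (pevalv (pgrad p) x) (pevalv (bubble K v0 p) x)) + kint K (peval p) ^+ 2 / jac K).
Proof.
have [C C0 HC] := @ref_poincare R n.+1 k; exists C => // M K p v0 ndK dp v0K.
have [v1 v1K v10] := other_vertex ndK v0K.
rewrite eq_sym in v10; have [s [es s0 _]] := isenum2 ndK.1 v0K v1K v10.
have [q [dq Eq Edq]] := ref_pull s dp.
have J0 := jac_gt0 ndK.
have cp := @continuous_peval _ _ p.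
have cgb : continuous (fun x => dot (pevalv (pgrad p) x) (pevalv (bubble K v0 p) x)).
  by apply: continuous_dot => i; exact: continuous_pevalv.
rewrite (kint_avg ndK es (contX2 cp)) (kint_avg ndK es cp) (kint_avg ndK es cgb).
have -> : avg (@vert _ _ M \o s) (fun x => peval p x ^+ 2) = vint ref (fun y => peval q y ^+ 2).
  by apply: eq_vint => y _; rewrite Eq.
have -> : avg (@vert _ _ M \o s) (peval p) = vint ref (peval q).
  by apply: eq_vint => y _; rewrite Eq.
have -> : avg (@vert _ _ M \o s) (fun x => dot (pevalv (pgrad p) x) (pevalv (bubble K v0 p) x)) = vint ref (rvar q).
  apply: eq_vint => y _ /=; rewrite dot_grad_bubble// /rvar.
  set x := spt _ y.
  have S (f : 'I_(nvert M) -> R) : f v0 = 0 -> \sum_(v in K) f v = \sum_j f (s (lift ord0 j)).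
    by move=> f0; rewrite (isenum_sum f es) big_ord_recl s0 f0 add0r.
  rewrite !S; [|by rewrite subrr dot0r ?expr0n ?mulr0..].
  have E j : bc K x (s (lift ord0 j)) = y 0 j by rewrite (bc_spt ndK)// baryS.
  by congr (_ - _ ^+ 2); apply: eq_bigr => j _; rewrite E Edq s0.
rewrite (_ : jac K * vint ref (rvar q) + _ = jac K * (vint ref (rvar q) + vint ref (peval q) ^+ 2)); last first.
  by move: (jac K) (lt0r_neq0 J0) (vint _ _) (vint _ (peval q)) => j j0 a b; field.
by rewrite mulrCA; apply: ler_wpM2l; [exact: ltW|exact: HC].
Qed.

End PolyIneq.

(** * The broken Poincare inequality *)

Section BrokenPoincare.
Context {R : realType} {n : nat}.
Local Notation pt := 'rV[R]_n.+1.
Local Notation poly := (mpoly n.+1 R).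
Local Notation sq u := (dot u u).

Section Mesh.
Variables (M : mesh R n.+1) (Omega : set pt) (sigma D : R).
Local Notation V := 'I_(nvert M).
Local Notation vx := (@vert R n.+1 M).
Hypotheses (tri : triangulation M Omega) (s0 : 0 < sigma) (sr : shape_regular M sigma).
Hypotheses (D0 : 0 < D) (HD : forall x, closure Omega x -> enorm x <= D).

Lemma cell_shape K : K \in cells M -> shape sigma K.
Proof.
move=> KM; have ndK := cell_nondeg tri KM; split=> // v vK.
by apply: (hK_gbc_le ndK s0 _ vK); exact: sr.
Qed.

Lemma simplex_enorm K x : K \in cells M -> simplex K x -> enorm x <= D.
Proof. by move=> KM Kx; apply/HD/(simplex_closure tri KM). Qed.

Lemma enormD_le (u w : pt) : enorm (u + w) <= enorm u + enorm w.
Proof.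
rewrite -(@ler_pXn2r _ 2)// ?nnegrE ?addr_ge0 ?enorm_ge0// sqrrD !enorm_sqr.
rewrite dotDl !dotDr (dotC w u); have := dot_le u w; rewrite -mulr_natl.
by move: (enorm u * enorm w) (dot u u) (dot u w) (dot w w) => a b c d; lra.
Qed.

Lemma hK_le K : K \in cells M -> hK K <= 2 * D.
Proof.
move=> KM; have ndK := cell_nondeg tri KM.
have [v vK] : exists v, v \in K by apply/card_gt0P; rewrite ndK.1.
apply: ge_sup.
  by exists (enorm (vx v - vx v)), (vx v), (vx v); split => //; exact: simplex_vert.
move=> r [y [z [Ky Kz ->]]]; apply: le_trans (enormD_le _ _) _; rewrite enormN.
by have := lerD (simplex_enorm KM Ky) (simplex_enorm KM Kz); rewrite -mulr2n mulr_natl.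
Qed.

Lemma facet_face K F : K \in cells M -> F \in facets K -> F \in faces M.
Proof. by move=> KM FK; rewrite inE; apply/exists_inP; exists K. Qed.

Definition trace_fun (h : {set V} -> pt -> R) :=
  (forall F, F \in ifaces M -> L2F F (h F)) /\
  (forall F, F \in faces M :\: ifaces M -> h F = fun=> 0).

Lemma trace_fun_L2F h F : trace_fun h -> F \in faces M -> L2F F (h F).
Proof.
move=> [h1 h2] Ff; have [Fi|Fi] := boolP (F \in ifaces M); first exact: h1.
by rewrite h2 ?inE ?Fi ?Ff//; [exact: L2F0|rewrite !inE in Fi Ff *; rewrite Fi Ff].
Qed.

(** The facet is flat, so the identity field has a constant normal component on it; this makes its
    flux weighted by [h^2] integrable and single-valued up to sign. *)
Lemma outnormal_cst K F : K \in cells M -> F \in facets K -> exists2 s, `|s| <= D &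
  forall y, @refsimplex R n y -> dot (face_map F y) (outnormal K F) = s.
Proof.
move=> KM /imsetP[u uK ->]; have ndK := cell_nondeg tri KM.
have [a aF] : exists a, a \in K :\ u by apply/card_gt0P; rewrite (card_facet ndK).
have /andP[au aK] : (a != u) && (a \in K) by move: aF; rewrite !inE.
rewrite (outnormalE ndK uK); exists (dot (vx a) (nrm K u)); last first.
  move=> y ry; apply/eqP; rewrite -subr_eq0 -dotBl (face_dot_nrm ndK uK aK ry).
  by rewrite (negbTE au) mul0r.
have [n1 _ _] := nrm_is_normal ndK uK.
have e1 : enorm (vx a) <= D by apply: (simplex_enorm KM); exact: simplex_vert.
rewrite ler_norml; apply/andP; split.
  by rewrite lerNl -dotNl (le_trans (dot_le _ _))// enormN n1 mulr1.
by rewrite (le_trans (dot_le _ _))// n1 mulr1.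
Qed.

Lemma face_flux_cancel (g : {set V} -> pt -> R) (p : pt -> pt) :
  (forall F K, K \in cells_of F -> intgF F (fun x => g F x * dot (p x) (outnormal K F))) ->
  (forall F, F \in faces M :\: ifaces M -> g F = fun=> 0) ->
  \sum_(K in cells M) bint K (fun F x => g F x * dot (p x) (outnormal K F)) = 0.
Proof.
move=> Ig g0; rewrite /bint.
apply: (face_sum_single tri (s := fun K F => sint F (fun x => g F x * dot (p x) (outnormal K F)))).
- move=> F K L Fi KF LF KL; rewrite -mulN1r -sintZ; last exact: Ig.
  by apply: eq_sint => y _; rewrite (outnormal_opp tri KF LF KL) dotNr mulrN mulN1r.
- by move=> F K Ff KF; rewrite -[RHS](sint0 F); apply: eq_sint => y _; rewrite g0// mul0r.
Qed.

Lemma trace_flux_cancel h : trace_fun h ->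
  \sum_(K in cells M) bint K (fun F x => h F x ^+ 2 * dot x (outnormal K F)) = 0.
Proof.
move=> th; apply: (face_flux_cancel (g := fun F x => h F x ^+ 2) (p := id)).
- move=> F K KF; have KM : K \in cells M by move: KF; rewrite inE => /andP[].
  have FK : F \in facets K by move: KF; rewrite inE => /andP[].
  have [s _ Hs] := outnormal_cst KM FK.
  apply: (eq_intg (f := fun y => s * h F (face_map F y) ^+ 2)); first exact: msr_ref.
    by move=> y ry /=; rewrite Hs// mulrC.
  apply: (intgZ s (@msr_ref R n)); apply: L2F_sqr; apply: trace_fun_L2F => //.
  exact: facet_face KM FK.
- move=> F Ff; apply/funext => x; have [_ h2] := th.
  by rewrite h2// expr0n.
Qed.

(** The divergence of [w^2 x] is [n.+1 w^2] plus [2 w grad w . x]. On the boundary, [w^2] is traded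
    for [h^2], whose flux cancels in the sum over the cells, at the price of the jump [w - h]. The
    parameter [e] sets how much of the trace of [w] is to be absorbed on the left. *)
Lemma cell_poincare_step (e : R) K w (h : {set V} -> pt -> R) : 0 < e -> K \in cells M -> C1 w ->
  (forall F, F \in facets K -> L2F F (h F)) ->
  n.+1%:R * kint K (fun x => w x ^+ 2) <=
  (4^-1 + e * n.+2%:R ^+ 2 * sigma) * kint K (fun x => w x ^+ 2)
  + (4 * D ^+ 2 + e * n.+2%:R * sigma * (2 * D) ^+ 2) * kint K (fun x => sq (grad w x))
  + (e^-1 * D ^+ 2 + 2 * D ^+ 2) * ((hK K)^-1 * bint K (fun F x => (w x - h F x) ^+ 2))
  + bint K (fun F x => h F x ^+ 2 * dot x (outnormal K F)).
Proof.
move=> e0 KM Cw Lh; have ndK := cell_nondeg tri KM; have h0 := hK_gt0 ndK.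
have [_ sh] := cell_shape KM.
have cw : continuous w by case: Cw.
have cid (i : 'I_n.+1) : continuous (fun x : pt => x 0 i) by exact: coord_continuous.
have cg : continuous (fun x => sq (grad w x)) by apply: continuous_dot => i; exact: continuous_grad.
have cgx : continuous (fun x => dot (grad w x) x) by apply: continuous_dot => i; [exact: continuous_grad|exact: cid].
have cw2 : continuous (fun x => w x ^+ 2) by exact: contX2.
pose q : {ffun 'I_n.+1 -> poly} := [ffun k => mpolyX R (mnm1 k)].
have qE x : pevalv q x = x by apply/rowP => k; rewrite mxE ffunE pevalX.
have dqE x : peval (Defs.pdiv q) x = n.+1%:R.
  transitivity (\sum_(k < n.+1) (1 : R)); last by rewrite sumr_const card_ord.
  rewrite /Defs.pdiv peval_sum; apply: eq_bigr => k _.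
  rewrite -(C1g_partial _ _ (C1g_peval (q k))) (_ : peval (q k) = fun z => z 0 k).
    by rewrite (C1g_partial _ _ (C1g_coord k)) eqxx.
  by apply/funext => z; rewrite ffunE pevalX.
have Cww := C1gM (C1_C1g Cw) (C1_C1g Cw).
have G := cell_green_field ndK q (C1g_C1 Cww).
have G1 : n.+1%:R * kint K (fun x => w x ^+ 2) =
    kint K (fun x => - 2 * (w x * dot (grad w x) x)) + bint K (fun F x => w x ^+ 2 * dot x (outnormal K F)).
  have -> : bint K (fun F x => w x ^+ 2 * dot x (outnormal K F)) =
      bint K (fun F x => w x * w x * dot (pevalv q x) (outnormal K F)).
    by apply: eq_bigr => F _; congr (sint F _); apply/funext => x; rewrite qE expr2.
  rewrite -G addrCA -(kintD ndK); last 2 first.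
  - by apply: contM; [exact: contC|exact: contM].
  - apply: continuous_dot => i; first exact: continuous_grad (C1g_C1 Cww).
    exact: continuous_pevalv.
  rewrite [X in _ + X]vint_eq0 ?addr0; last first.
    move=> x _; rewrite (grad_C1g _ Cww) qE /dot !mulr_sumr -big_split/= big1// => k _.
    by rewrite !mxE; ring.
  by rewrite -(kintZ ndK)//; congr (kint K _); apply/funext => x; rewrite dqE mulrC expr2.
have B1 : kint K (fun x => - 2 * (w x * dot (grad w x) x)) <=
    4^-1 * kint K (fun x => w x ^+ 2) + 4 * D ^+ 2 * kint K (fun x => sq (grad w x)).
  rewrite -!(kintZ ndK)// -(kintD ndK); [|by apply: contM => //; exact: contC..].
  apply: (kint_le ndK).
  - by apply: contM; [exact: contC|exact: contM].
  - by apply: contD; apply: contM => //; exact: contC.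
  move=> x Kx; have hx : sq x <= D ^+ 2.
    by rewrite -enorm_sqr lerXn2r ?nnegrE ?enorm_ge0 ?(ltW D0)//; exact: simplex_enorm KM Kx.
  have := le_trans (dot_sqr_le (grad w x) x) (ler_wpM2l (dot_ge0 _) hx).
  move: (dot (grad w x) x) (w x) => b a; move: (sq _) (D ^+ 2) => c1 c2 hb.
  have := sqr_ge0 (2^-1 * a + 2 * b).
  rewrite (_ : _ ^+ 2 = 4^-1 * a ^+ 2 + 2 * (a * b) + 4 * b ^+ 2); last by field.
  by move: hb; move: (a ^+ 2) (b ^+ 2) (a * b) => *; lra.
have Fs F : F \in facets K -> sint F (fun x => w x ^+ 2 * dot x (outnormal K F)) <=
   e * (hK K * sint F (fun x => w x ^+ 2)) +
   (e^-1 * D ^+ 2 + 2 * D ^+ 2) * ((hK K)^-1 * sint F (fun x => (w x - h F x) ^+ 2)) +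
   sint F (fun x => h F x ^+ 2 * dot x (outnormal K F)).
  move=> FK; have [s sD Hs] := outnormal_cst KM FK.
  have Lw : L2F F w by exact: L2F_cont.
  have I1 := L2F_sqr Lw; have I2 := L2F_sqr (Lh F FK); have I3 := L2F_sqr (L2FB Lw (Lh F FK)).
  rewrite -[X in X <= _](_ : s * sint F (fun x => w x ^+ 2) = _); last first.
    by rewrite -sintZ//; apply: eq_sint => y ry; rewrite Hs// mulrC.
  rewrite -[X in _ <= _ + X](_ : s * sint F (fun x => h F x ^+ 2) = _); last first.
    by rewrite -sintZ//; apply: eq_sint => y ry; rewrite Hs// mulrC.
  rewrite -lerBlDr -mulrBr -sintB// -(sintZ s (intgFB I1 I2)).
  rewrite [e * (_ * sint _ _)]mulrA [_ * ((hK K)^-1 * _)]mulrA -(sintZ (e * hK K) I1) -(sintZ _ I3) -sintD; [|exact: intgFZ..].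
  apply: le_sint.
  - by apply: intgFZ; exact: intgFB.
  - by apply: intgFD; exact: intgFZ.
  move=> y _; move: (w _) (h F _) => a b; move: (hK_le KM) sD h0; move: (hK K) => t tD sD t0.
  have s2 : s ^+ 2 <= D ^+ 2 by rewrite -real_normK ?num_real// lerXn2r ?nnegrE// ltW.
  (* From [a^2 - b^2 = 2 a (a - b) - (a - b)^2]: Young with weight [e t] for the first term,
     [|s| <= D <= 2 D^2 / t] for the second since [t = hK K] is at most [2 D]. *)
  have H1 : 2 * (s * (a * (a - b))) <= e * t * a ^+ 2 + (e^-1 * D ^+ 2) * t^-1 * (a - b) ^+ 2.
    apply: (@le_trans _ _ (e * t * a ^+ 2 + (e * t)^-1 * (s * (a - b)) ^+ 2)).
      rewrite -subr_ge0 (_ : _ - _ = (e * t)^-1 * (e * t * a - s * (a - b)) ^+ 2).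
        by rewrite mulr_ge0 ?sqr_ge0// invr_ge0 mulr_ge0// ltW.
      by field; rewrite !gt_eqF.
    rewrite lerD2l exprMn (_ : e^-1 * _ * _ * _ = (e * t)^-1 * (D ^+ 2 * (a - b) ^+ 2)).
      by apply: ler_wpM2l; [rewrite invr_ge0 mulr_ge0// ltW|apply: ler_wpM2r => //; exact: sqr_ge0].
    by rewrite invfM; ring.
  have H2 : - (s * (a - b) ^+ 2) <= 2 * D ^+ 2 * t^-1 * (a - b) ^+ 2.
    rewrite -mulNr ler_wpM2r ?sqr_ge0//; apply: (@le_trans _ _ D).
      by move: sD; rewrite ler_norml lerNl => /andP[].
    by rewrite ler_pdivlMr// (_ : 2 * D ^+ 2 = D * (2 * D)) ?ler_pM2l//; ring.
  have -> : s * (a ^+ 2 - b ^+ 2) = 2 * (s * (a * (a - b))) + - (s * (a - b) ^+ 2) by ring.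
  have := lerD H1 H2; congr (_ <= _); ring.
have B2 : bint K (fun F x => w x ^+ 2 * dot x (outnormal K F)) <=
   e * (n.+2%:R * (sigma * (n.+2%:R * kint K (fun x => w x ^+ 2) + hK K ^+ 2 * kint K (fun x => sq (grad w x))))) +
   (e^-1 * D ^+ 2 + 2 * D ^+ 2) * ((hK K)^-1 * bint K (fun F x => (w x - h F x) ^+ 2)) +
   bint K (fun F x => h F x ^+ 2 * dot x (outnormal K F)).
  apply: le_trans (ler_sum _ Fs) _; rewrite !big_split/= -!mulr_sumr; do 2 apply: lerD => //.
  apply: ler_wpM2l; first exact: ltW.
  rewrite mulr_sumr (_ : \sum_(F in facets K) _ = \sum_(v in K) hK K * sint (K :\ v) (fun x => w x ^+ 2)); last first.
    have := bintE K (fun F x => w x ^+ 2); rewrite /bint -!mulr_sumr => ->//.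
  rewrite mulr_natl -[X in _ *+ X]ndK.1 -sumr_const; apply: ler_sum => v vK.
  exact: (cell_trace_C1 ndK s0 (sh v vK) Cw vK).
have B3 : hK K ^+ 2 * kint K (fun x => sq (grad w x)) <= (2 * D) ^+ 2 * kint K (fun x => sq (grad w x)).
  apply: ler_wpM2r; first by apply: kint_ge0 => x _; exact: dot_ge0.
  by rewrite lerXn2r ?nnegrE ?(ltW h0) ?mulr_ge0 ?(ltW D0)//; exact: hK_le.
rewrite G1; apply: le_trans (lerD B1 B2) _.
rewrite addrA lerD2r addrA lerD2r.
have B4 := ler_wpM2l (_ : 0 <= e * n.+2%:R * sigma) B3.
rewrite !mulr_ge0 ?(ltW e0) ?(ltW s0)// in B4; move: (B4 isT).
move: (kint K _) (kint K _) (hK K ^+ 2) (D ^+ 2) ((2 * D) ^+ 2) (n.+2%:R) => a g t2 d2 dd N HB.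
rewrite -subr_ge0; move: HB; rewrite -subr_ge0.
by congr (0 <= _); ring.
Qed.

End Mesh.

Lemma broken_poincare (sigma D : R) : 0 < sigma -> 0 < D -> exists2 C, 0 < C &
  forall (M : mesh R n.+1) (Omega : set pt), triangulation M Omega -> shape_regular M sigma ->
  (forall x, closure Omega x -> enorm x <= D) ->
  forall (w : {set 'I_(nvert M)} -> pt -> R) h, (forall K, K \in cells M -> C1 (w K)) -> trace_fun h ->
  \sum_(K in cells M) kint K (fun x => w K x ^+ 2) <=
  C * (\sum_(K in cells M) kint K (fun x => sq (grad (w K) x)) +
       \sum_(K in cells M) (hK K)^-1 * bint K (fun F x => (w K x - h F x) ^+ 2)).
Proof.
(* The square of [w] then comes back with factor 1/4 + 1/4 = 1/2, which is absorbed by [n.+1]; what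
   remains is at most twice the other terms. *)
move=> s0 D0; pose e := (4 * n.+2%:R ^+ 2 * sigma)^-1.
have e0 : 0 < e by rewrite invr_gt0 !mulr_gt0// exprn_gt0.
pose A := 4 * D ^+ 2 + e * n.+2%:R * sigma * (2 * D) ^+ 2; pose B := e^-1 * D ^+ 2 + 2 * D ^+ 2.
have A0 : 0 < A by rewrite addr_gt0 ?mulr_gt0 ?exprn_gt0// mulr_gt0.
have B0 : 0 < B by rewrite addr_gt0 ?mulr_gt0 ?exprn_gt0// invr_gt0.
exists (2 * (A + B)); first by rewrite mulr_gt0// addr_gt0.
move=> M Omega tri sr HD w h Cw th.
set a := \sum_(K in cells M) _; set g := \sum_(K in cells M) kint K _; set j := \sum_(K in cells M) _ * _.
have a0 : 0 <= a by apply: sumr_ge0 => K _; apply: kint_ge0 => x _; exact: sqr_ge0.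
have g0 : 0 <= g by apply: sumr_ge0 => K _; apply: kint_ge0 => x _; exact: dot_ge0.
have j0 : 0 <= j.
  apply: sumr_ge0 => K KM; rewrite mulr_ge0 ?invr_ge0 ?(ltW (hK_gt0 (cell_nondeg tri KM)))//.
  by apply: sumr_ge0 => F _; apply: sint_ge0 => x; exact: sqr_ge0.
have : n.+1%:R * a <= (4^-1 + e * n.+2%:R ^+ 2 * sigma) * a + A * g + B * j.
  rewrite -[leRHS]addr0 -(trace_flux_cancel tri HD th) /a /g /j !mulr_sumr -!big_split/=.
  apply: ler_sum => K KM; apply: (cell_poincare_step tri s0 sr D0 HD e0 KM (Cw K KM)) => F FK.
  exact: trace_fun_L2F th (facet_face KM FK).
have -> : e * n.+2%:R ^+ 2 * sigma = 4^-1.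
  have : n.+2%:R != 0 :> R by rewrite pnatr_eq0.
  by rewrite /e; move: (n.+2%:R) (lt0r_neq0 s0) => N s1 N1; field; rewrite N1 s1.
have : a <= n.+1%:R * a by rewrite ler_peMl// ler1n.
have Ag : A * j >= 0 by rewrite mulr_ge0// ltW.
have Bg : B * g >= 0 by rewrite mulr_ge0// ltW.
move: Ag Bg; move: (n.+1%:R * a) => t Ag Bg; lra.
Qed.

End BrokenPoincare.

(** * Consistency *)

Section Boxes.
Context {R : realType}.
Local Notation T := (measurableTypeR R).

Definition openbox n (a b : 'I_n -> R) : set 'rV[R]_n := [set x | forall i, a i < x 0 i < b i].

Definition boxes n : set (set (n.-tuple T)) :=
  [set A | exists a b, A = @rowt R n @^-1` openbox a b].

Lemma openboxE n (a b : 'I_n -> R) :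
  @rowt R n @^-1` openbox a b = [set t : n.-tuple T | forall i, [set` `]a i, b i[ ] (tnth t i)].
Proof. by apply/seteqP; split => t /= H i; move: (H i); rewrite mxE in_itv. Qed.

Lemma msr_openbox n (a b : 'I_n -> R) : msr (openbox a b).
Proof. rewrite /msr openboxE; apply: (@measurable_box R n (fun i => [set` `]a i, b i[ ])) => i.
exact: measurable_itv. Qed.

Lemma boxes_setI n : setI_closed (@boxes n).
Proof.
move=> _ _ [a [b ->]] [a' [b' ->]].
exists (fun i => Num.max (a i) (a' i)), (fun i => Num.min (b i) (b' i)).
rewrite -preimage_setI; congr (_ @^-1` _); apply/seteqP; split => x.
  by move=> [H H'] i; have /andP[h1 h2] := H i; have /andP[h3 h4] := H' i; rewrite gt_max lt_min h1 h2 h3 h4.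
move=> H; split => i; have := H i; rewrite gt_max lt_min => /andP[/andP[h1 h2] /andP[h3 h4]].
  by rewrite h1 h3.
by rewrite h2 h4.
Qed.

Lemma boxes_generate n : (measurable : set (set (n.-tuple T))) = <<s @boxes n >>.
Proof.
apply/seteqP; split; last first.
  apply: smallest_sub; first exact: sigma_algebra_measurable.
  by move=> _ [a [b ->]]; exact: msr_openbox.
have sG : sigma_algebra [set: n.-tuple T] <<s @boxes n >> by exact: smallest_sigma_algebra.
apply: smallest_sub => //.
elim/big_ind : _ => //; first by move=> A B HA HB; rewrite subUset.
move=> i _ A [B mB <-].
have mB' : (@RGenOInfty.G R).-sigma.-measurable B by rewrite -RGenOInfty.measurableE.
have : preimage_set_system setT (fun t : n.-tuple T => (tnth t i : R)) (@RGenOInfty.G R).-sigma.-measurable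
    (setT `&` (fun t : n.-tuple T => (tnth t i : R)) @^-1` B) by exists B.
rewrite -g_sigma_preimageE; apply: smallest_sub => // _ [_ [x ->] <-].
rewrite setTI (_ : _ @^-1` _ = \bigcup_k
    (@rowt R n @^-1` openbox (fun j => if j == i then x else - k%:R) (fun _ => k%:R))).
  by apply: sigma_algebra_bigcup => k; apply: sub_sigma_algebra; eexists; eexists.
apply/seteqP; split => t /=; last first.
  by move=> [k _ /(_ i)]; rewrite eqxx mxE in_itv/= andbT => /andP[].
rewrite in_itv/= andbT => xt.
have [k Hk] : exists k : nat, forall j, `|tnth t j : R| < k%:R.
  exists (Num.truncn (\sum_j `|tnth t j : R|)).+1 => j.
  by apply: le_lt_trans (truncnS_gt _); rewrite (bigD1 j)//= lerDl sumr_ge0.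
exists k => // j; rewrite mxE; have := Hk j; rewrite ltr_norml => /andP[h1 h2].
by case: eqP => [->|_]; rewrite ?xt/= ?h1 ?h2//; have := Hk i; rewrite ltr_norml => /andP[].
Qed.

(** Boxes are stable under intersection and generate the measurable sets, so by Dynkin's theorem the
    integral vanishes on every measurable set. The bound [c] on the support makes the whole space as
    good as a box. *)
Lemma box_ae_eq0 n (f : 'rV[R]_n -> R) (c : R) : intg setT f ->
  (forall x, f x != 0 -> forall i, `|x 0 i| < c) ->
  (forall a b, vint (openbox a b) f = 0) -> ae_in setT (fun x => f x = 0).
Proof.
move=> If fc H.
pose phi (t : n.-tuple T) := (f (rowt t))%:E.
have If' : (lebn n).-integrable setT phi by exact: If.
have mphi : measurable_fun setT phi by case/integrableP: If'.
pose P : set_system (n.-tuple T) := fun S => (\int[lebn n]_(t in S) phi t = 0)%E.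
have IS S : measurable S -> (lebn n).-integrable S phi.
  by move=> mS; apply: integrableS If' => //; exact: measurableT.
have PG S : boxes S -> P S.
  move=> [a [b ->]]; have := H a b; rewrite /vint /Rintegral => H0.
  have := integrable_fin_num (msr_openbox a b) (IS _ (msr_openbox a b)).
  by move=> fin; rewrite /P -(fineK fin) H0.
have PT : P setT.
  have := PG _ (ex_intro _ (fun=> - c) (ex_intro _ (fun=> c) erefl)).
  rewrite /P => E; rewrite -[RHS]E [RHS]integral_mkcond; apply: eq_integral => t _.
  rewrite /patch; case: ifPn => // tB.
  apply: contrapT => /eqP; rewrite eqe => f0; move: tB; rewrite notin_setE; apply => i.
  by have := fc _ f0 i; rewrite ltr_norml => /andP[-> ->].
have PA S : measurable S -> P S.
  rewrite {1}boxes_generate => HS.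
  apply: (dynkin_induction (@boxes_generate n) (@boxes_setI n) PT PG _ _ HS).
    move=> A mA PA; have mCA := measurableC mA.
    have := @integral_setU _ _ R (lebn n) A (~` A) phi mA mCA.
    rewrite setUCr => /(_ mphi); rewrite /P in PT PA *; rewrite PT PA add0e => <-//.
    by apply/disj_setPCl.
  move=> F mF tF PF; rewrite /P integral_bigcup//; last first.
    by apply: IS; exact: bigcupT_measurable.
  by apply: eseries0 => i _ _; exact: PF.
have := @integral_ae_eq _ _ R (lebn n) setT measurableT (cst 0%E) phi If' (measurable_cst _).
have HE : (forall E : set (n.-tuple T), E `<=` setT -> measurable E ->
    (\int[lebn n]_(x in E) phi x = \int[lebn n]_(x in E) cst 0%E x)%E).
  by move=> E _ mE; rewrite (PA E mE) integral0.
move=> /(_ HE); apply: filterS => t /(_ I) /= []; by move=> ->.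
Qed.

End Boxes.

(** * A C^1 cut-off function *)

Section Ramp.
Context {R : realType}.
Implicit Types t h : R.

(** The square of the positive part is C^1, and its Taylor remainder of first order is at most
    [h ^+ 2]. The ramp is half of its second difference. *)
Definition pp t : R := Num.max t 0 ^+ 2.

Lemma pp_taylor t h : `|pp (t + h) - pp t - 2 * Num.max t 0 * h| <= h ^+ 2.
Proof.
rewrite /pp ler_norml; have [t0|t0] := leP t 0; have [th0|th0] := leP (t + h) 0.
all: by apply/andP; split; nra.
Qed.

(* A C^1 ramp from 0 (on [t <= 0]) to 1 (on [t >= 2]). *)
Definition ramp t : R := (pp t - 2 * pp (t - 1) + pp (t - 2)) / 2.

Lemma ramp_le0 t : t <= 0 -> ramp t = 0.
Proof.
move=> t0; rewrite /ramp /pp (max_r t0) (max_r (_ : t - 1 <= 0)) ?(max_r (_ : t - 2 <= 0)); last 2 first.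
- lra.
- lra.
by rewrite expr0n !mulr0 subrr addr0 mul0r.
Qed.

Lemma ramp_ge2 t : 2 <= t -> ramp t = 1.
Proof.
move=> t2; rewrite /ramp /pp (max_l (_ : 0 <= t)) ?(max_l (_ : 0 <= t - 1)) ?(max_l (_ : 0 <= t - 2)).
- by field.
- lra.
- lra.
- lra.
Qed.

Lemma ramp01 t : 0 <= ramp t <= 1.
Proof.
have [t0|t0] := leP t 0; first by rewrite ramp_le0 ?lexx ?ler01.
have [t2|t2] := leP 2 t; first by rewrite ramp_ge2 ?lexx ?ler01.
rewrite /ramp /pp (max_l (ltW t0)) (max_r (_ : t - 2 <= 0)); last by lra.
have [t1|t1] := leP (t - 1) 0; apply/andP; split; nra.
Qed.

Lemma ramp_ge0 t : 0 <= ramp t.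
Proof. by case/andP: (ramp01 t). Qed.

Lemma ramp_le1 t : ramp t <= 1.
Proof. by case/andP: (ramp01 t). Qed.

Lemma is_derive_taylor n (f : 'rV[R]_n -> R) (x v : 'rV[R]_n) (D C : R) :
  (forall h, `|f (h *: v + x) - f x - h * D| <= C * h ^+ 2) -> is_derive x v f D.
Proof.
move=> H.
have C0 : 0 <= C.
  have := H 1; rewrite expr1n mulr1; exact: le_trans (normr_ge0 _).
have cv : (fun h => h^-1 *: ((f \o shift x) (h *: v) - f x)) @ (0 : R)^' --> D.
  apply/cvgrPdist_le => e e0; near=> h.
  have h0 : h != 0 by near: h; exact: nbhs_dnbhs_neq.
  have hn : 0 < `|h| by rewrite normr_gt0.
  rewrite -(ler_pM2r hn) -normrM mulrBl distrC.
  rewrite [X in X - _](_ : _ = f (h *: v + x) - f x) 1?[D * h]mulrC; last first.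
    by rewrite /= /GRing.scale /= mulrAC mulVf// mul1r.
  apply: (le_trans (H h)); rewrite -real_normK ?num_real// expr2 mulrA ler_pM2r//.
  have : `|h| <= e / (C + 1).
    near: h; apply: dnbhs0_le; rewrite divr_gt0// ltr_wpDl//.
  rewrite ler_pdivlMr ?ltr_wpDl//; apply: le_trans.
  by rewrite mulrC ler_wpM2l// lerDl.
have dv : derivable f x v by apply/cvg_ex; exists D.
by apply: DeriveDef => //; apply/cvg_lim.
Unshelve. all: by end_near.
Qed.

Lemma C1_pp n (a : R) (G : 'rV[R]_n) : C1 (fun x => pp (a + dot G x)).
Proof.
apply: (C1g_C1 (g := fun i x => 2 * Num.max (a + dot G x) 0 * G 0 i)).
have ca : continuous (fun x => a + dot G x) by apply: contD; [exact: contC|exact: continuous_dotr].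
have cm : continuous (fun x => Num.max (a + dot G x) 0).
  move=> x; exact: (@continuous_max R _ (fun x => a + dot G x) (fun=> 0) x (ca x) (@contC R _ 0 x)).
split; last first.
  split; first by apply: contX2.
  by move=> i; apply: contM; [apply: contM => //; exact: contC|exact: contC].
move=> i x; apply: (is_derive_taylor (C := G 0 i ^+ 2)) => h.
rewrite dotDr dotZr dot_deltar [h * _ + _]addrC addrA.
have := pp_taylor (a + dot G x) (h * G 0 i); rewrite exprMn [h ^+ 2 * _]mulrC.
by rewrite (_ : h * (2 * _ * _) = 2 * Num.max (a + dot G x) 0 * (h * G 0 i))//; ring.
Qed.

Lemma C1M n (f g : 'rV[R]_n -> R) : C1 f -> C1 g -> C1 (fun x => f x * g x).
Proof. by move=> cf cg; exact: C1g_C1 (C1gM (C1_C1g cf) (C1_C1g cg)). Qed.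

Lemma C1D n (f g : 'rV[R]_n -> R) : C1 f -> C1 g -> C1 (fun x => f x + g x).
Proof. by move=> cf cg; exact: C1g_C1 (C1gD (C1_C1g cf) (C1_C1g cg)). Qed.

Lemma C1_cst n (a : R) : C1 (fun _ : 'rV[R]_n => a).
Proof. exact: C1g_C1 (@C1g_cst R n a). Qed.

Lemma C1_prod n (I : Type) (s : seq I) (P : pred I) (f : I -> 'rV[R]_n -> R) :
  (forall i, C1 (f i)) -> C1 (fun x => \prod_(i <- s | P i) f i x).
Proof.
move=> Cf; elim: s => [|i s IH].
  by rewrite (_ : (fun x => _) = fun=> 1); [exact: C1_cst|apply/funext => x; rewrite big_nil].
rewrite (_ : (fun x => _) = fun x => (if P i then f i x else 1) * \prod_(i <- s | P i) f i x).
  by apply: C1M; [case: (P i); [exact: Cf|exact: C1_cst]|exact: IH].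
by apply/funext => x; rewrite big_cons; case: ifP; rewrite ?mul1r.
Qed.

Lemma C1_ramp n (a : R) (G : 'rV[R]_n) : C1 (fun x => ramp (a + dot G x)).
Proof.
rewrite (_ : (fun x => _) = fun x => 2^-1 * (pp (a + dot G x) + (-2 * pp (a - 1 + dot G x) + pp (a - 2 + dot G x)))).
  apply: C1M; first exact: C1_cst.
  apply: C1D; first exact: C1_pp.
  by apply: C1D; [apply: C1M; [exact: C1_cst|exact: C1_pp]|exact: C1_pp].
apply/funext => x; rewrite /ramp.
rewrite (_ : a + dot G x - 1 = a - 1 + dot G x); last by ring.
rewrite (_ : a + dot G x - 2 = a - 2 + dot G x); last by ring.
by field.
Qed.

End Ramp.

(** * Test functions concentrated near an interior face *)

Section NormalJump.
Context {R : realType} {n : nat} (M : mesh R n.+1) (Omega : set 'rV[R]_n.+1).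
Local Notation V := 'I_(nvert M).
Local Notation pt := 'rV[R]_n.+1.
Local Notation vx := (@vert R n.+1 M).
Hypotheses (polyO : polyhedral_domain Omega) (tri : triangulation M Omega).
Variables (K L F : {set V}) (v w : V).
Hypotheses (KM : K \in cells M) (LM : L \in cells M) (KL : K != L) (vK : v \in K) (wL : w \in L).
Hypotheses (FK : F = K :\ v) (FL : F = L :\ w).
Let ndK : nondeg K := cell_nondeg tri KM.
Let ndL : nondeg L := cell_nondeg tri LM.

Lemma face_bcspec (J : {set V}) (y : 'rV[R]_n) (s : 'I_n.+1 -> V) : isenum s F -> F \subset J ->
  bcspec J (spt (vx \o s) y) (fun u => \sum_(i | s i == u) bary y i).
Proof.
move=> es FJ; split.
- move=> u uJ; apply: big1 => i /eqP iu; move: uJ; rewrite -iu.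
  by rewrite (fintype.subsetP FJ _ (isenum_mem i es)).
- rewrite -(sum_bary y) (exchange_big_dep xpredT)//=; apply: eq_bigr => i _.
  by rewrite (big_pred1 (s i))// => u; rewrite eq_sym.
- rewrite /spt (partition_big s xpredT)//=; apply: eq_bigr => u _.
  by rewrite scaler_suml; apply: eq_bigr => i /eqP <-.
Qed.

Lemma face_bc (J : {set V}) (y : 'rV[R]_n) (s : 'I_n.+1 -> V) i : nondeg J -> isenum s F -> F \subset J ->
  bc J (spt (vx \o s) y) (s i) = bary y i.
Proof.
move=> ndJ es FJ; rewrite (bc_uniq ndJ (face_bcspec y es FJ)).
by rewrite (big_pred1 i)// => j /=; rewrite (inj_eq es.1).
Qed.

Lemma F_subK : F \subset K. Proof. by rewrite FK finset.subsetDl. Qed.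
Lemma F_subL : F \subset L. Proof. by rewrite FL finset.subsetDl. Qed.

(** An open neighborhood of the relative interior of [F]. The coordinates of the two opposite
    vertices are left free, so that it extends to both sides of the face. *)
Definition fcore := [set x : pt | forall a : V, a \in F -> 0 < bc K x a /\ 0 < bc L x a].

(** The free coordinates at [v] and [w] are negative multiples of the distances along the two
    normals, which are opposite; so one of them is nonnegative. *)
Lemma fcore_sub x : fcore x -> simplex K x \/ simplex L x.
Proof.
move=> Hx; have [a aF] : exists a, a \in F by apply/card_gt0P; rewrite FK (card_facet ndK).
have := outnormal_opp tri (F := F) (K := K) (L := L).
rewrite !inE KM LM (facetE vK FK) (facetE wL FL) => /(_ isT isT KL).
rewrite {1}FL FK (outnormalE ndK)// (outnormalE ndL)// => nE.
have aK : a \in K by apply: (fintype.subsetP F_subK).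
have aL : a \in L by apply: (fintype.subsetP F_subL).
have va : v != a by apply: contraTneq aF => <-; rewrite FK !inE eqxx.
have wa : w != a by apply: contraTneq aF => <-; rewrite FL !inE eqxx.
have G0 := enorm_gt0 (gbc_neq0 ndK vK); have H0 := enorm_gt0 (gbc_neq0 ndL wL).
have bE J u : nondeg J -> u \in J -> a \in J -> u != a -> bc J x u = - enorm (gbc J u) * dot (nrm J u) (x - vx a).
  move=> ndJ uJ aJ ua; rewrite -[LHS]subr0 -[X in _ - X](_ : bc J (vx a) u = 0); last first.
    by rewrite (bc_vert ndJ)// eq_sym (negbTE ua).
  rewrite (bcB ndJ) /nrm dotNl dotZl mulrNN mulrA mulfV ?mul1r// gt_eqF//.
  exact: enorm_gt0 (gbc_neq0 ndJ uJ).
have [d0|d0] := leP (dot (nrm K v) (x - vx a)) 0.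
- left; apply/(simplexKE ndK) => u; have [uK|uK] := boolP (u \in K); last by rewrite (bc_notin ndK).
  have [->|uv] := eqVneq u v; first by rewrite bE// mulNr oppr_ge0 mulr_ge0_le0// ltW.
  by have [|/ltW] := Hx u; rewrite ?FK ?inE ?uv.
- right; apply/(simplexKE ndL) => u; have [uL|uL] := boolP (u \in L); last by rewrite (bc_notin ndL).
  have [->|uw] := eqVneq u w; first by rewrite bE// nE dotNl mulrNN mulr_ge0// ltW.
  by have [|_ /ltW] := Hx u; rewrite ?FL ?inE ?uw.
Qed.

Lemma open_fcore : open fcore.
Proof.
rewrite (_ : fcore = [set x | forall a : V, 0 < (if a \in F then bc K x a else 1)] `&`
  [set x | forall a : V, 0 < (if a \in F then bc L x a else 1)]).
  by apply: openI; apply: open_pos_forall => a; case: (a \in F); [exact: continuous_bc|exact: contC|exact: continuous_bc|exact: contC].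
apply/seteqP; split => [x H|x [H1 H2] a aF]; last by have := H1 a; have := H2 a; rewrite aF.
by split => a; case: ifPn => // /H[].
Qed.

Lemma fcore_domain : fcore `<=` Omega.
Proof.
apply: subset_trans (domain_regular polyO) => x Hx.
apply: (filterS _ (open_nbhs_nbhs (conj open_fcore Hx))) => z Hz.
by case: (fcore_sub Hz) => H; [exact: (simplex_closure tri KM)|exact: (simplex_closure tri LM)].
Qed.

(** By conformity a point common to [J] and to [K] or [L] has the same barycentric coordinates in
    both cells. Those of the vertices of [F] are positive, so these vertices belong to [G], and the
    cardinalities agree. *)
Lemma fcore_face G J x : J \in cells M -> G \in facets J -> simplex G x -> fcore x -> G = F.
Proof.
move=> JM /imsetP[u uJ EG] Gx Hx; have ndJ := cell_nondeg tri JM.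
have GJ : G \subset J by rewrite EG finset.subsetDl.
have [b0 bG] := (simplexE ndJ x GJ).1 Gx.
have Jx : simplex J x by apply/(simplexKE ndJ).
have cF : #|F| = #|G| by rewrite FK EG !card_facet.
have key I : I \in cells M -> simplex I x -> (forall a, a \in F -> 0 < bc I x a) -> G = F.
  move=> IM Ix pos; have ndI := cell_nondeg tri IM; have [_ _ triI] := tri.
  have : simplex (I :&: J) x by rewrite -triI.
  move=> /(simplexE ndI _ (finset.subsetIl _ _))[_ HI].
  have E : bc J x = bc I x.
    apply: (bc_uniq ndJ); split; [|exact: bc_sum|exact: bc_comb].
    by move=> z zJ; apply: HI; rewrite inE (negbTE zJ) andbF.
  apply/eqP; rewrite eq_sym eqEcard cF leqnn andbT; apply/fintype.subsetP => a aF.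
  by apply: contraT => aG; have := pos a aF; rewrite -E bG// ltxx.
case: (fcore_sub Hx) => ?; [apply: (key K)|apply: (key L)] => //.
- by move=> a /Hx[].
- by move=> a /Hx[].
Qed.

Section TestFunction.
Variables (al be : V -> R) (m : nat).
Hypothesis al0 : forall a, 0 <= al a.

(** As [m] grows, the restriction to [F] tends to the indicator of the points whose coordinates lie
    strictly between [al] and [be]. The shift by 1 together with [al >= 0] keeps the support where
    the coordinates are at least 1/(m+1), away from all other faces. Lower cut-offs use both cells,
    so the support stays in [fcore]; an upper cut-off from one cell suffices. *)
Definition bump (x : pt) : R := \prod_(a in F)
  (ramp (m.+1%:R * (bc K x a - al a) - 1) * ramp (m.+1%:R * (bc L x a - al a) - 1) *
   ramp (m.+1%:R * (be a - bc K x a))).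

Lemma C1_bump : C1 bump.
Proof.
apply: C1_prod => a; have N : forall J b c, nondeg J -> C1 (fun x => ramp (b + c * bc J x a)).
  move=> J b c ndJ; rewrite (_ : (fun x => _) = fun x => ramp ((b + c * bc J 0 a) + dot (c *: gbc J a) x)).
    exact: C1_ramp.
  by apply/funext => x; rewrite (bcE ndJ x) dotZl mulrDr addrA.
apply: C1M; first apply: C1M.
- rewrite (_ : (fun x => _) = fun x => ramp (- m.+1%:R * al a - 1 + m.+1%:R * bc K x a)); first exact: N.
  by apply/funext => x; congr ramp; ring.
- rewrite (_ : (fun x => _) = fun x => ramp (- m.+1%:R * al a - 1 + m.+1%:R * bc L x a)); first exact: N.
  by apply/funext => x; congr ramp; ring.
- rewrite (_ : (fun x => _) = fun x => ramp (m.+1%:R * be a + - m.+1%:R * bc K x a)); first exact: N.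
  by apply/funext => x; congr ramp; ring.
Qed.

Definition bump_supp := [set x : pt | forall a : V, a \in F -> m.+1%:R^-1 <= bc K x a /\ m.+1%:R^-1 <= bc L x a].

Lemma bump_neq0 x : bump x != 0 -> bump_supp x.
Proof.
have m0 : 0 < m.+1%:R :> R by rewrite ltr0n.
have key t a : ramp (m.+1%:R * (t - al a) - 1) != 0 -> m.+1%:R^-1 <= t.
  apply: contra_neqT; rewrite -ltNge => tm; apply: ramp_le0.
  rewrite subr_le0 mulrC -ler_pdivlMr// mul1r.
  by rewrite (le_trans _ (ltW tm))// lerBlDr lerDl.
move/prodf_neq0 => H a aF; have := H a aF.
rewrite mulf_eq0 negb_or => /andP[+ _]; rewrite mulf_eq0 negb_or => /andP[h1 h2].
by split; [exact: key h1|exact: key h2].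
Qed.

Lemma bump_supp_core : bump_supp `<=` fcore.
Proof. by move=> x H a /H[h1 h2]; split; [apply: lt_le_trans h1|apply: lt_le_trans h2]; rewrite invr_gt0 ltr0n. Qed.

Lemma compact_bump_supp : compact bump_supp.
Proof.
pose B := vbnd M.
apply: (@subclosed_compact _ _ [set x : pt | forall i, (`[- B, B]%classic : set R) (x 0 i)]).
- rewrite (_ : bump_supp = (\bigcap_(a in [set a | a \in F]) [set x : pt | m.+1%:R^-1 <= bc K x a]) `&`
     (\bigcap_(a in [set a | a \in F]) [set x : pt | m.+1%:R^-1 <= bc L x a])); last first.
    apply/seteqP; split => [x H|x [H1 H2] a aF]; last by split; [exact: H1|exact: H2].
    by split => a /H[].
  apply: closedI; apply: closed_bigI => a _.
  + apply: (@preimage_closed _ _ (fun x : pt => bc K x a) [set r | m.+1%:R^-1 <= r]); last exact: closed_ge.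
    by move=> x _; exact: continuous_bc.
  + apply: (@preimage_closed _ _ (fun x : pt => bc L x a) [set r | m.+1%:R^-1 <= r]); last exact: closed_ge.
    by move=> x _; exact: continuous_bc.
- by apply: (@rV_compact R n.+1 (fun=> `[- B, B]%classic)) => i; exact: segment_compact.
- move=> x /bump_supp_core/fcore_sub H i /=; rewrite in_itv/= -ler_norml.
  by case: H => H; exact: bounded_simplex H i.
Qed.

Lemma C1c_bump : C1c Omega bump.
Proof.
split; first exact: C1_bump.
exists bump_supp; split; first exact: compact_bump_supp.
- exact: subset_trans bump_supp_core fcore_domain.
- by move=> x nx; apply/eqP; apply: contrapT => /negP/bump_neq0.
Qed.

Lemma bump01 x : 0 <= bump x <= 1.
Proof.
apply/andP; split.
  apply: prodr_ge0 => a _.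
  by apply: mulr_ge0; [apply: mulr_ge0; exact: ramp_ge0|exact: ramp_ge0].
apply: prodr_ile1 => a _; apply/andP; split.
  by apply: mulr_ge0; [apply: mulr_ge0; exact: ramp_ge0|exact: ramp_ge0].
apply: mulr_ile1; [|exact: ramp_ge0| |exact: ramp_le1].
  by apply: mulr_ge0; exact: ramp_ge0.
by apply: mulr_ile1; [exact: ramp_ge0|exact: ramp_ge0|exact: ramp_le1|exact: ramp_le1].
Qed.

Lemma bump_face G J y : J \in cells M -> G \in facets J -> G != F -> @refsimplex R n y ->
  bump (face_map G y) = 0.
Proof.
move=> JM GJ GF ry; apply/eqP; apply: contraNT GF => /bump_neq0/bump_supp_core Hx.
apply/eqP; apply: (fcore_face JM GJ _ Hx).
by case/imsetP: GJ => u uJ ->; apply: face_map_simplex => //; exact: cell_nondeg tri _ JM.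
Qed.

End TestFunction.

End NormalJump.

Section NormalJump.
Context {R : realType} {n : nat} (M : mesh R n.+1) (Omega : set 'rV[R]_n.+1) (D : R).
Local Notation V := 'I_(nvert M).
Local Notation pt := 'rV[R]_n.+1.
Local Notation vx := (@vert R n.+1 M).
Local Notation ref := (@refsimplex R n).
Hypotheses (polyO : polyhedral_domain Omega) (tri : triangulation M Omega).
Hypothesis HD : forall x, closure Omega x -> forall k, `|x 0 k| <= D.
Variables (p : pt -> pt) (f : pt -> R) (pn : {set V} -> {set V} -> pt -> R).
Hypotheses (Lf : L2 Omega f) (Lp : L2v Omega p) (wd : weak_div Omega p f).
Hypothesis ntr : forall J, J \in cells M -> is_normal_trace J p f (pn J).

Lemma domain_L2 g : continuous g -> L2 Omega g.
Proof.
move=> cg; apply: (L2_cont (M := D)) => //; first by apply: msr_open; exact: domain_open.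
by move=> x Ox; apply: HD; exact: subset_closure.
Qed.

(** Summing the Green formulas that define the normal traces recovers the integral over [Omega],
    which the weak divergence makes zero. *)
Lemma weak_div_faces b : C1c Omega b ->
  \sum_(J in cells M) bint J (fun G x => pn J G x * b x) = 0.
Proof.
move=> Cb; have mO : msr Omega by apply: msr_open; exact: domain_open.
have cb : continuous b by case: Cb => -[].
have I1 : intg Omega (fun x => dot (p x) (grad b x)).
  by apply: intg_dot => // i; apply: domain_L2; apply: continuous_grad; case: Cb.
have I2 : intg Omega (fun x => f x * b x) by apply: L2_mul => //; exact: domain_L2.
transitivity (\sum_(J in cells M) kint J (fun x => dot (p x) (grad b x) + f x * b x)).
  by apply: eq_bigr => J JM; have [_ ->//] := ntr JM; case: Cb.
rewrite -(vint_mesh polyO tri (intgD mO I1 I2)) (vintD mO I1 I2) (wd Cb).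
by rewrite addNr.
Qed.

Variables (K L F : {set V}).
Hypotheses (KF : K \in cells_of F) (LF : L \in cells_of F) (KL : K != L).

Definition njump (y : 'rV[R]_n) := pn K F (face_map F y) + pn L F (face_map F y).

Lemma njump_bump (b : pt -> R) : C1c Omega b ->
  (forall J G y, J \in cells M -> G \in facets J -> G != F -> ref y -> b (face_map G y) = 0) ->
  vint ref (fun y => njump y * b (face_map F y)) = 0.
Proof.
move=> Cb b0; have := weak_div_faces Cb.
have cb : continuous b by case: Cb => -[].
have KM : K \in cells M by move: KF; rewrite inE => /andP[].
have LM : L \in cells M by move: LF; rewrite inE => /andP[].
have FK : F \in facets K by move: KF; rewrite inE => /andP[].
have FL : F \in facets L by move: LF; rewrite inE => /andP[].
rewrite /bint (face_sum (fun J G => sint G (fun x => pn J G x * b x))).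
rewrite (bigD1 F)/=; last exact: facet_face KM FK.
rewrite [X in _ + X]big1 ?addr0 => [|G /andP[Gf GF]]; last first.
  rewrite big1// => J; rewrite inE => /andP[JM GJ]; rewrite -[RHS](sint0 G).
  by apply: eq_sint => y ry; rewrite (b0 J G)// mulr0.
rewrite (cells_of_pair tri KF LF KL) big_setU1 ?inE//= big_set1.
have Lb : L2F F b by exact: L2F_cont.
have LK : L2F F (pn K F) by have [h _] := ntr KM; exact: h.
have LL : L2F F (pn L F) by have [h _] := ntr LM; exact: h.
rewrite -sintD; [|exact: L2F_mul..].
have := KF => /cells_ofP[v [_ vK FKv]].
have ndK := cell_nondeg tri KM.
rewrite FKv /sint (sqrt_gram ndK vK) => /eqP; rewrite mulf_eq0 mulf_eq0.
rewrite (gt_eqF (jac_gt0 ndK)) (gt_eqF (enorm_gt0 (gbc_neq0 ndK vK))) /= => /eqP <-.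
by rewrite -FKv; apply: eq_vint => y _ /=; rewrite /njump mulrDl.
Qed.

(** Dominated convergence along the bumps shows that the jump has zero integral over every
    barycentric box; these contain the Cartesian boxes cut down to the open reference simplex, and
    [box_ae_eq0] applies to the extension by zero. *)
Lemma njump_ae0 : ae_face F (fun x => pn K F x + pn L F x = 0).
Proof.
have := KF => /cells_ofP[v [KM vK FKv]]; have := LF => /cells_ofP[w [LM wL FLw]].
have ndK := cell_nondeg tri KM; have ndL := cell_nondeg tri LM.
have cF : #|F| = n.+1 by rewrite FKv card_facet.
have [s0 s0F] : exists a, a \in F by apply/card_gt0P; rewrite cF.
have fm := face_map_spt s0F cF; have es := isenum_enum s0F cF.
set s := (fun i : 'I_n.+1 => _) in fm es.
have FK : F \in facets K by exact: facetE vK FKv.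
have FL : F \in facets L by exact: facetE wL FLw.
have LK : L2F F (pn K F) by have [h _] := ntr KM; exact: h.
have LL : L2F F (pn L F) by have [h _] := ntr LM; exact: h.
have mr := @msr_refsimplex R n; have mri : @msr R n (@refint R n) by apply: msr_open; exact: open_refint.
have Lr : L2 ref njump by exact: L2FD LK LL.
have L1 : L2 ref (fun=> 1 : R) by apply: (L2_cont mr (@bounded_refsimplex R n)); exact: contC.
have Ir : intg ref njump by apply: (eq_intg mr _ (L2_mul mr Lr L1)) => y _; rewrite mulr1.
have mf : measurable_fun (@rowt R n @^-1` ref) (njump \o @rowt R n) by case: Lr.
have Bz (a b : 'I_n.+1 -> R) : (forall i, 0 <= a i) ->
    vint ref (restr [set y | forall i, a i < bary y i < b i] njump) = 0.
  move=> a0.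
  pose al u := \sum_(i | s i == u) a i; pose be u := \sum_(i | s i == u) b i.
  have alE i : al (s i) = a i by rewrite /al (big_pred1 i)// => j /=; rewrite (inj_eq es.1).
  have beE i : be (s i) = b i by rewrite /be (big_pred1 i)// => j /=; rewrite (inj_eq es.1).
  have al0 u : 0 <= al u by apply: sumr_ge0.
  pose bp m := bump K L F al be m.
  have Z m : vint ref (fun y => njump y * bp m (face_map F y)) = 0.
    apply: njump_bump; first exact: (C1c_bump polyO tri KM LM KL vK wL FKv FLw be m al0).
    by move=> J G y; exact: (bump_face tri KM LM KL vK wL FKv FLw be m al0).
  have cbp m : continuous (bp m : pt -> R).
    by have [] := C1_bump tri F KM LM al be m.
  have mfb m : measurable_fun (@rowt R n @^-1` ref) (fun t => njump (rowt t) * bp m (face_map F (rowt t))).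
    apply: measurable_funM => //.
    have Lb : L2F F (bp m) by exact: L2F_cont.
    by have [] := Lb.
  have Ifb m : intg ref (fun y => njump y * bp m (face_map F y)).
    by apply: L2_mul => //; exact: L2F_cont.
  have cB y i : bc K (face_map F y) (s i) = bary y i.
    by rewrite fm; apply: (face_bc y i ndK es); rewrite FKv finset.subsetDl.
  have cL y i : bc L (face_map F y) (s i) = bary y i.
    by rewrite fm; apply: (face_bc y i ndL es); rewrite FLw finset.subsetDl.
  have sF u : u \in F -> exists i, u = s i by rewrite es.2 => /imsetP[i _ ->]; exists i.
  have cv y : ref y -> (fun m => (njump y * bp m (face_map F y))%:E) @ \oo -->
      (restr [set y | forall i, a i < bary y i < b i] njump y)%:E.
    move=> ry; apply: cvg_near_cst; rewrite /restr; case: ifPn => [|].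
      rewrite inE => yB.
      (* A ramp equals 1 from the argument 2 on: the lower cut-offs, shifted by 1, need [m.+1] times
         the gap to be at least 3, the upper ones at least 2. So the sequence is eventually constant
         at each point. *)
      pose N := Num.truncn (\sum_i (3 / (bary y i - a i) + 2 / (b i - bary y i))).
      exists N => // m /= Nm; congr (_%:E); rewrite (_ : bp m _ = 1) ?mulr1//.
      apply: big1 => u /sF[i ->]; rewrite cB cL alE beE.
      have /andP[h1 h2] := yB i; rewrite -subr_gt0 in h1; rewrite -subr_gt0 in h2.
      have : 3 / (bary y i - a i) + 2 / (b i - bary y i) <= m.+1%:R.
        apply: (@le_trans _ _ (\sum_i (3 / (bary y i - a i) + 2 / (b i - bary y i)))).
          rewrite [leRHS](bigD1 i)//= lerDl sumr_ge0// => j _; have /andP[h3 h4] := yB j.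
          by rewrite addr_ge0// divr_ge0// subr_ge0 ltW.
        by rewrite (le_trans (ltW (truncnS_gt _)))// ler_nat ltnS.
      move=> h3.
      have h4 : 3 / (bary y i - a i) <= m.+1%:R.
        by apply: le_trans h3; rewrite lerDl divr_ge0// ltW.
      have h5 : 2 / (b i - bary y i) <= m.+1%:R.
        by apply: le_trans h3; rewrite lerDr divr_ge0// ltW.
      rewrite ler_pdivrMr// in h4; rewrite ler_pdivrMr// in h5.
      rewrite (ramp_ge2 h5) !ramp_ge2 ?mulr1//; rewrite lerBrDr (le_trans _ h4)//; lra.
    rewrite notin_setE => /existsNP[i /negP yB].
    exists 0%N => // m _; congr (_%:E); rewrite (_ : bp m _ = 0) ?mulr0//.
    apply/eqP; rewrite /bp /bump prodf_seq_eq0; apply/hasP; exists (s i); first by rewrite mem_index_enum.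
    rewrite (isenum_mem i es) /= cB cL alE beE mulf_eq0.
    move: yB; rewrite negb_and -!leNgt => /orP[h|h].
      rewrite mulf_eq0 (ramp_le0 (t := m.+1%:R * (bary y i - a i) - 1)) ?eqxx//.
      rewrite subr_le0 (le_trans (_ : _ <= 0))// mulr_ge0_le0// subr_le0//.
    by rewrite (ramp_le0 (t := m.+1%:R * (b i - bary y i))) ?eqxx ?orbT// mulr_ge0_le0// subr_le0.
  have cvI := @dominated_cvg _ _ R (lebn n) (@rowt R n @^-1` ref) mr
    (fun m t => (njump (rowt t) * bp m (face_map F (rowt t)))%:E)
    (fun t => (restr [set y | forall i, a i < bary y i < b i] njump (rowt t))%:E)
    (fun t => (`|njump (rowt t)|)%:E).
  have : (fun m : nat => 0%E : \bar R) @ \oo -->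
     (\int[lebn n]_(t in @rowt R n @^-1` ref) (restr [set y | forall i, a i < bary y i < b i] njump (rowt t))%:E)%E.
    rewrite [X in X @ _](_ : _ = (fun m => \int[lebn n]_(t in @rowt R n @^-1` ref) (njump (rowt t) * bp m (face_map F (rowt t)))%:E))%E; last first.
      apply/funext => m; have := Z m; rewrite /vint /Rintegral => Zm.
      by rewrite -(fineK (integrable_fin_num mr (Ifb m))) Zm.
    apply: cvI.
    - by move=> m; apply/measurable_EFinP; exact: mfb.
    - by move=> t rt; exact: cv.
    - by [].
    - by have := integrable_abse Ir; exact.
    - move=> m t rt /=; rewrite lee_fin normrM ler_piMr//.
      by have /andP[h1 h2] := bump01 K L F al be m (face_map F (rowt t)); rewrite ger0_norm.
  move=> /(cvg_lim (@ereal_hausdorff R)); rewrite lim_cst; last exact: ereal_hausdorff.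
  move=> E; by rewrite /vint /Rintegral -E.
pose g := restr (@refint R n) njump.
have Ig : intg setT g.
  apply: intg_restr => //; first exact: measurableT.
  by apply: intg_sub Ir => //; exact: refint_sub.
have : ae_in setT (fun y => g y = 0).
  apply: (box_ae_eq0 (c := 2) Ig).
    move=> y; rewrite /g /restr; case: ifPn => [|]; rewrite ?eqxx// inE => yi _ i.
    by apply: (le_lt_trans (bounded_refsimplex (refint_sub yi) i)); rewrite ltr1n.
  move=> a b.
  (* Describes the box intersected with the open simplex by barycentric bounds: the coordinate
     [ord0] must only be positive, and its upper bound 2 is never reached. *)
  pose al (i : 'I_n.+1) := oapp (fun j => Num.max (a j) 0) 0 (unlift ord0 i).
  pose be (i : 'I_n.+1) := oapp b 2 (unlift ord0 i).
  pose B := [set y : 'rV[R]_n | forall i, al i < bary y i < be i].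
  have al0 i : 0 <= al i by rewrite /al; case: unliftP => [j|] _ //=; rewrite le_max lexx orbT.
  have mB : msr B.
    apply: msr_open; rewrite (_ : B = [set y | forall i, 0 < bary y i - al i] `&` [set y | forall i, 0 < be i - bary y i]).
      by apply: openI; apply: open_pos_forall => i; apply: contB; by [exact: contC|exact: continuous_bary].
    apply/seteqP; split => y /=; first by move=> H; split => i; have /andP[h1 h2] := H i; rewrite subr_gt0.
    by move=> [H1 H2] i; rewrite -subr_gt0 H1 -subr_gt0 H2.
  have BO : B `<=` openbox a b.
    move=> y H j; have := H (lift ord0 j); rewrite /al /be liftK baryS /= gt_max.
    by move=> /andP[/andP[-> _] ->].
  have BI : B `<=` @refint R n by move=> y H i; have /andP[h _] := H i; exact: le_lt_trans (al0 i) h.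
  have Br : B `<=` ref by apply: subset_trans BI _; exact: refint_sub.
  transitivity (vint (openbox a b) (restr B njump)).
    apply: eq_vint => y yO; rewrite /g /restr; case: ifPn; rewrite ?(inE, notin_setE) => yi.
      rewrite mem_set// => i; have := yi i.
      case: (unliftP ord0 i) => [j ->|->] h; rewrite /al /be ?liftK ?unlift_none /=.
        by rewrite baryS in h *; rewrite gt_max h andbT; exact: yO.
      rewrite h /= bary0 ltrBlDr (lt_le_trans (ltr1n R 2 : 1 < 2))// lerDl.
      by apply: sumr_ge0 => j _; have := yi (lift ord0 j); rewrite baryS => /ltW.
    by rewrite memNset// => /BI.
  rewrite (vint_restr _ mB (msr_openbox a b) BO) -(vint_restr _ mB mr Br).
  exact: Bz.
have N : {ae lebn n, forall t : n.-tuple (measurableTypeR R), ~ (ref `\` @refint R n) (rowt t)}.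
  exists (@rowt R n @^-1` (ref `\` @refint R n)); split.
  - by apply: measurableD.
  - exact: null_refsimplex.
  - by move=> t /= /contrapT.
rewrite /ae_face /ae_in /= => H; apply: filterS2 N H => t nt Ht rt.
have := Ht I; rewrite /g /restr mem_set//; apply: contrapT => h; exact: nt.
Qed.

End NormalJump.

Section Consistency.
Context {R : realType} {n : nat}.
Local Notation pt := 'rV[R]_n.+1.
Local Notation poly := (mpoly n.+1 R).
Local Notation ref := (@refsimplex R n).
Local Notation sq u := (dot u u).

(** Passage to the limit in a Cauchy-Schwarz bound. The choice [e = t ^- 2] gives
    [2 |a| <= (k + y) / t], and the chosen [t] contradicts this unless [a = 0]. *)
Lemma cs_small (a k y : R) : 0 <= k -> (forall e, 0 < e -> cs a (k * e) y) -> a = 0.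
Proof.
move=> k0 H; apply/eqP; rewrite -normr_eq0; apply: contrapT => /negP a0.
have {}a0 : 0 < `|a| by rewrite lt_def a0 /=.
pose t := (`|k| + `|y| + 1) / `|a|.
have t0 : 0 < t by rewrite divr_gt0// ltr_wpDl// addr_ge0.
have := H (t ^- 2) _ t t0; rewrite invr_gt0 exprn_gt0// => /(_ isT).
rewrite (_ : t * (k * t ^- 2) = t^-1 * k); last by field; rewrite gt_eqF.
rewrite -mulrDr [t^-1 * _]mulrC ler_pdivlMr//; apply/negP; rewrite -ltNge.
rewrite (_ : 2 * `|a| * t = 2 * (`|k| + `|y| + 1)); last by rewrite /t; field; rewrite gt_eqF.
have := ler_norm k; have := ler_norm y; have := normr_ge0 k; have := normr_ge0 y; lra.
Qed.

Lemma add_2_le4 (a b e : R) : a <= e -> b <= e -> 2 * a + 2 * b <= 4 * e.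
Proof. lra. Qed.

Lemma sum_2_le4 (I : finType) (a b : I -> R) e : \sum_i a i <= e -> \sum_i b i <= e ->
  \sum_i (2 * a i + 2 * b i) <= 4 * e.
Proof. by rewrite big_split/= -!mulr_sumr; exact: add_2_le4. Qed.

Lemma intg_mfun m (A : set 'rV[R]_m) (f : 'rV[R]_m -> R) : intg A f ->
  measurable_fun (@rowt R m @^-1` A) (f \o @rowt R m).
Proof. by move=> /integrableP[mf _]; apply/measurable_EFinP. Qed.

Lemma vint_sqr_tri m (A : set 'rV[R]_m) (a b c : 'rV[R]_m -> R) : msr A -> L2 A a -> L2 A b -> L2 A c ->
  vint A (fun z => (a z - b z) ^+ 2) <=
  2 * vint A (fun z => (a z - c z) ^+ 2) + 2 * vint A (fun z => (b z - c z) ^+ 2).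
Proof.
move=> mA La Lb Lc.
have I1 := L2_sqr (L2B mA La Lb); have I2 := L2_sqr (L2B mA La Lc); have I3 := L2_sqr (L2B mA Lb Lc).
rewrite -!vintZ// -vintD//; [|exact: intgZ..].
apply: le_vint => //; first by apply: intgD => //; exact: intgZ.
move=> z _; have := sqr_ge0 ((a z - c z) + (b z - c z)).
move: (a z) (b z) (c z) => x y t; rewrite -subr_ge0 => h.
by rewrite -subr_ge0 (_ : _ - _ = ((x - t) + (y - t)) ^+ 2 - 0) //; ring.
Qed.

Section Mesh.
Variables (M : mesh R n.+1) (Omega : set pt) (sigma D : R).
Local Notation V := 'I_(nvert M).
Local Notation vx := (@vert R n.+1 M).
Hypotheses (polyO : polyhedral_domain Omega) (tri : triangulation M Omega).
Hypotheses (s0 : 0 < sigma) (sr : shape_regular M sigma).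
Hypothesis HD : forall x, closure Omega x -> forall k, `|x 0 k| <= D.

Lemma trace_approx (K F : {set V}) u g uF (e : R) : is_trace K F u g uF -> 0 < e -> exists w,
  [/\ C1 w, vint (interior (simplex K)) (fun x => (w x - u x) ^+ 2) <= e,
     vint (interior (simplex K)) (fun x => sq (grad w x - g x)) <= e &
     sint F (fun x => (w x - uF x) ^+ 2) <= e].
Proof.
move=> [_ [w [Cw [H1 H2] H3]]] e0.
have key (a : nat -> R) : a @ \oo --> 0 -> \forall k \near \oo, a k <= e.
  move=> /cvgrPdist_le/(_ e e0); apply: filterS => k; rewrite sub0r normrN.
  exact: le_trans (ler_norm _).
have [k [[h1 h2] h3]] := filter_ex (filterI (filterI (key _ H1) (key _ H2)) (key _ H3)).
by exists (w k).
Qed.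

Variables (K : {set V}) (u : pt -> R) (g : pt -> pt) (uh : {set V} -> pt -> R).
Hypotheses (KM : K \in cells M).
Local Notation A := (interior (simplex K)).
Hypotheses (Lu : L2 A u) (Lg : L2v A g).
Hypothesis tr : forall F, F \in facets K -> is_trace K F u g (uh F).
Let ndK : nondeg K := cell_nondeg tri KM.
Let mA : msr A := @msrK R n M K.

Lemma L2_grad w i : C1 w -> L2 A (fun x => grad w x 0 i).
Proof. by move=> Cw; apply: L2K; exact: continuous_grad. Qed.

Lemma vint_dotE (p q : pt -> pt) : L2v A p -> L2v A q ->
  vint A (fun x => dot (p x) (q x)) = \sum_i vint A (fun x => p x 0 i * q x 0 i).
Proof. by move=> Lp Lq; rewrite -vint_sum// => i _; exact: L2_mul. Qed.

Lemma grad_approx_tri (w w' : pt -> R) e : C1 w -> C1 w' ->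
  vint A (fun x => sq (grad w x - g x)) <= e -> vint A (fun x => sq (grad w' x - g x)) <= e ->
  vint A (fun x => sq (grad w x - grad w' x)) <= 4 * e.
Proof.
move=> Cw Cw' h1 h2.
have Lw i : L2 A (fun x => grad w x 0 i) by exact: L2_grad.
have Lw' i : L2 A (fun x => grad w' x 0 i) by exact: L2_grad.
have E (a b : pt -> pt) : L2v A a -> L2v A b ->
    vint A (fun x => sq (a x - b x)) = \sum_i vint A (fun x => (a x 0 i - b x 0 i) ^+ 2).
  move=> La Lb; rewrite vint_dotE; last 2 first.
  - move=> i; rewrite (_ : (fun x => _) = fun x => a x 0 i - b x 0 i); first exact: L2B.
    by apply/funext => x; rewrite !mxE.
  - move=> i; rewrite (_ : (fun x => _) = fun x => a x 0 i - b x 0 i); first exact: L2B.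
    by apply/funext => x; rewrite !mxE.
  by apply: eq_bigr => i _; apply: eq_vint => x _; rewrite !mxE expr2.
rewrite E// in h1; rewrite E// in h2; rewrite E//.
apply: (@le_trans _ _ (\sum_i (2 * vint A (fun x => (grad w x 0 i - g x 0 i) ^+ 2) +
                              2 * vint A (fun x => (grad w' x 0 i - g x 0 i) ^+ 2)))).
  by apply: ler_sum => i _; exact: (vint_sqr_tri mA).
exact: (sum_2_le4 h1 h2).
Qed.

(** [is_trace] provides a separate approximating sequence for each face. Two approximations of [u]
    are close in H^1, so by [cell_trace_C1] one of them approximates the traces on all faces. The
    constant may depend on the cell, since [e] tends to zero afterwards. *)
Lemma trace_approx_all : exists2 C, 0 <= C & forall e, 0 < e -> exists w,
  [/\ C1 w, vint A (fun x => (w x - u x) ^+ 2) <= e,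
     vint A (fun x => sq (grad w x - g x)) <= e &
     forall F, F \in facets K -> sint F (fun x => (w x - uh F x) ^+ 2) <= C * e].
Proof.
have h0 := hK_gt0 ndK; have [_ sh] := cell_shape tri s0 sr KM.
have LA f : continuous f -> L2 A f by exact: L2K.
exists (2 * (sigma * (n.+2%:R * 4 + hK K ^+ 2 * 4) / hK K) + 2).
  rewrite addr_ge0// mulr_ge0// divr_ge0 ?(ltW h0)// mulr_ge0 ?(ltW s0)//.
  by rewrite addr_ge0// mulr_ge0// sqr_ge0.
move=> e e0; have [v vK] : exists v, v \in K by apply/card_gt0P; rewrite ndK.1.
have [w [Cw w1 w2 w3]] := trace_approx (tr (facetE vK erefl)) e0.
exists w; split => // F FK; have [w' [Cw' w1' w2' w3']] := trace_approx (tr FK) e0.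
have cw : continuous w by case: Cw.
have cw' : continuous w' by case: Cw'.
have LF : L2F F (uh F) by have [] := tr FK.
have Lw : L2F F w by exact: L2F_cont.
have Lw' : L2F F w' by exact: L2F_cont.
have Cd0 := C1gD (C1_C1g Cw) (C1gM (@C1g_cst R n.+1 (-1)) (C1_C1g Cw')).
pose dw x := w x + -1 * w' x; have Cd : C1 dw by exact: C1g_C1 Cd0.
have dE x : dw x = w x - w' x by rewrite /dw mulN1r.
have gE x : grad dw x = grad w x - grad w' x.
  by rewrite (grad_C1g _ Cd0); apply/rowP => i; rewrite !mxE mul0r add0r mulN1r.
have [z zK FE] := imsetP FK.
have := cell_trace_C1 ndK s0 (sh z zK) Cd zK; rewrite -FE => H1.
have B1 : kint K (fun x => dw x ^+ 2) <= 4 * e.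
  rewrite (_ : (fun x => _) = fun x => (w x - w' x) ^+ 2); last by apply/funext => x; rewrite dE.
  apply: (le_trans (vint_sqr_tri mA (LA _ cw) (LA _ cw') Lu)).
  exact: add_2_le4.
have B2 : kint K (fun x => sq (grad dw x)) <= 4 * e.
  rewrite (_ : (fun x => _) = fun x => sq (grad w x - grad w' x)); last by apply/funext => x; rewrite gE.
  exact: grad_approx_tri.
have H2 : sint F (fun x => dw x ^+ 2) <= sigma * (n.+2%:R * 4 + hK K ^+ 2 * 4) / hK K * e.
  rewrite mulrAC ler_pdivlMr// mulrC; apply: (le_trans H1); rewrite -[leRHS]mulrA.
  apply: ler_wpM2l; first exact: ltW.
  have -> : (n.+2%:R * 4 + hK K ^+ 2 * 4) * e = n.+2%:R * (4 * e) + hK K ^+ 2 * (4 * e) by ring.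
  by apply: lerD; apply: ler_wpM2l => //; exact: sqr_ge0.
have H3 : sint F (fun x => (w x - uh F x) ^+ 2) <= 2 * sint F (fun x => dw x ^+ 2) + 2 * sint F (fun x => (w' x - uh F x) ^+ 2).
  have Ld : L2F F dw by apply: L2F_cont; case: Cd.
  rewrite -!sintZ; [|exact/L2F_sqr/L2FB|exact: L2F_sqr].
  rewrite -sintD; [|apply: intgFZ; exact: L2F_sqr|apply: intgFZ; exact/L2F_sqr/L2FB].
  apply: le_sint; [exact/L2F_sqr/L2FB| |].
    by apply: intgFD; apply: intgFZ; [exact: L2F_sqr|exact/L2F_sqr/L2FB].
  move=> y _; rewrite dE; move: (w _) (w' _) (uh F _) => a b c.
  have := sqr_ge0 ((a - b) - (b - c)); rewrite -subr_ge0 => h.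
  by rewrite -subr_ge0 (_ : _ - _ = ((a - b) - (b - c)) ^+ 2 - 0) //; ring.
apply: (le_trans H3); rewrite [leRHS]mulrDl -[2 * _ * e]mulrA.
by apply: lerD; apply: ler_wpM2l.
Qed.

(** The defect of the formula for [u] is the defect for [u - w] with [w] smooth, which
    Cauchy-Schwarz makes arbitrarily small. *)
Lemma green_H1 (q : {ffun 'I_n.+1 -> poly}) :
  kint K (fun x => u x * peval (Defs.pdiv q) x) + kint K (fun x => dot (g x) (pevalv q x)) =
  bint K (fun F x => uh F x * dot (pevalv q x) (outnormal K F)).
Proof.
have [C C0 HC] := trace_approx_all.
pose Cq := kint K (fun x => peval (Defs.pdiv q) x ^+ 2) + \sum_i kint K (fun x => pevalv q x 0 i ^+ 2) +
  \sum_(F in facets K) sint F (fun x => dot (pevalv q x) (outnormal K F) ^+ 2).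
apply/eqP; rewrite -subr_eq0; apply/eqP.
have C10 : 0 <= 2 + \sum_(F in facets K) C by rewrite addr_ge0// sumr_ge0.
apply: (cs_small (y := Cq) C10) => e e0; have [w [Cw w1 w2 w3]] := HC e e0.
have cw : continuous w by case: Cw.
have LA f : continuous f -> L2 A f by exact: L2K.
have cd := @continuous_peval R _ (Defs.pdiv q).
have cq i : continuous (fun x => pevalv q x 0 i) by exact: continuous_pevalv.
have cn F : continuous (fun x => dot (pevalv q x) (outnormal K F)).
  by apply: continuous_dot => // i; exact: contC.
have Lgr i : L2 A (fun x => grad w x 0 i) by exact: L2_grad.
have LF F : F \in facets K -> L2F F (uh F) by move=> FK; have [] := tr FK.
have G := cell_green_field ndK q Cw.
have E1 : kint K (fun x => (w x - u x) * peval (Defs.pdiv q) x) =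
   kint K (fun x => w x * peval (Defs.pdiv q) x) - kint K (fun x => u x * peval (Defs.pdiv q) x).
  by rewrite /kint -(vintB mA); [apply: eq_vint => x _; rewrite mulrBl|apply: (L2_mul mA) => //; exact: LA..].
have E2 : \sum_i kint K (fun x => (grad w x 0 i - g x 0 i) * pevalv q x 0 i) =
   kint K (fun x => dot (grad w x) (pevalv q x)) - kint K (fun x => dot (g x) (pevalv q x)).
  rewrite /kint !vint_dotE//; [|by move=> i; exact: LA..].
  rewrite -sumrB; apply: eq_bigr => i _.
  by rewrite -(vintB mA); [apply: eq_vint => x _; rewrite mulrBl|apply: (L2_mul mA) => //; exact: LA..].
have E3 : \sum_(F in facets K) sint F (fun x => (w x - uh F x) * dot (pevalv q x) (outnormal K F)) =
   bint K (fun F x => w x * dot (pevalv q x) (outnormal K F)) - bint K (fun F x => uh F x * dot (pevalv q x) (outnormal K F)).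
  rewrite /bint -sumrB; apply: eq_bigr => F FK; rewrite -sintB; last 2 first.
  - by apply: L2F_mul; exact: L2F_cont.
  - by apply: L2F_mul; [exact: LF|exact: L2F_cont].
  by apply: eq_sint => y _; rewrite mulrBl.
have -> : kint K (fun x => u x * peval (Defs.pdiv q) x) + kint K (fun x => dot (g x) (pevalv q x)) -
    bint K (fun F x => uh F x * dot (pevalv q x) (outnormal K F)) =
  - (kint K (fun x => (w x - u x) * peval (Defs.pdiv q) x) +
     \sum_i kint K (fun x => (grad w x 0 i - g x 0 i) * pevalv q x 0 i) -
     \sum_(F in facets K) sint F (fun x => (w x - uh F x) * dot (pevalv q x) (outnormal K F))).
  rewrite E1 E2 E3 -G; move: (kint K _) (kint K _) (kint K _) (kint K _) (bint K _) => a b c d f.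
  by ring.
have S1 : cs (kint K (fun x => (w x - u x) * peval (Defs.pdiv q) x)) e (kint K (fun x => peval (Defs.pdiv q) x ^+ 2)).
  by apply: (cs_le (vint_cs mA (L2B mA (LA _ cw) Lu) (LA _ cd))).
have S2 : cs (\sum_i kint K (fun x => (grad w x 0 i - g x 0 i) * pevalv q x 0 i)) e (\sum_i kint K (fun x => pevalv q x 0 i ^+ 2)).
  apply: (cs_le (x := \sum_i vint A (fun x => (grad w x 0 i - g x 0 i) ^+ 2)) (y := \sum_i kint K (fun x => pevalv q x 0 i ^+ 2))) => //.
    by apply: cs_sum => i _; apply: (vint_cs mA); [exact: L2B|exact: LA].
  apply: le_trans w2; rewrite vint_dotE; last 2 first.
  - move=> i; rewrite (_ : (fun x => _) = fun x => grad w x 0 i - g x 0 i); first exact: L2B.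
    by apply/funext => x; rewrite [LHS]mxE [X in _ + X]mxE.
  - move=> i; rewrite (_ : (fun x => _) = fun x => grad w x 0 i - g x 0 i); first exact: L2B.
    by apply/funext => x; rewrite [LHS]mxE [X in _ + X]mxE.
  apply: ler_sum => i _; rewrite le_eqVlt; apply/orP; left; apply/eqP; apply: eq_vint => x _.
  by rewrite [X in _ = X * _]mxE [X in _ = (_ + X) * _]mxE [X in _ = _ * X]mxE [X in _ = _ * (_ + X)]mxE expr2.
have S3 : cs (\sum_(F in facets K) sint F (fun x => (w x - uh F x) * dot (pevalv q x) (outnormal K F)))
    ((\sum_(F in facets K) C) * e) (\sum_(F in facets K) sint F (fun x => dot (pevalv q x) (outnormal K F) ^+ 2)).
  rewrite mulr_suml; apply: cs_sum => F FK.
  by apply: (cs_le (sint_cs (L2FB (L2F_cont F cw) (LF F FK)) (L2F_cont F (cn F)))) => //; exact: w3.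
apply: csN; apply: (cs_le (csD (csD S1 S2) (csN S3))) => //.
by rewrite mulrDl [2 * e]mulrDl !mul1r.
Qed.

End Mesh.

Theorem hdg_consistent (Omega : set pt) (alpha : pt -> 'M[R]_n.+1) (M : mesh R n.+1) (sigma : R)
  (S : spaces M) (tau : {set 'I_(nvert M)} -> R) :
  polyhedral_domain Omega -> coefficient Omega alpha -> 0 < sigma ->
  triangulation M Omega -> shape_regular M sigma ->
  (forall F h, F \in ifaces M -> Hloc S F h -> L2F F h) ->
  consistent (fun x => invmx (alpha x)) Omega S tau.
Proof.
move=> polyO ca s0 tri sr LH f p u g pn uh Lf [[Lu Lg _] Lp ae0 wd] tr ntr Y [_ _ [H1 H2]].
have [D D0 HD] := domain_bounded polyO.
have mO : msr Omega by apply: msr_open; exact: domain_open.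
have AO K : K \in cells M -> interior (simplex K) `<=` Omega.
  by move=> KM; rewrite (interior_simplex (cell_nondeg tri KM)); exact: ocell_domain.
have mA (K : {set 'I_(nvert M)}) : msr (interior (simplex K)) by exact: (@msrK R n M K).
have LuK K : K \in cells M -> L2 (interior (simplex K)) u by move=> KM; exact: L2_sub (AO K KM) Lu.
have LgK K : K \in cells M -> L2v (interior (simplex K)) g by move=> KM i; exact: L2_sub (AO K KM) (Lg i).
have LpK K : K \in cells M -> L2v (interior (simplex K)) p by move=> KM i; exact: L2_sub (AO K KM) (Lp i).
have th : trace_fun (dh Y) by split => // F Fi; apply: LH => //; exact: H1.
rewrite /Ah /ah /bh /ch /=.
(* The exact solution has the same trace from the cell and on the face, so the stabilization
   disappears for any [tau]. *)
have -> : \sum_(K in cells M) bint K (fun F x => tau K * (uh F x - uh F x) * (peval (dv Y K) x - dh Y F x)) = 0.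
  apply: big1 => K _; apply: big1 => F _; rewrite -[RHS](sint0 F); apply: eq_sint => y _.
  by rewrite subrr mulr0 mul0r.
rewrite oppr0 addr0.
have -> : \sum_(K in cells M) bint K (fun F x => dh Y F x * pn K F x) = 0.
  apply: (face_sum_single tri (s := fun K F => sint F (fun x => dh Y F x * pn K F x))).
    move=> F K L Fi KF LF KL; have := njump_ae0 polyO tri HD Lf Lp wd ntr KF LF KL.
    have KM : K \in cells M by move: KF; rewrite inE => /andP[].
    have LM : L \in cells M by move: LF; rewrite inE => /andP[].
    have FK : F \in facets K by move: KF; rewrite inE => /andP[].
    have FL : F \in facets L by move: LF; rewrite inE => /andP[].
    have LK : L2F F (pn K F) by have [h _] := ntr K KM; exact: h.
    have LL : L2F F (pn L F) by have [h _] := ntr L LM; exact: h.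
    have Lh : L2F F (dh Y F) by exact: th.1.
    move=> ae1; rewrite -mulN1r -sintZ; last exact: L2F_mul.
    congr (_ * _); apply: (ae_vint (@msr_ref R n)).
    - exact: (intg_mfun (L2F_mul Lh LL)).
    - exact: (intg_mfun (intgFZ (-1) (L2F_mul Lh LK))).
    move: ae1; rewrite /ae_face /ae_in /= => ae1.
    apply: filterS ae1 => t Ht rt; have := Ht rt => /= /eqP; rewrite addr_eq0 => /eqP ->.
    by rewrite mulrN mulN1r opprK.
  move=> F K Ff KF; rewrite -[RHS](sint0 F); apply: eq_sint => y _.
  by rewrite (th.2 F Ff) mul0r.
rewrite addr0.
have -> : - (\sum_(K in cells M) kint K (fun x => peval (dv Y K) x * f x)) =
    - \sum_(K in cells M) kint K (fun x => f x * peval (dv Y K) x).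
  by congr (- _); apply: eq_bigr => K _; apply: eq_vint => x _; rewrite mulrC.
rewrite addrC -[RHS]addr0; congr (_ + _).
rewrite -sumrN -!big_split/=; apply: big1 => K KM.
rewrite -(green_H1 tri s0 sr KM (LuK K KM) (LgK K KM) (fun F FK => tr K F KM FK) (dq Y K)).
have Lq : L2v (interior (simplex K)) (pevalv (dq Y K)).
  by move=> i; apply: L2K; exact: continuous_pevalv.
have -> : kint K (fun x => dot (mulmv (invmx (alpha x)) (p x)) (pevalv (dq Y K) x)) =
   - kint K (fun x => dot (g x) (pevalv (dq Y K) x)).
  have Igq := intg_dot (mA K) (LgK K KM) Lq.
  rewrite -mulN1r -(vintZ _ (mA K) Igq).
  apply: (ae_vint (mA K)).
  - exact: (intg_mfun (intg_coef ca (mA K) mO (AO K KM) (LpK K KM) Lq)).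
  - exact: (intg_mfun (intgZ (-1) (mA K) Igq)).
  move: ae0; rewrite /ae_in /= => ae0.
  apply: filterS ae0 => t Ht At; have := Ht (AO K KM _ At).
  by move=> /eqP; rewrite addr_eq0 => /eqP ->; rewrite dotNl mulN1r.
by rewrite addKr addNr.
Qed.

End Consistency.

(** * The bilinear form *)

Section Forms.
Context {R : realType} {n : nat}.
Local Notation pt := 'rV[R]_n.+1.
Local Notation poly := (mpoly n.+1 R).
Local Notation vpoly := {ffun 'I_n.+1 -> poly}.
Local Notation sq u := (dot u u).

Lemma pevalv_lin a (q p : vpoly) x : pevalv (q + a *: p) x = pevalv q x + a *: pevalv p x.
Proof. by apply/rowP => i; rewrite !mxE !ffunE pevalD pevalZ. Qed.

Lemma pdiv_lin a (q p : vpoly) x :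
  peval (Defs.pdiv (q + a *: p)) x = peval (Defs.pdiv q) x + a * peval (Defs.pdiv p) x.
Proof.
rewrite /Defs.pdiv !peval_sum mulr_sumr -big_split/=; apply: eq_bigr => i _.
by rewrite !ffunE linearD linearZ/= pevalD pevalZ.
Qed.

Lemma pevalv0 x : pevalv (0 : vpoly) x = 0.
Proof. by apply/rowP => i; rewrite !mxE ffunE peval0. Qed.

Lemma pdiv0 x : peval (Defs.pdiv (0 : vpoly)) x = 0.
Proof. by rewrite /Defs.pdiv peval_sum big1// => i _; rewrite ffunE linear0 peval0. Qed.

Section Mesh.
Variables (Omega : set pt) (alpha : pt -> 'M[R]_n.+1) (M : mesh R n.+1).
Local Notation V := 'I_(nvert M).
Local Notation c := (fun x => invmx (alpha x)).
Hypotheses (polyO : polyhedral_domain Omega) (ca : coefficient Omega alpha) (tri : triangulation M Omega).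
Implicit Types (X Y Z : dfun M) (K F : {set V}).

Lemma msr_domain : msr Omega.
Proof. by apply: msr_open; exact: domain_open. Qed.

Lemma cell_domain K : K \in cells M -> interior (simplex K) `<=` Omega.
Proof. by move=> KM; rewrite (interior_simplex (cell_nondeg tri KM)); exact: ocell_domain. Qed.

Lemma L2v_pevalv K (q : vpoly) : L2v (interior (simplex K)) (pevalv q).
Proof. by move=> i; apply: L2K; exact: continuous_pevalv. Qed.

Lemma intg_coefK K (q p : vpoly) : K \in cells M ->
  intg (interior (simplex K)) (fun x => dot (mulmv (c x) (pevalv q x)) (pevalv p x)).
Proof.
move=> KM; apply: (intg_coef ca (@msrK R n M K) msr_domain (cell_domain KM)); exact: L2v_pevalv.
Qed.

Definition dlin (a : R) X Z : dfun M := DFun (fun K => dq X K + a *: dq Z K)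
  (fun K => dv X K + a *: dv Z K) (fun F x => dh X F x + a * dh Z F x).

Definition dflip Y : dfun M := DFun (dq Y) (fun K => - dv Y K) (fun F x => - dh Y F x).

Definition good X := trace_fun (dh X).

Lemma good_lin a X Z : good X -> good Z -> good (dlin a X Z).
Proof.
move=> [h1 h2] [k1 k2]; split => F Fi.
  by apply: L2FD; [exact: h1|apply: L2FZ; exact: k1].
by apply/funext => x /=; rewrite h2// k2// mulr0 addr0.
Qed.

Lemma good_flip Y : good Y -> good (dflip Y).
Proof.
move=> [h1 h2]; split => F Fi.
  by rewrite /= (_ : (fun x => _) = fun x => -1 * dh Y F x); [apply: L2FZ; exact: h1|apply/funext => x; rewrite mulN1r].
by apply/funext => x /=; rewrite h2// oppr0.
Qed.

Lemma good_L2F X K F : good X -> K \in cells M -> F \in facets K -> L2F F (dh X F).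
Proof. by move=> gX KM FK; apply: trace_fun_L2F => //; exact: facet_face KM FK. Qed.

Lemma L2F_peval F (p : poly) : L2F F (peval p : pt -> R).
Proof. by apply: L2F_cont; exact: continuous_peval. Qed.

Lemma continuous_flux K F (q : vpoly) : continuous (fun x : pt => dot (pevalv q x) (outnormal K F)).
Proof. by apply: continuous_dot => // i; [exact: continuous_pevalv|exact: contC]. Qed.

Lemma L2F_flux K F (q : vpoly) : L2F F (fun x => dot (pevalv q x) (outnormal K F)).
Proof. by apply: L2F_cont; exact: continuous_flux. Qed.

Lemma ah_linl a X Z Y : ah c (embed (dlin a X Z)) (embed Y) =
  ah c (embed X) (embed Y) + a * ah c (embed Z) (embed Y).
Proof.
rewrite /ah mulr_sumr -big_split/=; apply: eq_bigr => K KM.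
rewrite /kint -vintZ; [|exact: msrK|exact: intg_coefK].
rewrite -vintD; [|exact: msrK|exact: intg_coefK|by apply: intgZ; [exact: msrK|exact: intg_coefK]].
by apply: eq_vint => x _; rewrite pevalv_lin mulmvD mulmvZ dotDl dotZl.
Qed.

Lemma bh_linq a X Z Y : good Y ->
  bh (embed (dlin a X Z)) (embed Y) = bh (embed X) (embed Y) + a * bh (embed Z) (embed Y).
Proof.
move=> gY; rewrite /bh mulrDr mulrN addrACA -opprD !mulr_sumr -!big_split/=; congr (- _ + _).
  apply: eq_bigr => K KM; rewrite -(kintZ (cell_nondeg tri KM) a); last by apply: contM; exact: continuous_peval.
  rewrite -(kintD (cell_nondeg tri KM)); [|by apply: contM; exact: continuous_peval|by apply: contM; [exact: contC|apply: contM; exact: continuous_peval]].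
  by congr (kint K _); apply/funext => x; rewrite pdiv_lin mulrDr mulrCA.
apply: eq_bigr => K KM; rewrite /bint mulr_sumr -big_split/=; apply: eq_bigr => F FK.
have Lh := good_L2F gY KM FK.
rewrite -sintZ; last by apply: L2F_mul => //; exact: L2F_flux.
rewrite -sintD; [|by apply: L2F_mul => //; exact: L2F_flux|by apply: intgFZ; apply: L2F_mul => //; exact: L2F_flux].
by apply: eq_sint => y _; rewrite pevalv_lin dotDl dotZl mulrDr mulrCA.
Qed.

Lemma bh_linu a X Z Y : good X -> good Z ->
  bh (embed Y) (embed (dlin a X Z)) = bh (embed Y) (embed X) + a * bh (embed Y) (embed Z).
Proof.
move=> gX gZ; rewrite /bh mulrDr mulrN addrACA -opprD !mulr_sumr -!big_split/=; congr (- _ + _).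
  apply: eq_bigr => K KM; rewrite -(kintZ (cell_nondeg tri KM) a); last by apply: contM; exact: continuous_peval.
  rewrite -(kintD (cell_nondeg tri KM)); [|by apply: contM; exact: continuous_peval|by apply: contM; [exact: contC|apply: contM; exact: continuous_peval]].
  by congr (kint K _); apply/funext => x; rewrite pevalD pevalZ mulrDl mulrA.
apply: eq_bigr => K KM; rewrite /bint mulr_sumr -big_split/=; apply: eq_bigr => F FK.
have Lh := good_L2F gX KM FK; have Lk := good_L2F gZ KM FK.
rewrite -sintZ; last by apply: L2F_mul => //; exact: L2F_flux.
rewrite -sintD; [|by apply: L2F_mul => //; exact: L2F_flux|by apply: intgFZ; apply: L2F_mul => //; exact: L2F_flux].
by apply: eq_sint => y _; rewrite mulrDl mulrA.
Qed.

Definition dtrace X K F : pt -> R := fun x => peval (dv X K) x - dh X F x.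

Lemma L2F_dtrace X K F : good X -> K \in cells M -> F \in facets K -> L2F F (dtrace X K F).
Proof. by move=> gX KM FK; apply: L2FB; [exact: L2F_peval|exact: good_L2F FK]. Qed.

Lemma chE tau X Y : good X -> good Y -> ch tau (embed X) (embed Y) =
  - \sum_(K in cells M) tau K * bint K (fun F x => dtrace X K F x * dtrace Y K F x).
Proof.
move=> gX gY; congr (- _); apply: eq_bigr => K KM.
rewrite /bint mulr_sumr; apply: eq_bigr => F FK.
by rewrite -sintZ; [apply: eq_sint => y _; rewrite mulrA|apply: L2F_mul; exact: L2F_dtrace].
Qed.

Lemma ch_linl tau a X Z Y : good X -> good Z -> good Y ->
  ch tau (embed (dlin a X Z)) (embed Y) = ch tau (embed X) (embed Y) + a * ch tau (embed Z) (embed Y).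
Proof.
move=> gX gZ gY; rewrite !chE//; last exact: good_lin.
rewrite mulrN -opprD; congr (- _); rewrite mulr_sumr -big_split/=; apply: eq_bigr => K KM.
rewrite mulrCA -mulrDr; congr (_ * _); rewrite /bint mulr_sumr -big_split/=; apply: eq_bigr => F FK.
have I1 := L2F_mul (L2F_dtrace gX KM FK) (L2F_dtrace gY KM FK).
have I2 := L2F_mul (L2F_dtrace gZ KM FK) (L2F_dtrace gY KM FK).
rewrite -(sintZ _ I2) -(sintD I1 (intgFZ _ I2)); apply: eq_sint => y _.
by rewrite /dtrace /= pevalD pevalZ; ring.
Qed.

Lemma Ah_linl tau a X Z Y : good X -> good Z -> good Y ->
  Ah c tau (embed (dlin a X Z)) (embed Y) = Ah c tau (embed X) (embed Y) + a * Ah c tau (embed Z) (embed Y).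
Proof.
move=> gX gZ gY; rewrite /Ah ah_linl bh_linu// bh_linq// ch_linl//.
by move: (ah _ _ _) (ah _ _ _) (bh _ _) (bh _ _) (bh _ _) (bh _ _) (ch _ _ _) (ch _ _ _) => *; ring.
Qed.

(** Changing the sign of the scalar part makes the two mixed terms cancel and turns the negative
    stabilization into a positive one. *)
Lemma Ah_flip tau Y : good Y -> Ah c tau (embed (dflip Y)) (embed Y) =
  norm_q2 c Y + \sum_(K in cells M) tau K * bint K (fun F x => dtrace Y K F x ^+ 2).
Proof.
move=> gY; have gF := good_flip gY; rewrite /Ah /norm_q2 chE//.
have -> : bh (embed Y) (embed (dflip Y)) = - bh (embed Y) (embed Y).
  rewrite /bh opprD !opprK -sumrN; congr (_ + _).
    apply: eq_bigr => K KM; rewrite -mulN1r -(kintZ (cell_nondeg tri KM) (-1)); last first.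
      by apply: contM; exact: continuous_peval.
    by congr (kint K _); apply/funext => x; rewrite /= pevalN mulN1r mulNr opprK.
  rewrite -sumrN; apply: eq_bigr => K KM; rewrite /bint -sumrN; apply: eq_bigr => F FK.
  rewrite -mulN1r -sintZ; first by apply: eq_sint => y _; rewrite /= mulN1r mulNr.
  by apply: L2F_mul; [exact: good_L2F FK|exact: L2F_flux].
have -> : bh (embed (dflip Y)) (embed Y) = bh (embed Y) (embed Y) by [].
rewrite -addrA addrA subrK; congr (_ + _); rewrite -sumrN; apply: eq_bigr => K KM.
rewrite -mulrN; congr (_ * _); rewrite /bint -sumrN; apply: eq_bigr => F FK.
rewrite -mulN1r -sintZ; last by apply: L2F_mul; exact: L2F_dtrace.
by apply: eq_sint => y _; rewrite /dtrace /= pevalN; ring.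
Qed.

(** The mixed form in the shape suited to the H^1 norm: no derivative of the flux, only [grad v] and
    the trace difference [v - v^]. *)
Lemma bh_parts X Y : good Y -> bh (embed X) (embed Y) =
  \sum_(K in cells M) kint K (fun x => dot (pevalv (pgrad (dv Y K)) x) (pevalv (dq X K) x)) -
  \sum_(K in cells M) bint K (fun F x => dtrace Y K F x * dot (pevalv (dq X K) x) (outnormal K F)).
Proof.
move=> gY; rewrite /bh -sumrN -sumrB -big_split/=; apply: eq_bigr => K KM.
have := cell_green_field (cell_nondeg tri KM) (dq X K) (C1g_C1 (C1g_peval (dv Y K))).
rewrite (_ : (fun x => dot (grad _ x) _) = fun x => dot (pevalv (pgrad (dv Y K)) x) (pevalv (dq X K) x)); last first.
  by apply/funext => x; rewrite grad_peval.
have -> : bint K (fun F x => dtrace Y K F x * dot (pevalv (dq X K) x) (outnormal K F)) =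
    bint K (fun F x => peval (dv Y K) x * dot (pevalv (dq X K) x) (outnormal K F)) -
    bint K (fun F x => dh Y F x * dot (pevalv (dq X K) x) (outnormal K F)).
  rewrite /bint -sumrB; apply: eq_bigr => F FK.
  rewrite -sintB; last 2 first.
  - by apply: L2F_mul; [exact: L2F_peval|exact: L2F_flux].
  - by apply: L2F_mul; [exact: good_L2F FK|exact: L2F_flux].
  by apply: eq_sint => y _; rewrite mulrBl.
move=> <-; move: (kint K _) (kint K _) (bint K _) => a b d; ring.
Qed.

Lemma sint_ae0 F f : L2F F f -> ae_face F (fun x => f x = 0) -> forall g, L2F F g -> sint F (fun x => f x * g x) = 0.
Proof.
move=> Lf; rewrite /ae_face /ae_in /= => ae0 g Lg; rewrite -[RHS](sint0 F); congr (_ * _).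
apply: (ae_vint (@msr_ref R n)).
- exact: (intg_mfun (L2F_mul Lf Lg)).
- exact: measurable_cst.
by apply: filterS ae0 => t Ht rt; rewrite /= Ht// mul0r.
Qed.

Lemma Ah_zero tau X Y : good X -> good Y -> is_zero X -> Ah c tau (embed X) (embed Y) = 0.
Proof.
move=> gX gY [Z1 Z2]; rewrite /Ah chE// /ah /bh.
have aeF K F : K \in cells M -> F \in facets K -> ae_face F (fun x => dh X F x = 0).
  by move=> KM FK; apply: Z2; exact: facet_face KM FK.
rewrite big1 => [|K KM]; last first.
  by apply: vint_eq0 => x _; rewrite /= (Z1 K KM).1 pevalv0 dotC; apply: big1 => i _; rewrite mulmvE big1 ?mulr0// => j _; rewrite mxE mulr0.
rewrite big1 => [|K KM]; last by apply: vint_eq0 => x _; rewrite /= (Z1 K KM).2 peval0 mul0r.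
rewrite [X in - 0 + X]big1 => [|K KM]; last first.
  apply: big1 => F FK; apply: (sint_ae0 (good_L2F gX KM FK) (aeF K F KM FK)); exact: L2F_flux.
rewrite big1 => [|K KM]; last by apply: vint_eq0 => x _; rewrite /= (Z1 K KM).1 pdiv0 mulr0.
rewrite [X in (_ + (- 0 + X))]big1 => [|K KM]; last first.
  apply: big1 => F FK; rewrite -[RHS](sint0 F); apply: eq_sint => y _.
  by rewrite /= (Z1 K KM).1 pevalv0 dot0l mulr0.
rewrite big1 ?oppr0 ?addr0// => K KM; rewrite /bint big1 ?mulr0// => F FK.
transitivity (sint F (fun x => dh X F x * (-1 * dtrace Y K F x))).
  by apply: eq_sint => y _; rewrite {1}/dtrace (Z1 K KM).2 peval0 sub0r; ring.
apply: (sint_ae0 (good_L2F gX KM FK) (aeF K F KM FK)); apply: L2FZ; exact: L2F_dtrace.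
Qed.

(** One good test triple for each [Y] suffices. It must be admissible in the supremum: it is not
    zero because the form is positive on it ([Ah_zero]), and its norm is not zero by continuity of
    the form. *)
Lemma inf_sup_intro (S : spaces M) tau (N : dfun M -> R) (M0 c1 c2 : R) : 0 < c1 -> 0 < c2 ->
  (forall X, in_Uh S X -> good X) ->
  continuous_form c S tau N M0 ->
  (forall X, 0 <= N X) ->
  (forall Y, in_Uh S Y -> ~ is_zero Y -> 0 < N Y) ->
  (forall Y, in_Uh S Y -> exists X, [/\ in_Uh S X, c1 * N Y ^+ 2 <= Ah c tau (embed X) (embed Y) & N X <= c2 * N Y]) ->
  inf_sup c S tau N (c1 / c2).
Proof.
move=> c10 c20 HU HC N0 Np H; apply: le_ereal_inf_tmp => _ [Y [UY nzY] <-].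
have [X [UX HA HN]] := H Y UY; have NY := Np Y UY nzY.
have A0 : 0 < Ah c tau (embed X) (embed Y) by apply: lt_le_trans HA; rewrite mulr_gt0// exprn_gt0.
have nzX : ~ is_zero X by move=> /(Ah_zero tau (HU _ UX) (HU _ UY)) E; rewrite E ltxx in A0.
have NX : 0 < N X.
  rewrite lt_def N0 andbT; apply: contraTneq A0 => NX0; rewrite -leNgt.
  by apply: le_trans (ler_norm _) _; apply: le_trans (HC X Y UX UY) _; rewrite NX0 mulr0 mul0r.
apply: (@le_trans _ _ (Ah c tau (embed X) (embed Y) / (N X * N Y))%:E); last first.
  by apply: ereal_sup_ubound; exists X.
rewrite lee_fin ler_pdivlMr ?mulr_gt0//; apply: le_trans HA.
rewrite -mulrA ler_pM2l// mulrC ler_pdivrMr// expr2 -mulrA [N X * _]mulrC.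
by rewrite ler_pM2l// mulrC.
Qed.

End Mesh.
End Forms.

Section Zero.
Context {R : realType} {n : nat}.
Local Notation pt := 'rV[R]_n.+1.
Local Notation poly := (mpoly n.+1 R).
Local Notation vpoly := {ffun 'I_n.+1 -> poly}.
Local Notation sq u := (dot u u).

Lemma vint_sqr_ae0 m (A : set 'rV[R]_m) (f : 'rV[R]_m -> R) : msr A -> L2 A f ->
  vint A (fun x => f x ^+ 2) = 0 -> ae_in A (fun x => f x = 0).
Proof.
move=> mA Lf H; have If := L2_sqr Lf.
have mf2 := intg_mfun If.
have := ae_eq_integral_abs (lebn m) mA (f := fun t => (f (rowt t) ^+ 2)%:E).
move=> /(_ (proj2 (measurable_EFinP _ _) mf2))[H1 _].
have : ae_eq (lebn m) (@rowt R m @^-1` A) (fun t => (f (rowt t) ^+ 2)%:E) (cst 0%E).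
  apply: H1; have := integrable_fin_num mA If => /fineK E.
  rewrite (_ : (fun x => _) = fun t => (f (rowt t) ^+ 2)%:E).
    by rewrite -E; move: H; rewrite /vint /Rintegral => ->.
  by apply/funext => t; rewrite gee0_abs// lee_fin sqr_ge0.
rewrite /ae_in; apply: filterS => t Ht At; have := Ht At => -[] /eqP.
by rewrite sqrf_eq0 => /eqP.
Qed.

Lemma kint_sqr_eq0 (M : mesh R n.+1) (K : {set 'I_(nvert M)}) (p : poly) : nondeg K ->
  kint K (fun x => peval p x ^+ 2) = 0 -> p = 0.
Proof.
move=> ndK H; have oK := open_ocell ndK.
have [x0 Kx0] : exists x, ocell K x.
  have [y Hy] := @refint_neq0 R n.+1; have [s es] := isenum_exists ndK.1.
  exists (spt (@vert _ _ M \o s) y) => v vK.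
  have /imsetP[i _ ->] : v \in [set s i | i : 'I_n.+2]%SET by rewrite -es.2.
  by rewrite (bc_spt ndK _ _ es).
apply: (peval_open_eq0 oK Kx0) => x Kx; apply/eqP; rewrite -sqrf_eq0; apply/eqP.
apply: (vint_pos_eq0 (A := interior (simplex K)) (U := ocell K) (f := fun x => peval p x ^+ 2) (M := vbnd M)) => //.
- exact: (@msrK R n M K).
- by move=> z /interior_subset; exact: bounded_simplex.
- by apply: contX2; exact: continuous_peval.
- by move=> z _; exact: sqr_ge0.
- by rewrite interior_simplex.
Qed.

Lemma kint_sqE (M : mesh R n.+1) (K : {set 'I_(nvert M)}) (q : vpoly) : nondeg K ->
  kint K (fun x => sq (pevalv q x)) = \sum_i kint K (fun x => peval (q i) x ^+ 2).
Proof.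
move=> ndK; rewrite -(kint_sum ndK); last by move=> i; apply: contX2; exact: continuous_peval.
by congr (kint K _); apply/funext => x; apply: eq_bigr => i _; rewrite !mxE expr2.
Qed.

Lemma kint_sq_eq0 (M : mesh R n.+1) (K : {set 'I_(nvert M)}) (q : vpoly) : nondeg K ->
  kint K (fun x => sq (pevalv q x)) = 0 -> q = 0.
Proof.
move=> ndK; rewrite kint_sqE// => /eqP; rewrite psumr_eq0.
  move=> /allP H; apply/ffunP => i; rewrite ffunE; apply: (kint_sqr_eq0 ndK).
  by apply/eqP/H; rewrite mem_index_enum.
by move=> i _; apply: kint_ge0 => x _; exact: sqr_ge0.
Qed.

Lemma flux_bound (m : nat) (sigma : R) : 0 < sigma -> exists2 C, 0 < C &
  forall (M : mesh R n.+1) (K : {set 'I_(nvert M)}) (q : vpoly), shape sigma K -> Pkd m q ->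
  hK K * bint K (fun F x => dot (pevalv q x) (outnormal K F) ^+ 2) <= C * kint K (fun x => sq (pevalv q x)).
Proof.
move=> s0; have [C C0 HC] := @cell_trace R n m sigma s0.
exists (n.+2%:R * C); first by rewrite mulr_gt0.
move=> M K q shK dq; have [ndK _] := shK; have h0 := hK_gt0 ndK.
rewrite bintE mulr_sumr -mulrA mulr_natl -[X in _ *+ X]ndK.1 -sumr_const.
apply: ler_sum => v vK; rewrite kint_sqE// mulr_sumr.
apply: (@le_trans _ _ (\sum_i hK K * sint (K :\ v) (fun x => peval (q i) x ^+ 2))); last first.
  by apply: ler_sum => i _; exact: HC.
have Iq i : intgF (K :\ v) (fun x => peval (q i) x ^+ 2) by apply: L2F_sqr; exact: L2F_peval.
rewrite -mulr_sumr ler_pM2l// -sint_sum//.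
apply: le_sint.
- by apply: L2F_sqr; exact: L2F_flux.
- exact: (intg_sum _ (P := xpredT) (@msr_ref R n) (fun i _ => Iq i)).
move=> y _; apply: le_trans (dot_sqr_le _ _) _.
rewrite (outnormalE ndK vK); have [n1 _ _] := nrm_is_normal ndK vK.
rewrite -(enorm_sqr (nrm K v)) n1 expr1n mulr1 le_eqVlt; apply/orP; left; apply/eqP.
by apply: eq_bigr => i _; rewrite !mxE expr2.
Qed.

End Zero.

(** * Stability with respect to the discrete H^1 norm *)

Section PrimalForms.
Context {R : realType} {n : nat}.
Local Notation pt := 'rV[R]_n.+1.
Local Notation poly := (mpoly n.+1 R).
Local Notation vpoly := {ffun 'I_n.+1 -> poly}.
Local Notation sq u := (dot u u).
Variables (Omega : set pt) (alpha : pt -> 'M[R]_n.+1) (M : mesh R n.+1).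
Local Notation V := 'I_(nvert M).
Local Notation c := (fun x => invmx (alpha x)).
Hypotheses (polyO : polyhedral_domain Omega) (ca : coefficient Omega alpha) (tri : triangulation M Omega).
Implicit Types (X Y Z : dfun M) (K F : {set V}).

Definition qsq X := \sum_(K in cells M) kint K (fun x => sq (pevalv (dq X K) x)).
Definition gsq X := \sum_(K in cells M) kint K (fun x => sq (pevalv (pgrad (dv X K)) x)).
Definition jsq X := \sum_(K in cells M) (hK K)^-1 * bint K (fun F x => dtrace X K F x ^+ 2).

Lemma qsq_ge0 X : 0 <= qsq X.
Proof. by apply: sumr_ge0 => K _; apply: kint_ge0 => x _; exact: dot_ge0. Qed.

Lemma gsq_ge0 X : 0 <= gsq X.
Proof. by apply: sumr_ge0 => K _; apply: kint_ge0 => x _; exact: dot_ge0. Qed.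

Lemma bint_sqr_ge0 K (f : {set V} -> pt -> R) : 0 <= bint K (fun F x => f F x ^+ 2).
Proof. by apply: sumr_ge0 => F _; apply: sint_ge0 => x; exact: sqr_ge0. Qed.

Lemma jsq_ge0 X : 0 <= jsq X.
Proof.
apply: sumr_ge0 => K KM; rewrite mulr_ge0 ?invr_ge0 ?bint_sqr_ge0//.
exact: ltW (hK_gt0 (cell_nondeg tri KM)).
Qed.

Lemma norm_q2_ge0 X : 0 <= norm_q2 c X.
Proof.
apply: sumr_ge0 => K KM; apply: vint_ge0 => x Kx; apply: (coef_ge0 ca).
exact: (cell_domain polyO tri KM).
Qed.

Lemma ah_cs X Y : cs (ah c (embed X) (embed Y)) (norm_q2 c X) (norm_q2 c Y).
Proof.
apply: cs_sum => K KM; apply: (coef_cs ca (@msrK R n M K) (msr_domain polyO) (cell_domain polyO tri KM)).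
all: exact: L2v_pevalv.
Qed.

Lemma qsq_le B X : (forall x, Omega x -> forall v, sq v <= B * dot (mulmv (c x) v) v) ->
  qsq X <= B * norm_q2 c X.
Proof.
move=> HB; rewrite /qsq /norm_q2 /ah mulr_sumr; apply: ler_sum => K KM.
have IK := intg_coefK polyO ca tri (dq X K) (dq X K) KM.
rewrite /kint -vintZ//; last exact: (@msrK R n M K).
apply: le_vint; [exact: (@msrK R n M K)| |by apply: intgZ => //; exact: (@msrK R n M K)|].
  by apply: (intgK (cell_nondeg tri KM)); apply: continuous_dot => i; exact: continuous_pevalv.
by move=> x Kx; apply: HB; exact: (cell_domain polyO tri KM).
Qed.

Lemma norm_q2_le B X : (forall x, Omega x -> forall v, dot (mulmv (c x) v) v <= B * sq v) ->
  norm_q2 c X <= B * qsq X.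
Proof.
move=> HB; rewrite /qsq /norm_q2 /ah mulr_sumr; apply: ler_sum => K KM.
have IK := intg_coefK polyO ca tri (dq X K) (dq X K) KM.
have cq : continuous (fun x => sq (pevalv (dq X K) x)).
  by apply: continuous_dot => i; exact: continuous_pevalv.
rewrite -(kintZ (cell_nondeg tri KM))//.
apply: le_vint; [exact: (@msrK R n M K)|by []| |].
  by apply: (intgK (cell_nondeg tri KM)); apply: contM => //; exact: contC.
by move=> x Kx; apply: HB; exact: (cell_domain polyO tri KM).
Qed.

Lemma norm_q2_lin a X Z : norm_q2 c (dlin a X Z) <= 2 * norm_q2 c X + 2 * a ^+ 2 * norm_q2 c Z.
Proof.
rewrite /norm_q2 /ah !mulr_sumr -big_split/=; apply: ler_sum => K KM.
have mK := @msrK R n M K.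
have I1 := intg_coefK polyO ca tri (dq X K) (dq X K) KM.
have I2 := intg_coefK polyO ca tri (dq Z K) (dq Z K) KM.
rewrite /kint -(vintZ 2 mK I1) -(vintZ (2 * a ^+ 2) mK I2) -vintD//; [|exact: intgZ..].
apply: le_vint => //.
- exact: (intg_coefK polyO ca tri (dq X K + a *: dq Z K) (dq X K + a *: dq Z K) KM).
- by apply: intgD => //; exact: intgZ.
move=> x Kx; rewrite pevalv_lin; have Ox := cell_domain polyO tri KM Kx.
have := coef_ge0 ca (pevalv (dq X K) x - a *: pevalv (dq Z K) x) Ox.
rewrite !mulmvD !mulmvN !mulmvZ !dotDl !dotNl !dotDr !dotNr !dotZl !dotZr.
rewrite (coef_dotC ca (pevalv (dq Z K) x) (pevalv (dq X K) x) Ox).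
move: (dot _ _) (dot _ (pevalv (dq Z K) x)) (dot (mulmv _ (pevalv (dq Z K) x)) _) => x1 x2 x3.
rewrite expr2; lra.
Qed.

(** Uses the form integrated by parts; the trace difference takes the weight [(hK K)^-1] and the
    flux the weight [hK K], which the hypothesis returns to the cell integral. *)
Lemma bh_cs (C : R) X Y : good Y -> 0 <= C ->
  (forall K, K \in cells M -> hK K * bint K (fun F x => dot (pevalv (dq X K) x) (outnormal K F) ^+ 2) <=
     C * kint K (fun x => sq (pevalv (dq X K) x))) ->
  cs (bh (embed X) (embed Y)) ((1 + C) * qsq X) (gsq Y + jsq Y).
Proof.
move=> gY C0 HC; rewrite (bh_parts tri X gY) mulrDl mul1r; apply: csD.
  apply: csC; apply: cs_sum => K KM; have ndK := cell_nondeg tri KM.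
  rewrite !kint_sqE//.
  rewrite (_ : kint K _ = \sum_i kint K (fun x => pevalv (pgrad (dv Y K)) x 0 i * pevalv (dq X K) x 0 i)); last first.
    by rewrite -(kint_sum ndK)// => i; apply: contM; exact: continuous_pevalv.
  apply: cs_sum => i _.
  rewrite (_ : (fun x => peval (dq X K i) x ^+ 2) = fun x => pevalv (dq X K) x 0 i ^+ 2); last first.
    by apply/funext => x; rewrite mxE.
  rewrite (_ : (fun x => peval (pgrad (dv Y K) i) x ^+ 2) = fun x => pevalv (pgrad (dv Y K)) x 0 i ^+ 2); last first.
    by apply/funext => x; rewrite mxE.
  by apply: kint_cs; exact: continuous_pevalv.
apply: csN; apply: csC.
apply: (@cs_le _ _ (jsq Y) (\sum_(K in cells M) hK K * bint K (fun F x => dot (pevalv (dq X K) x) (outnormal K F) ^+ 2))) => //.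
  apply: cs_sum => K KM; rewrite -{2}[hK K]invrK; apply: cs_weight.
    by rewrite invr_gt0; exact: hK_gt0 (cell_nondeg tri KM).
  by apply: cs_sum => F FK; apply: sint_cs; [exact: L2F_dtrace|exact: L2F_flux].
by rewrite /qsq mulr_sumr; apply: ler_sum => K KM; exact: HC.
Qed.

Lemma ch_cs (r : R) X Y : good X -> good Y -> 0 <= r ->
  cs (ch (fun K => r * (hK K)^-1) (embed X) (embed Y)) (r * jsq X) (r * jsq Y).
Proof.
move=> gX gY r0; rewrite chE//; apply: csN; rewrite /jsq !mulr_sumr; apply: cs_sum => K KM.
rewrite !mulrA; apply: csZ.
  by rewrite mulr_ge0// invr_ge0 ltW// hK_gt0//; exact: cell_nondeg tri _ KM.
by apply: cs_sum => F FK; apply: sint_cs; exact: L2F_dtrace.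
Qed.

Lemma norm_12E rho X : norm_12 rho X = gsq X + rho^-1 * jsq X.
Proof. by []. Qed.

Lemma norm_12_flip rho Y : good Y -> norm_12 rho (dflip Y) = norm_12 rho Y.
Proof.
move=> gY; have E : forall a b d e : R, a = d -> b = e -> a + rho^-1 * b = d + rho^-1 * e by move=> *; congr (_ + _ * _).
apply: E.
  apply: eq_bigr => K _; congr (kint K _); apply/funext => x.
  have -> : pevalv (pgrad (dv (dflip Y) K)) x = - pevalv (pgrad (dv Y K)) x.
    by apply/rowP => i; rewrite !mxE !ffunE linearN pevalN.
  by rewrite dotNl dotNr opprK.
apply: eq_bigr => K _; congr (_ * _); apply: eq_bigr => F _; congr (sint F _); apply/funext => x.
by rewrite /= pevalN -opprD sqrrN.
Qed.

End PrimalForms.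

Section PrimalStability.
Context {R : realType} {n : nat}.
Local Notation pt := 'rV[R]_n.+1.
Local Notation poly := (mpoly n.+1 R).
Local Notation vpoly := {ffun 'I_n.+1 -> poly}.
Local Notation sq u := (dot u u).

Section Spaces.
Variables (M : mesh R n.+1) (S : spaces M).

Definition lin_spaces :=
  [/\ forall K, K \in cells M -> lin_subspace (Qloc S K),
      forall K, K \in cells M -> lin_subspace (Vloc S K),
      forall F, F \in ifaces M -> Hloc S F (fun=> 0) /\
        forall a g h, Hloc S F g -> Hloc S F h -> Hloc S F (fun x => g x + a * h x) &
      forall F, F \in ifaces M -> Hloc S F `<=` L2F F].

Hypothesis lS : lin_spaces.

Lemma lin_subspaceP (E : lmodType R) (W : set E) a u v : lin_subspace W -> W u -> W v -> W (u + a *: v).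
Proof. by move=> [_ H] Wu Wv; rewrite addrC; exact: H. Qed.

Lemma in_Uh_good X : in_Uh S X -> good X.
Proof.
by have [_ _ _ H] := lS; move=> [_ _ [h1 h2]]; split=> // F Fi; exact: H Fi _ (h1 F Fi).
Qed.

Lemma in_Uh_lin a X Z : in_Uh S X -> in_Uh S Z -> in_Uh S (dlin a X Z).
Proof.
have [lq lv lh _] := lS; move=> [x1 x2 [x3 x4]] [z1 z2 [z3 z4]]; split => [K KM|K KM|].
- exact: (lin_subspaceP a (lq K KM) (x1 K KM) (z1 K KM)).
- exact: (lin_subspaceP a (lv K KM) (x2 K KM) (z2 K KM)).
split => F Fi; first exact: (lh F Fi).2 (x3 F Fi) (z3 F Fi).
by apply/funext => x /=; rewrite x4// z4// mulr0 addr0.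
Qed.

Lemma in_Uh_flip X : in_Uh S X -> in_Uh S (dflip X).
Proof.
have [_ lv lh _] := lS; move=> [x1 x2 [x3 x4]]; split => [//|K KM|].
  have := lin_subspaceP (-1) (lv K KM) (lv K KM).1 (x2 K KM).
  by rewrite add0r scaleN1r.
split => F Fi /=.
  have := (lh F Fi).2 (-1) _ _ (lh F Fi).1 (x3 F Fi).
  by rewrite (_ : (fun x => _) = fun x => - dh X F x)//; apply/funext => x; rewrite add0r mulN1r.
by apply/funext => x /=; rewrite x4// oppr0.
Qed.

End Spaces.

Lemma admissible_lin m (M : mesh R n.+1) (S : spaces M) : admissible m S -> lin_spaces S.
Proof.
move=> [aV aQ aH]; split => [K KM|K KM|F Fi|F Fi h].
- exact: (aQ K KM).1.
- exact: (aV K KM).1.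
- have [k [phi [_ ->]]] := aH F Fi; split.
    by exists (fun=> 0); apply/funext => x; rewrite big1// => j _; rewrite mul0r.
  move=> a _ _ [b ->] [e ->]; exists (fun j => b j + a * e j).
  apply/funext => x; rewrite mulr_sumr -big_split/=; apply: eq_bigr => j _.
  by rewrite mulrDl mulrA.
have [k [phi [Lp ->]]] := aH F Fi => -[a ->].
by apply: L2F_sum => j _; apply: L2FZ; exact: Lp.
Qed.

Section Stable.
Variables (Omega : set pt) (alpha : pt -> 'M[R]_n.+1) (M : mesh R n.+1) (sigma D B Cf rho : R).
Local Notation V := 'I_(nvert M).
Local Notation c := (fun x => invmx (alpha x)).
Hypotheses (polyO : polyhedral_domain Omega) (ca : coefficient Omega alpha) (tri : triangulation M Omega).
Hypotheses (s0 : 0 < sigma) (sr : shape_regular M sigma) (B0 : 0 < B) (Cf0 : 0 < Cf).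
Hypothesis HB1 : forall x, Omega x -> forall v, sq v <= B * dot (mulmv (c x) v) v.
Hypothesis HB2 : forall x, Omega x -> forall v, dot (mulmv (c x) v) v <= B * sq v.
Variables (m : nat) (S : spaces M).
Hypotheses (aS : admissible m S) (gS : grad_incl S).
Hypothesis HCf : forall (K : {set V}) (q : vpoly), shape sigma K -> Pkd m q ->
  hK K * bint K (fun F x => dot (pevalv q x) (outnormal K F) ^+ 2) <= Cf * kint K (fun x => sq (pevalv q x)).
Hypothesis rho01 : 0 < rho <= 1.
Implicit Types (X Y Z : dfun M) (K F : {set V}).

Let lS := admissible_lin aS.
Let N2 X := norm_q2 c X + (gsq X + rho^-1 * jsq X).

Lemma flux_Uh X K : in_Uh S X -> K \in cells M ->
  hK K * bint K (fun F x => dot (pevalv (dq X K) x) (outnormal K F) ^+ 2) <=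
     Cf * kint K (fun x => sq (pevalv (dq X K) x)).
Proof.
move=> [x1 _ _] KM; apply: HCf; first exact: (cell_shape tri s0 sr KM).
by have [_ aQ _] := aS; exact: (aQ K KM).2 _ (x1 K KM).
Qed.

Lemma primal_continuity_bound q g j r qs : 0 <= q -> 0 <= g -> 0 <= j -> 1 <= r -> qs <= B * q ->
  q + (g + j) + (1 + Cf) * qs + r * j <= (2 + (1 + Cf) * B) * (q + (g + r * j)).
Proof.
move=> q0 g0 j0 r1 hq.
have h1 : (1 + Cf) * qs <= (1 + Cf) * B * q by rewrite -mulrA ler_wpM2l// addr_ge0// ltW.
have h2 : j <= r * j by rewrite ler_peMl.
have h3 : 0 <= (1 + Cf) * B by rewrite mulr_ge0 ?addr_ge0// ltW.
have h4 := mulr_ge0 h3 g0; have h5 := mulr_ge0 h3 (le_trans j0 h2).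
by move: h1 h2 h4 h5; move: ((1 + Cf) * B) (r * j) ((1 + Cf) * qs) => a b e *; nra.
Qed.

Lemma rhoV_ge1 : 1 <= rho^-1.
Proof. by case/andP: rho01 => r0 r1; rewrite invf_ge1. Qed.

Lemma normU2_ge0 X : 0 <= N2 X.
Proof.
rewrite !addr_ge0 ?gsq_ge0 ?(norm_q2_ge0 polyO ca tri)// mulr_ge0 ?(jsq_ge0 tri)//.
exact: le_trans ler01 rhoV_ge1.
Qed.

Lemma normU2_sqr X : normU2 c rho X ^+ 2 = N2 X.
Proof. by rewrite /normU2 norm_12E sqr_sqrtr// normU2_ge0. Qed.

Lemma primal_continuous :
  continuous_form c S (fun K => rho^-1 * (hK K)^-1) (normU2 c rho) (2 + (1 + Cf) * B).
Proof.
move=> X Y UX UY; have gX := in_Uh_good lS UX; have gY := in_Uh_good lS UY.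
have C0 := ltW Cf0; have r0 : 0 <= rho^-1 := le_trans ler01 rhoV_ge1.
have A1 := ah_cs polyO ca tri X Y.
have A2 := csC (bh_cs tri gX C0 (fun K KM => flux_Uh UY KM)).
have A3 := bh_cs tri gY C0 (fun K KM => flux_Uh UX KM).
have A4 := ch_cs tri gX gY r0.
have K0 : 0 <= 2 + (1 + Cf) * B by rewrite addr_ge0// mulr_ge0 ?addr_ge0// ltW.
have := csD (csD (csD A1 A2) A3) A4; rewrite -/(Ah c _ _ _) => H.
have {}H : cs (Ah c (fun K => rho^-1 * (hK K)^-1) (embed X) (embed Y))
    ((2 + (1 + Cf) * B) * N2 X) ((2 + (1 + Cf) * B) * N2 Y).
  apply: (cs_le H).
    exact: (primal_continuity_bound (norm_q2_ge0 polyO ca tri X) (gsq_ge0 X) (jsq_ge0 tri X) rhoV_ge1 (qsq_le polyO ca tri X HB1)).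
  rewrite [X in X + _ <= _]addrAC.
  exact: (primal_continuity_bound (norm_q2_ge0 polyO ca tri Y) (gsq_ge0 Y) (jsq_ge0 tri Y) rhoV_ge1 (qsq_le polyO ca tri Y HB1)).
apply: le_trans (cs_norm _ _ H) _; try by rewrite mulr_ge0// normU2_ge0.
rewrite !sqrtrM// mulrACA -expr2 sqr_sqrtr// /normU2 !norm_12E mulrA.
exact: lexx.
Qed.

Lemma primal_ah_bound q g (a : R) : 2 * `|a| <= (2 * B)^-1 * (B * g) + (2 * B) * q -> `|a| <= g / 4 + B * q.
Proof.
have -> : (2 * B)^-1 * (B * g) = g / 2 by field; rewrite gt_eqF.
lra.
Qed.

Lemma primal_jump_bound j g (a : R) : 2 * `|a| <= (2 * Cf)^-1 * (Cf * g) + (2 * Cf) * j -> `|a| <= g / 4 + Cf * j.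
Proof.
have -> : (2 * Cf)^-1 * (Cf * g) = g / 2 by field; rewrite gt_eqF.
lra.
Qed.

(** Here [q] is the flux term, [g] the gradient term and [jr] the jump term weighted by the inverse
    of [rho]. The cross terms take half of [g]; their costs [B q] and [Cf j], multiplied by [e], are
    absorbed by the first test triple. The step [j <= jr] is where [rho <= 1] enters. *)
Lemma primal_inf_sup_bound (q g j jr a b e w : R) : 0 <= q -> 0 <= g -> 0 <= j -> j <= jr -> 0 < e ->
  e * (2 * (B + Cf + 1)) = 1 ->
  `|a| <= g / 4 + B * q -> `|b| <= g / 4 + Cf * j -> w = a + (g - b) ->
  e / 2 * (q + (g + jr)) <= (q + jr) + e * w.
Proof.
move=> q0 g0 j0 jr0 e0 E /ler_normlP[a1 a2] /ler_normlP[b1 b2] ->.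
have h1 : e * (- (g / 4 + B * q)) <= e * a by rewrite ler_pM2l//; lra.
have h2 : e * (g - (g / 4 + Cf * j)) <= e * (g - b) by rewrite ler_pM2l//; lra.
have e1 : e * B <= 1 / 2 by have := mulr_gt0 e0 B0; have := mulr_gt0 e0 Cf0; lra.
have e2 : e * Cf <= 1 / 2 - e / 2 by have := mulr_gt0 e0 B0; have := mulr_gt0 e0 Cf0; lra.
have e3 : e * B <= 1 / 2 - e / 2 by have := mulr_gt0 e0 B0; have := mulr_gt0 e0 Cf0; lra.
have k1 : e * B * q <= (1 / 2 - e / 2) * q by rewrite ler_wpM2r.
have k2 : e * Cf * j <= (1 / 2 - e / 2) * j by rewrite ler_wpM2r.
have k3 : e / 2 * j <= e / 2 * jr by rewrite ler_wpM2l// divr_ge0// ltW.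
have k4 : (1 / 2 - e / 2) * j <= (1 / 2 - e / 2) * jr by rewrite ler_wpM2l//; have := mulr_gt0 e0 B0; lra.
have := mulr_ge0 (ltW e0) g0.
lra.
Qed.

(** A purely flux perturbation; it belongs to the discrete space exactly because of [grad_incl]. *)
Definition dgrad Y : dfun M := DFun (fun K => pgrad (dv Y K)) (fun=> 0) (fun _ => fun=> 0).

Lemma dgrad_Uh Y : in_Uh S Y -> in_Uh S (dgrad Y).
Proof.
have [_ lv lh _] := lS; move=> [_ yv _]; split => [|K KM|]; first exact: gS.
  exact: (lv K KM).1.
by split=> // F Fi; exact: (lh F Fi).1.
Qed.

Lemma Ah_dgrad tau Y : good Y -> Ah c tau (embed (dgrad Y)) (embed Y) =
  ah c (embed (dgrad Y)) (embed Y) + (gsq Y -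
   \sum_(K in cells M) bint K (fun F x => dtrace Y K F x * dot (pevalv (pgrad (dv Y K)) x) (outnormal K F))).
Proof.
move=> gY; rewrite /Ah (bh_parts tri (dgrad Y) gY).
have -> : bh (embed Y) (embed (dgrad Y)) = 0.
  rewrite /bh big1 => [|K KM]; last by apply: vint_eq0 => x _; rewrite /= peval0 mul0r.
  rewrite big1 ?oppr0 ?addr0// => K KM; apply: big1 => F FK.
  by rewrite -[RHS](sint0 F); apply: eq_sint => y _; rewrite /= mul0r.
have -> : ch tau (embed (dgrad Y)) (embed Y) = 0.
  rewrite /ch big1 ?oppr0// => K KM; apply: big1 => F FK; rewrite -[RHS](sint0 F); apply: eq_sint => y _.
  by rewrite /= peval0 subrr mulr0 mul0r.
by rewrite !addr0.
Qed.

Lemma primal_inf_sup_test Y : in_Uh S Y -> exists X, [/\ in_Uh S X,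
  (2 * (B + Cf + 1))^-1 / 2 * normU2 c rho Y ^+ 2 <=
     Ah c (fun K => rho^-1 * (hK K)^-1) (embed X) (embed Y) &
  normU2 c rho X <= Num.sqrt (2 + 2 * B) * normU2 c rho Y].
Proof.
move=> UY; have gY := in_Uh_good lS UY; have UZ := dgrad_Uh UY.
have UF := in_Uh_flip lS UY; set e := (_)^-1.
have S1 : 0 < 2 * (B + Cf + 1) by rewrite mulr_gt0// !addr_gt0.
have e0 : 0 < e by rewrite invr_gt0.
have eE : e * (2 * (B + Cf + 1)) = 1 by rewrite mulVf// gt_eqF.
have q0 := norm_q2_ge0 polyO ca tri Y; have g0 := gsq_ge0 Y; have j0 := jsq_ge0 tri Y.
have qZ : norm_q2 c (dgrad Y) <= B * gsq Y by exact: (norm_q2_le polyO ca tri (dgrad Y) HB2).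
exists (dlin e (dflip Y) (dgrad Y)); split; first exact: in_Uh_lin.
  rewrite (Ah_linl polyO ca tri _ _ (in_Uh_good lS UF) (in_Uh_good lS UZ) gY) (Ah_flip alpha tri)// Ah_dgrad// normU2_sqr.
  have -> : \sum_(K in cells M) rho^-1 * (hK K)^-1 * bint K (fun F x => dtrace Y K F x ^+ 2) = rho^-1 * jsq Y.
    by rewrite /jsq mulr_sumr; apply: eq_bigr => K _; rewrite mulrA.
  apply: (primal_inf_sup_bound q0 g0 j0 _ e0 eE _ _ erefl).
  - by rewrite ler_peMl// rhoV_ge1.
  - apply: primal_ah_bound; have := ah_cs polyO ca tri (dgrad Y) Y.
    move=> H; have := cs_le H qZ (lexx _) => /(_ (2 * B)^-1); rewrite invrK invr_gt0; apply.
    by rewrite mulr_gt0.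
  apply: primal_jump_bound.
  have H : cs (\sum_(K in cells M) bint K (fun F x => dtrace Y K F x * dot (pevalv (pgrad (dv Y K)) x) (outnormal K F)))
      (jsq Y) (Cf * gsq Y).
    apply: (@cs_le _ _ (jsq Y) (\sum_(K in cells M) hK K * bint K (fun F x => dot (pevalv (pgrad (dv Y K)) x) (outnormal K F) ^+ 2))) => //.
      apply: cs_sum => K KM; rewrite -{2}[hK K]invrK; apply: cs_weight.
        by rewrite invr_gt0; exact: hK_gt0 (cell_nondeg tri KM).
      by apply: cs_sum => F FK; apply: sint_cs; [exact: L2F_dtrace|exact: L2F_flux].
    by rewrite /gsq mulr_sumr; apply: ler_sum => K KM; exact: (flux_Uh UZ KM).
  by rewrite addrC; exact: H (mulr_gt0 _ Cf0).
have C0 : 0 <= 2 + 2 * B by rewrite addr_ge0// mulr_ge0// ltW.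
have -> : dlin e (dflip Y) (dgrad Y) = DFun (dq (dlin e (dflip Y) (dgrad Y))) (dv (dflip Y)) (dh (dflip Y)).
  congr DFun; first by apply/funext => K; rewrite /= scaler0 addr0.
  by apply/funext => F; apply/funext => x; rewrite /= mulr0 addr0.
rewrite /normU2 -sqrtrM// ler_wsqrtr//.
have -> : norm_12 rho (DFun (dq (dlin e (dflip Y) (dgrad Y))) (dv (dflip Y)) (dh (dflip Y))) = norm_12 rho (dflip Y) by [].
rewrite norm_12_flip//.
apply: (@le_trans _ _ (2 * norm_q2 c Y + 2 * e ^+ 2 * (B * gsq Y) + norm_12 rho Y)).
  rewrite lerD2r; apply: le_trans (norm_q2_lin polyO ca tri e (dflip Y) (dgrad Y)) _.
  by rewrite lerD2l ler_wpM2l// mulr_ge0// sqr_ge0.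
have e1 : e ^+ 2 <= 1.
  by apply: exprn_ile1 => //; [exact: ltW|have := mulr_gt0 e0 B0; have := mulr_gt0 e0 Cf0; lra].
have r0 : 0 <= rho^-1 := le_trans ler01 rhoV_ge1.
have g1 : 0 <= B * gsq Y by rewrite mulr_ge0// ltW.
have k1 : e ^+ 2 * (B * gsq Y) <= B * gsq Y by rewrite ler_piMl.
have k2 := mulr_ge0 r0 j0.
have k3 := mulr_ge0 (ltW B0) k2; have k4 := mulr_ge0 (ltW B0) q0.
rewrite norm_12E mulrDl !mulrDr -!mulrA.
by move: k1 k2 k3 k4 g1 q0 g0; move: (B * gsq Y) (rho^-1 * jsq Y) (norm_q2 c Y) (gsq Y) => a b d g *; lra.
Qed.

(** A zero norm kills the gradients and the trace differences; the broken Poincare inequality then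
    kills [v], and the trace differences reduce to [v^]. *)
Lemma normU2_gt0 Y : (forall x, closure Omega x -> enorm x <= D) -> 0 < D ->
  in_Uh S Y -> ~ is_zero Y -> 0 < normU2 c rho Y.
Proof.
move=> HD D0 UY nz; rewrite lt_def sqrtr_ge0 andbT; apply/eqP => N0; apply: nz.
have gY := in_Uh_good lS UY.
have r0 : 0 < rho^-1 := lt_le_trans ltr01 rhoV_ge1.
have [q0 g0 j0] : [/\ norm_q2 c Y = 0, gsq Y = 0 & jsq Y = 0].
  have := normU2_sqr Y; rewrite N0 expr0n/= => /esym/eqP; rewrite /N2.
  have q0 := norm_q2_ge0 polyO ca tri Y; have g0 := gsq_ge0 Y; have j0 := jsq_ge0 tri Y.
  rewrite paddr_eq0// ?addr_ge0 ?mulr_ge0 ?(ltW r0)// => /andP[/eqP-> ].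
  by rewrite paddr_eq0 ?mulr_ge0 ?(ltW r0)// mulf_eq0 (gt_eqF r0)/= => /andP[/eqP-> /eqP->].
have bint0 K F : K \in cells M -> F \in facets K -> sint F (fun x => dtrace Y K F x ^+ 2) = 0.
  move=> KM FK; have h0 : 0 < (hK K)^-1 by rewrite invr_gt0; exact: hK_gt0 (cell_nondeg tri KM).
  have /eqP := j0; rewrite /jsq psumr_eq0 => [/allP/(_ K)|L LM]; last first.
    by rewrite mulr_ge0 ?bint_sqr_ge0// invr_ge0 ltW// hK_gt0//; exact: cell_nondeg tri _ LM.
  rewrite mem_index_enum KM /= mulf_eq0 gt_eqF//= => /(_ isT).
  rewrite psumr_eq0 => [/allP/(_ F)|E _]; last by apply: sint_ge0 => x; exact: sqr_ge0.
  by rewrite mem_index_enum FK /= => /(_ isT)/eqP.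
have q1 K : K \in cells M -> dq Y K = 0.
  move=> KM; apply: (kint_sq_eq0 (cell_nondeg tri KM)).
  have : qsq Y <= 0 by apply: le_trans (qsq_le polyO ca tri Y HB1) _; rewrite q0 mulr0.
  rewrite le_eqVlt ltNge qsq_ge0 orbF psumr_eq0 => [/allP/(_ K)|L _]; last first.
    by apply: kint_ge0 => x _; exact: dot_ge0.
  by rewrite mem_index_enum KM /= => /(_ isT)/eqP.
have v1 K : K \in cells M -> dv Y K = 0.
  move=> KM; apply: (kint_sqr_eq0 (cell_nondeg tri KM)).
  have [Cp Cp0 HP] := @broken_poincare R n sigma D s0 D0.
  have := HP M Omega tri sr HD (fun K => peval (dv Y K)) (dh Y) (fun K _ => C1g_C1 (C1g_peval (dv Y K))) gY.
  rewrite -/(jsq Y) j0 addr0.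
  rewrite (_ : \sum_(L in cells M) kint L (fun x => sq (grad _ x)) = gsq Y); last first.
    by apply: eq_bigr => L _; congr (kint L _); apply/funext => x; rewrite grad_peval.
  have S0 L : 0 <= kint L (fun x => peval (dv Y L) x ^+ 2) by apply: kint_ge0 => x _; exact: sqr_ge0.
  rewrite g0 mulr0 le_eqVlt ltNge sumr_ge0// orbF psumr_eq0// => /allP/(_ K).
  by rewrite mem_index_enum KM /= => /(_ isT)/eqP.
split=> [K KM|F /face_cell[K /cells_ofP[v [KM vK FK]]]]; first by rewrite q1// v1.
have FK' : F \in facets K by rewrite FK; exact: facetE vK _.
have := bint0 K F KM FK'; have ndK := cell_nondeg tri KM.
rewrite (_ : (fun x => _) = fun x => dh Y F x ^+ 2); last first.
  by apply/funext => x; rewrite /dtrace v1// peval0 sub0r sqrrN.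
rewrite /sint FK (sqrt_gram ndK vK) -FK => /eqP.
rewrite mulf_eq0 (gt_eqF (mulr_gt0 _ (enorm_gt0 (gbc_neq0 ndK vK)))) ?jac_gt0//= => /eqP H.
exact: (vint_sqr_ae0 (@msr_ref R n) (good_L2F gY KM FK') H).
Qed.

End Stable.

Lemma domain_enorm (Omega : set pt) : polyhedral_domain Omega ->
  exists2 D : R, 0 < D & forall x, closure Omega x -> enorm x <= D.
Proof.
move=> polyO; have [D D0 HD] := domain_bounded polyO.
exists (n.+1%:R * D) => [|x Ox]; first by rewrite mulr_gt0.
by apply: enorm_le_bound => [|k]; [exact: ltW|exact: HD].
Qed.

Theorem stability_primal (Omega : set pt) (alpha : pt -> 'M[R]_n.+1) (sigma : R) (m : nat) :
  polyhedral_domain Omega -> coefficient Omega alpha -> 0 < sigma ->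
  exists rho0 M0 beta1 : R, 0 < rho0 /\ 0 < beta1 /\
    forall M : mesh R n.+1, triangulation M Omega -> shape_regular M sigma ->
    forall S : spaces M, admissible m S -> grad_incl S ->
    forall rho : R, 0 < rho <= rho0 ->
      uniformly_stable (fun x => invmx (alpha x)) Omega S (fun K => rho^-1 * (hK K)^-1)
        (normU2 (fun x => invmx (alpha x)) rho) M0 beta1.
Proof.
move=> polyO ca s0; have [B B0 HB] := coef_bounds ca.
have [Cf Cf0 HCf] := @flux_bound R n m sigma s0.
have [D D0 HD] := domain_enorm polyO.
exists 1, (2 + (1 + Cf) * B), ((2 * (B + Cf + 1))^-1 / 2 / Num.sqrt (2 + 2 * B)).
have c1 : 0 < (2 * (B + Cf + 1))^-1 / 2 by rewrite divr_gt0// invr_gt0 mulr_gt0// !addr_gt0.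
have c2 : 0 < Num.sqrt (2 + 2 * B) by rewrite sqrtr_gt0 addr_gt0// mulr_gt0.
split=> //; split=> [|M tri sr S aS gS rho rho01]; first by rewrite divr_gt0.
have H1 x (Ox : Omega x) := (HB x Ox).2.1; have H2 x (Ox : Omega x) := (HB x Ox).2.2.
have HC := @primal_continuous Omega alpha M sigma B Cf rho polyO ca tri s0 sr B0 Cf0 H1 m S aS (HCf M) rho01.
split=> //.
  apply: (hdg_consistent _ polyO ca s0 tri sr) => F h Fi.
  by have [_ _ _ H] := admissible_lin aS; exact: H.
apply: (inf_sup_intro c1 c2 (in_Uh_good (admissible_lin aS)) HC).
- by move=> X; exact: sqrtr_ge0.
- move=> Y; exact: (normU2_gt0 polyO ca tri s0 sr H1 aS rho01 HD D0).
- move=> Y; exact: (primal_inf_sup_test polyO ca tri s0 sr B0 Cf0 H2 aS gS (HCf M) rho01).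
Qed.

End PrimalStability.

(** * Face projections and the divergence lift *)

Section Riesz.
Context {R : realType} (N : nat).
Local Notation vec := 'rV[R]_N.

Definition linform (f : vec -> R) := forall s x y, f (s *: x + y) = s * f x + f y.

Lemma linform_sum f x : linform f -> f x = \sum_i x 0 i * f (delta_mx 0 i).
Proof.
move=> lf; have f0 : f 0 = 0.
  by have := lf 1 0 0; rewrite scale1r addr0 mul1r => /eqP; rewrite addrC -subr_eq subrr => /eqP.
have fD u v : f (u + v) = f u + f v by rewrite -[u]scale1r lf mul1r scale1r.
have fZ a u : f (a *: u) = a * f u by rewrite -[a *: u]addr0 lf f0 addr0.
rewrite {1}[x]row_sum_delta (big_morph f fD f0).
by apply: eq_bigr => i _; rewrite fZ.
Qed.

(* Boundedness by the quadratic form makes [b] vanish on the kernel of [B]. *)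
Lemma riesz (B : vec -> vec -> R) (b : vec -> R) (C : R) :
  (forall x, linform (B x)) -> (forall y, linform (B^~ y)) -> linform b ->
  (forall x, b x ^+ 2 <= C * B x x) -> exists a, forall y, B a y = b y.
Proof.
move=> lB lB' lb H.
pose G : 'M[R]_N := \matrix_(i, j) B (delta_mx 0 i) (delta_mx 0 j).
pose v : vec := \row_j b (delta_mx 0 j).
have BE x y : B x y = (x *m G *m y^T) 0 0.
  rewrite -mulmxA (linform_sum x (lB' y)) mxE; apply: eq_bigr => i _; congr (_ * _).
  by rewrite (linform_sum y (lB _)) mxE; apply: eq_bigr => j _; rewrite !mxE mulrC.
have bE y : b y = (v *m y^T) 0 0.
  by rewrite (linform_sum y lb) mxE; apply: eq_bigr => j _; rewrite !mxE mulrC.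
have [/submxP[a aG]|] := boolP (v <= G)%MS.
  by exists a => y; rewrite BE bE aG.
(* If [v] is outside the row space of [G], some column of the cokernel detects it: [B z z = 0] while
   [b z] is not zero, against the bound. *)
rewrite submxE => /rV0Pn[j]; set z := (col j (cokermx G))^T => nz; exfalso.
have zE : v *m z^T = col j (v *m cokermx G) by rewrite trmxK !colE mulmxA.
have Bz : B z z = 0 by rewrite BE -mulmxA trmxK colE [G *m _]mulmxA mulmx_coker mul0mx mulmx0 mxE.
have := H z; rewrite Bz mulr0 bE zE mxE => h.
by case/negP: nz; rewrite -sqrf_eq0 eq_le h sqr_ge0.
Qed.

End Riesz.

Section FaceProjection.
Context {R : realType} {n : nat}.
Local Notation pt := 'rV[R]_n.+1.
Local Notation poly := (mpoly n.+1 R).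
Local Notation vpoly := {ffun 'I_n.+1 -> poly}.
Variables (M : mesh R n.+1).
Local Notation V := 'I_(nvert M).
Implicit Types (F : {set V}) (f g : pt -> R).

Lemma pcomb_lin k s (x y : 'rV[R]_#|{: bmultinom n.+1 k.+1}|) :
  pcomb (s *: x + y) = s *: pcomb x + pcomb y.
Proof.
rewrite /pcomb scaler_sumr -big_split/=; apply: eq_bigr => i _.
by rewrite !mxE scalerDl scalerA.
Qed.

(** [riesz] tolerates a semidefinite Gram matrix, which is essential: the monomials of the whole
    space are linearly dependent once restricted to a face. *)
Lemma face_proj F r g : L2F F g -> exists w, Pk_face r w /\
  forall z, Pk_face r z -> sint F (fun x => (w x - g x) * z x) = 0.
Proof.
move=> Lg; pose P x : pt -> R := peval (@pcomb R n.+1 r x).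
have LP x : L2F F (P x) by exact: L2F_peval.
have PE s x y : P (s *: x + y) = fun z => s * P x z + P y z.
  by apply/funext => z; rewrite /P pcomb_lin pevalD pevalZ.
have lin f : L2F F f -> linform (fun y => sint F (fun z => f z * P y z)).
  move=> Lf s x y /=; rewrite -sintZ; last exact: L2F_mul.
  rewrite -sintD; [|by apply: intgFZ; exact: L2F_mul|exact: L2F_mul].
  by apply: eq_sint => z _; rewrite PE; ring.
have [||||a Ha] := @riesz R _ (fun x y => sint F (fun z => P x z * P y z))
    (fun y => sint F (fun z => g z * P y z)) (sint F (fun z => g z ^+ 2)).
- by move=> x; exact: lin.
- move=> y s x1 x2; have E x : sint F (fun z => P x z * P y z) = sint F (fun z => P y z * P x z).
    by apply: eq_sint => z _; rewrite mulrC.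
  by rewrite /= !E; exact: (lin _ (LP y) s x1 x2).
- exact: lin.
- move=> x; rewrite (_ : (fun z => P x z * P x z) = fun z => P x z ^+ 2); last by apply/funext => z; rewrite expr2.
  apply: cs_sqr; [by apply: sint_ge0 => z; exact: sqr_ge0|by apply: sint_ge0 => z; exact: sqr_ge0|].
  exact: sint_cs.
exists (P a); split; first by exists (pcomb a) => //; exact: deg_le_pcomb.
move=> _ [p dp ->]; have [y Ey] := pcomb_surj dp.
have := Ha y; rewrite /P -Ey => /eqP; rewrite -subr_eq0 => /eqP <-.
rewrite -sintB; [|by apply: L2F_mul; exact: L2F_peval|by apply: L2F_mul => //; exact: L2F_peval].
by apply: eq_sint => z _; rewrite mulrBl.
Qed.

Lemma l2proj_spec (S : spaces M) F r g : Hloc S F = Pk_face r -> L2F F g ->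
  Pk_face r (l2proj S F g) /\
  forall z, Pk_face r z -> sint F (fun x => (l2proj S F g x - g x) * z x) = 0.
Proof.
move=> SF Lg; have [w Hw] := face_proj r Lg.
rewrite /l2proj SF; exact: (xgetPex (P := [set w | Pk_face r w /\ _]) (fun=> 0) (ex_intro _ w Hw)).
Qed.

Lemma eq_l2proj (S : spaces M) F f g :
  (forall y, @refsimplex R n y -> f (face_map F y) = g (face_map F y)) -> l2proj S F f = l2proj S F g.
Proof.
move=> fg; rewrite /l2proj; congr (xget _ _); apply/seteqP.
have E w z : sint F (fun x => (w x - f x) * z x) = sint F (fun x => (w x - g x) * z x).
  by apply: eq_sint => y ry; rewrite fg.
by split=> w [Hw Ho]; split=> // z Hz; rewrite -(Ho z Hz) E.
Qed.

Lemma L2F_face F r g : Pk_face r g -> L2F F g.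
Proof. by move=> [p _ ->]; exact: L2F_peval. Qed.

(** Discrete traces see only the projection of a normal jump; hence the norm may contain just that
    projection. *)
Lemma l2proj_dual (S : spaces M) F r g z : Hloc S F = Pk_face r -> L2F F g -> Pk_face r z ->
  sint F (fun x => z x * g x) = sint F (fun x => z x * l2proj S F g x).
Proof.
move=> SF Lg Hz; have [Hw Ho] := l2proj_spec SF Lg.
have Lz := L2F_face F Hz; have Lw := L2F_face F Hw.
apply/eqP; rewrite eq_sym -subr_eq0 -sintB; [|exact: L2F_mul..].
by rewrite -[X in _ == X](Ho z Hz); apply/eqP/eq_sint => y _; rewrite -mulrBr mulrC.
Qed.

End FaceProjection.

Section LocalSpaces.
Context {R : realType} {n : nat}.
Local Notation pt := 'rV[R]_n.+1.
Local Notation poly := (mpoly n.+1 R).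
Local Notation vpoly := {ffun 'I_n.+1 -> poly}.

Lemma Pk_lin k : lin_subspace (@Pk R n.+1 k).
Proof.
split=> [|a u v hu hv]; first exact: deg_le0.
by apply: deg_leD => //; exact: deg_leZ.
Qed.

Lemma Pkd_lin k : lin_subspace (@Pkd R n.+1 k).
Proof.
split=> [i|a u v hu hv i]; rewrite !ffunE; first exact: deg_le0.
by apply: deg_leD => //; exact: deg_leZ.
Qed.

Lemma RTk_lin k : lin_subspace (@RTk R n.+1 k).
Proof.
split=> [|a u v [u1 [u2 [hu1 hu2 Eu]]] [v1 [v2 [hv1 hv2 Ev]]]].
  exists 0, 0; split; [exact: (Pkd_lin k).1|exact: (Pk_lin k).1|].
  by move=> i; rewrite !ffunE mulr0 addr0.
exists (a *: u1 + v1), (a *: u2 + v2); split.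
- exact: (Pkd_lin k).2.
- exact: (Pk_lin k).2.
move=> i; rewrite !ffunE Eu Ev scalerDr scalerAr mulrDr.
by rewrite addrACA.
Qed.

Lemma RTk_Pkd k : @RTk R n.+1 k `<=` Pkd k.+1.
Proof.
move=> q [a [b [ha hb E]]] i; rewrite E; apply: deg_leD.
  by apply: deg_leW (ha i).
exact: (deg_leM (deg_leX i) hb).
Qed.

Lemma RTkS k l : (k <= l)%N -> @RTk R n.+1 k `<=` RTk l.
Proof.
move=> kl q [a [b [ha hb E]]]; exists a, b; split=> // [i|]; exact: deg_leW kl _.
Qed.

Lemma deg_le_pdiv k (q : vpoly) : Pkd k.+1 q -> deg_le k (Defs.pdiv q).
Proof. by move=> dq; apply: deg_le_sum => i _; have := deg_le_mderiv i (dq i). Qed.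

(** What the two families share: the flux space lies between RT of order [k], which receives the
    lifted field, and the polynomials of degree [k.+1], whose divergences are in [V]. *)
Definition hdg_spaces (k r : nat) (M : mesh R n.+1) (S : spaces M) :=
  [/\ forall F, Hloc S F = Pk_face r, forall K, Vloc S K = Pk k,
      forall K, lin_subspace (Qloc S K), forall K, Qloc S K `<=` Pkd k.+1 &
      forall K, RTk k `<=` Qloc S K].

Lemma hdg_spaces_P k r (M : mesh R n.+1) : hdg_spaces k r (spaces_P k r M).
Proof. by split=> // K; [exact: Pkd_lin|move=> q|move=> q; exact: RTk_Pkd]. Qed.

Lemma hdg_spaces_RT k r (M : mesh R n.+1) : hdg_spaces k r (spaces_RT k r M).
Proof. by split=> // K; [exact: RTk_lin|move=> q; exact: RTk_Pkd|move=> q]. Qed.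

Lemma hdg_lin k r (M : mesh R n.+1) (S : spaces M) : hdg_spaces k r S -> lin_spaces S.
Proof.
move=> [hH hV hQ _ _]; split=> [K _|K _|F Fi|F Fi].
- exact: hQ.
- by rewrite hV; exact: Pk_lin.
- rewrite hH; split.
    by exists 0; [exact: deg_le0|apply/funext => x; rewrite peval0].
  move=> a _ _ [p dp ->] [q dq ->]; exists (p + a *: q).
    by apply: deg_leD => //; exact: deg_leZ.
  by apply/funext => x; rewrite pevalD pevalZ.
by rewrite hH => g; exact: L2F_face.
Qed.

End LocalSpaces.

(** * Raviart-Thomas fields of lowest order *)

Section LowestOrder.
Context {R : realType} {n : nat}.
Local Notation pt := 'rV[R]_n.+1.
Local Notation poly := (mpoly n.+1 R).
Local Notation vpoly := {ffun 'I_n.+1 -> poly}.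
Local Notation sq u := (dot u u).

Section OneCell.
Variables (M : mesh R n.+1) (K : {set 'I_(nvert M)}).
Local Notation V := 'I_(nvert M).
Local Notation vx := (@vert R n.+1 M).

(* The Raviart-Thomas field with flux [a v] through the facet opposite to [v]. *)
Definition rt0 (a : V -> R) : vpoly := [ffun k => \sum_(v in K)
  (a v * enorm (gbc K v)) *: (mpolyX R (mnm1 k) - mpolyC n.+1 (vx v 0 k))].

Lemma pevalv_rt0 a x : pevalv (rt0 a) x = \sum_(v in K) (a v * enorm (gbc K v)) *: (x - vx v).
Proof.
apply/rowP => k; rewrite mxE ffunE peval_sum summxE; apply: eq_bigr => v _.
by rewrite pevalZ pevalD pevalN pevalX pevalC !mxE.
Qed.

Lemma rt0_RT a : RTk 0 (rt0 a).
Proof.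
exists [ffun k => mpolyC n.+1 (- \sum_(v in K) (a v * enorm (gbc K v)) * vx v 0 k)].
exists (mpolyC n.+1 (\sum_(v in K) a v * enorm (gbc K v))); split.
- by move=> i; rewrite ffunE; exact: deg_leC.
- exact: deg_leC.
move=> i; rewrite !ffunE mulrC mul_mpolyC scaler_suml raddfN/= raddf_sum/= -sumrN -big_split/=.
by apply: eq_bigr => v _; rewrite [in RHS]mpolyCM mul_mpolyC scalerDr scalerN addrC.
Qed.

Lemma peval_div_rt0 a x : peval (Defs.pdiv (rt0 a)) x =
  \sum_(i < n.+1) \sum_(v in K) a v * enorm (gbc K v).
Proof.
rewrite /Defs.pdiv peval_sum; apply: eq_bigr => i _; rewrite ffunE linear_sum/= peval_sum.
apply: eq_bigr => v _; rewrite linearZ/= pevalZ linearB/= mderivC subr0 mderivX mnm1E eqxx scale1r.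
have -> : mnm_sub (mnm1 i) (mnm1 i) = mnm0 :> multinom n.+1 by apply/mnmP => j; rewrite mnmBE mnm0E subnn.
by rewrite mpolyX0 -mpolyC1 pevalC mulr1.
Qed.

Hypothesis ndK : nondeg K.

Lemma kint1_gt0 : 0 < kint K (fun=> 1).
Proof. by have := jac_gt0 ndK; rewrite /jac pmulr_lgt0// invr_gt0 rvol_gt0. Qed.

Lemma kint1_jac : kint K (fun=> 1) = rvol n.+1 * jac K.
Proof. by rewrite /jac mulrC mulfVK// gt_eqF// rvol_gt0. Qed.

Lemma sint1 v : v \in K -> sint (K :\ v) (fun=> 1) = jac K * enorm (gbc K v) * rvol n.
Proof. by move=> vK; rewrite (sintE ndK). Qed.

Lemma sint1_gt0 v : v \in K -> 0 < sint (K :\ v) (fun=> 1).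
Proof.
move=> vK; rewrite sint1//; apply: mulr_gt0 (rvol_gt0 n).
exact: mulr_gt0 (jac_gt0 ndK) (enorm_gt0 (gbc_neq0 ndK vK)).
Qed.

Lemma intgF1 (F : {set V}) : intgF F (fun=> 1).
Proof.
have L1 : L2F F (fun=> 1) by apply: L2F_cont; exact: contC.
by have := L2F_mul L1 L1; rewrite (_ : (fun x => _) = fun=> 1)//; apply/funext => x; rewrite mulr1.
Qed.

Lemma rt0_normal a u y : u \in K -> @refsimplex R n y ->
  dot (pevalv (rt0 a) (face_map (K :\ u) y)) (nrm K u) = a u.
Proof.
move=> uK ry; rewrite pevalv_rt0 dot_suml (bigD1 u)//= big1 ?addr0 => [|v /andP[vK vu]].
  rewrite dotZl (face_dot_nrm ndK)// eqxx mul1r -mulrA mulfV ?mulr1//.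
  by rewrite gt_eqF// enorm_gt0// gbc_neq0.
by rewrite dotZl (face_dot_nrm ndK)// (negbTE vu) mul0r mulr0.
Qed.

(** The divergence of such a field is constant, so the total flux determines it. *)
Lemma rt0_div a mu : \sum_(u in K) a u * sint (K :\ u) (fun=> 1) = mu * kint K (fun=> 1) ->
  forall x, peval (Defs.pdiv (rt0 a)) x = mu.
Proof.
move=> H x; rewrite peval_div_rt0; set s := \sum_(i < n.+1) _.
have C1c := C1g_C1 (C1g_cst n.+1 (1 : R)).
have := cell_green_field ndK (rt0 a) C1c.
rewrite (_ : (fun z => 1 * peval (Defs.pdiv (rt0 a)) z) = fun=> s * 1); last first.
  by apply/funext => z; rewrite peval_div_rt0 mul1r mulr1.
rewrite (kintZ ndK)//; last exact: contC.
rewrite (_ : (fun z => dot (grad _ z) _) = fun=> 0); last first.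
  apply/funext => z; apply: big1 => i _; rewrite mxE.
  by rewrite (C1g_partial _ _ (C1g_cst n.+1 (1 : R))) mul0r.
rewrite (_ : kint K (fun=> 0) = 0) ?addr0; last exact: vint_eq0.
rewrite bintE//.
rewrite (_ : \sum_(u in K) _ = mu * kint K (fun=> 1)) => [/(mulIf _)->//|].
  by rewrite gt_eqF// kint1_gt0.
rewrite -H; apply: eq_bigr => u uK; rewrite -sintZ; last first.
  exact: intgF1.
apply: eq_sint => y ry; rewrite (outnormalE ndK uK) rt0_normal//.
by rewrite mul1r mulr1.
Qed.

End OneCell.

(** In each summand [|x - vx v| <= hK K]. The volume is [rvol n.+1 * jac K] and the area
    [jac K * enorm (gbc K v) * rvol n], so both sides differ by a factor
    [hK K * enorm (gbc K v) <= sigma]. *)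
Lemma rt0_bound (sigma : R) : 0 < sigma -> exists2 C, 0 < C &
  forall (M : mesh R n.+1) (K : {set 'I_(nvert M)}) a, shape sigma K ->
  kint K (fun x => sq (pevalv (rt0 K a) x)) <=
  C * (hK K * \sum_(v in K) a v ^+ 2 * sint (K :\ v) (fun=> 1)).
Proof.
move=> s0; have r1 := @rvol_gt0 R n; have r2 := @rvol_gt0 R n.+1.
exists (n.+2%:R * sigma * (rvol n.+1 / rvol n)); first by rewrite !mulr_gt0// invr_gt0.
move=> M K a [ndK shK]; have h0 := hK_gt0 ndK; have J0 := jac_gt0 ndK.
set c := \sum_(v in K) n.+2%:R * (a v * enorm (gbc K v)) ^+ 2 * hK K ^+ 2.
apply: (@le_trans _ _ (kint K (fun=> c * 1))).
  apply: (kint_le ndK).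
  - by apply: continuous_dot => i; exact: continuous_pevalv.
  - exact: contC.
  move=> x Kx; rewrite pevalv_rt0 mulr1; apply: le_trans (dot_sum_le _ _) _.
  rewrite ndK.1 mulr_sumr; apply: ler_sum => v vK; rewrite -mulrA ler_wpM2l//.
  rewrite dotZl dotZr mulrA -expr2 ler_wpM2l ?sqr_ge0//.
  exact: (edge_le_hK ndK vK Kx).
rewrite (kintZ ndK); last exact: contC.
rewrite kint1_jac// !mulr_suml !mulr_sumr; apply: ler_sum => v vK.
rewrite sint1//; have G0 := enorm_gt0 (gbc_neq0 ndK vK).
have E : n.+2%:R * sigma * (rvol n.+1 / rvol n) * (hK K * (a v ^+ 2 * (jac K * enorm (gbc K v) * rvol n))) =
  n.+2%:R * a v ^+ 2 * enorm (gbc K v) * hK K * (rvol n.+1 * jac K) * sigma.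
  by field; rewrite gt_eqF.
rewrite E [leLHS](_ : _ = n.+2%:R * a v ^+ 2 * enorm (gbc K v) * hK K * (rvol n.+1 * jac K) *
  (hK K * enorm (gbc K v))); last by ring.
apply: ler_wpM2l; last exact: shK.
apply: mulr_ge0; last by apply: mulr_ge0; exact: ltW.
by do 3?apply: mulr_ge0; rewrite ?sqr_ge0 ?ltW.
Qed.

End LowestOrder.

(** * Equilibrated fluxes from a lowest-order hybrid method *)

Section HybridFlux.
Context {R : realType} {n : nat}.
Local Notation pt := 'rV[R]_n.+1.

Lemma cs_mul (a b : R) : cs (a * b) (a ^+ 2) (b ^+ 2).
Proof.
move=> t t0; rewrite normrM -[a ^+ 2]real_normK ?num_real// -[b ^+ 2]real_normK ?num_real//.
rewrite -(@ler_pM2l _ t)// mulrDr [t * (t^-1 * _)]mulrA mulfV ?gt_eqF// mul1r -subr_ge0.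
rewrite (_ : _ - _ = (t * `|a| - `|b|) ^+ 2) ?sqr_ge0//; ring.
Qed.

Section Mesh.
Variables (M : mesh R n.+1).
Local Notation V := 'I_(nvert M).
Local Notation area F := (sint F (fun=> 1)).
Local Notation vol K := (kint K (fun=> 1)).
Local Notation idx := ({set V} + {set V})%type.
Local Notation vec := 'rV[R]_#|{: idx}|.
Implicit Types (K F : {set V}) (x y : vec).

Definition cval x K : R := x 0 (enum_rank (inl K : idx)).
(** Unknowns are indexed by all vertex sets; the test encodes the boundary condition. Entries at
    other sets are inert, so [hform] has a kernel and the system is solved by [riesz], not by
    inverting a matrix. *)
Definition fval x F : R := if F \in ifaces M then x 0 (enum_rank (inr F : idx)) else 0.
Definition hflux x K F : R := (hK K)^-1 * (cval x K - fval x F).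
Definition hform x y := \sum_(K in cells M) \sum_(F in facets K)
  hflux x K F * area F * (cval y K - fval y F).

Lemma cval_lin s x y K : cval (s *: x + y) K = s * cval x K + cval y K.
Proof. by rewrite /cval !mxE. Qed.

Lemma fval_lin s x y F : fval (s *: x + y) F = s * fval x F + fval y F.
Proof. by rewrite /fval; case: ifP => _; rewrite ?mulr0 ?addr0// !mxE. Qed.

Lemma hform_linr x : linform (hform x).
Proof.
move=> s y z; rewrite /hform mulr_sumr -big_split/=; apply: eq_bigr => K _.
rewrite mulr_sumr -big_split/=; apply: eq_bigr => F _; rewrite cval_lin fval_lin.
by move: (hflux _ _ _) (area F) (cval _ _) (cval _ _) (fval _ _) (fval _ _) => a b c d e f; ring.
Qed.

Lemma hform_linl y : linform (hform^~ y).
Proof.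
move=> s x z; rewrite /hform mulr_sumr -big_split/=; apply: eq_bigr => K _.
rewrite mulr_sumr -big_split/=; apply: eq_bigr => F _; rewrite /hflux cval_lin fval_lin.
by move: (_^-1) (area F) (cval x _) (cval z _) (fval x _) (fval z _) (cval y _ - _) => a b c d e f g; ring.
Qed.

Lemma cval_delta K (i : idx) : cval (delta_mx 0 (enum_rank i)) K = (inl K == i)%:R.
Proof. by rewrite /cval mxE eqxx/= (inj_eq enum_rank_inj). Qed.

Lemma fval_delta F (i : idx) : F \in ifaces M -> fval (delta_mx 0 (enum_rank i)) F = (inr F == i)%:R.
Proof. by move=> Fi; rewrite /fval Fi mxE eqxx/= (inj_eq enum_rank_inj). Qed.

End Mesh.

(* The fluxes are those of the lowest order hybrid method for the Poisson
   problem with right-hand side [m]: [hform x y = sum m * vol * y]. *)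
Lemma hybrid_flux (sigma D : R) : 0 < sigma -> 0 < D -> exists2 C, 0 < C &
  forall (M : mesh R n.+1) (Omega : set pt), triangulation M Omega -> shape_regular M sigma ->
  (forall x, closure Omega x -> enorm x <= D) ->
  forall m : {set 'I_(nvert M)} -> R, exists a : {set 'I_(nvert M)} -> {set 'I_(nvert M)} -> R,
  [/\ forall F, F \in ifaces M -> \sum_(K in cells_of F) a K F = 0,
      forall K, K \in cells M -> \sum_(F in facets K) a K F * sint F (fun=> 1) = m K * kint K (fun=> 1) &
      \sum_(K in cells M) hK K * (\sum_(F in facets K) a K F ^+ 2 * sint F (fun=> 1)) <=
        C * \sum_(K in cells M) m K ^+ 2 * kint K (fun=> 1)].
Proof.
move=> s0 D0; have [C C0 HC] := @broken_poincare R n sigma D s0 D0; exists C => //.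
move=> M Omega tri sr HD m.
have nd K : K \in cells M -> nondeg K by exact: (cell_nondeg tri).
have h0 K : K \in cells M -> 0 < hK K by move=> KM; exact: hK_gt0 (nd K KM).
have area_gt0 K F : K \in cells M -> F \in facets K -> 0 < sint F (fun=> 1).
  by move=> KM /imsetP[v vK ->]; exact: (sint1_gt0 (nd K KM) vK).
pose b y := \sum_(K in cells M) m K * kint K (fun=> 1) * cval y K.
pose S := \sum_(K in cells M) m K ^+ 2 * kint K (fun=> 1).
have S0 : 0 <= S.
  by apply: sumr_ge0 => K KM; rewrite mulr_ge0 ?sqr_ge0// ltW// (kint1_gt0 (nd K KM)).
have lb : linform b.
  move=> s y z; rewrite /b mulr_sumr -big_split/=; apply: eq_bigr => K _; rewrite cval_lin.
  by move: (m K * _) (cval _ _) (cval _ _) => c d e; ring.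
have BE y : hform y y = \sum_(K in cells M) (hK K)^-1 * bint K (fun F _ => (cval y K - fval y F) ^+ 2).
  apply: eq_bigr => K KM; rewrite /bint mulr_sumr; apply: eq_bigr => F FK.
  rewrite (_ : (fun=> (cval y K - fval y F) ^+ 2) = fun=> (cval y K - fval y F) ^+ 2 * 1); last by rewrite mulr1.
  rewrite sintZ; last exact: intgF1.
  by rewrite /hflux; move: (_^-1) (sint _ _) (_ - _) => c d e; ring.
(* The broken Poincare inequality for piecewise constants, whose gradients vanish: only the
   differences between cell and face values remain, and they form [hform y y]. *)
have Hb y : b y ^+ 2 <= S * C * hform y y.
  have P0 : 0 <= \sum_(K in cells M) kint K (fun=> cval y K ^+ 2).
    by apply: sumr_ge0 => K KM; apply: kint_ge0 => x _; exact: sqr_ge0.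
  apply: (@le_trans _ _ (S * \sum_(K in cells M) kint K (fun=> cval y K ^+ 2))).
    apply: cs_sqr => //; apply: cs_sum => K KM.
    rewrite (_ : kint K (fun=> cval y K ^+ 2) = kint K (fun=> 1) * cval y K ^+ 2); last first.
      rewrite -[RHS]mulrC -(kintZ (nd K KM)); last exact: contC.
      by rewrite mulr1.
    rewrite mulrAC [m K * _ * _]mulrC [m K ^+ 2 * _]mulrC; apply: csZ; last exact: cs_mul.
    by rewrite ltW// (kint1_gt0 (nd K KM)).
  rewrite -mulrA ler_wpM2l//.
  have trf : trace_fun (fun F => (fun=> fval y F) : pt -> R).
    split=> F; first by move=> _; apply: L2F_cont; exact: contC.
    by rewrite inE /fval => /andP[/negbTE ->].
  have := HC M Omega tri sr HD (fun K => (fun=> cval y K)) _ (fun K _ => C1g_C1 (C1g_cst n.+1 (cval y K))) trf.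
  rewrite [X in C * (X + _)]big1 ?add0r => [|K KM]; first by rewrite BE.
  apply: vint_eq0 => x _; apply: big1 => i _; rewrite mxE.
  by rewrite (C1g_partial _ _ (C1g_cst n.+1 (cval y K))) mul0r.
have [a Ha] := riesz (@hform_linr M) (@hform_linl M) lb Hb.
exists (hflux a); split.
- move=> F Fi.
  (* Testing with the unknown of a face gives conservation of the flux across it; testing with the
     unknown of a cell will give the balance in that cell. *)
  have := Ha (delta_mx 0 (enum_rank (inr F : {set 'I_(nvert M)} + {set 'I_(nvert M)})%type)).
  rewrite /b big1 => [|K _]; last by rewrite cval_delta mulr0.
  have F0 : 0 < sint F (fun=> 1).
    by have [K [L [KF _ _ _]]] := iface_cells tri Fi; move: KF; rewrite inE => /andP[]; exact: area_gt0.
  rewrite /hform face_sum (bigD1 F)/=; last by move: Fi; rewrite inE => /andP[].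
  rewrite [X in _ + X]big1 ?addr0 => [|G /andP[Gf GF]]; last first.
    apply: big1 => K _; rewrite cval_delta sub0r /fval; case: ifP => Gi; last by rewrite oppr0 mulr0.
    by have := fval_delta (inr F) Gi; rewrite /fval Gi => ->; rewrite -sum_eqE/= (negbTE GF) oppr0 mulr0.
  under eq_bigr => K KF do rewrite cval_delta fval_delta// eqxx sub0r mulrN1.
  rewrite sumrN -mulr_suml => /eqP; rewrite oppr_eq0 mulf_eq0 (gt_eqF F0) orbF => /eqP.
  exact.
- move=> K KM.
  have := Ha (delta_mx 0 (enum_rank (inl K : {set 'I_(nvert M)} + {set 'I_(nvert M)})%type)).
  rewrite /b (bigD1 K)//= [X in _ + X]big1 ?addr0 => [|L /andP[LM LK]]; last first.
    by rewrite cval_delta -sum_eqE/= (negbTE LK) mulr0.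
  rewrite cval_delta eqxx mulr1 => <-; rewrite /hform [RHS](bigD1 K)//=.
  have f0 F : fval (delta_mx 0 (enum_rank (inl K : {set 'I_(nvert M)} + {set 'I_(nvert M)})%type)) F = 0.
    by rewrite /fval; case: ifP => // Fi; have := fval_delta (inl K) Fi; rewrite /fval Fi.
  rewrite [X in _ = _ + X]big1 ?addr0 => [|L /andP[LM LK]]; last first.
    by apply: big1 => F _; rewrite cval_delta -sum_eqE/= (negbTE LK) f0 subr0 mulr0.
  by apply: eq_bigr => F _; rewrite cval_delta eqxx f0 subr0 mulr1.
rewrite [leLHS](_ : _ = hform a a); last first.
  apply: eq_bigr => K KM; rewrite mulr_sumr; apply: eq_bigr => F FK; rewrite /hflux.
  have := gt_eqF (h0 K KM); move: (hK K) (sint _ _) (cval _ _) (fval _ _) => c d e f c0.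
  by field; rewrite c0.
(* At the solution [b a = hform a a], so the bound reads [B^2 <= S C B] and one factor [B] can be
   divided out. *)
have := Hb a; rewrite -Ha expr2 -/S; set B := hform a a => H.
have [B0|B0] := leP B 0; last by move: H; rewrite ler_pM2r// mulrC.
by apply: le_trans B0 _; rewrite mulr_ge0// ltW.
Qed.

End HybridFlux.

(** * A field with continuous normal traces whose divergence controls a given [v] *)

Section DivergenceLift.
Context {R : realType} {n : nat}.
Local Notation pt := 'rV[R]_n.+1.
Local Notation poly := (mpoly n.+1 R).
Local Notation vpoly := {ffun 'I_n.+1 -> poly}.
Local Notation sq u := (dot u u).

Lemma facet_sum (M : mesh R n.+1) (K : {set 'I_(nvert M)}) (g : {set 'I_(nvert M)} -> R) :
  \sum_(F in facets K) g F = \sum_(v in K) g (K :\ v).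
Proof.
rewrite /facets big_imset//= => u v uK vK E.
apply/eqP/negPn/negP => uv; have : u \in K :\ v by rewrite !inE uv uK.
by rewrite -E !inE eqxx.
Qed.

Lemma pevalvD (q p : vpoly) (x : pt) : pevalv (q + p) x = pevalv q x + pevalv p x.
Proof. by apply/rowP => i; rewrite !mxE !ffunE pevalD. Qed.

Lemma pdivD (q p : vpoly) (x : pt) :
  peval (Defs.pdiv (q + p)) x = peval (Defs.pdiv q) x + peval (Defs.pdiv p) x.
Proof. by have := pdiv_lin 1 q p x; rewrite scale1r mul1r. Qed.

Lemma sqD_le (a b : R) : (a + b) ^+ 2 <= 2 * a ^+ 2 + 2 * b ^+ 2.
Proof. by rewrite -subr_ge0 (_ : _ - _ = (a - b) ^+ 2) ?sqr_ge0//; ring. Qed.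

Lemma dotD_le (u v : pt) : sq (u + v) <= 2 * sq u + 2 * sq v.
Proof.
rewrite /dot !mulr_sumr -big_split/=; apply: ler_sum => i _.
by rewrite mxE -!expr2; exact: sqD_le.
Qed.

Lemma kint_mean (M : mesh R n.+1) (K : {set 'I_(nvert M)}) (p : poly) : nondeg K ->
  (kint K (peval p) / jac K) ^+ 2 * kint K (fun=> 1) <= rvol n.+1 ^+ 2 * kint K (fun x => peval p x ^+ 2).
Proof.
move=> ndK; have J0 := jac_gt0 ndK; have r0 := @rvol_gt0 R n.+1.
have I0 : 0 <= kint K (fun x => peval p x ^+ 2) by apply: kint_ge0 => x _; exact: sqr_ge0.
have := kint_cs K (@continuous_peval R _ p) (@contC R _ 1).
rewrite (_ : (fun x => peval p x * 1) = peval p); last by apply/funext => x; rewrite mulr1.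
rewrite (_ : (fun=> 1 ^+ 2) = fun=> 1); last by apply/funext => x; rewrite expr1n.
move=> /(cs_sqr I0 (ltW (kint1_gt0 ndK))) H.
rewrite expr_div_n mulrAC ler_pdivrMr ?exprn_gt0//.
apply: (le_trans (ler_wpM2r (ltW (kint1_gt0 ndK)) H)).
rewrite (kint1_jac K) le_eqVlt; apply/orP; left; apply/eqP.
by move: (kint K _) => a; ring.
Qed.

Lemma divergence_lift (k : nat) (sigma D : R) : 0 < sigma -> 0 < D -> exists2 C, 0 < C &
  forall (M : mesh R n.+1) (Omega : set pt), triangulation M Omega -> shape_regular M sigma ->
  (forall x, closure Omega x -> enorm x <= D) ->
  forall v : {set 'I_(nvert M)} -> poly, (forall K, K \in cells M -> deg_le k (v K)) ->
  let vv := \sum_(K in cells M) kint K (fun x => peval (v K) x ^+ 2) in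
  exists p : {set 'I_(nvert M)} -> vpoly,
  [/\ forall K, K \in cells M -> RTk k (p K),
      forall F y, F \in ifaces M -> @refsimplex R n y ->
        \sum_(K in cells_of F) dot (pevalv (p K) (face_map F y)) (outnormal K F) = 0,
      \sum_(K in cells M) kint K (fun x => sq (pevalv (p K) x)) <= C * vv,
      \sum_(K in cells M) kint K (fun x => peval (Defs.pdiv (p K)) x ^+ 2) <= C * vv &
      vv <= C * - \sum_(K in cells M) kint K (fun x => peval (v K) x * peval (Defs.pdiv (p K)) x)].
Proof.
move=> s0 D0.
have [C1 C10 H1] := @cell_bubble R n k sigma s0.
have [C2 C20 H2] := @cell_poincare R n k.
have [C3 C30 H3] := @rt0_bound R n sigma s0.
have [C4 C40 H4] := @hybrid_flux R n sigma D s0 D0.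
have r0 := @rvol_gt0 R n.+1.
pose rv : R := rvol n.+1 ^+ 2; have rv0 : 0 < rv by exact: exprn_gt0.
pose Ca := 2 * (C1 * (2 * D) ^+ 2) + 2 * (C3 * (C4 * rv)); pose Cb := 2 * C1 + 2 * rv.
have Ca0 : 0 < Ca.
  have a1 := mulr_gt0 C10 (exprn_gt0 2 (mulr_gt0 (ltr0n R 2) D0)).
  by have a2 := mulr_gt0 C30 (mulr_gt0 C40 rv0); rewrite /Ca; lra.
have Cb0 : 0 < Cb by rewrite /Cb; lra.
exists (Ca + Cb + C2); first exact: addr_gt0 (addr_gt0 Ca0 Cb0) C20.
move=> M Omega tri sr HD v dv vv.
have nd K : K \in cells M -> nondeg K by exact: (cell_nondeg tri).
have sh K : K \in cells M -> shape sigma K by exact: (cell_shape tri s0 sr).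
pose I K := kint K (fun x => peval (v K) x ^+ 2).
have I0 K : 0 <= I K by apply: kint_ge0 => x _; exact: sqr_ge0.
have vv0 : 0 <= vv by apply: sumr_ge0 => K _; exact: I0.
have e1 : Ca <= Ca + Cb + C2 by clearbody Ca Cb; lra.
have e2 : Cb <= Ca + Cb + C2 by clearbody Ca Cb; lra.
have e3 : C2 <= Ca + Cb + C2 by clearbody Ca Cb; lra.
(* The mean of [v] times [rvol n.+1]; with this scaling [m K * kint K (peval (v K))] is the second
   term of [cell_poincare]. *)
pose m K := kint K (peval (v K)) / jac K.
have [a [a1 a2 a3]] := H4 M Omega tri sr HD m.
have mI K : K \in cells M -> m K ^+ 2 * kint K (fun=> 1) <= rv * I K.
  by move=> KM; exact: kint_mean (nd K KM).
have /boolp.choice[qb Hqb] : forall K, exists q : vpoly, K \in cells M -> exists2 w, w \in K & q = bubble K w (v K).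
  move=> K; have [KM|KM] := boolP (K \in cells M); last by exists 0.
  have [w wK] : exists w, w \in K by apply/card_gt0P; rewrite (nd K KM).1.
  by exists (bubble K w (v K)) => _; exists w.
pose b K := rt0 K (fun u => - a K (K :\ u)).
have divb K : K \in cells M -> forall x, peval (Defs.pdiv (b K)) x = - m K.
  move=> KM; apply: (rt0_div (nd K KM)); rewrite mulNr -(a2 K KM) facet_sum -sumrN.
  by apply: eq_bigr => u _; rewrite mulNr.
have normb K u y : K \in cells M -> u \in K -> @refsimplex R n y ->
    dot (pevalv (b K) (face_map (K :\ u) y)) (outnormal K (K :\ u)) = - a K (K :\ u).
  by move=> KM uK ry; rewrite (outnormalE (nd K KM) uK) (rt0_normal (nd K KM)).
have normq K u y : K \in cells M -> u \in K -> @refsimplex R n y ->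
    dot (pevalv (qb K) (face_map (K :\ u) y)) (outnormal K (K :\ u)) = 0.
  move=> KM uK ry; have [w wK ->] := Hqb K KM.
  by rewrite (outnormalE (nd K KM) uK) (bubble_normal (nd K KM)).
have Sb : \sum_(K in cells M) kint K (fun x => sq (pevalv (b K) x)) <= C3 * (C4 * (rv * vv)).
  apply: (@le_trans _ _ (C3 * \sum_(K in cells M) hK K * (\sum_(F in facets K) a K F ^+ 2 * sint F (fun=> 1)))).
    rewrite mulr_sumr; apply: ler_sum => K KM; apply: le_trans (H3 M K _ (sh K KM)) _.
    rewrite facet_sum le_eqVlt; apply/orP; left; apply/eqP; congr (_ * (_ * _)).
    by apply: eq_bigr => u _; rewrite sqrrN.
  rewrite ler_pM2l//; apply: le_trans a3 _; rewrite ler_pM2l// mulr_sumr.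
  by apply: ler_sum => K KM; exact: mI.
exists (fun K => qb K + b K); split.
- move=> K KM; have [w wK ->] := Hqb K KM.
  rewrite -[b K]scale1r; apply: (lin_subspaceP 1 (RTk_lin k)).
    by apply: bubble_RT; exact: dv.
  by apply: (RTkS (leq0n k)); exact: rt0_RT.
- move=> F y Fi ry; transitivity (\sum_(K in cells_of F) - a K F); last by rewrite sumrN a1// oppr0.
  apply: eq_bigr => K /cells_ofP[u [KM uK ->]].
  by rewrite pevalvD dotDl normq// normb// add0r.
- apply: (@le_trans _ _ (Ca * vv)); last first.
    exact: (ler_wpM2r vv0 e1).
  apply: (@le_trans _ _ (\sum_(K in cells M) (2 * (C1 * (2 * D) ^+ 2 * I K) + 2 * kint K (fun x => sq (pevalv (b K) x))))).
    apply: ler_sum => K KM; have ndK := nd K KM; have [w wK Eq] := Hqb K KM.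
    have cq (q : vpoly) : continuous (fun x => sq (pevalv q x)).
      by apply: continuous_dot => i; exact: continuous_pevalv.
    apply: (@le_trans _ _ (kint K (fun x => 2 * sq (pevalv (qb K) x) + 2 * sq (pevalv (b K) x)))).
      apply: (kint_le ndK) => [||x _]; first exact: cq.
        by apply: contD; apply: contM; exact: contC || exact: cq.
      by rewrite pevalvD; exact: dotD_le.
    rewrite (kintD ndK); try by apply: contM; [exact: contC|exact: cq].
    rewrite !(kintZ ndK); try exact: cq.
    rewrite lerD2r ler_pM2l// Eq; apply: le_trans (H1 M K (v K) w (sh K KM) (dv K KM) wK).1 _.
    apply: (ler_wpM2r (I0 K)); apply: (ler_wpM2l (ltW C10)).
    have hD := hK_le tri HD KM; have h0 := ltW (hK_gt0 ndK).
    by rewrite lerXn2r// nnegrE; exact: le_trans h0 hD.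
  have E z : Ca * z = 2 * (C1 * (2 * D) ^+ 2 * z) + 2 * (C3 * (C4 * (rv * z))) by rewrite /Ca; ring.
  rewrite (E vv) big_split/= -!mulr_sumr lerD2l.
  by apply: ler_wpM2l.
- apply: (@le_trans _ _ (Cb * vv)); last first.
    exact: (ler_wpM2r vv0 e2).
  rewrite mulr_sumr; apply: ler_sum => K KM; have ndK := nd K KM; have [w wK Eq] := Hqb K KM.
  apply: (@le_trans _ _ (kint K (fun x => 2 * peval (Defs.pdiv (qb K)) x ^+ 2 + 2 * m K ^+ 2 * 1))).
    have c1 (q : vpoly) : continuous (fun x => peval (Defs.pdiv q) x ^+ 2).
      by apply: contX2; exact: continuous_peval.
    apply: (kint_le ndK) => [||x _]; first exact: c1.
      by apply: contD; [apply: contM => //; exact: contC|exact: contC].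
    by rewrite pdivD divb// mulr1; apply: le_trans (sqD_le _ _) _; rewrite sqrrN.
  rewrite (kintD ndK); [|by apply: contM; [exact: contC|apply: contX2; exact: continuous_peval]|exact: contC].
  rewrite !(kintZ ndK); [|exact: contC|by apply: contX2; exact: continuous_peval].
  have E z : Cb * z = 2 * (C1 * z) + 2 * (rv * z) by rewrite /Cb; ring.
  rewrite (E (I K)) -(mulrA 2 (m K ^+ 2)); apply: lerD; apply: ler_wpM2l => //; last exact: mI.
  by rewrite Eq; exact: (H1 M K (v K) w (sh K KM) (dv K KM) wK).2.
(* The bubble has no normal trace, so integration by parts turns its share into the integral of
   [grad v . bubble]; the other field has divergence [- m K]. The sum is the right-hand side of
   [cell_poincare]. *)
- have P K : K \in cells M -> I K <= C2 * - kint K (fun x => peval (v K) x * peval (Defs.pdiv (qb K + b K)) x).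
    move=> KM; have ndK := nd K KM; have [w wK Eq] := Hqb K KM.
    apply: le_trans (H2 M K (v K) w ndK (dv K KM) wK) _; rewrite ler_pM2l// le_eqVlt; apply/orP; left; apply/eqP.
    have -> : kint K (fun x => peval (v K) x * peval (Defs.pdiv (qb K + b K)) x) =
        kint K (fun x => peval (v K) x * peval (Defs.pdiv (qb K)) x) - m K * kint K (peval (v K)).
      rewrite -mulNr -(kintZ ndK); last exact: continuous_peval.
      rewrite -(kintD ndK); [|by apply: contM; exact: continuous_peval|by apply: contM; [exact: contC|exact: continuous_peval]].
      by congr (kint K _); apply/funext => x; rewrite pdivD divb// mulrDr [_ * - m K]mulrC.
    have := cell_green_field ndK (qb K) (C1g_C1 (C1g_peval (v K))).
    rewrite (_ : bint K _ = 0); last first.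
      rewrite bintE big1// => u uK; rewrite -[RHS](sint0 (K :\ u)); apply: eq_sint => y ry.
      by rewrite normq// mulr0.
    rewrite (_ : (fun x => dot (grad _ x) _) = fun x => dot (pevalv (pgrad (v K)) x) (pevalv (qb K) x)); last first.
      by apply/funext => x; rewrite grad_peval.
    rewrite -Eq /m; move: (kint K _) (kint K _) (kint K _) (jac K)^-1 => c d e j E.
    by rewrite opprB -(addr0_eq E); ring.
  apply: (@le_trans _ _ (C2 * - \sum_(K in cells M) kint K (fun x => peval (v K) x * peval (Defs.pdiv (qb K + b K)) x))).
    by rewrite -sumrN mulr_sumr; apply: ler_sum => K KM; exact: P.
  apply: ler_wpM2r e3.
  rewrite -sumrN; apply: sumr_ge0 => K KM.
  by rewrite -(pmulr_rge0 _ C20); exact: le_trans (I0 K) (P K KM).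
Qed.

End DivergenceLift.

(** * Stability with respect to the discrete H(div) norm *)

Section MixedStability.
Context {R : realType} {n : nat}.
Local Notation pt := 'rV[R]_n.+1.
Local Notation poly := (mpoly n.+1 R).
Local Notation vpoly := {ffun 'I_n.+1 -> poly}.
Local Notation sq u := (dot u u).

Lemma sint_sqrD_le (M : mesh R n.+1) (F : {set 'I_(nvert M)}) (f g : pt -> R) : L2F F f -> L2F F g ->
  sint F (fun x => (f x + g x) ^+ 2) <= 2 * sint F (fun x => f x ^+ 2) + 2 * sint F (fun x => g x ^+ 2).
Proof.
move=> Lf Lg; have If := L2F_sqr Lf; have Ig := L2F_sqr Lg.
rewrite -(sintZ 2 If) -(sintZ 2 Ig) -sintD; [|exact: intgFZ..].
apply: le_sint; [exact: (L2F_sqr (L2FD Lf Lg))|by apply: intgFD; exact: intgFZ|].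
by move=> y _; exact: sqD_le.
Qed.

Lemma sint_sqrZ (M : mesh R n.+1) (F : {set 'I_(nvert M)}) a (f : pt -> R) : L2F F f ->
  sint F (fun x => (a * f x) ^+ 2) = a ^+ 2 * sint F (fun x => f x ^+ 2).
Proof.
by move=> Lf; rewrite -sintZ; [apply: eq_sint => y _; rewrite exprMn|exact: L2F_sqr].
Qed.

Lemma kint_sqrD_le (M : mesh R n.+1) (K : {set 'I_(nvert M)}) (a : R) (p q : poly) : nondeg K ->
  kint K (fun x => (peval p x + a * peval q x) ^+ 2) <=
  2 * kint K (fun x => peval p x ^+ 2) + 2 * a ^+ 2 * kint K (fun x => peval q x ^+ 2).
Proof.
move=> ndK; have c2 (f : poly) : continuous (fun x : pt => peval f x ^+ 2).
  by apply: contX2; exact: continuous_peval.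
rewrite -(kintZ ndK 2)// -(kintZ ndK (2 * a ^+ 2))// -(kintD ndK); [|by apply: contM; [exact: contC|exact: c2]..].
apply: (kint_le ndK).
- apply: contX2; apply: contD; first exact: continuous_peval.
  by apply: contM; [exact: contC|exact: continuous_peval].
- by apply: contD; apply: contM; exact: contC || exact: c2.
by move=> x _; apply: le_trans (sqD_le _ _) _; rewrite exprMn (mulrA 2 (a ^+ 2)).
Qed.

Section Mesh.
Variables (Omega : set pt) (alpha : pt -> 'M[R]_n.+1) (M : mesh R n.+1) (sigma B Ct : R) (k r : nat) (S : spaces M).
Local Notation V := 'I_(nvert M).
Local Notation c := (fun x => invmx (alpha x)).
Hypotheses (polyO : polyhedral_domain Omega) (ca : coefficient Omega alpha) (tri : triangulation M Omega).
Hypotheses (s0 : 0 < sigma) (sr : shape_regular M sigma) (B0 : 0 < B) (Ct0 : 0 < Ct).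
Hypothesis HB1 : forall x, Omega x -> forall v, sq v <= B * dot (mulmv (c x) v) v.
Hypothesis HB2 : forall x, Omega x -> forall v, dot (mulmv (c x) v) v <= B * sq v.
Hypothesis hS : hdg_spaces k r S.
Hypothesis HCt : forall (K : {set V}) (p : poly) v, shape sigma K -> deg_le k p -> v \in K ->
  hK K * sint (K :\ v) (fun x => peval p x ^+ 2) <= Ct * kint K (fun x => peval p x ^+ 2).
Implicit Types (X Y Z : dfun M) (K F : {set V}).

Let lS := hdg_lin hS.
Let nd K : K \in cells M -> nondeg K. Proof. exact: (cell_nondeg tri). Qed.

Definition dsq X := \sum_(K in cells M) kint K (fun x => peval (Defs.pdiv (dq X K)) x ^+ 2).
Definition vsq X := \sum_(K in cells M) kint K (fun x => peval (dv X K) x ^+ 2).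
Definition wsq X := \sum_(F in ifaces M) hF F * sint F (fun x => dh X F x ^+ 2).
Definition psq X := \sum_(F in ifaces M) (hF F)^-1 * sint F (fun x => l2proj S F (jump (embed X) F) x ^+ 2).
Definition csq X := \sum_(K in cells M) hK K * bint K (fun F x => dtrace X K F x ^+ 2).
Definition tsq X := \sum_(K in cells M) hK K * bint K (fun F x => peval (dv X K) x ^+ 2).
Definition hsq X := \sum_(K in cells M) hK K * bint K (fun F x => dh X F x ^+ 2).

Lemma dsq_ge0 X : 0 <= dsq X.
Proof. by apply: sumr_ge0 => K _; apply: kint_ge0 => x _; exact: sqr_ge0. Qed.

Lemma vsq_ge0 X : 0 <= vsq X.
Proof. by apply: sumr_ge0 => K _; apply: kint_ge0 => x _; exact: sqr_ge0. Qed.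

Let hF0 F : F \in ifaces M -> 0 < hF F.
Proof. by rewrite inE => /andP[Ff _]; exact: hF_gt0 tri _ _ s0 sr Ff. Qed.

Lemma sqr_sint_ge0 F (f : pt -> R) : 0 <= sint F (fun x => f x ^+ 2).
Proof. by apply: sint_ge0 => x; exact: sqr_ge0. Qed.

Lemma wsq_ge0 X : 0 <= wsq X.
Proof. by apply: sumr_ge0 => F Fi; apply: mulr_ge0 (sqr_sint_ge0 _ _); exact: ltW (hF0 Fi). Qed.

Lemma psq_ge0 X : 0 <= psq X.
Proof.
apply: sumr_ge0 => F Fi; apply: mulr_ge0 (sqr_sint_ge0 _ _).
by rewrite invr_ge0; exact: ltW (hF0 Fi).
Qed.

Lemma csq_ge0 X : 0 <= csq X.
Proof.
by apply: sumr_ge0 => K KM; apply: mulr_ge0 (bint_sqr_ge0 _ _); exact: ltW (hK_gt0 (nd KM)).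
Qed.

Lemma csq_le_ht X : good X -> csq X <= 2 * tsq X + 2 * hsq X.
Proof.
move=> gX; rewrite /csq /tsq /hsq !mulr_sumr -big_split/=; apply: ler_sum => K KM.
rewrite [2 * _]mulrCA [2 * (hK K * bint K (fun F x => dh X F x ^+ 2))]mulrCA -mulrDr.
apply: ler_wpM2l; first exact: ltW (hK_gt0 (nd KM)).
rewrite /bint !mulr_sumr -big_split/=; apply: ler_sum => F FK.
have Lh := good_L2F gX KM FK.
have := sint_sqrD_le (L2F_peval F (dv X K)) (L2FZ (-1) Lh).
rewrite sint_sqrZ// sqrrN expr1n mul1r.
by rewrite (_ : (fun x => _) = fun x => dtrace X K F x ^+ 2)//; apply/funext => x; rewrite mulN1r.
Qed.

Lemma hsq_le_ct X : good X -> hsq X <= 2 * csq X + 2 * tsq X.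
Proof.
move=> gX; rewrite /csq /tsq /hsq !mulr_sumr -big_split/=; apply: ler_sum => K KM.
rewrite [2 * _]mulrCA [2 * (hK K * bint K (fun F x => peval (dv X K) x ^+ 2))]mulrCA -mulrDr.
apply: ler_wpM2l; first exact: ltW (hK_gt0 (nd KM)).
rewrite /bint !mulr_sumr -big_split/=; apply: ler_sum => F FK.
have Ld := L2F_dtrace gX KM FK.
have := sint_sqrD_le (L2FZ (-1) Ld) (L2F_peval F (dv X K)).
rewrite sint_sqrZ// sqrrN expr1n mul1r.
rewrite (_ : (fun x => _) = fun x => dh X F x ^+ 2)//; apply/funext => x.
by rewrite /dtrace; congr (_ ^+ 2); ring.
Qed.

Lemma tsq_le X : in_Uh S X -> tsq X <= n.+2%:R * Ct * vsq X.
Proof.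
move=> [_ UV _]; rewrite /tsq /vsq mulr_sumr; apply: ler_sum => K KM; have ndK := nd KM.
have dK : deg_le k (dv X K) by have [_ hV _ _ _] := hS; have := UV K KM; rewrite hV.
rewrite bintE mulr_sumr -mulrA mulr_natl -[X in _ *+ X]ndK.1 -sumr_const.
by apply: ler_sum => v vK; apply: HCt => //; exact: (cell_shape tri s0 sr KM).
Qed.

Lemma hsqE X : good X ->
  hsq X = \sum_(F in ifaces M) (\sum_(K in cells_of F) hK K) * sint F (fun x => dh X F x ^+ 2).
Proof.
move=> gX; rewrite /hsq.
under eq_bigr => K KM do rewrite /bint mulr_sumr.
rewrite face_sum (bigID (mem (ifaces M)))/= [X in _ + X]big1 ?addr0; last first.
  move=> F /andP[Ff Fi]; apply: big1 => K _.
  have -> : dh X F = fun=> 0 by apply: gX.2; rewrite inE Fi.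
  rewrite (_ : (fun x => _) = fun=> 0); first by rewrite sint0 mulr0.
  by apply/funext => x; rewrite expr0n.
apply: eq_big => [F|F _]; last by rewrite mulr_suml.
by apply: andb_idl; rewrite inE => /andP[].
Qed.

Lemma hsq_le X : good X -> hsq X <= 2 * (1 + sigma) * wsq X.
Proof.
move=> gX; rewrite hsqE// /wsq mulr_sumr; apply: ler_sum => F Fi.
rewrite [leRHS]mulrA; apply: (ler_wpM2r (sqr_sint_ge0 _ _)).
have [K [L [KF LF KL ->]]] := iface_cells tri Fi.
rewrite big_setU1 ?inE//= big_set1.
have := lerD (hK_le_hF tri s0 sr KF) (hK_le_hF tri s0 sr LF).
by move=> H; apply: le_trans H _; rewrite -mulrA mulr_natl mulr2n.
Qed.

Lemma wsq_le X : good X -> wsq X <= hsq X.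
Proof.
move=> gX; rewrite hsqE//; apply: ler_sum => F Fi; apply: (ler_wpM2r (sqr_sint_ge0 _ _)).
have Ff : F \in faces M by move: Fi; rewrite inE => /andP[].
have [K KF hFK] := hF_le_cell tri Ff; rewrite (bigD1 K)//=; apply: le_trans hFK _.
rewrite lerDl; apply: sumr_ge0 => L /andP[LF _].
by apply: ltW; apply: hK_gt0; apply: nd; move: LF; rewrite inE => /andP[].
Qed.

Lemma L2F_jump X F : L2F F (jump (embed X) F).
Proof. by apply: L2F_sum => K _; exact: L2F_flux. Qed.

(** The mixed form in the shape suited to the H(div) norm: since [v^] is single-valued, the normal
    traces enter only through their jumps across interior faces. *)
Lemma bh_jump X Y : good Y -> bh (embed X) (embed Y) =
  - \sum_(K in cells M) kint K (fun x => peval (dv Y K) x * peval (Defs.pdiv (dq X K)) x) +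
  \sum_(F in ifaces M) sint F (fun x => dh Y F x * jump (embed X) F x).
Proof.
move=> gY; congr (_ + _); rewrite /bint face_sum (bigID (mem (ifaces M)))/= [X in _ + X]big1 ?addr0; last first.
  move=> F /andP[Ff Fi]; apply: big1 => K _.
  have -> : dh Y F = fun=> 0 by apply: gY.2; rewrite inE Fi.
  by rewrite -[RHS](sint0 F); apply: eq_sint => y _; rewrite mul0r.
apply: eq_big => [F|F /andP[_ Fi]]; first by apply: andb_idl; rewrite inE => /andP[].
rewrite -sint_sum; last by move=> K _; apply: L2F_mul; [exact: gY.1|exact: L2F_flux].
by apply: eq_sint => y _; rewrite /jump mulr_sumr.
Qed.

Let HlocE F : Hloc S F = Pk_face r. Proof. by have [-> _ _ _ _] := hS. Qed.

Lemma L2F_proj X F : L2F F (l2proj S F (jump (embed X) F)).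
Proof. exact: L2F_face (l2proj_spec (HlocE F) (L2F_jump X F)).1. Qed.

Lemma in_Uh_face X F : in_Uh S X -> F \in ifaces M -> Pk_face r (dh X F).
Proof. by move=> [_ _ [h1 _]] Fi; have := h1 F Fi; rewrite HlocE. Qed.

Section Rho.
Variable rho : R.
Hypothesis rho01 : 0 < rho <= 1.
Local Notation tau := (fun K => rho * hK K).

Let r0 : 0 < rho. Proof. by case/andP: rho01. Qed.

Lemma bh_cs_jump X Y : in_Uh S Y ->
  cs (bh (embed X) (embed Y)) (dsq X + rho^-1 * psq X) (vsq Y + rho * wsq Y).
Proof.
move=> UY; have gY := in_Uh_good lS UY; rewrite bh_jump//; apply: csD.
  apply: csN; apply: csC; apply: cs_sum => K KM; apply: kint_cs; exact: continuous_peval.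
rewrite /psq /wsq !mulr_sumr; apply: csC; apply: cs_sum => F Fi.
rewrite (l2proj_dual (HlocE F) (L2F_jump X F) (in_Uh_face UY Fi)) (mulrA rho) (mulrA rho^-1) -invfM.
apply: cs_weight; first by rewrite mulr_gt0// hF0.
by apply: sint_cs; [exact: gY.1|exact: L2F_proj].
Qed.

Lemma ch_cs_tau X Y : good X -> good Y ->
  cs (ch tau (embed X) (embed Y)) (rho * csq X) (rho * csq Y).
Proof.
move=> gX gY; rewrite chE//; apply: csN; rewrite /csq !mulr_sumr; apply: cs_sum => K KM.
rewrite !mulrA; apply: csZ; first by apply: mulr_ge0; apply: ltW => //; exact: hK_gt0 (nd KM).
by apply: cs_sum => F FK; apply: sint_cs; exact: L2F_dtrace.
Qed.

Let Ce := n.+2%:R * Ct.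
(** Squares of [v - v^] cost twice those of [v] and of [v^]. The former are bounded on faces by [Ce]
    times [vsq], the latter by [2 (1 + sigma)] times [wsq], as an interior face has two cells. *)
Let Cc := 2 * Ce + 4 * (1 + sigma).
Let Ce0 : 0 < Ce. Proof. exact: mulr_gt0. Qed.
Let Cc0 : 0 < Cc. Proof. by have := Ce0; have := s0; rewrite /Cc; clearbody Ce => *; lra. Qed.

Lemma csq_le X : in_Uh S X -> rho * csq X <= Cc * (vsq X + rho * wsq X).
Proof.
move=> UX; have gX := in_Uh_good lS UX.
have h1 := csq_le_ht gX; have h2 := tsq_le UX; have h3 := hsq_le gX.
have h : csq X <= 2 * Ce * vsq X + 4 * (1 + sigma) * wsq X.
  by move: h1 h2 h3; rewrite -/Ce; move: (csq X) (tsq X) (hsq X) (vsq X) (wsq X) => *; lra.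
apply: le_trans (ler_wpM2l (ltW r0) h) _; have [_ r1] := andP rho01.
have v0 := vsq_ge0 X; have w0 := mulr_ge0 (ltW r0) (wsq_ge0 X); have e0 := ltW Ce0.
have a1 := mulr_ge0 e0 v0; have a2 := mulr_ge0 e0 w0.
have a3 := mulr_ge0 (ltW s0) v0.
have a4 : rho * (Ce * vsq X) <= Ce * vsq X by rewrite ler_piMl.
rewrite /Cc; move: a1 a2 a3 a4 v0; clearbody Ce.
rewrite mulrDr [rho * (2 * Ce * _)](_ : _ = 2 * (rho * (Ce * vsq X))); last by ring.
rewrite [rho * (4 * (1 + sigma) * _)](_ : _ = 4 * (1 + sigma) * (rho * wsq X)); last by ring.
by move: (vsq X) (rho * wsq X) (rho * _) => *; lra.
Qed.

(** Control of [v^] comes from the stabilization and from the trace inequality for [v]; no test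
    triple aims at it. *)
Lemma wsq_le_cv X : in_Uh S X -> rho * wsq X <= 2 * (rho * csq X) + 2 * Ce * vsq X.
Proof.
move=> UX; have gX := in_Uh_good lS UX.
have h1 := hsq_le_ct gX; have h2 := tsq_le UX; have h3 := wsq_le gX.
have h : wsq X <= 2 * csq X + 2 * Ce * vsq X.
  by move: h1 h2 h3; rewrite -/Ce; move: (csq X) (tsq X) (hsq X) (vsq X) (wsq X) => *; lra.
apply: le_trans (ler_wpM2l (ltW r0) h) _; have [_ r1] := andP rho01.
have a1 := mulr_ge0 (ltW Ce0) (vsq_ge0 X).
have a4 : rho * (Ce * vsq X) <= Ce * vsq X by rewrite ler_piMl.
rewrite mulrDr [rho * (2 * Ce * _)](_ : _ = 2 * (rho * (Ce * vsq X))); last by ring.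
rewrite [rho * (2 * _)]mulrCA -[2 * Ce * _]mulrA.
by move: a4; move: (rho * csq X) (Ce * vsq X) => *; lra.
Qed.

Let N2 X := norm_q2 c X + dsq X + rho^-1 * psq X + (vsq X + rho * wsq X).

Lemma normU1_ge0 X : 0 <= N2 X.
Proof.
have := norm_q2_ge0 polyO ca tri X; have := dsq_ge0 X; have := vsq_ge0 X.
have := mulr_ge0 (ltW r0) (wsq_ge0 X).
have ri : 0 <= rho^-1 by rewrite invr_ge0 ltW.
have := mulr_ge0 ri (psq_ge0 X).
by rewrite /N2; move: (norm_q2 _ _) (dsq _) (vsq _) (rho * _) (_ * psq _) => *; lra.
Qed.

Lemma normU1_sqr X : normU1 c S rho X ^+ 2 = N2 X.
Proof. by rewrite /normU1 sqr_sqrtr// normU1_ge0. Qed.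

Lemma mixed_continuous : continuous_form c S tau (normU1 c S rho) (1 + Cc).
Proof.
move=> X Y UX UY; have gX := in_Uh_good lS UX; have gY := in_Uh_good lS UY.
have A1 := ah_cs polyO ca tri X Y.
have A2 := csC (bh_cs_jump Y UX).
have A3 := bh_cs_jump X UY.
have A4 := ch_cs_tau gX gY.
have K0 : 0 <= 1 + Cc by apply: addr_ge0 => //; exact: ltW Cc0.
have := csD (csD (csD A1 A2) A3) A4; rewrite -/(Ah c _ _ _) => H.
have ri : 0 <= rho^-1 by rewrite invr_ge0 ltW.
have L Z : in_Uh S Z -> norm_q2 c Z + (dsq Z + rho^-1 * psq Z) + (vsq Z + rho * wsq Z) + rho * csq Z <= (1 + Cc) * N2 Z.
  move=> UZ; have h := csq_le UZ.
  have q0 := mulr_ge0 (ltW Cc0) (norm_q2_ge0 polyO ca tri Z).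
  have d0 := mulr_ge0 (ltW Cc0) (dsq_ge0 Z).
  have p0 := mulr_ge0 (ltW Cc0) (mulr_ge0 ri (psq_ge0 Z)).
  move: h q0 d0 p0; rewrite /N2; clearbody Cc.
  by move: (norm_q2 _ _) (dsq _) (rho * csq _) (vsq _ + _) (_ * psq _) => *; lra.
have {}H : cs (Ah c tau (embed X) (embed Y)) ((1 + Cc) * N2 X) ((1 + Cc) * N2 Y).
  apply: (cs_le H); last exact: L.
  by rewrite [X in X + _ <= _]addrAC; exact: L.
apply: le_trans (cs_norm _ _ H) _; try by apply: mulr_ge0 => //; exact: normU1_ge0.
rewrite !sqrtrM// mulrACA -expr2 sqr_sqrtr// mulrA.
exact: lexx.
Qed.

Lemma dsq_lin a X Z : dsq (dlin a X Z) <= 2 * dsq X + 2 * a ^+ 2 * dsq Z.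
Proof.
rewrite /dsq !mulr_sumr -big_split/=; apply: ler_sum => K KM.
apply: le_trans (kint_sqrD_le a (Defs.pdiv (dq X K)) (Defs.pdiv (dq Z K)) (nd KM)).
rewrite le_eqVlt; apply/orP; left; apply/eqP; congr (kint K _).
by apply/funext => x; rewrite pdiv_lin.
Qed.

Lemma vsq_lin a X Z : vsq (dlin a X Z) <= 2 * vsq X + 2 * a ^+ 2 * vsq Z.
Proof.
rewrite /vsq !mulr_sumr -big_split/=; apply: ler_sum => K KM.
apply: le_trans (kint_sqrD_le a (dv X K) (dv Z K) (nd KM)).
rewrite le_eqVlt; apply/orP; left; apply/eqP; congr (kint K _).
by apply/funext => x; rewrite pevalD pevalZ.
Qed.

Lemma wsq_lin a X Z : good X -> good Z -> wsq (dlin a X Z) <= 2 * wsq X + 2 * a ^+ 2 * wsq Z.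
Proof.
move=> gX gZ; rewrite /wsq !mulr_sumr -big_split/=; apply: ler_sum => F Fi.
rewrite [2 * (hF F * _)]mulrCA [2 * a ^+ 2 * (hF F * _)]mulrCA -mulrDr.
apply: ler_wpM2l; first exact: ltW (hF0 Fi).
have := sint_sqrD_le (gX.1 F Fi) (L2FZ a (gZ.1 F Fi)).
by rewrite (sint_sqrZ a (gZ.1 F Fi)) mulrA.
Qed.

Lemma vsq_flip Y : vsq (dflip Y) = vsq Y.
Proof. by apply: eq_bigr => K _; congr (kint K _); apply/funext => x; rewrite pevalN sqrrN. Qed.

Lemma wsq_flip Y : wsq (dflip Y) = wsq Y.
Proof. by apply: eq_bigr => F _; congr (_ * sint F _); apply/funext => x; rewrite sqrrN. Qed.

Variables (Cl : R) (Y : dfun M) (p : {set V} -> vpoly).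
Hypotheses (Cl0 : 0 < Cl) (UY : in_Uh S Y).
Hypothesis p_RT : forall K, K \in cells M -> RTk k (p K).
Hypothesis p_jump : forall F y, F \in ifaces M -> @refsimplex R n y ->
  \sum_(K in cells_of F) dot (pevalv (p K) (face_map F y)) (outnormal K F) = 0.
Hypothesis p_sq : \sum_(K in cells M) kint K (fun x => sq (pevalv (p K) x)) <= Cl * vsq Y.
Hypothesis p_div : \sum_(K in cells M) kint K (fun x => peval (Defs.pdiv (p K)) x ^+ 2) <= Cl * vsq Y.
Hypothesis p_lift : vsq Y <= Cl *
  - \sum_(K in cells M) kint K (fun x => peval (dv Y K) x * peval (Defs.pdiv (p K)) x).

Let gY := in_Uh_good lS UY.

(** The factor [(rho hF)^-1] makes the weighted square of the face component equal to the jump term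
    of the norm of [Y] ([wsq_dtest]), so the size of the triple is uniform in [rho]. *)
Definition dtest : dfun M := DFun p (fun K => - Defs.pdiv (dq Y K))
  (fun F => if F \in ifaces M then fun x => (rho * hF F)^-1 * l2proj S F (jump (embed Y) F) x else fun=> 0).

Lemma dtest_Uh : in_Uh S dtest.
Proof.
have [hH hV hQ hQd hRT] := hS; have [yq yv _] := UY; split.
- by move=> K KM; apply: hRT; exact: p_RT.
- by move=> K KM; rewrite hV; apply: deg_leN; apply: deg_le_pdiv; exact: hQd _ _ (yq K KM).
split=> F; last by rewrite inE /= => /andP[/negbTE ->].
move=> Fi; rewrite /= Fi; have [_ _ lh _] := lS.
have := (lh F Fi).2 (rho * hF F)^-1 _ (l2proj S F (jump (embed Y) F)) (lh F Fi).1.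
rewrite (_ : (fun x => _) = fun x => (rho * hF F)^-1 * l2proj S F (jump (embed Y) F) x); last first.
  by apply/funext => x; rewrite add0r.
by apply; rewrite hH; exact: (l2proj_spec (HlocE F) (L2F_jump Y F)).1.
Qed.

Let gZ := in_Uh_good lS dtest_Uh.

Lemma qsq_dtest : norm_q2 c dtest <= B * (Cl * vsq Y).
Proof.
apply: le_trans (norm_q2_le polyO ca tri dtest HB2) _.
by rewrite ler_pM2l.
Qed.

Lemma vsq_dtest : vsq dtest = dsq Y.
Proof. by apply: eq_bigr => K _; congr (kint K _); apply/funext => x; rewrite pevalN sqrrN. Qed.

Lemma wsq_dtest : rho * wsq dtest = rho^-1 * psq Y.
Proof.
rewrite /wsq /psq !mulr_sumr; apply: eq_bigr => F Fi; rewrite /= Fi sint_sqrZ; last exact: L2F_proj.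
rewrite [RHS](_ : _ = rho * (hF F * ((rho * hF F)^-1 ^+ 2 * sint F (fun x => l2proj S F (jump (embed Y) F) x ^+ 2))))//.
by move: (sint _ _) => z; field; rewrite (gt_eqF r0) (gt_eqF (hF0 Fi)).
Qed.

Lemma bh_dtestr : bh (embed Y) (embed dtest) = dsq Y + rho^-1 * psq Y.
Proof.
rewrite bh_jump//; congr (_ + _).
  rewrite -sumrN; apply: eq_bigr => K KM; rewrite -mulN1r -(kintZ (nd KM)); last first.
    by apply: contM; exact: continuous_peval.
  by congr (kint K _); apply/funext => x; rewrite pevalN; ring.
rewrite /psq mulr_sumr; apply: eq_bigr => F Fi; rewrite /= Fi.
have LP := L2F_proj Y F; have LJ := L2F_jump Y F.
transitivity ((rho * hF F)^-1 * sint F (fun x => l2proj S F (jump (embed Y) F) x * jump (embed Y) F x)).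
  by rewrite -sintZ; [apply: eq_sint => y _; rewrite mulrA|exact: L2F_mul].
rewrite (l2proj_dual (HlocE F) LJ (l2proj_spec (HlocE F) LJ).1) (mulrA rho^-1) -invfM.
by congr (_ * _); apply: eq_sint => y _; rewrite expr2.
Qed.

Lemma bh_dtestl : bh (embed dtest) (embed Y) =
  - \sum_(K in cells M) kint K (fun x => peval (dv Y K) x * peval (Defs.pdiv (p K)) x).
Proof.
rewrite bh_jump//= [X in _ + X]big1 ?addr0// => F Fi.
by rewrite -[RHS](sint0 F); apply: eq_sint => y ry; rewrite /jump /= p_jump// mulr0.
Qed.

Lemma mixed_ah_bound (g s t q a : R) : 0 < g -> 0 < s -> 2 * `|a| <= g^-1 / s * (s * t) + g * s * q ->
  `|a| <= g^-1 * t / 2 + g * s * q / 2.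
Proof.
move=> g0 s1; rewrite (_ : g^-1 / s * (s * t) = g^-1 * t); last by field; rewrite !gt_eqF.
move: (g^-1 * t) (g * s * q) => *; lra.
Qed.

(** Cost of the cross terms after Young's inequality: [Cl * (B * Cl)] is charged to the flux term
    and [Cc] to the stabilization. The factor [e] reduces it to at most one half, and [gm] pays for
    replacing [Cl^-1 * v] by [v] together with the face term [w], of which [v] is charged
    [2 * Ce]. *)
Let G := Cl * (B * Cl) + Cc.
Let e := (2 * (G + 1))^-1.
Let gm := ((Cl + 1) * (3 + 2 * Ce))^-1.

Let G0 : 0 < G. Proof. by apply: addr_gt0 => //; apply: mulr_gt0 => //; exact: mulr_gt0. Qed.
Let e0 : 0 < e. Proof. by rewrite invr_gt0 mulr_gt0// addr_gt0. Qed.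

Let eE : e * (2 * (G + 1)) = 1.
Proof. by rewrite mulVf// gt_eqF// mulr_gt0// addr_gt0. Qed.

Let eG : e * G <= 1 / 2.
Proof. by move: eE e0; clearbody e G => *; lra. Qed.

Let e1 : e <= 1 / 2.
Proof. by have := mulr_gt0 e0 G0; move: eE; clearbody e G => *; lra. Qed.

Lemma mixed_inf_sup_bound (q d v w s a b A W : R) : 0 <= q -> 0 <= d -> 0 <= v -> 0 <= s ->
  w <= 2 * s + 2 * Ce * v -> v <= Cl * W ->
  `|a| <= Cl^-1 * v / 2 + Cl * (B * Cl) * q / 2 -> `|b| <= d / 2 + Cc * s / 2 ->
  A = a + d + W + b -> e / 2 * gm * (q + d + (v + w)) <= (q + s) + e * A.
Proof.
move=> q0 d0 v0 s1 hw hW /ler_normlP[ha _] /ler_normlP[hb _] ->.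
have hi : Cl^-1 * v <= W by rewrite mulrC ler_pdivrMr// mulrC.
have h1 : d / 2 + Cl^-1 * v / 2 - G * (q + s) / 2 <= a + d + W + b.
  have g1 : 0 <= Cc * q by rewrite mulr_ge0// ltW.
  have g2 : 0 <= Cl * (B * Cl) * s by apply: mulr_ge0 => //; apply: ltW; apply: mulr_gt0 => //; exact: mulr_gt0.
  move: hi ha hb g1 g2; rewrite /G; clearbody Cc; move: (Cl * (B * Cl)) (Cl^-1 * v) => x y *; nra.
have h2 : e * (d / 2 + Cl^-1 * v / 2 - G * (q + s) / 2) <= e * (a + d + W + b) by rewrite ler_pM2l.

have h3 : e * G * (q + s) <= 1 / 2 * (q + s) by rewrite ler_wpM2r// addr_ge0.

have gm0 : 0 < gm by rewrite invr_gt0 mulr_gt0 ?addr_gt0 ?mulr_gt0.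
have g3 : gm * (Cl + 1) * (3 + 2 * Ce) = 1.
  by rewrite -mulrA mulVf// gt_eqF// mulr_gt0 ?addr_gt0 ?mulr_gt0.
have k0 := mulr_gt0 gm0 Cl0; have k1 := mulr_gt0 gm0 Ce0; have k2 := mulr_gt0 k0 Ce0.
have g4 : gm <= 1 / 2 by move: g3 k0 k1 k2; clearbody gm Ce => *; nra.
have g5 : gm * (1 + 2 * Ce) * v <= Cl^-1 * v.
  rewrite ler_wpM2r// -(@ler_pM2r _ Cl)// mulVf ?gt_eqF//.
  by move: g3 k0 k1 k2; clearbody gm Ce => *; nra.
have g6 : gm * (q + d + (v + w)) <= q + d + (Cl^-1 * v + s).
  have l1 : gm * w <= gm * (2 * s + 2 * Ce * v) by rewrite ler_pM2l.
  have l2 : gm * q <= 1 / 2 * q by rewrite ler_wpM2r.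
  have l3 : gm * d <= 1 / 2 * d by rewrite ler_wpM2r.
  have l4 : gm * s <= 1 / 2 * s by rewrite ler_wpM2r.
  by move: l1 l2 l3 l4 g5; move: (Cl^-1 * v); clearbody gm Ce => *; lra.
have h4 : e / 2 * (gm * (q + d + (v + w))) <= e / 2 * (q + d + (Cl^-1 * v + s)).
  by rewrite ler_wpM2l// divr_ge0// ltW.
have h5 : e * (q + s) <= 1 / 2 * (q + s) by rewrite ler_wpM2r// addr_ge0.
move: h2 h3 h4 h5; rewrite -(mulrA (e / 2)); move: (gm * _) (Cl^-1 * v) (a + d + W + b).
by clearbody e G => *; lra.
Qed.

Lemma mixed_inf_sup_test : e / 2 * gm * normU1 c S rho Y ^+ 2 <=
  Ah c tau (embed (dlin e (dflip Y) dtest)) (embed Y).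
Proof.
have ri : 0 <= rho^-1 by rewrite invr_ge0 ltW.
rewrite (Ah_linl polyO ca tri _ _ (in_Uh_good lS (in_Uh_flip lS UY)) gZ gY) (Ah_flip alpha tri)// normU1_sqr.
have -> : \sum_(K in cells M) rho * hK K * bint K (fun F x => dtrace Y K F x ^+ 2) = rho * csq Y.
  by rewrite /csq mulr_sumr; apply: eq_bigr => K _; rewrite mulrA.
rewrite /N2 -(addrA (norm_q2 c Y)).
have q0 := norm_q2_ge0 polyO ca tri Y.
have d0 : 0 <= dsq Y + rho^-1 * psq Y by apply: addr_ge0 (dsq_ge0 Y) (mulr_ge0 ri (psq_ge0 Y)).
apply: (mixed_inf_sup_bound q0 d0 (vsq_ge0 Y) (mulr_ge0 (ltW r0) (csq_ge0 Y)) (wsq_le_cv UY) p_lift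
  (a := ah c (embed dtest) (embed Y)) (b := ch tau (embed dtest) (embed Y))).
- apply: mixed_ah_bound => //; first exact: mulr_gt0.
  have := ah_cs polyO ca tri dtest Y => H; have := cs_le H qsq_dtest (lexx _).
  move=> /(_ (Cl * (B * Cl))^-1); rewrite invrK invr_gt0 invfM (mulrA B).
  by apply; apply: mulr_gt0 => //; exact: mulr_gt0.
- have H := cs_le (ch_cs_tau gZ gY) (csq_le dtest_Uh) (lexx _).
  have := H Cc^-1; rewrite invrK invr_gt0 vsq_dtest wsq_dtest => /(_ Cc0).
  rewrite mulKf ?gt_eqF//; move: (`|_|) (Cc * _) (dsq Y + _) => *; lra.
by rewrite /Ah bh_dtestr -bh_dtestl; move: (ah _ _ _) (bh _ _) (ch _ _ _) (dsq Y + _) => *; ring.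
Qed.

(** Adding a multiple of [p] leaves the normal jumps unchanged, so the term weighted by the inverse
    of [rho] does not grow. *)
Lemma psq_dtest a : psq (dlin a (dflip Y) dtest) = psq Y.
Proof.
apply: eq_bigr => F Fi.
suff -> : l2proj S F (jump (embed (dlin a (dflip Y) dtest)) F) = l2proj S F (jump (embed Y) F) by [].
apply: eq_l2proj => y ry; rewrite /jump /=.
under eq_bigr => K _ do rewrite pevalv_lin dotDl dotZl.
by rewrite big_split/= -mulr_sumr p_jump// mulr0 addr0.
Qed.

Lemma normU1_dtest : normU1 c S rho (dlin e (dflip Y) dtest) <=
  Num.sqrt (4 + 2 * (B + 1) * Cl) * normU1 c S rho Y.
Proof.
have e2 : e ^+ 2 <= 1.
  by apply: exprn_ile1; [exact: ltW|apply: le_trans e1 _; lra].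
have C0 : 0 <= 4 + 2 * (B + 1) * Cl by rewrite addr_ge0// !mulr_ge0 ?addr_ge0// ltW.
rewrite /normU1 -sqrtrM// ler_wsqrtr//.
change (N2 (dlin e (dflip Y) dtest) <= (4 + 2 * (B + 1) * Cl) * N2 Y).
have ri : 0 <= rho^-1 by rewrite invr_ge0 ltW.
have q0 := norm_q2_ge0 polyO ca tri Y; have d0 := dsq_ge0 Y; have v0 := vsq_ge0 Y.
have p0 := mulr_ge0 ri (psq_ge0 Y); have w0 := mulr_ge0 (ltW r0) (wsq_ge0 Y).
have h1 : norm_q2 c (dlin e (dflip Y) dtest) <= 2 * norm_q2 c Y + 2 * (B * (Cl * vsq Y)).
  apply: le_trans (norm_q2_lin polyO ca tri e (dflip Y) dtest) _.
  rewrite lerD2l -mulrA ler_pM2l//; apply: le_trans qsq_dtest.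
  by apply: ler_piMl => //; exact: (norm_q2_ge0 polyO ca tri).
have h2 : dsq (dlin e (dflip Y) dtest) <= 2 * dsq Y + 2 * (Cl * vsq Y).
  apply: le_trans (dsq_lin e (dflip Y) dtest) _.
  rewrite lerD2l -mulrA ler_pM2l//; apply: le_trans p_div.
  by apply: ler_piMl => //; exact: dsq_ge0.
have h3 : vsq (dlin e (dflip Y) dtest) <= 2 * vsq Y + 2 * dsq Y.
  apply: le_trans (vsq_lin e (dflip Y) dtest) _; rewrite vsq_flip vsq_dtest.
  by rewrite lerD2l -mulrA ler_pM2l//; exact: ler_piMl.
have h4 : rho * wsq (dlin e (dflip Y) dtest) <= 2 * (rho * wsq Y) + 2 * (rho^-1 * psq Y).
  apply: le_trans (ler_wpM2l (ltW r0) (wsq_lin e (in_Uh_good lS (in_Uh_flip lS UY)) gZ)) _.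
  rewrite wsq_flip mulrDr mulrCA lerD2l mulrCA wsq_dtest -mulrA ler_pM2l//.
  exact: ler_piMl.
rewrite /N2 psq_dtest.
have k0 := mulr_ge0 (ltW Cl0) q0; have k1 := mulr_ge0 (ltW Cl0) d0; have k2 := mulr_ge0 (ltW Cl0) v0.
have k3 := mulr_ge0 (ltW Cl0) p0; have k4 := mulr_ge0 (ltW Cl0) w0.
have l0 := mulr_ge0 (ltW B0) k0; have l1 := mulr_ge0 (ltW B0) k1; have l3 := mulr_ge0 (ltW B0) k3; have l4 := mulr_ge0 (ltW B0) k4.
move: h1 h2 h3 h4 q0 d0 v0 p0 w0 k0 k1 k2 k3 k4 l0 l1 l3 l4.
move: (norm_q2 c (dlin _ _ _)) (norm_q2 c Y) (dsq (dlin _ _ _)) (dsq Y) (vsq (dlin _ _ _)) (vsq Y).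
move: (rho * wsq (dlin _ _ _)) (rho * wsq Y) (rho^-1 * psq Y); move=> *; lra.
Qed.

Lemma normU1_gt0 : ~ is_zero Y -> 0 < normU1 c S rho Y.
Proof.
move=> nz; rewrite lt_def sqrtr_ge0 andbT; apply/eqP => N0; apply: nz.
have ri : 0 < rho^-1 by rewrite invr_gt0.
have q0 := norm_q2_ge0 polyO ca tri Y; have d0 := dsq_ge0 Y; have v0 := vsq_ge0 Y.
have p0 := mulr_ge0 (ltW ri) (psq_ge0 Y); have w0 := mulr_ge0 (ltW r0) (wsq_ge0 Y).
have [q1 v1 w1] : [/\ norm_q2 c Y = 0, vsq Y = 0 & rho * wsq Y = 0].
  have := normU1_sqr Y; rewrite N0 expr0n/= /N2; move: q0 d0 v0 p0 w0.
  by move: (norm_q2 _ _) (dsq _) (vsq _) (rho * _) (_ * psq _) => *; split; lra.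
have {}w1 : wsq Y = 0 by move/eqP: w1; rewrite mulf_eq0 (gt_eqF r0)/= => /eqP.
split=> [K KM|F Ff].
  split.
    apply: (kint_sq_eq0 (nd KM)).
    have : qsq Y <= 0 by apply: le_trans (qsq_le polyO ca tri Y HB1) _; rewrite q1 mulr0.
    rewrite le_eqVlt ltNge qsq_ge0 orbF psumr_eq0 => [/allP/(_ K)|L _]; last first.
      by apply: kint_ge0 => x _; exact: dot_ge0.
    by rewrite mem_index_enum KM /= => /(_ isT)/eqP.
  apply: (kint_sqr_eq0 (nd KM)); move/eqP: v1; rewrite psumr_eq0 => [/allP/(_ K)|L _]; last first.
    by apply: kint_ge0 => x _; exact: sqr_ge0.
  by rewrite mem_index_enum KM /= => /(_ isT)/eqP.
have [Fi|Fi] := boolP (F \in ifaces M); last first.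
  have -> : dh Y F = fun=> 0 by apply: gY.2; rewrite inE Fi.
  exact: aeW.
have [K /cells_ofP[v [KM vK FK]]] := face_cell Ff; have ndK := nd KM.
have : sint F (fun x => dh Y F x ^+ 2) = 0.
  move/eqP: w1; rewrite psumr_eq0 => [/allP/(_ F)|L Li]; last first.
    by apply: mulr_ge0 (sqr_sint_ge0 _ _); exact: ltW (hF0 Li).
  by rewrite mem_index_enum Fi /= mulf_eq0 (gt_eqF (hF0 Fi))/= => /(_ isT)/eqP.
rewrite /sint FK (sqrt_gram ndK vK) -FK => /eqP.
rewrite mulf_eq0 (gt_eqF (mulr_gt0 _ (enorm_gt0 (gbc_neq0 ndK vK)))) ?jac_gt0//= => /eqP H.
exact: (vint_sqr_ae0 (@msr_ref R n) (gY.1 F Fi) H).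
Qed.

End Rho.
End Mesh.
End MixedStability.

Theorem stability_mixed (R : realType) (n : nat) (Omega : set 'rV[R]_n.+1)
    (alpha : 'rV[R]_n.+1 -> 'M[R]_n.+1) (sigma : R) (k r : nat) (S : forall M : mesh R n.+1, spaces M) :
  polyhedral_domain Omega -> coefficient Omega alpha -> 0 < sigma ->
  (forall M, hdg_spaces k r (S M)) ->
  exists M0 beta1 : R, 0 < beta1 /\
    forall M : mesh R n.+1, triangulation M Omega -> shape_regular M sigma ->
    forall rho : R, 0 < rho <= 1 ->
      uniformly_stable (fun x => invmx (alpha x)) Omega (S M) (fun K => rho * hK K)
        (normU1 (fun x => invmx (alpha x)) (S M) rho) M0 beta1.
Proof.
move=> polyO ca s0 hS; have [B B0 HB] := coef_bounds ca.
have [Ct Ct0 HCt] := @cell_trace R n k sigma s0.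
have [D D0 HD] := domain_enorm polyO.
have [Cl Cl0 HCl] := @divergence_lift R n k sigma D s0 D0.
pose Ce := n.+2%:R * Ct; pose Cc := 2 * Ce + 4 * (1 + sigma).
have Ce0 : 0 < Ce by exact: mulr_gt0.
have Cc0 : 0 < Cc by apply: addr_gt0; [exact: mulr_gt0|by rewrite mulr_gt0// addr_gt0].
pose G := Cl * (B * Cl) + Cc.
have G0 : 0 < G by apply: addr_gt0 => //; apply: mulr_gt0 => //; exact: mulr_gt0.
pose c1 := (2 * (G + 1))^-1 / 2 * ((Cl + 1) * (3 + 2 * Ce))^-1.
pose c2 := Num.sqrt (4 + 2 * (B + 1) * Cl).
have c10 : 0 < c1.
  apply: mulr_gt0; first by rewrite divr_gt0// invr_gt0 mulr_gt0// addr_gt0.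
  by rewrite invr_gt0; apply: mulr_gt0; rewrite addr_gt0// mulr_gt0.
have c20 : 0 < c2 by rewrite sqrtr_gt0 addr_gt0// !mulr_gt0// addr_gt0.
exists (1 + Cc), (c1 / c2); split=> [|M tri sr rho rho01]; first exact: divr_gt0.
have H1 x (Ox : Omega x) := (HB x Ox).2.1; have H2 x (Ox : Omega x) := (HB x Ox).2.2.
have lS := hdg_lin (hS M).
have HC := @mixed_continuous R n Omega alpha M sigma Ct k r (S M) polyO ca tri s0 sr Ct0 (hS M) (HCt M) rho rho01.
split=> //.
  apply: (hdg_consistent _ polyO ca s0 tri sr) => F h Fi.
  by have [_ _ _ H] := lS; exact: H.
apply: (inf_sup_intro c10 c20 (in_Uh_good lS) HC).
- by move=> X; exact: sqrtr_ge0.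
- by move=> Y UY nz; exact: (normU1_gt0 polyO ca tri s0 sr H1 (hS M) rho01 UY nz).
move=> Y UY; have dY K : K \in cells M -> deg_le k (dv Y K).
  by move=> KM; have [_ UV _] := UY; have [_ hV _ _ _] := hS M; have := UV K KM; rewrite hV.
have [p [p1 p2 p3 p4 p5]] := HCl M Omega tri sr HD (dv Y) dY.
(* The lifted field depends on [Y], but its constant [Cl] was fixed before the mesh, which keeps
   [c1] and [c2] uniform. *)
exists (dlin (2 * (G + 1))^-1 (dflip Y) (dtest (S M) rho Y p)); split.
- apply: (in_Uh_lin lS); first exact: (in_Uh_flip lS).
  exact: (dtest_Uh (hS M) rho UY p1).
- exact: (mixed_inf_sup_test polyO ca tri s0 sr B0 Ct0 H2 (hS M) (HCt M) rho01 Cl0 UY p1 p2 p3 p5).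
exact: (normU1_dtest polyO ca tri s0 sr B0 Ct0 H2 (hS M) rho01 Cl0 UY p1 p2 p3 p4).
Qed.

Unset Implicit Arguments.
Set Strict Implicit.
Set Printing Implicit Defensive.

Theorem theorem3p2 (R : realType) (d : nat) (d_gt0 : (0 < d)%N)
    (Omega : set 'rV[R]_d) (Omega_poly : polyhedral_domain Omega)
    (alpha : 'rV[R]_d -> 'M[R]_d) (alpha_coef : coefficient Omega alpha)
    (sigma : R) (sigma_gt0 : 0 < sigma) :
  let c := fun x => invmx (alpha x) in
  (forall (k r : nat) (S : forall M : mesh R d, spaces M),
     ((r <= k.+1)%N /\ S = @spaces_P R d k r) \/
     ((r <= k)%N /\ S = @spaces_RT R d k r) ->
     exists M0 beta1 : R, 0 < beta1 /\
       forall M : mesh R d, triangulation M Omega -> shape_regular M sigma ->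
       forall rho : R, 0 < rho <= 1 ->
         uniformly_stable c Omega (S M) (fun K => rho * hK K)
           (normU1 c (S M) rho) M0 beta1) /\
  (forall m : nat, exists rho0 M0 beta1 : R, 0 < rho0 /\ 0 < beta1 /\
     forall M : mesh R d, triangulation M Omega -> shape_regular M sigma ->
     forall S : spaces M, admissible m S -> grad_incl S ->
     forall rho : R, 0 < rho <= rho0 ->
       uniformly_stable c Omega S (fun K => rho^-1 * (hK K)^-1)
         (normU2 c rho) M0 beta1).
Proof.
case: d d_gt0 Omega Omega_poly alpha alpha_coef => // n _ Omega polyO alpha ca; split.
  move=> k r S hS; apply: (@stability_mixed R n Omega alpha sigma k r S polyO ca sigma_gt0) => M.
  by case: hS => -[_ ->]; [exact: hdg_spaces_P|exact: hdg_spaces_RT].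
by move=> m; exact: stability_primal.
Qed.
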